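(* Let $a\in\mathbb{C}$. As $\tau\downarrow0$ (i.e. $\tau=iT$, $T>0$, $T\to0$), the honest and modified (super)characters in the case $m=2$ have the following asymptotics. 1) Characters: (i) $\widetilde{\rm ch}^{(+)}_{H(\Lambda^{[-1,0]})}(\tau,a\tau)\sim-2\cos(a\pi)\,e^{-\frac{7}{24}\cdot\frac{\pi i}{\tau}}$; (ii) ${\rm ch}^{(+)}_{H(\Lambda^{[-1,0]})}(\tau,a\tau)\sim-\frac12(-i\tau)^{\frac12}e^{\frac{5}{24}\cdot\frac{\pi i}{\tau}}$; (iii) ${\rm ch}^{(+)}_{H(\Lambda^{[-1,2]})}(\tau,a\tau)\sim\frac12(-i\tau)^{\frac12}e^{\frac{5}{24}\cdot\frac{\pi i}{\tau}}$; (iv) ${\rm ch}^{(+)}_{H(\Lambda^{[-1,1]})}(\tau,a\tau)\sim\frac i2e^{\frac{5}{24}\cdot\frac{\pi i}{\tau}}$. 2) Supercharacters: (i) $\widetilde{\rm ch}^{(-)}_{H(\Lambda^{[-1,0]})}(\tau,a\tau)\sim-\frac{i}{\sqrt2}e^{\frac1{12}\cdot\frac{\pi i}{\tau}}$; (ii) ${\rm ch}^{(-)}_{H(\Lambda^{[-1,m_2]})}(\tau,a\tau)\sim-\frac{i}{\sqrt2}e^{\frac1{12}\cdot\frac{\pi i}{\tau}}$ for $m_2=0,1,2$.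
   Context: $f\sim g$ as $\tau\downarrow0$ means $f=g\cdot(1+o(1))$ as $T\to0^+$ with $\tau=iT$. The values at possible removable singularities are by continuity. Notation: $q^a:=e^{2\pi i a\tau}$ with ${\rm Im}\,\tau>0$, $\eta(\tau)=q^{1/24}\prod_{n\ge1}(1-q^n)$, and for $a,b\in\{0,1\}$ the Mumford theta functions are $\vartheta_{ab}(\tau,z)=\sum_{n\in\mathbb{Z}}e^{\pi i\tau(n+\frac a2)^2+2\pi i(n+\frac a2)(z+\frac b2)}$. For $m\in\frac12\mathbb{N}$, $s\in\frac12\mathbb{Z}$ put $\Phi_1^{[m,s]}(\tau,z_1,z_2,t)=e^{-2\pi imt}\sum_{j\in\mathbb{Z}}\frac{e^{2\pi imj(z_1+z_2)+2\pi isz_1}e^{2\pi i\tau(mj^2+sj)}}{1-e^{2\pi iz_1}e^{2\pi ij\tau}}$, $\Phi_2^{[m,s]}(\tau,z_1,z_2,t)=e^{-2\pi imt}\sum_{j\in\mathbb{Z}}\frac{e^{-2\pi imj(z_1+z_2)-2\pi isz_2}e^{2\pi i\tau(mj^2+sj)}}{1-e^{-2\pi iz_2}e^{2\pi ij\tau}}$, $\Phi^{[m,s]}=\Phi_1^{[m,s]}-\Phi_2^{[m,s]}$. Let $\theta_{k,m}(\tau,z)=\sum_{j\in\mathbb{Z}}e^{2\pi im(j+\frac{k}{2m})z}e^{2\pi i\tau m(j+\frac{k}{2m})^2}$, $E(x)=2\int_0^xe^{-\pi t^2}dt$, and $R_{j;m}(\tau,w)=\sum_{n\in j+2m\mathbb{Z}}\big\{{\rm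 sgn}(n-\frac12-j+2m)-E\big((n-2m\frac{{\rm Im}\,w}{{\rm Im}\,\tau})\sqrt{{\rm Im}(\tau)/m}\big)\big\}e^{-\frac{\pi in^2\tau}{2m}+2\pi inw}$. The correction term is $\Phi^{[m,s]}_{\rm add}(\tau,z_1,z_2,t)=-\frac12e^{-2\pi imt}\sum_{k\in s+\mathbb{Z},\,s\le k<s+2m}R_{k;m}(\tau,\frac{z_1-z_2}{2})[\theta_{k,m}-\theta_{-k,m}](\tau,z_1+z_2)$, and the modification is $\widetilde\Phi^{[m,s]}=\Phi^{[m,s]}+\Phi^{[m,s]}_{\rm add}$. N=3 denominators: $R^{(+)}(\tau,z)=\eta(\frac\tau2)\eta(2\tau)\frac{\vartheta_{11}(\tau,z)}{\vartheta_{00}(\tau,z)}$, $R^{(-)}(\tau,z)=\frac{\eta(\tau)^3}{\eta(\frac\tau2)}\frac{\vartheta_{11}(\tau,z)}{\vartheta_{01}(\tau,z)}$. For $m_2\in\{0,1,2\}$ let $H(\Lambda^{[-1,m_2]})$ be the N=3 superconformal module obtained by quantum Hamiltonian reduction of the $\widehat{osp}(3|2)$-module of highest weight $-\Lambda_0-\frac{m_2}{2}\alpha_1$. Its (honest) character and supercharacter are the functions of $(\tau,z)$ given by $R^{(+)}{\rm ch}^{(+)}_{H(\Lambda^{[-1,m_2]})}=\Phi^{[1,\frac{m_2+1}2]}(2\tau,z+\frac\tau2-\frac12,z-\frac\tau2+\frac12,\frac\tau8)$ and $R^{(-)}{\rm ch}^{(-)}_{H(\Lambda^{[-1,m_2]})}=\Phi^{[1,\frac{m_2+1}2]}(2\tau,z+\frac\tau2,z-\frac\tau2,\frac\tau8)$.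 The modified (super)characters $\widetilde{\rm ch}^{(\pm)}$ are defined by the same formulas with $\Phi$ replaced by $\widetilde\Phi$. *)

(* Defs.v *)
From Stdlib Require Import Reals ZArith Lra.
From Coquelicot Require Import Coquelicot.

(* [C_scope] stays on top so that bare formulas are complex; real subformulas
   are marked with [%R]. *)
Open Scope R_scope.
Open Scope C_scope.

(* The limit of [f] along [F], with an unspecified value if there is none. *)
Definition Clim {T : Type} (F : (T -> Prop) -> Prop) (f : T -> C) : C :=
  @iota C_CompleteNormedModule
    (fun l : C_CompleteNormedModule => filterlim f F (locally l)).

Lemma Clim_unique {T : Type} (F : (T -> Prop) -> Prop) (FF : ProperFilter' F)
  (f : T -> C) (l : C) :
  filterlim f F (@locally C_CompleteNormedModule l) -> Clim F f = l.
Proof.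
exact (@iota_filterlim_locally _ C_CompleteNormedModule T F FF f l).
Qed.

Fixpoint Csum (u : nat -> C) (N : nat) : C :=
  match N with
  | O => 0
  | S N' => Csum u N' + u N'
  end.

Fixpoint Cprod (u : nat -> C) (N : nat) : C :=
  match N with
  | O => 1
  | S N' => Cprod u N' * u N'
  end.

Definition Cseries (u : nat -> C) : C :=
  Clim eventually (Csum u).

(* Sum over all integers; every bilateral series below converges absolutely. *)
Definition Zsum (u : Z -> C) : C :=
  Cseries (fun n => u (Z.of_nat n)) + Cseries (fun n => u (- Z.of_nat (S n))%Z).

Definition Cinfprod (u : nat -> C) : C := Clim eventually (Cprod u).

Definition Cexp (z : C) : C :=
  ((exp (Re z) * cos (Im z))%R, (exp (Re z) * sin (Im z))%R).

Definition Ccos (z : C) : C := (Cexp (Ci * z) + Cexp (- (Ci * z))) / 2.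

Definition qpow (tau a : C) : C := Cexp (2 * PI * Ci * a * tau).

Definition eta (tau : C) : C :=
  qpow tau (1 / 24) * Cinfprod (fun n => 1 - qpow tau (INR (S n))).

Definition vartheta (a b : nat) (tau z : C) : C :=
  Zsum (fun n : Z =>
    Cexp (PI * Ci * tau * (IZR n + INR a / 2) ^ 2
          + 2 * PI * Ci * (IZR n + INR a / 2) * (z + INR b / 2))).

Definition theta (k m : R) (tau z : C) : C :=
  Zsum (fun j : Z =>
    Cexp (2 * PI * Ci * m * (IZR j + k / (2 * m)) * z)
    * Cexp (2 * PI * Ci * tau * m * (IZR j + k / (2 * m)) ^ 2)).

(* A half-integer is given by its double: [M] and [S] stand for m = M/2 and
   s = S/2, with m a nonnegative and s an arbitrary half-integer. *)
Definition half_nat (M : nat) : R := (INR M / 2)%R.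
Definition half_int (S : Z) : R := (IZR S / 2)%R.

Definition Phi1 (M : nat) (S : Z) (tau z1 z2 t : C) : C :=
  let m := half_nat M in
  let s := half_int S in
  Cexp (- (2 * PI * Ci * m * t)) *
  Zsum (fun j : Z =>
    Cexp (2 * PI * Ci * m * IZR j * (z1 + z2) + 2 * PI * Ci * s * z1)
    * Cexp (2 * PI * Ci * tau * (m * IZR j ^ 2 + s * IZR j))
    / (1 - Cexp (2 * PI * Ci * z1) * Cexp (2 * PI * Ci * IZR j * tau))).

Definition Phi2 (M : nat) (S : Z) (tau z1 z2 t : C) : C :=
  let m := half_nat M in
  let s := half_int S in
  Cexp (- (2 * PI * Ci * m * t)) *
  Zsum (fun j : Z =>
    Cexp (- (2 * PI * Ci * m * IZR j * (z1 + z2)) - 2 * PI * Ci * s * z2)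
    * Cexp (2 * PI * Ci * tau * (m * IZR j ^ 2 + s * IZR j))
    / (1 - Cexp (- (2 * PI * Ci * z2)) * Cexp (2 * PI * Ci * IZR j * tau))).

Definition Phi (M : nat) (S : Z) (tau z1 z2 t : C) : C :=
  Phi1 M S tau z1 z2 t - Phi2 M S tau z1 z2 t.

Definition E (x : R) : R := (2 * RInt (fun t => exp (- (PI * t ^ 2))) 0 x)%R.

(* The summation index is n = j + 2ml with l an integer. *)
Definition Rjm (j m : R) (tau w : C) : C :=
  Zsum (fun l : Z =>
    let n := (j + 2 * m * IZR l)%R in
    RtoC (sign (n - 1 / 2 - j + 2 * m)
          - E ((n - 2 * m * (Im w / Im tau)) * sqrt (Im tau / m)))%R
    * Cexp (- (PI * Ci * n ^ 2 * tau / (2 * m)) + 2 * PI * Ci * n * w)).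

(* The index k = s + i runs over i = 0, ..., 2m - 1 (and 2m = M). *)
Definition Phi_add (M : nat) (S : Z) (tau z1 z2 t : C) : C :=
  let m := half_nat M in
  let s := half_int S in
  - (1 / 2) * Cexp (- (2 * PI * Ci * m * t)) *
  Csum (fun i : nat =>
    let k := (s + INR i)%R in
    Rjm k m tau ((z1 - z2) / 2)
    * (theta k m tau (z1 + z2) - theta (- k) m tau (z1 + z2))) M.

Definition Phi_mod (M : nat) (S : Z) (tau z1 z2 t : C) : C :=
  Phi M S tau z1 z2 t + Phi_add M S tau z1 z2 t.

Definition R_plus (tau z : C) : C :=
  eta (tau / 2) * eta (2 * tau) * (vartheta 1 1 tau z / vartheta 0 0 tau z).

Definition R_minus (tau z : C) : C :=
  eta tau ^ 3 / eta (tau / 2) * (vartheta 1 1 tau z / vartheta 0 1 tau z).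

(* The quotient num/den at [z], extended by continuity to its removable
   singularities: numerator and denominator may both vanish, or both have a
   pole, at [z]. *)
Definition quotient_by_continuity (num den : C -> C) (z : C) : C :=
  Clim (locally' z) (fun w => num w / den w).

(* (m, s) = (1, (m2 + 1) / 2) has doubles (2, m2 + 1). *)
Definition ch_plus (m2 : nat) (tau z : C) : C :=
  quotient_by_continuity
    (fun w => Phi 2 (Z.of_nat m2 + 1) (2 * tau)
                (w + tau / 2 - 1 / 2) (w - tau / 2 + 1 / 2) (tau / 8))
    (R_plus tau) z.

Definition ch_minus (m2 : nat) (tau z : C) : C :=
  quotient_by_continuity
    (fun w => Phi 2 (Z.of_nat m2 + 1) (2 * tau)
                (w + tau / 2) (w - tau / 2) (tau / 8))
    (R_minus tau) z.

Definition ch_plus_mod (m2 : nat) (tau z : C) : C :=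
  quotient_by_continuity
    (fun w => Phi_mod 2 (Z.of_nat m2 + 1) (2 * tau)
                (w + tau / 2 - 1 / 2) (w - tau / 2 + 1 / 2) (tau / 8))
    (R_plus tau) z.

Definition ch_minus_mod (m2 : nat) (tau z : C) : C :=
  quotient_by_continuity
    (fun w => Phi_mod 2 (Z.of_nat m2 + 1) (2 * tau)
                (w + tau / 2) (w - tau / 2) (tau / 8))
    (R_minus tau) z.

Definition equiv_down0 (f g : C -> C) : Prop :=
  @is_equiv R C_AbsRing C_NormedModule (at_right 0)
    (fun T : R => f (Ci * T)) (fun T : R => g (Ci * T)).

(* This is f = g (1 + o(1)), also where g vanishes. *)
Lemma equiv_down0_alt (f g : C -> C) :
  equiv_down0 f g <->
  exists h : R -> C,
    (forall eps : posreal, at_right 0 (fun T => (Cmod (h T) <= eps)%R)) /\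
    at_right 0 (fun T : R => f (Ci * T) = g (Ci * T) * (1 + h T)).
Proof.
split.
- intros H.
  exists (fun T : R => match Ceq_dec (g (Ci * T)) 0 with
                       | left _ => RtoC 0
                       | right _ => f (Ci * T) / g (Ci * T) - 1 end).
  split.
  + intros eps; generalize (H eps); apply filter_imp; intros T HT.
    destruct (Ceq_dec (g (Ci * T)) 0) as [Hg|Hg].
    * rewrite Cmod_0; apply Rlt_le, cond_pos.
    * change (Cmod (g (Ci * T)%C - f (Ci * T)%C)%C <= eps * Cmod (g (Ci * T)%C))%R in HT.
      replace (f (Ci * T) / g (Ci * T) - 1)
        with (- (g (Ci * T) - f (Ci * T)) / g (Ci * T)) by (field; exact Hg).
      rewrite Cmod_div, Cmod_opp by exact Hg.
      apply Rmult_le_reg_r with (Cmod (g (Ci * T))); [now apply Cmod_gt_0|].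
      unfold Rdiv; rewrite Rmult_assoc, Rinv_l, Rmult_1_r; [exact HT|].
      apply Rgt_not_eq; now apply Cmod_gt_0.
  + generalize (H (mkposreal 1 Rlt_0_1)); apply filter_imp; intros T HT.
    destruct (Ceq_dec (g (Ci * T)) 0) as [Hg|Hg].
    * change (Cmod (g (Ci * T)%C - f (Ci * T)%C)%C <= 1 * Cmod (g (Ci * T)%C))%R in HT.
      rewrite Hg, Cmod_0, Rmult_0_r in HT; rewrite Hg.
      assert (H0 : 0 - f (Ci * T) = 0).
      { apply Cmod_eq_0, Rle_antisym; [exact HT|apply Cmod_ge_0]. }
      replace (f (Ci * T)) with (- (0 - f (Ci * T))) by ring.
      rewrite H0; ring.
    * field; exact Hg.
- intros [h [Hh Hf]] eps.
  generalize (filter_and _ _ (Hh eps) Hf); apply filter_imp; intros T [H1 H2].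
  change (Cmod (g (Ci * T)%C - f (Ci * T)%C)%C <= eps * Cmod (g (Ci * T)%C))%R.
  rewrite H2.
  replace (g (Ci * T) - g (Ci * T) * (1 + h T)) with (- (h T * g (Ci * T))) by ring.
  rewrite Cmod_opp, Cmod_mult.
  apply Rmult_le_compat_r; [apply Cmod_ge_0|exact H1].
Qed.

(* (-i tau)^{1/2} for tau = iT, T > 0, where -i tau = T is a positive real. *)
Definition sqrt_mi (tau : C) : C := RtoC (sqrt (Re (- Ci * tau))).

Definition exp_cusp (c : R) (tau : C) : C := Cexp (c * (PI * Ci / tau)).

(* Main.v *)
(* With q = e^{2 pi i tau}, the functions Phi^{[1,s]} are Appell sums in q^j.  Expanding
   theta(v) / (1 - v q^j) into a Laurent series turns theta times an Appell sum into a double sum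
   over a lattice; its coefficients satisfy the two-step recursion of a theta series, so
   Phi^{[1,1]}, and the mean of Phi^{[1,1/2]} and Phi^{[1,3/2]}, are quotients of theta functions,
   while the difference of the latter two is a multiple of vartheta_11.  Since E is odd, the
   terms of R_{1/2;1} and R_{3/2;1} cancel in pairs at the arguments needed (leaving an exponential and
   0), and Phi_add subtracts exactly half of that difference.  Hence for every tau = iT all
   (super)characters are explicit combinations of at most two theta-eta quotients.  Poisson
   summation gives the behaviour of each theta and eta factor as T -> 0; where two terms
   occur, one is exponentially smaller.  When cos (a pi) = 0 the numerator vartheta_01 in 1(i)
   vanishes identically, so the equivalence there is an equality with 0. *)
Require Import Defs.
From Stdlib Require Import Reals ZArith Lra Lia Psatz.
From Coquelicot Require Import Coquelicot.
Open Scope R_scope.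
Open Scope C_scope.

(** * Limits and bilateral series *)

(** The double series converges for every v different from 0, in particular at v = 1, a pole of the
    Appell sum itself. The recursion leaves one multiplicative constant free; at v = 1 a single term
    survives, and its value, the cube of the eta product, fixes that constant. [Phi1] and [Phi2]
    have poles in powers of q^2, but z1 - z2 differs from tau by an integer, so they are the even-
    and odd-indexed terms of one Appell sum of base q. Polya's limit argument for Poisson summation
    leaves the asymptotics of the central binomial coefficient unknown; the self-dual theta series
    at T = 1 determines it. The same formula, read as a Riemann sum, gives the normalization
    E(infinity) = 1 behind the convergence of the R-series. The characters are limits at possibly
    removable singularities, so each identity is proved on a punctured neighbourhood, where no
    factor vanishes, and carried to the point by continuity of theta functions. All exchanges of
    limits and sums rest on one family of majorants, c exp(-alpha k^2 + beta |k|). *)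

Definition tends {T : Type} (F : (T -> Prop) -> Prop) (f : T -> C) (l : C) : Prop :=
  forall eps : R, (0 < eps)%R -> F (fun t => (Cmod (f t - l) < eps)%R).

Lemma tends_iff {T : Type} (F : (T -> Prop) -> Prop) {FF : Filter F} (f : T -> C) (l : C) :
  tends F f l <-> filterlim f F (@locally C_CompleteNormedModule l).
Proof.
split.
- intros H; apply (filterlim_locally_ball_norm (U := C_NormedModule)); intros eps.
  exact (H eps (cond_pos eps)).
- intros H eps Heps.
  exact (proj1 (filterlim_locally_ball_norm (U := C_NormedModule) f l) H (mkposreal eps Heps)).
Qed.

Lemma Cmod_minus_sym (x y : C) : Cmod (x - y) = Cmod (y - x).
Proof. rewrite <- Cmod_opp; f_equal; ring. Qed.

Lemma Cmod_triangle_minus (x y z : C) : (Cmod (x - z) <= Cmod (x - y) + Cmod (y - z))%R.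
Proof. replace (x - z) with ((x - y) + (y - z)) by ring; apply Cmod_triangle. Qed.

Section Tends.

Context {T : Type} (F : (T -> Prop) -> Prop).

Lemma tends_unique {FF : ProperFilter F} (f : T -> C) (l l' : C) :
  tends F f l -> tends F f l' -> l = l'.
Proof.
intros H H'.
destruct (Ceq_dec l l') as [E|E]; [exact E|exfalso].
assert (P : (0 < Cmod (l - l') / 2)%R).
{ apply Rmult_lt_0_compat; [apply Cmod_gt_0|lra].
  intros E'; apply E; replace l with ((l - l') + l') by ring; rewrite E'; ring. }
destruct (filter_ex _ (filter_and _ _ (H _ P) (H' _ P))) as [t [H1 H2]].
pose proof (Cmod_triangle_minus l (f t) l') as H3.
rewrite (Cmod_minus_sym l (f t)) in H3; lra.
Qed.

Lemma tends_ext_loc {FF : Filter F} (f g : T -> C) (l : C) :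
  F (fun t => f t = g t) -> tends F f l -> tends F g l.
Proof.
intros E H eps Heps; generalize (filter_and _ _ E (H eps Heps)).
apply filter_imp; intros t [E1 H1]; now rewrite <- E1.
Qed.

Lemma tends_ext {FF : Filter F} (f g : T -> C) (l : C) :
  (forall t, f t = g t) -> tends F f l -> tends F g l.
Proof. intros E; apply tends_ext_loc, filter_forall, E. Qed.

Lemma tends_const {FF : Filter F} (l : C) : tends F (fun _ => l) l.
Proof.
intros eps Heps; apply filter_forall; intros _.
replace (l - l) with (RtoC 0) by ring; now rewrite Cmod_0.
Qed.

Lemma tends_plus {FF : Filter F} (f g : T -> C) (l m : C) :
  tends F f l -> tends F g m -> tends F (fun t => f t + g t) (l + m).
Proof.
intros Hf Hg eps Heps.
assert (E2 : (0 < eps / 2)%R) by lra.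
generalize (filter_and _ _ (Hf _ E2) (Hg _ E2)); apply filter_imp; intros t [H1 H2].
replace (f t + g t - (l + m)) with ((f t - l) + (g t - m)) by ring.
eapply Rle_lt_trans; [apply Cmod_triangle|lra].
Qed.

Lemma tends_bound {FF : Filter F} (f : T -> C) (l : C) (B : R) :
  (Cmod l < B)%R -> tends F f l -> F (fun t => (Cmod (f t) < B)%R).
Proof.
intros HB Hf.
assert (E2 : (0 < B - Cmod l)%R) by lra.
generalize (Hf _ E2); apply filter_imp; intros t H1.
replace (f t) with ((f t - l) + l) by ring.
eapply Rle_lt_trans; [apply Cmod_triangle|lra].
Qed.

Lemma tends_mult {FF : Filter F} (f g : T -> C) (l m : C) :
  tends F f l -> tends F g m -> tends F (fun t => f t * g t) (l * m).
Proof.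
intros Hf Hg eps Heps.
set (A := (Cmod l + 1)%R); set (B := (Cmod m + 1)%R).
assert (HA : (1 <= A)%R) by (unfold A; pose proof (Cmod_ge_0 l); lra).
assert (HB : (1 <= B)%R) by (unfold B; pose proof (Cmod_ge_0 m); lra).
assert (E1 : (0 < eps / (2 * A))%R) by (apply Rdiv_lt_0_compat; lra).
assert (E2 : (0 < eps / (2 * B))%R) by (apply Rdiv_lt_0_compat; lra).
assert (E3 : (Cmod l < A)%R) by (unfold A; lra).
generalize (filter_and _ _ (tends_bound _ _ _ E3 Hf)
             (filter_and _ _ (Hf _ E2) (Hg _ E1))).
apply filter_imp; intros t [H0 [H1 H2]].
replace (f t * g t - l * m) with (f t * (g t - m) + (f t - l) * m) by ring.
eapply Rle_lt_trans; [apply Cmod_triangle|]; rewrite !Cmod_mult.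
assert (I1 : (Cmod (f t) * Cmod (g t - m) <= A * (eps / (2 * A)))%R).
{ apply Rmult_le_compat; try apply Cmod_ge_0; lra. }
assert (I2 : (Cmod (f t - l) * Cmod m <= eps / (2 * B) * (B - 1))%R).
{ apply Rmult_le_compat; try apply Cmod_ge_0; [lra|unfold B; lra]. }
replace (A * (eps / (2 * A)))%R with (eps / 2)%R in I1 by (field; lra).
replace (eps / (2 * B) * (B - 1))%R with (eps / 2 - eps / (2 * B))%R in I2 by (field; lra).
lra.
Qed.

Lemma tends_scal {FF : Filter F} (c : C) (f : T -> C) (l : C) :
  tends F f l -> tends F (fun t => c * f t) (c * l).
Proof. intros H; apply tends_mult; [apply tends_const|exact H]. Qed.

Lemma tends_opp {FF : Filter F} (f : T -> C) (l : C) :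
  tends F f l -> tends F (fun t => - f t) (- l).
Proof.
intros H; replace (- l) with ((-(1)) * l) by ring.
apply tends_ext with (fun t => (-(1)) * f t); [intros; ring|now apply tends_scal].
Qed.

Lemma tends_minus {FF : Filter F} (f g : T -> C) (l m : C) :
  tends F f l -> tends F g m -> tends F (fun t => f t - g t) (l - m).
Proof. intros Hf Hg; apply tends_plus, tends_opp; assumption. Qed.

Lemma tends_nonzero {FF : Filter F} (f : T -> C) (l : C) :
  l <> 0 -> tends F f l -> F (fun t => (Cmod l / 2 < Cmod (f t))%R).
Proof.
intros Hl Hf.
assert (P : (0 < Cmod l / 2)%R) by (pose proof (proj1 (Cmod_gt_0 l) Hl); lra).
generalize (Hf _ P); apply filter_imp; intros t H1.
pose proof (Cmod_triangle_minus l (f t) 0) as H2.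
replace (l - 0) with l in H2 by ring; replace (f t - 0) with (f t) in H2 by ring.
rewrite (Cmod_minus_sym l (f t)) in H2; lra.
Qed.

Lemma tends_neq_0 {FF : Filter F} (f : T -> C) (l : C) :
  l <> 0 -> tends F f l -> F (fun t => f t <> 0).
Proof.
intros Hl Hf; generalize (tends_nonzero f l Hl Hf); apply filter_imp; intros t H E.
rewrite E, Cmod_0 in H; pose proof (Cmod_ge_0 l); lra.
Qed.

Lemma tends_inv {FF : Filter F} (f : T -> C) (l : C) :
  l <> 0 -> tends F f l -> tends F (fun t => / f t) (/ l).
Proof.
intros Hl Hf eps Heps.
pose proof (proj1 (Cmod_gt_0 l) Hl) as P.
assert (E1 : (0 < eps * (Cmod l * Cmod l / 2))%R)
  by (apply Rmult_lt_0_compat; [lra|]; pose proof (Rmult_lt_0_compat _ _ P P); lra).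
generalize (filter_and _ _ (tends_nonzero f l Hl Hf) (Hf _ E1)).
apply filter_imp; intros t [H1 H2].
assert (N : f t <> 0) by (intros N; rewrite N, Cmod_0 in H1; lra).
replace (/ f t - / l) with ((l - f t) / (f t * l)) by (field; split; assumption).
rewrite Cmod_div by (now apply Cmult_neq_0).
rewrite Cmod_mult, Cmod_minus_sym.
assert (P2 : (0 < Cmod (f t) * Cmod l)%R) by (apply Rmult_lt_0_compat; lra).
apply Rmult_lt_reg_r with (Cmod (f t) * Cmod l)%R; [exact P2|].
unfold Rdiv; rewrite Rmult_assoc, Rinv_l by lra; rewrite Rmult_1_r.
eapply Rlt_le_trans; [exact H2|].
apply Rmult_le_compat_l; [lra|].
replace (Cmod l * Cmod l / 2)%R with (Cmod l / 2 * Cmod l)%R by field.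
apply Rmult_le_compat_r; lra.
Qed.

Lemma tends_div {FF : Filter F} (f g : T -> C) (l m : C) :
  m <> 0 -> tends F f l -> tends F g m -> tends F (fun t => f t / g t) (l / m).
Proof. intros Hm Hf Hg; apply tends_mult; [|apply tends_inv]; assumption. Qed.

Lemma tends_RtoC {FF : Filter F} (f : T -> R) (l : R) :
  filterlim f F (locally l) -> tends F (fun t => RtoC (f t)) (RtoC l).
Proof.
intros H eps Heps.
generalize (proj1 (filterlim_locally f l) H (mkposreal eps Heps)).
apply filter_imp; intros t Ht.
rewrite <- RtoC_minus, Cmod_R; exact Ht.
Qed.

Lemma tends_le {FF : ProperFilter F} (f : T -> C) (l c : C) (B : R) :
  F (fun t => (Cmod (f t - c) <= B)%R) -> tends F f l -> (Cmod (l - c) <= B)%R.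
Proof.
intros H Hf; apply Rnot_lt_le; intros H1.
assert (P : (0 < Cmod (l - c) - B)%R) by lra.
destruct (filter_ex _ (filter_and _ _ H (Hf _ P))) as [t [H2 H3]].
pose proof (Cmod_triangle_minus l (f t) c) as H4.
rewrite (Cmod_minus_sym l (f t)) in H4; lra.
Qed.

End Tends.

Lemma tends_comp {S T : Type} (F : (S -> Prop) -> Prop) (G : (T -> Prop) -> Prop)
  (g : S -> T) (f : T -> C) (l : C) :
  filterlim g F G -> tends G f l -> tends F (fun s => f (g s)) l.
Proof. intros Hg Hf eps Heps; exact (Hg _ (Hf eps Heps)). Qed.

Lemma Clim_tends {T : Type} (F : (T -> Prop) -> Prop) {FF : ProperFilter F} (f : T -> C) (l : C) :
  tends F f l -> Clim F f = l.
Proof.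
intros H; apply (Clim_unique F (Proper_StrongProper F FF)); now apply tends_iff; [apply FF|].
Qed.

(** * Absolutely convergent bilateral series *)

Fixpoint Rsum (u : nat -> R) (N : nat) : R :=
  match N with
  | O => 0
  | S N' => (Rsum u N' + u N')%R
  end.

Lemma Csum_ext (u v : nat -> C) (N : nat) :
  (forall n, (n < N)%nat -> u n = v n) -> Csum u N = Csum v N.
Proof.
induction N as [|N IH]; intros H; [reflexivity|]; simpl.
now rewrite IH, H by (intros; try apply H; lia).
Qed.

Lemma Csum_plus (u v : nat -> C) (N : nat) :
  Csum (fun n => u n + v n) N = Csum u N + Csum v N.
Proof. induction N as [|N IH]; simpl; [ring|rewrite IH; ring]. Qed.

Lemma Csum_scal (c : C) (u : nat -> C) (N : nat) :
  Csum (fun n => c * u n) N = c * Csum u N.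
Proof. induction N as [|N IH]; simpl; [ring|rewrite IH; ring]. Qed.

Lemma Rsum_le (u v : nat -> R) (N : nat) :
  (forall n, (u n <= v n)%R) -> (Rsum u N <= Rsum v N)%R.
Proof. intros H; induction N as [|N IH]; simpl; [lra|specialize (H N); lra]. Qed.

Lemma Rsum_ext (u v : nat -> R) (N : nat) :
  (forall n, u n = v n) -> Rsum u N = Rsum v N.
Proof. intros H; induction N as [|N IH]; simpl; [lra|rewrite IH, H; lra]. Qed.

Lemma Rsum_plus (u v : nat -> R) (N : nat) :
  Rsum (fun n => (u n + v n)%R) N = (Rsum u N + Rsum v N)%R.
Proof. induction N as [|N IH]; simpl; [ring|rewrite IH; ring]. Qed.

Lemma Rsum_scal (c : R) (u : nat -> R) (N : nat) :
  Rsum (fun n => (c * u n)%R) N = (c * Rsum u N)%R.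
Proof. induction N as [|N IH]; simpl; [ring|rewrite IH; ring]. Qed.

Lemma Rsum_mono (u : nat -> R) (N N' : nat) :
  (forall n, (0 <= u n)%R) -> (N <= N')%nat -> (Rsum u N <= Rsum u N')%R.
Proof. intros H L; induction L; simpl; [lra|specialize (H m); lra]. Qed.

Lemma Rsum_pos (u : nat -> R) (N : nat) : (forall n, (0 <= u n)%R) -> (0 <= Rsum u N)%R.
Proof. intros H; exact (Rsum_mono u 0 N H (Nat.le_0_l N)). Qed.

Lemma Csum_diff_le (u : nat -> C) (M : nat -> R) (N N' : nat) :
  (forall n, (Cmod (u n) <= M n)%R) -> (N <= N')%nat ->
  (Cmod (Csum u N' - Csum u N) <= Rsum M N' - Rsum M N)%R.
Proof.
intros H L; induction L as [|N' L IH].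
- replace (Csum u N - Csum u N) with (RtoC 0) by ring; rewrite Cmod_0; lra.
- simpl; replace (Csum u N' + u N' - Csum u N) with ((Csum u N' - Csum u N) + u N') by ring.
  eapply Rle_trans; [apply Cmod_triangle|]; specialize (H N'); lra.
Qed.

Lemma Csum_le (u : nat -> C) (M : nat -> R) (N : nat) :
  (forall n, (Cmod (u n) <= M n)%R) -> (Cmod (Csum u N) <= Rsum M N)%R.
Proof.
intros H; pose proof (Csum_diff_le u M 0 N H (Nat.le_0_l N)) as H1.
change (Cmod (Csum u N - 0) <= Rsum M N - 0)%R in H1.
replace (Csum u N - 0) with (Csum u N) in H1 by ring; lra.
Qed.

Lemma Rsum_tail (M : nat -> R) (B eps : R) :
  (forall n, (0 <= M n)%R) -> (forall N, (Rsum M N <= B)%R) -> (0 < eps)%R ->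
  exists N0, forall N, (N0 <= N)%nat -> (Rsum M N - Rsum M N0 <= eps)%R.
Proof.
intros H0 HB Heps.
destruct (completeness (fun x => exists N, x = Rsum M N)) as [s [Hs1 Hs2]].
- exists B; intros x [N ->]; apply HB.
- exists (Rsum M 0); now exists 0%nat.
- assert (HN : exists N, (s - eps < Rsum M N)%R).
  { apply Classical_Prop.NNPP; intros H.
    assert (s <= s - eps)%R; [|lra].
    apply Hs2; intros x [N ->]; apply Rnot_lt_le; intros H'; apply H; now exists N. }
  destruct HN as [N HN]; exists N; intros N' _.
  assert (Rsum M N' <= s)%R by (apply Hs1; now exists N'); lra.
Qed.

(** The partial sums are Cauchy because the majorant has small tails; uniqueness of limits then
    identifies the chosen value in [Clim] with the actual limit. *)
Lemma Cseries_tends (u : nat -> C) (M : nat -> R) (B : R) :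
  (forall n, (Cmod (u n) <= M n)%R) -> (forall N, (Rsum M N <= B)%R) ->
  tends eventually (Csum u) (Cseries u).
Proof.
intros Hu HB.
assert (H0 : forall n, (0 <= M n)%R) by (intros n; eapply Rle_trans; [apply Cmod_ge_0|apply Hu]).
destruct (proj1 (filterlim_locally_cauchy (U := C_CompleteNormedModule) (F := eventually) (Csum u)))
  as [l Hl].
- intros eps.
  destruct (Rsum_tail M B (eps / 3) H0 HB) as [N0 HN0]; [destruct eps; simpl; lra|].
  exists (fun n => (N0 <= n)%nat); split; [now exists N0|].
  intros n m Hn Hm.
  apply (norm_compat1 (V := C_NormedModule)).
  change (Cmod (Csum u m - Csum u n) < eps)%R.
  eapply Rle_lt_trans; [apply (Cmod_triangle_minus _ (Csum u N0))|].
  rewrite (Cmod_minus_sym (Csum u N0)).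
  pose proof (Csum_diff_le u M N0 n Hu Hn); pose proof (Csum_diff_le u M N0 m Hu Hm).
  pose proof (HN0 n Hn); pose proof (HN0 m Hm); destruct eps as [e He]; simpl in *; lra.
- unfold Cseries; rewrite (Clim_unique eventually _ (Csum u) l Hl).
  apply tends_iff; [apply eventually_filter|exact Hl].
Qed.

(* The partial sums of [zfold u] are the sums of [u] over [-N <= k < N]. *)
Definition zfold (u : Z -> C) (n : nat) : C := u (Z.of_nat n) + u (- Z.of_nat (S n))%Z.
Definition zfoldR (M : Z -> R) (n : nat) : R := (M (Z.of_nat n) + M (- Z.of_nat (S n))%Z)%R.

(** For nonnegative terms a bound on the partial sums is equivalent to convergence, and a bound is
    easier to carry through comparisons, shifts and reflections than a limit. *)
Definition summable (M : Z -> R) : Prop :=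
  (forall k, (0 <= M k)%R) /\ exists B, forall N, (Rsum (zfoldR M) N <= B)%R.

Definition abs_summable (u : Z -> C) : Prop := summable (fun k => Cmod (u k)).

Lemma zfoldR_pos (M : Z -> R) : (forall k, (0 <= M k)%R) -> forall n, (0 <= zfoldR M n)%R.
Proof. intros H n; unfold zfoldR; apply Rplus_le_le_0_compat; apply H. Qed.

Lemma zfold_le (u : Z -> C) (M : Z -> R) :
  (forall k, (Cmod (u k) <= M k)%R) -> forall n, (Cmod (zfold u n) <= zfoldR M n)%R.
Proof.
intros H n; unfold zfold, zfoldR; eapply Rle_trans; [apply Cmod_triangle|].
apply Rplus_le_compat; apply H.
Qed.

Lemma summable_le (M M' : Z -> R) :
  (forall k, (0 <= M k <= M' k)%R) -> summable M' -> summable M.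
Proof.
intros H [H0 [B HB]]; split; [intros k; apply H|]; exists B; intros N.
eapply Rle_trans; [|apply HB]; apply Rsum_le; intros n; unfold zfoldR.
apply Rplus_le_compat; apply H.
Qed.

Lemma abs_summable_le (u : Z -> C) (M : Z -> R) :
  summable M -> (forall k, (Cmod (u k) <= M k)%R) -> abs_summable u.
Proof. intros HM H; apply summable_le with M; [|exact HM]; intros k; split; [apply Cmod_ge_0|apply H]. Qed.

Lemma summable_plus (M M' : Z -> R) :
  summable M -> summable M' -> summable (fun k => (M k + M' k)%R).
Proof.
intros [H0 [B HB]] [H0' [B' HB']]; split.
- intros k; specialize (H0 k); specialize (H0' k); lra.
- exists (B + B')%R; intros N.
  rewrite (Rsum_ext _ (fun n => (zfoldR M n + zfoldR M' n)%R)) by (intros; unfold zfoldR; ring).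
  rewrite Rsum_plus; specialize (HB N); specialize (HB' N); lra.
Qed.

Lemma summable_scal (c : R) (M : Z -> R) :
  (0 <= c)%R -> summable M -> summable (fun k => (c * M k)%R).
Proof.
intros Hc [H0 [B HB]]; split.
- intros k; apply Rmult_le_pos; auto.
- exists (c * B)%R; intros N.
  rewrite (Rsum_ext _ (fun n => (c * zfoldR M n)%R)) by (intros; unfold zfoldR; ring).
  rewrite Rsum_scal; apply Rmult_le_compat_l; auto.
Qed.

Lemma abs_summable_plus (u v : Z -> C) :
  abs_summable u -> abs_summable v -> abs_summable (fun k => u k + v k).
Proof.
intros Hu Hv; eapply abs_summable_le; [exact (summable_plus _ _ Hu Hv)|].
intros k; apply Cmod_triangle.
Qed.

Lemma abs_summable_scal (c : C) (u : Z -> C) :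
  abs_summable u -> abs_summable (fun k => c * u k).
Proof.
intros Hu; eapply abs_summable_le; [exact (summable_scal (Cmod c) _ (Cmod_ge_0 c) Hu)|].
intros k; rewrite Cmod_mult; apply Rle_refl.
Qed.

Lemma abs_summable_ext (u v : Z -> C) :
  (forall k, u k = v k) -> abs_summable u -> abs_summable v.
Proof.
intros E Hu; eapply abs_summable_le; [exact Hu|]; intros k; simpl; rewrite E; apply Rle_refl.
Qed.

Lemma Zsum_tends (u : Z -> C) :
  abs_summable u -> tends eventually (Csum (zfold u)) (Zsum u).
Proof.
intros [H0 [B HB]].
assert (HB1 : forall N, (Rsum (fun n => Cmod (u (Z.of_nat n))) N <= B)%R).
{ intros N; eapply Rle_trans; [|apply (HB N)]; apply Rsum_le; intros n; unfold zfoldR.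
  pose proof (Cmod_ge_0 (u (- Z.of_nat (S n))%Z)); lra. }
assert (HB2 : forall N, (Rsum (fun n => Cmod (u (- Z.of_nat (S n))%Z)) N <= B)%R).
{ intros N; eapply Rle_trans; [|apply (HB N)]; apply Rsum_le; intros n; unfold zfoldR.
  pose proof (Cmod_ge_0 (u (Z.of_nat n))); lra. }
unfold Zsum.
apply tends_ext with
  (fun N => Csum (fun n => u (Z.of_nat n)) N + Csum (fun n => u (- Z.of_nat (S n))%Z) N).
- apply eventually_filter.
- intros N; rewrite <- Csum_plus; reflexivity.
- apply tends_plus; [apply eventually_filter| |].
  + eapply Cseries_tends; [intros n; apply Rle_refl|exact HB1].
  + eapply Cseries_tends; [intros n; apply Rle_refl|exact HB2].
Qed.

Lemma Zsum_eq (u : Z -> C) (l : C) :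
  abs_summable u -> tends eventually (Csum (zfold u)) l -> Zsum u = l.
Proof. intros Hu Hl; eapply tends_unique; [apply eventually_filter|apply Zsum_tends, Hu|exact Hl]. Qed.

(** The order of quantifiers is the point: [N0] depends on the majorant only and serves all series
    below it at once. *)
Lemma Zsum_tail (M : Z -> R) (eps : R) :
  summable M -> (0 < eps)%R ->
  exists N0, forall u : Z -> C, (forall k, (Cmod (u k) <= M k)%R) ->
    (Cmod (Zsum u - Csum (zfold u) N0) <= eps)%R.
Proof.
intros HM Heps; destruct HM as [H0 [B HB]].
destruct (Rsum_tail _ B eps (zfoldR_pos M H0) HB Heps) as [N0 HN0].
exists N0; intros u Hu.
assert (Hs : abs_summable u) by (apply abs_summable_le with M; [split; eauto|exact Hu]).
apply (tends_le eventually (Csum (zfold u))); [|apply Zsum_tends, Hs].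
exists N0; intros N HN.
eapply Rle_trans; [apply Csum_diff_le; [apply zfold_le, Hu|exact HN]|auto].
Qed.

Lemma Zsum_le (M : Z -> R) (B : R) (u : Z -> C) :
  (forall N, (Rsum (zfoldR M) N <= B)%R) -> (forall k, (Cmod (u k) <= M k)%R) ->
  (Cmod (Zsum u) <= B)%R.
Proof.
intros HB Hu.
assert (Hs : abs_summable u).
{ apply abs_summable_le with M; [split; eauto|exact Hu].
  intros k; eapply Rle_trans; [apply Cmod_ge_0|apply Hu]. }
replace (Zsum u) with (Zsum u - 0) by ring.
apply (tends_le eventually (Csum (zfold u))); [|apply Zsum_tends, Hs].
apply filter_forall; intros N.
eapply Rle_trans; [|apply (HB N)].
pose proof (Csum_diff_le _ _ 0 N (zfold_le u M Hu) (Nat.le_0_l N)) as H; simpl in H.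
rewrite Rminus_0_r in H; exact H.
Qed.

Lemma tends_Csum {T : Type} (F : (T -> Prop) -> Prop) {FF : Filter F}
  (u : T -> nat -> C) (u0 : nat -> C) (N : nat) :
  (forall n, tends F (fun t => u t n) (u0 n)) ->
  tends F (fun t => Csum (u t) N) (Csum u0 N).
Proof.
intros H; induction N as [|N IH]; simpl; [apply tends_const, FF|now apply tends_plus].
Qed.

(** Tannery's theorem, along an arbitrary proper filter: truncate uniformly, pass to the limit in
    the finite sum, and bound both tails by the common majorant. *)
Lemma Zsum_dominated {T : Type} (F : (T -> Prop) -> Prop) {FF : ProperFilter F}
  (u : T -> Z -> C) (u0 : Z -> C) (M : Z -> R) :
  summable M -> F (fun t => forall k, (Cmod (u t k) <= M k)%R) ->
  (forall k, tends F (fun t => u t k) (u0 k)) ->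
  tends F (fun t => Zsum (u t)) (Zsum u0).
Proof.
intros HM Hu Hlim eps Heps.
assert (H0 : forall k, (Cmod (u0 k) <= M k)%R).
{ intros k; replace (u0 k) with (u0 k - 0) by ring.
  apply (tends_le F (fun t => u t k)); [|apply Hlim].
  revert Hu; apply filter_imp; intros t Ht; replace (u t k - 0) with (u t k) by ring; apply Ht. }
destruct (Zsum_tail M (eps / 3) HM) as [N0 HN0]; [lra|].
assert (E3 : (0 < eps / 3)%R) by lra.
assert (HC : tends F (fun t => Csum (zfold (u t)) N0) (Csum (zfold u0) N0)).
{ apply tends_Csum; [apply FF|]; intros n; unfold zfold; apply tends_plus; [apply FF| |]; apply Hlim. }
generalize (filter_and _ _ Hu (HC _ E3)); apply filter_imp; intros t [H1 H2].
pose proof (HN0 (u t) H1) as H3; pose proof (HN0 u0 H0) as H4.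
eapply Rle_lt_trans; [apply (Cmod_triangle_minus _ (Csum (zfold (u t)) N0))|].
pose proof (Cmod_triangle_minus (Csum (zfold (u t)) N0) (Csum (zfold u0) N0) (Zsum u0)) as H5.
rewrite (Cmod_minus_sym (Csum (zfold u0) N0) (Zsum u0)) in H5; lra.
Qed.

Lemma Zsum_ext (u v : Z -> C) : (forall k, u k = v k) -> Zsum u = Zsum v.
Proof.
intros H; replace v with u; [reflexivity|].
now apply FunctionalExtensionality.functional_extensionality.
Qed.

Lemma Zsum_plus (u v : Z -> C) :
  abs_summable u -> abs_summable v -> Zsum (fun k => u k + v k) = Zsum u + Zsum v.
Proof.
intros Hu Hv; apply Zsum_eq; [now apply abs_summable_plus|].
apply tends_ext with (fun N => Csum (zfold u) N + Csum (zfold v) N).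
- apply eventually_filter.
- intros N; rewrite <- Csum_plus; apply Csum_ext; intros; unfold zfold; ring.
- apply tends_plus; [apply eventually_filter| |]; now apply Zsum_tends.
Qed.

Lemma Zsum_scal (c : C) (u : Z -> C) :
  abs_summable u -> Zsum (fun k => c * u k) = c * Zsum u.
Proof.
intros Hu; apply Zsum_eq; [now apply abs_summable_scal|].
apply tends_ext with (fun N => c * Csum (zfold u) N).
- apply eventually_filter.
- intros N; rewrite <- Csum_scal; apply Csum_ext; intros; unfold zfold; ring.
- apply tends_scal; [apply eventually_filter|now apply Zsum_tends].
Qed.

Lemma abs_summable_opp (u : Z -> C) : abs_summable u -> abs_summable (fun k => - u k).
Proof.
intros Hu; apply abs_summable_ext with (fun k => (-(1)) * u k); [intros; ring|].
now apply abs_summable_scal.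
Qed.

Lemma Zsum_opp (u : Z -> C) : abs_summable u -> Zsum (fun k => - u k) = - Zsum u.
Proof.
intros Hu; rewrite (Zsum_ext _ (fun k => (-(1)) * u k)) by (intros; ring).
rewrite Zsum_scal by exact Hu; ring.
Qed.

Lemma abs_summable_minus (u v : Z -> C) :
  abs_summable u -> abs_summable v -> abs_summable (fun k => u k - v k).
Proof. intros; apply abs_summable_plus; [|apply abs_summable_opp]; assumption. Qed.

Lemma Zsum_minus (u v : Z -> C) :
  abs_summable u -> abs_summable v -> Zsum (fun k => u k - v k) = Zsum u - Zsum v.
Proof.
intros Hu Hv; unfold Cminus; rewrite Zsum_plus by (try apply abs_summable_opp; assumption).
now rewrite Zsum_opp.
Qed.

(** The map k -> -1 - k exchanges the two half-series in the definition of [Zsum], so the identity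
    holds without any summability. *)
Lemma Zsum_mirror (u : Z -> C) : Zsum (fun k => u (-1 - k)%Z) = Zsum u.
Proof.
unfold Zsum; rewrite Cplus_comm; f_equal; f_equal;
apply FunctionalExtensionality.functional_extensionality; intros n; f_equal; lia.
Qed.

Lemma summable_mirror (M : Z -> R) : summable M -> summable (fun k => M (-1 - k)%Z).
Proof.
intros [H0 [B HB]]; split; [intros; apply H0|]; exists B; intros N.
rewrite (Rsum_ext _ (zfoldR M)); [apply HB|].
intros n; unfold zfoldR; rewrite Rplus_comm; f_equal; f_equal; lia.
Qed.

Lemma Rsum_zfoldR_succ (M : Z -> R) (N : nat) :
  Rsum (zfoldR (fun k => M (k + 1)%Z)) N =
  (Rsum (zfoldR M) N + M (Z.of_nat N) - M (- Z.of_nat N)%Z)%R.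
Proof.
induction N as [|N IH]; [simpl; ring|].
simpl Rsum; rewrite IH; unfold zfoldR.
replace (Z.of_nat N + 1)%Z with (Z.of_nat (S N)) by lia.
replace (- Z.of_nat (S N) + 1)%Z with (- Z.of_nat N)%Z by lia; ring.
Qed.

Lemma Csum_zfold_succ (u : Z -> C) (N : nat) :
  Csum (zfold (fun k => u (k + 1)%Z)) N =
  Csum (zfold u) N + u (Z.of_nat N) - u (- Z.of_nat N)%Z.
Proof.
induction N as [|N IH]; [simpl; ring|].
simpl Csum; rewrite IH; unfold zfold.
replace (Z.of_nat N + 1)%Z with (Z.of_nat (S N)) by lia.
replace (- Z.of_nat (S N) + 1)%Z with (- Z.of_nat N)%Z by lia; ring.
Qed.

Lemma zfoldR_le_Rsum (M : Z -> R) (N : nat) :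
  (forall k, (0 <= M k)%R) -> (zfoldR M N <= Rsum (zfoldR M) (S N))%R.
Proof.
intros H; simpl; pose proof (Rsum_mono _ 0 N (zfoldR_pos M H) (Nat.le_0_l N)) as H1.
simpl in H1; lra.
Qed.

Lemma summable_succ (M : Z -> R) : summable M -> summable (fun k => M (k + 1)%Z).
Proof.
(* One [B] bounds the window itself, the other the single term that enters on the right when the
   window is shifted. *)
intros [H0 [B HB]]; split; [intros; apply H0|]; exists (B + B)%R; intros N.
rewrite Rsum_zfoldR_succ.
pose proof (H0 (- Z.of_nat N)%Z); pose proof (HB N); pose proof (HB (S N)).
pose proof (zfoldR_le_Rsum M N H0) as H3; unfold zfoldR at 1 in H3.
pose proof (H0 (- Z.of_nat (S N))%Z); lra.
Qed.

Lemma zfoldR_vanish (M : Z -> R) :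
  summable M -> forall eps, (0 < eps)%R -> eventually (fun N => (zfoldR M N < eps)%R).
Proof.
intros [H0 [B HB]] eps Heps.
destruct (Rsum_tail _ B (eps / 2) (zfoldR_pos M H0) HB) as [N0 HN0]; [lra|].
exists N0; intros N HN.
pose proof (HN0 (S N) ltac:(lia)) as H1; simpl in H1.
pose proof (Rsum_mono _ N0 N (zfoldR_pos M H0) HN); lra.
Qed.

Lemma abs_summable_vanish (u : Z -> C) :
  abs_summable u -> tends eventually (fun N => u (Z.of_nat N)) 0 /\
                    tends eventually (fun N => u (- Z.of_nat (S N))%Z) 0.
Proof.
intros Hu; split; intros eps Heps;
generalize (zfoldR_vanish _ Hu eps Heps); apply filter_imp; intros N H; unfold zfoldR in H.
- replace (u (Z.of_nat N) - 0) with (u (Z.of_nat N)) by ring.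
  pose proof (Cmod_ge_0 (u (- Z.of_nat (S N))%Z)); lra.
- replace (u (- Z.of_nat (S N))%Z - 0) with (u (- Z.of_nat (S N))%Z) by ring.
  pose proof (Cmod_ge_0 (u (Z.of_nat N))); lra.
Qed.

Lemma Zsum_succ (u : Z -> C) : abs_summable u -> Zsum (fun k => u (k + 1)%Z) = Zsum u.
Proof.
intros Hu; apply Zsum_eq; [exact (summable_succ _ Hu)|].
destruct (abs_summable_vanish u Hu) as [V1 V2].
apply tends_ext with (fun N => Csum (zfold u) N + u (Z.of_nat N) - u (- Z.of_nat N)%Z).
- apply eventually_filter.
- intros N; now rewrite Csum_zfold_succ.
- replace (Zsum u) with (Zsum u + 0 - 0) by ring.
  apply tends_minus; [apply eventually_filter| |].
  + apply tends_plus; [apply eventually_filter| |exact V1]; now apply Zsum_tends.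
  + intros eps Heps; destruct (V2 eps Heps) as [N0 HN0]; exists (S N0); intros [|N] HN; [lia|].
    apply HN0; lia.
Qed.

Lemma summable_reflect (M : Z -> R) (c : Z) : summable M -> summable (fun k => M (c - k)%Z).
Proof.
assert (S1 : forall n M, summable M -> summable (fun k => M (k + Z.of_nat n)%Z)).
{ intros n; induction n as [|n IH]; intros M' H.
  - apply summable_le with M'; [|exact H]; intros k; rewrite Z.add_0_r; split; [apply H|lra].
  - pose proof (summable_succ _ (IH _ H)) as H1.
    apply summable_le with (2 := H1); intros k; cbn beta; split; [apply H|apply Req_le; f_equal; lia]. }
intros H.
destruct (Z_le_gt_dec (-1) c) as [L|L].
- pose proof (S1 (Z.to_nat (c + 1)) _ H) as H1; apply summable_mirror in H1.
  apply summable_le with (2 := H1); intros k; cbn beta; split; [apply H|apply Req_le; f_equal; lia].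
- pose proof (summable_mirror _ H) as H1.
  pose proof (S1 (Z.to_nat (-1 - c)) _ H1) as H2.
  apply summable_le with (2 := H2); intros k; cbn beta; split; [apply H|apply Req_le; f_equal; lia].
Qed.

Lemma summable_shift (M : Z -> R) (c : Z) : summable M -> summable (fun k => M (k + c)%Z).
Proof.
intros H; pose proof (summable_reflect _ 0 (summable_reflect _ c H)) as H1.
apply summable_le with (2 := H1); intros k; cbn beta; split; [apply H|apply Req_le; f_equal; lia].
Qed.

Lemma abs_summable_reflect (u : Z -> C) (c : Z) :
  abs_summable u -> abs_summable (fun k => u (c - k)%Z).
Proof. intros H; exact (summable_reflect _ c H). Qed.

Lemma abs_summable_shift (u : Z -> C) (c : Z) :
  abs_summable u -> abs_summable (fun k => u (k + c)%Z).
Proof. intros H; exact (summable_shift _ c H). Qed.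

Lemma Zsum_shift (u : Z -> C) (c : Z) : abs_summable u -> Zsum (fun k => u (k + c)%Z) = Zsum u.
Proof.
assert (S1 : forall n u, abs_summable u -> Zsum (fun k => u (k + Z.of_nat n)%Z) = Zsum u).
{ intros n; induction n as [|n IH]; intros u' H.
  - apply Zsum_ext; intros; f_equal; lia.
  - rewrite <- (IH u' H), <- (Zsum_succ (fun k => u' (k + Z.of_nat n)%Z)).
    + apply Zsum_ext; intros; f_equal; lia.
    + now apply abs_summable_shift. }
intros H; destruct (Z_le_gt_dec 0 c) as [L|L].
- rewrite <- (S1 (Z.to_nat c) u H); apply Zsum_ext; intros; f_equal; lia.
- rewrite <- (S1 (Z.to_nat (- c)) (fun k => u (k + c)%Z)).
  + apply Zsum_ext; intros; f_equal; lia.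
  + now apply abs_summable_shift.
Qed.

Lemma Zsum_reflect (u : Z -> C) (c : Z) : abs_summable u -> Zsum (fun k => u (c - k)%Z) = Zsum u.
Proof.
intros H; rewrite <- (Zsum_shift u (c + 1) H), <- (Zsum_mirror (fun k => u (k + (c + 1))%Z)).
apply Zsum_ext; intros; f_equal; lia.
Qed.

(** The half-open window -2N <= k < 2N splits into 2j and 2j + 1 with j in the same kind of window;
    a window symmetric about 0 would leave a boundary term. *)
Lemma Csum_zfold_double (u : Z -> C) (N : nat) :
  Csum (zfold u) (2 * N) =
  Csum (zfold (fun k => u (2 * k)%Z)) N + Csum (zfold (fun k => u (2 * k + 1)%Z)) N.
Proof.
induction N as [|N IH]; [simpl; ring|].
replace (2 * S N)%nat with (S (S (2 * N))) by lia.
cbn [Csum]; rewrite IH; unfold zfold.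
replace (Z.of_nat (2 * N)) with (2 * Z.of_nat N)%Z by lia.
replace (Z.of_nat (S (2 * N))) with (2 * Z.of_nat N + 1)%Z by lia.
replace (- Z.of_nat (S (S (2 * N))))%Z with (2 * (- Z.of_nat (S N)))%Z by lia.
replace (- (2 * Z.of_nat N + 1))%Z with (2 * (- Z.of_nat (S N)) + 1)%Z by lia; ring.
Qed.

Lemma Rsum_zfoldR_double (M : Z -> R) (N : nat) :
  Rsum (zfoldR M) (2 * N) =
  (Rsum (zfoldR (fun k => M (2 * k)%Z)) N + Rsum (zfoldR (fun k => M (2 * k + 1)%Z)) N)%R.
Proof.
induction N as [|N IH]; [simpl; ring|].
replace (2 * S N)%nat with (S (S (2 * N))) by lia.
cbn [Rsum]; rewrite IH; unfold zfoldR.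
replace (Z.of_nat (2 * N)) with (2 * Z.of_nat N)%Z by lia.
replace (Z.of_nat (S (2 * N))) with (2 * Z.of_nat N + 1)%Z by lia.
replace (- Z.of_nat (S (S (2 * N))))%Z with (2 * (- Z.of_nat (S N)))%Z by lia.
replace (- (2 * Z.of_nat N + 1))%Z with (2 * (- Z.of_nat (S N)) + 1)%Z by lia; ring.
Qed.

Lemma summable_even_odd (M : Z -> R) :
  summable M -> summable (fun k => M (2 * k)%Z) /\ summable (fun k => M (2 * k + 1)%Z).
Proof.
intros [H0 [B HB]]; split; (split; [intros; apply H0|]); exists B; intros N;
pose proof (HB (2 * N)%nat) as H; rewrite Rsum_zfoldR_double in H.
- pose proof (Rsum_pos (zfoldR (fun k => M (2 * k + 1)%Z)) N (zfoldR_pos _ (fun k => H0 _))); lra.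
- pose proof (Rsum_pos (zfoldR (fun k => M (2 * k)%Z)) N (zfoldR_pos _ (fun k => H0 _))); lra.
Qed.

Lemma Zsum_even_odd (u : Z -> C) :
  abs_summable u ->
  Zsum u = Zsum (fun k => u (2 * k)%Z) + Zsum (fun k => u (2 * k + 1)%Z).
Proof.
intros Hu; destruct (summable_even_odd _ Hu) as [He Ho].
eapply (tends_unique eventually (fun N => Csum (zfold u) (2 * N))).
- apply (tends_comp eventually eventually (fun N => (2 * N)%nat) (Csum (zfold u))).
  + intros P [N0 HN0]; exists N0; intros N HN; apply HN0; lia.
  + now apply Zsum_tends.
- apply tends_ext with (fun N => Csum (zfold (fun k => u (2 * k)%Z)) N +
                                 Csum (zfold (fun k => u (2 * k + 1)%Z)) N).
  + apply eventually_filter.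
  + intros N; now rewrite Csum_zfold_double.
  + apply tends_plus; [apply eventually_filter| |]; now apply Zsum_tends.
Qed.

Lemma Csum_Zsum (u : nat -> Z -> C) (N : nat) :
  (forall n, abs_summable (u n)) ->
  abs_summable (fun k => Csum (fun n => u n k) N) /\
  Zsum (fun k => Csum (fun n => u n k) N) = Csum (fun n => Zsum (u n)) N.
Proof.
intros H; induction N as [|N [IH1 IH2]]; simpl.
- assert (Z0 : abs_summable (fun _ => RtoC 0)).
  { split; [intros; apply Cmod_ge_0|]; exists 0%R; intros N; induction N as [|N IH]; simpl; [lra|].
    unfold zfoldR in *; rewrite Cmod_0 in *; lra. }
  split; [exact Z0|]; apply Zsum_eq; [exact Z0|].
  apply tends_ext with (fun _ => RtoC 0); [apply eventually_filter| |apply tends_const, eventually_filter].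
  intros N; induction N as [|N IH]; simpl; [reflexivity|]; rewrite <- IH; unfold zfold; ring.
- split; [now apply abs_summable_plus|]; rewrite Zsum_plus, IH2; auto.
Qed.

(** A translate by c of the window of size N lies in the window of size N + |c|. The auxiliary
    claims [A] and [A'] list exactly the nonnegative terms left over for right and left translates,
    so one bound serves all c. *)
Lemma Rsum_bound_shift (M : Z -> R) :
  summable M -> exists B, forall c N, (Rsum (zfoldR (fun k => M (k + c)%Z)) N <= B)%R.
Proof.
intros HM; pose proof HM as [H0 [B HB]]; exists B; intros c N.
assert (G : (Rsum (zfoldR (fun k => M (k + c)%Z)) N <=
             Rsum (zfoldR M) (N + Z.abs_nat c))%R); [|eapply Rle_trans; [exact G|apply HB]].
assert (P : forall (n : nat), (Rsum (zfoldR (fun k => M (k + Z.of_nat n)%Z)) N <=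
                    Rsum (zfoldR M) (N + n))%R /\
                    (Rsum (zfoldR (fun k => M (k - Z.of_nat n)%Z)) N <=
                    Rsum (zfoldR M) (N + n))%R).
{ intros n.
  assert (A : forall n, (Rsum (zfoldR (fun k => M (k + Z.of_nat n)%Z)) N +
     Rsum (fun i => (M (- Z.of_nat (S (N + i)))%Z + M (- Z.of_nat N + Z.of_nat i)%Z)%R) n =
     Rsum (zfoldR M) (N + n))%R).
  { intros m; induction m as [|m IH].
    - simpl Rsum at 2; rewrite Nat.add_0_r, Rplus_0_r; apply Rsum_ext; intros i.
      unfold zfoldR; now rewrite !Z.add_0_r.
    - replace (N + S m)%nat with (S (N + m)) by lia; cbn [Rsum]; rewrite <- IH.
      assert (E : Rsum (zfoldR (fun k => M (k + Z.of_nat (S m))%Z)) N =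
                  (Rsum (zfoldR (fun k => M (k + Z.of_nat m)%Z)) N +
                   M (Z.of_nat N + Z.of_nat m)%Z - M (- Z.of_nat N + Z.of_nat m)%Z)%R).
      { rewrite <- (Rsum_zfoldR_succ (fun k => M (k + Z.of_nat m)%Z)).
        apply Rsum_ext; intros i; unfold zfoldR; f_equal; f_equal; lia. }
      rewrite E; unfold zfoldR at 3; rewrite Nat2Z.inj_add; ring. }
  assert (A' : forall n, (Rsum (zfoldR (fun k => M (k - Z.of_nat n)%Z)) N +
     Rsum (fun i => (M (Z.of_nat (N + i))%Z + M (Z.of_nat N - 1 - Z.of_nat i)%Z)%R) n =
     Rsum (zfoldR M) (N + n))%R).
  { intros m; induction m as [|m IH].
    - simpl Rsum at 2; rewrite Nat.add_0_r, Rplus_0_r; apply Rsum_ext; intros i.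
      unfold zfoldR; now rewrite !Z.sub_0_r.
    - replace (N + S m)%nat with (S (N + m)) by lia; cbn [Rsum]; rewrite <- IH.
      assert (E : Rsum (zfoldR (fun k => M (k - Z.of_nat m)%Z)) N =
                  (Rsum (zfoldR (fun k => M (k - Z.of_nat (S m))%Z)) N +
                   M (Z.of_nat N - Z.of_nat (S m))%Z - M (- Z.of_nat N - Z.of_nat (S m))%Z)%R).
      { rewrite <- (Rsum_zfoldR_succ (fun k => M (k - Z.of_nat (S m))%Z)).
        apply Rsum_ext; intros i; unfold zfoldR; f_equal; f_equal; lia. }
      rewrite E; unfold zfoldR at 3.
      replace (Z.of_nat N - Z.of_nat (S m))%Z with (Z.of_nat N - 1 - Z.of_nat m)%Z by lia.
      replace (- Z.of_nat N - Z.of_nat (S m))%Z with (- Z.of_nat (S (N + m)))%Z by lia; ring. }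
  split.
  - rewrite <- (A n).
    pose proof (Rsum_pos (fun i => (M (- Z.of_nat (S (N + i)))%Z + M (- Z.of_nat N + Z.of_nat i)%Z)%R)
      n (fun i => Rplus_le_le_0_compat _ _ (H0 _) (H0 _))); lra.
  - rewrite <- (A' n).
    pose proof (Rsum_pos (fun i => (M (Z.of_nat (N + i))%Z + M (Z.of_nat N - 1 - Z.of_nat i)%Z)%R)
      n (fun i => Rplus_le_le_0_compat _ _ (H0 _) (H0 _))); lra. }
destruct (P (Z.abs_nat c)) as [P1 P2].
destruct (Z_le_gt_dec 0 c) as [L|L].
- replace (Z.of_nat (Z.abs_nat c)) with c in P1 by lia; exact P1.
- eapply Rle_trans; [|exact P2]; apply Req_le, Rsum_ext; intros i; unfold zfoldR; f_equal; f_equal; lia.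
Qed.

(* The shape of the dominating function is the one met when multiplying bilateral series. *)
Lemma Zsum_swap (a : Z -> Z -> C) (M M' : Z -> R) :
  summable M -> summable M' ->
  (forall j N, (Cmod (a j N) <= M j * M' (N - j)%Z)%R) ->
  (forall N, abs_summable (fun j => a j N)) /\
  abs_summable (fun j => Zsum (fun N => a j N)) /\
  abs_summable (fun N => Zsum (fun j => a j N)) /\
  Zsum (fun j => Zsum (fun N => a j N)) = Zsum (fun N => Zsum (fun j => a j N)).
Proof.
intros HM HM' Ha.
destruct (Rsum_bound_shift M' HM') as [B HB].
assert (HBj : forall j N, (Rsum (zfoldR (fun k => M j * M' (k - j)%Z)%R) N <= M j * B)%R).
{ intros j N; rewrite (Rsum_ext _ (fun n => (M j * zfoldR (fun k => M' (k + (- j))%Z) n)%R))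
    by (intros; unfold zfoldR; rewrite Rmult_plus_distr_l; reflexivity).
  rewrite Rsum_scal; apply Rmult_le_compat_l; [apply HM|apply HB]. }
assert (SN : forall j, abs_summable (fun N => a j N)).
{ intros j; apply abs_summable_le with (fun N => (M j * M' (N - j)%Z)%R); [|auto].
  split; [intros; apply Rmult_le_pos; [apply HM|apply HM']|eauto]. }
destruct HM as [M0 [BM HBM]]; pose proof HM' as [M'0 [BM' HBM']].
assert (Bd : forall k, (M' k <= BM')%R).
{ intros k; destruct (Z_le_gt_dec 0 k).
  - eapply Rle_trans; [|apply (HBM' (S (Z.to_nat k)))].
    eapply Rle_trans; [|apply zfoldR_le_Rsum, M'0].
    unfold zfoldR; rewrite Z2Nat.id by lia; pose proof (M'0 (- Z.of_nat (S (Z.to_nat k)))%Z); lra.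
  - eapply Rle_trans; [|apply (HBM' (S (Z.to_nat (-1 - k))))].
    eapply Rle_trans; [|apply zfoldR_le_Rsum, M'0].
    unfold zfoldR; replace (- Z.of_nat (S (Z.to_nat (-1 - k))))%Z with k by lia.
    pose proof (M'0 (Z.of_nat (Z.to_nat (-1 - k)))); lra. }
assert (SJ : forall N, abs_summable (fun j => a j N)).
{ intros N; apply abs_summable_le with (fun j => (BM' * M j)%R).
  - apply summable_scal; [eapply Rle_trans; [apply (M'0 0%Z)|apply Bd]|split; eauto].
  - intros j; eapply Rle_trans; [apply Ha|]; rewrite Rmult_comm.
    apply Rmult_le_compat_r; [apply M0|apply Bd]. }
assert (SZ : abs_summable (fun N => Zsum (fun j => a j N))).
{ split; [intros; apply Cmod_ge_0|]; exists (BM * B)%R; intros K.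
  set (zz := fun N => Zsum (fun j => a j N)) in *.
  (* Unimodular factors with w_N z_N = |z_N| make the sum of absolute values linear in the terms, so
     that the finite sum over N can be moved inside the sum over j. *)
  set (w := fun N => match Ceq_dec (zz N) 0 with
                     | left _ => RtoC 1 | right _ => RtoC (Cmod (zz N)) / zz N end).
  assert (Hw : forall N, Cmod (w N) = 1%R /\ w N * zz N = RtoC (Cmod (zz N))).
  { intros N; unfold w; destruct (Ceq_dec (zz N) 0) as [E|E].
    - split; [apply Cmod_1|rewrite E, Cmod_0; ring].
    - pose proof (proj1 (Cmod_gt_0 (zz N)) E) as P; split.
      + rewrite Cmod_div by exact E; rewrite Cmod_R, Rabs_pos_eq by lra; field; lra.
      + field; exact E. }
  assert (E1 : RtoC (Rsum (zfoldR (fun N => Cmod (zz N))) K) =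
               Csum (zfold (fun N => w N * zz N)) K).
  { clear -Hw; induction K as [|K IH]; simpl; [reflexivity|].
    rewrite RtoC_plus, IH; unfold zfold, zfoldR; rewrite RtoC_plus.
    now rewrite !(proj2 (Hw _)). }
  set (u := fun (n : nat) (j : Z) => zfold (fun N => w N * a j N) n).
  assert (E2 : Csum (zfold (fun N => w N * zz N)) K = Csum (fun n => Zsum (u n)) K).
  { apply Csum_ext; intros n _; unfold u, zfold, zz.
    rewrite Zsum_plus by (apply abs_summable_scal, SJ).
    now rewrite !Zsum_scal by apply SJ. }
  destruct (Csum_Zsum u K) as [_ E3].
  { intros n; unfold u, zfold; apply abs_summable_plus; apply abs_summable_scal, SJ. }
  rewrite <- E3 in E2; rewrite E2 in E1.
  change (Rsum (zfoldR (fun N => Cmod (zz N))) K <= BM * B)%R.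
  rewrite <- (Rabs_pos_eq (Rsum _ K)), <- Cmod_R, E1.
  - apply Zsum_le with (fun j => (B * M j)%R).
    + intros N; rewrite (Rsum_ext _ (fun n => (B * zfoldR M n)%R)) by (intros; unfold zfoldR; ring).
      rewrite Rsum_scal, Rmult_comm; apply Rmult_le_compat_r; [|apply HBM].
      pose proof (HB 0%Z 0%nat) as H; simpl in H; exact H.
    + intros j; unfold u.
      eapply Rle_trans; [apply (Csum_le _ (zfoldR (fun N => (M j * M' (N - j)%Z)%R)))|
        rewrite (Rmult_comm B); apply HBj].
      apply zfold_le; intros k; rewrite Cmod_mult, (proj1 (Hw k)), Rmult_1_l; apply Ha.
  - apply Rsum_pos, zfoldR_pos; intros; apply Cmod_ge_0. }
assert (B0 : (0 <= B)%R) by (exact (HB 0%Z 0%nat)).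
split; [exact SJ|split; [|split; [exact SZ|]]].
{ apply abs_summable_le with (fun j => (B * M j)%R); [apply summable_scal; [exact B0|split; eauto]|].
  intros j; rewrite Rmult_comm; apply Zsum_le with (1 := HBj j); intros N; apply Ha. }
symmetry; apply Zsum_eq; [exact SZ|].
apply tends_ext with (fun K => Zsum (fun j => Csum (zfold (fun N => a j N)) K)).
- apply eventually_filter.
- intros K.
  destruct (Csum_Zsum (fun n j => zfold (fun N => a j N) n) K) as [_ E3].
  { intros n; unfold zfold; apply abs_summable_plus; apply SJ. }
  etransitivity; [exact E3|].
  apply Csum_ext; intros n _; unfold zfold; now rewrite Zsum_plus.
- apply (Zsum_dominated eventually) with (fun j => (B * M j)%R).
  + apply summable_scal; [pose proof (HB 0%Z 0%nat) as H; simpl in H; exact H|split; eauto].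
  + apply filter_forall; intros K j.
    eapply Rle_trans; [apply (Csum_le _ (zfoldR (fun N => (M j * M' (N - j)%Z)%R)))|
      rewrite (Rmult_comm B); apply HBj].
    apply zfold_le; intros k; apply Ha.
  + intros j; apply Zsum_tends, SN.
Qed.

(** * Complex exponential and integer powers *)

Lemma Cmult_cancel_l (c x y : C) : c <> 0 -> c * x = c * y -> x = y.
Proof.
intros Hc H; replace x with (/ c * (c * x)) by (field; exact Hc).
rewrite H; field; exact Hc.
Qed.

Lemma Cexp_plus (z w : C) : Cexp (z + w) = Cexp z * Cexp w.
Proof.
destruct z as [a b], w as [c d]; unfold Cexp, Cmult; simpl.
rewrite exp_plus, cos_plus, sin_plus; f_equal; ring.
Qed.

Lemma Cexp_0 : Cexp 0 = 1.
Proof. unfold Cexp; simpl; rewrite exp_0, cos_0, sin_0; unfold RtoC; f_equal; ring. Qed.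

Lemma Cexp_R (x : R) : Cexp (RtoC x) = RtoC (exp x).
Proof. unfold Cexp, RtoC; simpl; rewrite cos_0, sin_0; f_equal; ring. Qed.

Lemma Cexp_neq_0 (z : C) : Cexp z <> 0.
Proof.
intros H; apply C1_nz; rewrite <- Cexp_0; replace (RtoC 0) with (z + - z) by ring.
rewrite Cexp_plus, H; ring.
Qed.

Lemma Cexp_opp (z : C) : Cexp (- z) = / Cexp z.
Proof.
apply Cmult_cancel_l with (Cexp z); [apply Cexp_neq_0|].
rewrite <- Cexp_plus, Cinv_r by apply Cexp_neq_0.
replace (z + - z) with (RtoC 0) by ring; apply Cexp_0.
Qed.

Lemma Cmod_Cexp (z : C) : Cmod (Cexp z) = exp (Re z).
Proof.
unfold Cmod, Cexp; simpl.
match goal with |- sqrt ?e = _ => replace e with ((exp (Re z))²)%R end.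
- apply sqrt_Rsqr, Rlt_le, exp_pos.
- pose proof (sin2_cos2 (Im z)) as H; unfold Rsqr in *.
  transitivity (exp (Re z) * exp (Re z) * (sin (Im z) * sin (Im z) + cos (Im z) * cos (Im z)))%R;
  [rewrite H|]; ring.
Qed.

Lemma Cexp_2PI_Z (n : Z) : Cexp (2 * PI * Ci * IZR n) = 1.
Proof.
assert (H1 : Cexp (2 * PI * Ci) = 1).
{ unfold Cexp, Ci, Cmult, RtoC; simpl.
  replace ((2 * PI - 0 * 0) * 0 - (2 * 0 + 0 * PI) * 1)%R with 0%R by ring.
  replace ((2 * PI - 0 * 0) * 1 + (2 * 0 + 0 * PI) * 0)%R with (2 * PI)%R by ring.
  rewrite exp_0, cos_2PI, sin_2PI; f_equal; ring. }
assert (H2 : forall n : nat, Cexp (2 * PI * Ci * INR n) = 1).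
{ intros m; induction m as [|m IH].
  - simpl; replace (2 * PI * Ci * 0) with (RtoC 0) by ring; apply Cexp_0.
  - rewrite S_INR, RtoC_plus.
    replace (2 * PI * Ci * (INR m + 1)) with (2 * PI * Ci * INR m + 2 * PI * Ci) by ring.
    rewrite Cexp_plus, IH, H1; ring. }
destruct (Z_le_gt_dec 0 n).
- replace (IZR n) with (INR (Z.to_nat n)) by (rewrite INR_IZR_INZ, Z2Nat.id by lia; reflexivity).
  apply H2.
- replace (2 * PI * Ci * IZR n) with (- (2 * PI * Ci * INR (Z.to_nat (- n)))).
  + rewrite Cexp_opp, H2; field.
  + rewrite INR_IZR_INZ, Z2Nat.id, opp_IZR, RtoC_opp by lia; ring.
Qed.

Lemma tends_Cexp {T : Type} (F : (T -> Prop) -> Prop) {FF : Filter F} (f : T -> C) (l : C) :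
  tends F f l -> tends F (fun t => Cexp (f t)) (Cexp l).
Proof.
intros H.
assert (K0 : forall t, Rabs (Re (f t) - Re l) <= Cmod (f t - l) /\
                       Rabs (Im (f t) - Im l) <= Cmod (f t - l)).
{ intros t; pose proof (Rmax_Cmod (f t - l)) as M; destruct (f t) as [a b], l as [c d].
  simpl in *; pose proof (Rmax_l (Rabs (a + - c)) (Rabs (b + - d)));
  pose proof (Rmax_r (Rabs (a + - c)) (Rabs (b + - d))); unfold Rminus; split; lra. }
assert (HR : filterlim (fun t => Re (f t)) F (locally (Re l))).
{ apply filterlim_locally; intros eps; generalize (H eps (cond_pos eps)).
  apply filter_imp; intros t Ht; destruct (K0 t) as [K1 _].
  change (Rabs (Re (f t) - Re l) < eps)%R; lra. }
assert (HI : filterlim (fun t => Im (f t)) F (locally (Im l))).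
{ apply filterlim_locally; intros eps; generalize (H eps (cond_pos eps)).
  apply filter_imp; intros t Ht; destruct (K0 t) as [_ K1].
  change (Rabs (Im (f t) - Im l) < eps)%R; lra. }
assert (E : forall z, Cexp z = RtoC (exp (Re z)) * (RtoC (cos (Im z)) + Ci * RtoC (sin (Im z)))).
{ intros z; unfold Cexp, Ci, Cmult, Cplus, RtoC; simpl; f_equal; ring. }
rewrite E; apply tends_ext with
  (fun t => RtoC (exp (Re (f t))) * (RtoC (cos (Im (f t))) + Ci * RtoC (sin (Im (f t))))).
- exact FF.
- intros t; symmetry; apply E.
- apply tends_mult; [exact FF| |apply tends_plus; [exact FF| |apply tends_scal; [exact FF|]]];
  apply tends_RtoC; try exact FF.
  + eapply filterlim_comp; [exact HR|]; apply (continuity_pt_filterlim exp).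
    apply derivable_continuous_pt, derivable_pt_exp.
  + eapply filterlim_comp; [exact HI|]; apply (continuity_pt_filterlim cos), continuity_cos.
  + eapply filterlim_comp; [exact HI|]; apply (continuity_pt_filterlim sin), continuity_sin.
Qed.

Definition zpow (z : C) (n : Z) : C :=
  match n with
  | Z0 => 1
  | Zpos p => z ^ Pos.to_nat p
  | Zneg p => / z ^ Pos.to_nat p
  end.

Lemma zpow_of_nat (z : C) (n : nat) : zpow z (Z.of_nat n) = z ^ n.
Proof. destruct n as [|n]; [reflexivity|]; simpl zpow; now rewrite SuccNat2Pos.id_succ. Qed.

Lemma zpow_opp_of_nat (z : C) (n : nat) : zpow z (- Z.of_nat n) = / z ^ n.
Proof.
destruct n as [|n]; [simpl; field; apply C1_nz|]; simpl zpow; now rewrite SuccNat2Pos.id_succ.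
Qed.

Lemma zpow_succ (z : C) (n : Z) : z <> 0 -> zpow z (n + 1) = z * zpow z n.
Proof.
intros Hz; destruct (Z_le_gt_dec 0 n).
- rewrite <- (Z2Nat.id n) by lia.
  replace (Z.of_nat (Z.to_nat n) + 1)%Z with (Z.of_nat (S (Z.to_nat n))) by lia.
  rewrite !zpow_of_nat, Cpow_S; ring.
- replace n with (- Z.of_nat (S (Z.to_nat (-1 - n))))%Z by lia.
  replace (- Z.of_nat (S (Z.to_nat (-1 - n))) + 1)%Z with (- Z.of_nat (Z.to_nat (-1 - n)))%Z by lia.
  rewrite !zpow_opp_of_nat, Cpow_S; field; split; [now apply Cpow_nz|exact Hz].
Qed.

Lemma Z_bi_ind (P : Z -> Prop) :
  P 0%Z -> (forall n, P n -> P (n + 1)%Z) -> (forall n, P (n + 1)%Z -> P n) -> forall n, P n.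
Proof.
intros H0 Hs Hp; apply Z.bi_induction; [now intros ? ? ->|exact H0|].
intros n; split; intros H; [apply Hs|apply Hp]; exact H.
Qed.

(** A first-order recursion with invertible factor determines a function on all integers; the laws
    of exponents are obtained by checking it instead of splitting on signs. *)
Lemma zpow_char (z : C) (f : Z -> C) :
  z <> 0 -> f 0%Z = 1 -> (forall n, f (n + 1)%Z = z * f n) -> forall n, f n = zpow z n.
Proof.
intros Hz H0 Hs; apply Z_bi_ind; [exact H0| |]; intros n H.
- now rewrite Hs, zpow_succ, H.
- rewrite Hs, zpow_succ in H by exact Hz; now apply Cmult_cancel_l with z.
Qed.

Lemma zpow_neq_0 (z : C) (n : Z) : z <> 0 -> zpow z n <> 0.
Proof.
intros Hz; revert n; apply Z_bi_ind; [exact C1_nz| |]; intros n H.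
- rewrite zpow_succ by exact Hz; now apply Cmult_neq_0.
- rewrite zpow_succ in H by exact Hz; intros E; apply H; rewrite E; ring.
Qed.

Lemma zpow_add (z : C) (n m : Z) : z <> 0 -> zpow z (n + m) = zpow z n * zpow z m.
Proof.
intros Hz.
assert (H : zpow z (m + n) / zpow z m = zpow z n).
{ apply (zpow_char z (fun n => zpow z (m + n) / zpow z m) Hz).
  - rewrite Z.add_0_r; field; now apply zpow_neq_0.
  - intros k; rewrite Z.add_assoc, zpow_succ by exact Hz; field; now apply zpow_neq_0. }
rewrite <- H, Z.add_comm; field; now apply zpow_neq_0.
Qed.

Lemma zpow_opp (z : C) (n : Z) : z <> 0 -> zpow z (- n) = / zpow z n.
Proof.
intros Hz; apply Cmult_cancel_l with (zpow z n); [now apply zpow_neq_0|].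
rewrite <- zpow_add, Z.add_opp_diag_r, Cinv_r by (try apply zpow_neq_0; exact Hz); reflexivity.
Qed.

Lemma zpow_sub (z : C) (n m : Z) : z <> 0 -> zpow z (n - m) = zpow z n / zpow z m.
Proof. intros Hz; unfold Z.sub; now rewrite zpow_add, zpow_opp. Qed.

Lemma zpow_1_r (z : C) : zpow z 1 = z.
Proof. simpl; ring. Qed.

Lemma zpow_2 (z : C) : zpow z 2 = z * z.
Proof. simpl; ring. Qed.

Lemma zpow_1_l (n : Z) : zpow 1 n = 1.
Proof. symmetry; apply (zpow_char 1 (fun _ => 1)); [apply C1_nz|reflexivity|intros; ring]. Qed.

Lemma zpow_mult_l (z w : C) (n : Z) : z <> 0 -> w <> 0 -> zpow (z * w) n = zpow z n * zpow w n.
Proof.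
intros Hz Hw; symmetry; apply (zpow_char (z * w) (fun n => zpow z n * zpow w n)).
- now apply Cmult_neq_0.
- simpl; ring.
- intros k; rewrite !zpow_succ by assumption; ring.
Qed.

Lemma zpow_mult_r (z : C) (n m : Z) : z <> 0 -> zpow z (n * m) = zpow (zpow z n) m.
Proof.
intros Hz; apply (zpow_char (zpow z n) (fun m => zpow z (n * m))).
- now apply zpow_neq_0.
- now rewrite Z.mul_0_r.
- intros k; rewrite Z.mul_add_distr_l, Z.mul_1_r, zpow_add by exact Hz; ring.
Qed.

Lemma zpow_Cexp (w : C) (n : Z) : zpow (Cexp w) n = Cexp (IZR n * w).
Proof.
symmetry; apply (zpow_char (Cexp w) (fun n => Cexp (IZR n * w))).
- apply Cexp_neq_0.
- replace (0 * w) with (RtoC 0) by ring; apply Cexp_0.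
- intros k; rewrite <- Cexp_plus, plus_IZR, RtoC_plus; f_equal; ring.
Qed.

(** In exponential form, growth estimates for products of powers become inequalities between
    exponents. *)
Lemma Cmod_zpow (z : C) (n : Z) : z <> 0 -> Cmod (zpow z n) = exp (IZR n * ln (Cmod z)).
Proof.
intros Hz; apply RtoC_inj; rewrite <- Cexp_R, RtoC_mult, <- zpow_Cexp, Cexp_R.
rewrite exp_ln by (now apply Cmod_gt_0).
apply (zpow_char (RtoC (Cmod z)) (fun n => RtoC (Cmod (zpow z n)))).
- intros E; apply RtoC_inj in E; now apply Cmod_eq_0 in E.
- simpl; now rewrite Cmod_1.
- intros k; rewrite zpow_succ, Cmod_mult, RtoC_mult by exact Hz; reflexivity.
Qed.

Lemma zpow_m1_even (n : Z) : zpow (-(1)) (2 * n) = 1.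
Proof.
assert (H : -(1) <> 0) by (intros E; apply C1_nz; replace (RtoC 1) with (- (-(1))) by ring; rewrite E; ring).
rewrite zpow_mult_r, zpow_2 by exact H.
replace (-(1) * -(1)) with (RtoC 1) by ring; apply zpow_1_l.
Qed.

Lemma Copp_neq_0 (z : C) : z <> 0 -> - z <> 0.
Proof. intros Hz E; apply Hz; replace z with (- (- z)) by ring; rewrite E; ring. Qed.

Lemma zpow_Copp (z : C) (n : Z) : z <> 0 -> zpow (- z) n = zpow (-(1)) n * zpow z n.
Proof.
intros Hz; rewrite <- zpow_mult_l by (try apply Copp_neq_0, C1_nz; exact Hz).
f_equal; ring.
Qed.

Lemma Cinv_neq_0 (z : C) : z <> 0 -> / z <> 0.
Proof. intros Hz E; apply C1_nz; rewrite <- (Cinv_r z Hz), E; ring. Qed.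

Lemma tends_pow {T : Type} (F : (T -> Prop) -> Prop) {FF : Filter F} (n : nat) (f : T -> C) (l : C) :
  tends F f l -> tends F (fun t => f t ^ n) (l ^ n).
Proof.
intros H; induction n as [|n IH]; [exact (tends_const F 1)|exact (tends_mult F _ _ _ _ H IH)].
Qed.

Lemma tends_zpow {T : Type} (F : (T -> Prop) -> Prop) {FF : Filter F} (f : T -> C) (l : C) (n : Z) :
  l <> 0 -> tends F f l -> tends F (fun t => zpow (f t) n) (zpow l n).
Proof.
intros Hl H.
destruct n as [|p|p]; simpl; [exact (tends_const F 1)|now apply tends_pow|].
apply tends_inv; [exact FF|now apply Cpow_nz|now apply tends_pow].
Qed.

(** * Gaussian majorants and the theta series in multiplicative form *)

Definition tri (n : Z) : Z := (n * (n - 1) / 2)%Z.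

Lemma tri_double (n : Z) : (2 * tri n = n * (n - 1))%Z.
Proof.
unfold tri; symmetry; apply Z_div_exact_2; [lia|].
destruct (Z.Even_or_Odd n) as [[k ->]|[k ->]].
- replace (2 * k * (2 * k - 1))%Z with (k * (2 * k - 1) * 2)%Z by ring; now rewrite Z_mod_mult.
- replace ((2 * k + 1) * (2 * k + 1 - 1))%Z with ((2 * k + 1) * k * 2)%Z by ring; now rewrite Z_mod_mult.
Qed.

Lemma tri_add (n m : Z) : tri (n + m) = (tri n + tri m + n * m)%Z.
Proof. pose proof (tri_double n); pose proof (tri_double m); pose proof (tri_double (n + m)); nia. Qed.

Lemma tri_succ (n : Z) : tri (n + 1) = (tri n + n)%Z.
Proof. pose proof (tri_double n); pose proof (tri_double (n + 1)); nia. Qed.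

Lemma tri_reflect (n : Z) : tri (1 - n) = tri n.
Proof. pose proof (tri_double n); pose proof (tri_double (1 - n)); nia. Qed.

Lemma IZR_tri (n : Z) : IZR (tri n) = ((IZR n ^ 2 - IZR n) / 2)%R.
Proof.
assert (H : (2 * IZR (tri n) = IZR n * (IZR n - 1))%R)
  by (rewrite <- !mult_IZR, <- minus_IZR, <- mult_IZR; f_equal; apply tri_double).
lra.
Qed.

Lemma exp_le_compat (x y : R) : (x <= y)%R -> (exp x <= exp y)%R.
Proof. intros [H| ->]; [apply Rlt_le, exp_increasing, H|lra]. Qed.

Lemma summable_exp_abs (l : R) : (0 < l)%R -> summable (fun k => exp (- (l * Rabs (IZR k)))).
Proof.
intros Hl; split; [intros; apply Rlt_le, exp_pos|].
assert (P : (exp (- l) < 1)%R) by (rewrite <- exp_0; apply exp_increasing; lra).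
exists (2 / (1 - exp (- l)))%R; intros N.
assert (H : (Rsum (zfoldR (fun k => exp (- (l * Rabs (IZR k))))) N <=
             2 * (1 - exp (- (l * INR N))) / (1 - exp (- l)))%R).
{ induction N as [|N IH].
  - simpl; rewrite Rmult_0_r, Ropp_0, exp_0; right; field; lra.
  - cbn [Rsum]; unfold zfoldR at 2.
    assert (E1 : exp (- (l * Rabs (IZR (Z.of_nat N)))) = exp (- (l * INR N))).
    { rewrite <- INR_IZR_INZ, Rabs_pos_eq by apply pos_INR; reflexivity. }
    assert (E2 : (exp (- (l * Rabs (IZR (- Z.of_nat (S N))))) <= exp (- (l * INR N)))%R).
    { rewrite opp_IZR, Rabs_Ropp, <- INR_IZR_INZ, Rabs_pos_eq by apply pos_INR.
      apply exp_le_compat; rewrite S_INR; nra. }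
    assert (E3 : exp (- (l * INR (S N))) = (exp (- (l * INR N)) * exp (- l))%R).
    { rewrite S_INR, <- exp_plus; f_equal; ring. }
    rewrite E3, E1.
    replace (2 * (1 - exp (- (l * INR N)) * exp (- l)) / (1 - exp (- l)))%R with
      (2 * (1 - exp (- (l * INR N))) / (1 - exp (- l)) + 2 * exp (- (l * INR N)))%R by (field; lra).
    lra. }
eapply Rle_trans; [exact H|].
unfold Rdiv; apply Rmult_le_compat_r; [apply Rlt_le, Rinv_0_lt_compat; lra|].
pose proof (exp_pos (- (l * INR N))); lra.
Qed.

(** Completing the square bounds -alpha x^2 + beta x by d - x, reducing to a geometric series. The
    family is closed under multiplication by v^k and by polynomials in k, which is why it serves as
    majorant throughout. *)
Lemma summable_gauss (c alpha beta : R) :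
  (0 <= c)%R -> (0 < alpha)%R ->
  summable (fun k => (c * exp (- alpha * IZR k ^ 2 + beta * Rabs (IZR k)))%R).
Proof.
intros Hc Ha; apply summable_scal; [exact Hc|].
set (d := ((beta + 1) ^ 2 / (4 * alpha))%R).
apply summable_le with (fun k => (exp d * exp (- (1 * Rabs (IZR k))))%R);
  [|apply summable_scal; [apply Rlt_le, exp_pos|apply summable_exp_abs; lra]].
intros k; split; [apply Rlt_le, exp_pos|].
rewrite <- exp_plus; apply exp_le_compat.
rewrite <- (pow2_abs (IZR k)); set (x := Rabs (IZR k)).
assert (H : (0 <= (2 * alpha * x - (beta + 1)) ^ 2 / (4 * alpha))%R).
{ apply Rmult_le_pos; [apply pow2_ge_0|apply Rlt_le, Rinv_0_lt_compat; lra]. }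
replace ((2 * alpha * x - (beta + 1)) ^ 2 / (4 * alpha))%R with
  (alpha * x ^ 2 - (beta + 1) * x + d)%R in H by (unfold d; field; lra).
lra.
Qed.

(** Triangular exponents keep all powers of q integral, so no branch of q^(1/2) has to be chosen. In
    this normalization the zeros of [Th q] are the points -q^k. *)
Definition theta_term (q v : C) (n : Z) : C := zpow q (tri n) * zpow v n.

Definition Th (q v : C) : C := Zsum (theta_term q v).

Lemma Cmod_theta_term (q v : C) (n : Z) :
  q <> 0 -> v <> 0 ->
  Cmod (theta_term q v n) = exp (IZR (tri n) * ln (Cmod q) + IZR n * ln (Cmod v)).
Proof. intros Hq Hv; unfold theta_term; now rewrite Cmod_mult, !Cmod_zpow, exp_plus. Qed.

Lemma ln_Cmod_neg (q : C) : q <> 0 -> (Cmod q < 1)%R -> (ln (Cmod q) < 0)%R.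
Proof. intros Hq H; rewrite <- ln_1; apply ln_increasing; [now apply Cmod_gt_0|exact H]. Qed.

Lemma theta_term_le (q v : C) (beta : R) (n : Z) :
  q <> 0 -> (Cmod q < 1)%R -> v <> 0 -> (Rabs (ln (Cmod v)) <= beta)%R ->
  (Cmod (theta_term q v n) <=
   exp (- (- ln (Cmod q) / 2) * IZR n ^ 2 + (- ln (Cmod q) / 2 + beta) * Rabs (IZR n)))%R.
Proof.
intros Hq Hq1 Hv Hb; rewrite Cmod_theta_term, IZR_tri by assumption.
apply exp_le_compat.
set (l := ln (Cmod q)); set (x := IZR n).
assert (Hl : (l < 0)%R) by (now apply ln_Cmod_neg).
assert (H1 : (x * ln (Cmod v) <= beta * Rabs x)%R).
{ eapply Rle_trans; [apply Rle_abs|]; rewrite Rabs_mult, Rmult_comm.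
  apply Rmult_le_compat_r; [apply Rabs_pos|exact Hb]. }
assert (H2 : (- l * x <= - l * Rabs x)%R) by (apply Rmult_le_compat_l; [lra|apply Rle_abs]).
nra.
Qed.

Lemma theta_term_summable (q v : C) :
  q <> 0 -> (Cmod q < 1)%R -> v <> 0 -> abs_summable (theta_term q v).
Proof.
intros Hq Hq1 Hv.
pose proof (ln_Cmod_neg q Hq Hq1) as Hl.
apply abs_summable_le with (1 := summable_gauss 1 (- ln (Cmod q) / 2)
  (- ln (Cmod q) / 2 + Rabs (ln (Cmod v))) ltac:(lra) ltac:(lra)).
intros k; rewrite Rmult_1_l; apply theta_term_le; auto; apply Rle_refl.
Qed.

Lemma theta_term_shift (q v : C) (n j : Z) :
  q <> 0 -> v <> 0 ->
  theta_term q v (n + j) = theta_term q v j * theta_term q (v * zpow q j) n.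
Proof.
intros Hq Hv; unfold theta_term.
rewrite tri_add, !zpow_add, zpow_mult_l, (zpow_mult_r q n j), <- !zpow_mult_r, (Z.mul_comm j n)
  by (try apply zpow_neq_0; assumption); ring.
Qed.

Lemma Th_shift (q v : C) (j : Z) :
  q <> 0 -> (Cmod q < 1)%R -> v <> 0 ->
  Th q v = theta_term q v j * Th q (v * zpow q j).
Proof.
intros Hq Hq1 Hv; unfold Th.
rewrite <- (Zsum_shift _ j) by (now apply theta_term_summable).
rewrite <- Zsum_scal by (apply theta_term_summable; auto; apply Cmult_neq_0; [|apply zpow_neq_0]; auto).
apply Zsum_ext; intros n; now apply theta_term_shift.
Qed.

(** The reflection n -> 1 - n fixes n(n-1)/2 and reverses parity; this pairing produces the zero of
    the theta series at v = -1. *)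
Lemma theta_term_m1_reflect (q : C) (n : Z) :
  q <> 0 -> theta_term q (-(1)) (1 - n) = - theta_term q (-(1)) n.
Proof.
intros Hq; unfold theta_term; rewrite tri_reflect.
assert (H : -(1) <> 0) by apply Copp_neq_0, C1_nz.
rewrite zpow_sub, zpow_1_r by exact H.
assert (E : zpow (-(1)) n * zpow (-(1)) n = 1).
{ rewrite <- zpow_add by exact H; replace (n + n)%Z with (2 * n)%Z by lia; apply zpow_m1_even. }
assert (E' : / zpow (-(1)) n = zpow (-(1)) n).
{ apply Cmult_cancel_l with (zpow (-(1)) n); [now apply zpow_neq_0|].
  rewrite E, Cinv_r by (now apply zpow_neq_0); reflexivity. }
unfold Cdiv; rewrite E'; ring.
Qed.

Lemma C_double_eq_0 (z : C) : z = - z -> z = 0.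
Proof.
intros H; destruct z as [a b]; injection H as H1 H2; unfold RtoC; f_equal; lra.
Qed.

Lemma Th_m1 (q : C) : q <> 0 -> (Cmod q < 1)%R -> Th q (-(1)) = 0.
Proof.
intros Hq Hq1; apply C_double_eq_0.
pose proof (theta_term_summable q (-(1)) Hq Hq1 (Copp_neq_0 1 C1_nz)) as Hs.
unfold Th; rewrite <- (Zsum_reflect _ 1 Hs) at 1; rewrite <- Zsum_opp by exact Hs.
apply Zsum_ext; intros n; now apply theta_term_m1_reflect.
Qed.

Lemma Rabs_ln_le (x y : R) : (0 < y)%R -> (y / 2 <= x <= 2 * y)%R -> (Rabs (ln x) <= Rabs (ln y) + ln 2)%R.
Proof.
intros Hy [H1 H2].
assert (L1 : (ln y - ln 2 <= ln x)%R).
{ rewrite <- ln_div by lra; apply ln_le; lra. }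
assert (L2 : (ln x <= ln 2 + ln y)%R).
{ rewrite <- ln_mult by lra; apply ln_le; lra. }
assert (L3 : (0 < ln 2)%R) by (rewrite <- ln_1; apply ln_increasing; lra).
unfold Rabs; destruct (Rcase_abs (ln x)), (Rcase_abs (ln y)); lra.
Qed.

(** Close to l the modulus of f lies between |l|/2 and 2|l|, so its logarithm is at most |ln |l|| +
    ln 2 in absolute value, and the n-th power costs only a linear term in the Gaussian exponent. *)
Lemma tends_Laurent {T : Type} (F : (T -> Prop) -> Prop) {FF : ProperFilter F}
  (c : Z -> C) (f : T -> C) (l : C) (a b d : R) :
  l <> 0 -> (0 < a)%R ->
  (forall n, (Cmod (c n) <= d * exp (- a * IZR n ^ 2 + b * Rabs (IZR n)))%R) ->
  tends F f l -> tends F (fun t => Zsum (fun n => c n * zpow (f t) n)) (Zsum (fun n => c n * zpow l n)).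
Proof.
intros Hl Ha Hc Hf.
pose proof (proj1 (Cmod_gt_0 l) Hl) as Pl.
set (e := (Rabs (ln (Cmod l)) + ln 2)%R).
assert (Hd : (0 <= d)%R).
{ specialize (Hc 0%Z); pose proof (Cmod_ge_0 (c 0%Z)).
  pose proof (exp_pos (- a * 0 ^ 2 + b * Rabs 0)); nra. }
apply (Zsum_dominated F) with (1 := summable_gauss d a (b + e) Hd Ha).
- generalize (filter_and _ _ (tends_nonzero F f l Hl Hf) (Hf (Cmod l) Pl)).
  apply filter_imp; intros t [H1 H2] n.
  assert (H3 : (Cmod (f t) <= 2 * Cmod l)%R).
  { replace (f t) with ((f t - l) + l) by ring.
    eapply Rle_trans; [apply Cmod_triangle|lra]. }
  assert (N : f t <> 0) by (apply Cmod_gt_0; lra).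
  rewrite Cmod_mult, Cmod_zpow by exact N.
  eapply Rle_trans; [apply Rmult_le_compat_r; [apply Rlt_le, exp_pos|apply Hc]|].
  rewrite Rmult_assoc, <- exp_plus; apply Rmult_le_compat_l; [exact Hd|]; apply exp_le_compat.
  assert (H4 : (IZR n * ln (Cmod (f t)) <= e * Rabs (IZR n))%R).
  { eapply Rle_trans; [apply Rle_abs|]; rewrite Rabs_mult, Rmult_comm.
    apply Rmult_le_compat_r; [apply Rabs_pos|]; apply Rabs_ln_le; lra. }
  lra.
- intros n; apply tends_scal; [apply FF|apply tends_zpow; [apply FF|exact Hl|exact Hf]].
Qed.

Lemma tends_Th {T : Type} (F : (T -> Prop) -> Prop) {FF : ProperFilter F} (q : C) (f : T -> C) (l : C) :
  q <> 0 -> (Cmod q < 1)%R -> l <> 0 -> tends F f l -> tends F (fun t => Th q (f t)) (Th q l).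
Proof.
intros Hq Hq1 Hl Hf; unfold Th, theta_term.
pose proof (ln_Cmod_neg q Hq Hq1) as Hn.
apply (tends_Laurent F (fun n => zpow q (tri n)) f l (- ln (Cmod q) / 2) (- ln (Cmod q) / 2) 1);
  auto; [lra|].
intros n; pose proof (theta_term_le q 1 0 n Hq Hq1 C1_nz) as H.
unfold theta_term in H; rewrite zpow_1_l, Cmult_1_r, Rplus_0_r in H.
rewrite Rmult_1_l; apply H; rewrite Cmod_1, ln_1, Rabs_R0; lra.
Qed.

(** * The triple product, the pentagonal series and the cube of eta *)

Section InfiniteProduct.

Context (u : nat -> C) (M : nat -> R) (B : R).
Context (Hu : forall n, (Cmod (u n) <= M n)%R) (HB : forall N, (Rsum M N <= B)%R).

Let P : nat -> C := Cprod (fun n => 1 + u n).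

Lemma M_pos n : (0 <= M n)%R.
Proof. eapply Rle_trans; [apply Cmod_ge_0|apply Hu]. Qed.

Lemma Cprod_le N : (Cmod (P N) <= exp B)%R.
Proof.
eapply Rle_trans; [|apply exp_le_compat, (HB N)].
unfold P; induction N as [|N IH]; cbn [Cprod Rsum]; [rewrite Cmod_1, exp_0; lra|].
rewrite Cmod_mult, exp_plus; apply Rmult_le_compat; try apply Cmod_ge_0; [exact IH|].
eapply Rle_trans; [apply Cmod_triangle|]; rewrite Cmod_1.
eapply Rle_trans; [|apply exp_ineq1_le]; specialize (Hu N); lra.
Qed.

(** The increments of the partial products are P_n u_n with P_n bounded, so the product is 1 plus an
    absolutely convergent series. *)
Lemma Cprod_tends : tends eventually P (Cinfprod (fun n => 1 + u n)).
Proof.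
assert (E : forall N, 1 + Csum (fun n => P n * u n) N = P N).
{ induction N as [|N IH]; [simpl; unfold P; simpl; ring|].
  cbn [Csum]; rewrite Cplus_assoc, IH; unfold P; simpl; ring. }
assert (T : tends eventually P (1 + Cseries (fun n => P n * u n))).
{ apply tends_ext with (fun N => 1 + Csum (fun n => P n * u n) N); [apply eventually_filter|exact E|].
  apply tends_plus; [apply eventually_filter|apply tends_const, eventually_filter|].
  apply Cseries_tends with (fun n => (exp B * M n)%R) (exp B * B)%R.
  - intros n; rewrite Cmod_mult; apply Rmult_le_compat; try apply Cmod_ge_0; [apply Cprod_le|apply Hu].
  - intros N; rewrite Rsum_scal; apply Rmult_le_compat_l; [apply Rlt_le, exp_pos|apply HB]. }
change (tends eventually P (Clim eventually P)); rewrite (Clim_tends _ _ _ T); exact T.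
Qed.

Context (Hnz : forall n, 1 + u n <> 0).

Lemma Cprod_neq_0 N : P N <> 0.
Proof. unfold P; induction N as [|N IH]; simpl; [apply C1_nz|apply Cmult_neq_0; auto]. Qed.

(** Once the tail of [M] is at most 1/2, the inequality prod (1 - M_k) >= 1 - sum M_k shows that at
    most half of the modulus is lost; before that only finitely many nonzero values occur. *)
Lemma Cprod_lower : exists c, (0 < c)%R /\ forall N, (c <= Cmod (P N))%R.
Proof.
destruct (Rsum_tail M B (1 / 2) M_pos HB) as [N0 HN0]; [lra|].
assert (L1 : forall K, exists c, (0 < c)%R /\ forall N, (N <= K)%nat -> (c <= Cmod (P N))%R).
{ induction K as [|K [c [Hc IH]]].
  - exists (Cmod (P 0)); split; [apply Cmod_gt_0, Cprod_neq_0|].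
    intros N HN; replace N with 0%nat by lia; lra.
  - exists (Rmin c (Cmod (P (S K)))); split.
    + apply Rmin_glb_lt; [exact Hc|apply Cmod_gt_0, Cprod_neq_0].
    + intros N HN; destruct (Nat.eq_dec N (S K)) as [->|]; [apply Rmin_r|].
      eapply Rle_trans; [apply Rmin_l|apply IH; lia]. }
destruct (L1 N0) as [c [Hc H1]].
exists (c / 2)%R; split; [lra|]; intros N.
destruct (Nat.le_gt_cases N N0) as [L|L]; [specialize (H1 N L); lra|].
assert (H2 : forall N, (N0 <= N)%nat ->
  (Cmod (P N0) * (1 - (Rsum M N - Rsum M N0)) <= Cmod (P N))%R).
{ intros K LK; induction LK as [|K LK IH]; [lra|].
  unfold P at 2; cbn [Cprod Rsum]; fold P; change (Cprod (fun n => 1 + u n) K) with (P K).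
  rewrite Cmod_mult.
  assert (I1 : (1 - M K <= Cmod (1 + u K))%R).
  { pose proof (Cmod_triangle_minus 1 (- u K) 0) as I.
    replace (1 - (- u K)) with (1 + u K) in I by ring.
    replace (- u K - 0) with (- u K) in I by ring.
    replace (1 - 0) with (RtoC 1) in I by ring.
    rewrite Cmod_opp, Cmod_1 in I; specialize (Hu K); lra. }
  pose proof (HN0 K LK) as I2; pose proof (HN0 (S K) ltac:(lia)) as I3; cbn [Rsum] in I3.
  pose proof (Rsum_mono M N0 K M_pos LK) as I4; pose proof (M_pos K) as I5.
  pose proof (Cmod_ge_0 (P N0)) as I6.
  set (s := (Rsum M K - Rsum M N0)%R) in *.
  replace (Rsum M K + M K - Rsum M N0)%R with (s + M K)%R by (unfold s; ring).
  assert (I7 : (0 <= s)%R) by (unfold s; lra).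
  assert (I8 : (M K <= 1 / 2)%R) by (unfold s in *; lra).
  assert (I9 : (0 <= 1 - s)%R) by lra.
  apply Rle_trans with (Cmod (P N0) * (1 - s) * (1 - M K))%R.
  - rewrite Rmult_assoc; apply Rmult_le_compat_l; [exact I6|].
    pose proof (Rmult_le_pos _ _ I7 I5); lra.
  - apply Rmult_le_compat; try lra; apply Rmult_le_pos; lra. }
specialize (H2 N ltac:(lia)); pose proof (HN0 N ltac:(lia)) as H3.
specialize (H1 N0 ltac:(lia)).
apply Rle_trans with (2 := H2).
apply Rle_trans with (Cmod (P N0) * (1 / 2))%R; [lra|].
apply Rmult_le_compat_l; [apply Cmod_ge_0|lra].
Qed.

Lemma Cinfprod_neq_0 : Cinfprod (fun n => 1 + u n) <> 0.
Proof.
destruct Cprod_lower as [c [Hc H]]; intros E.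
pose proof Cprod_tends as T; rewrite E in T.
destruct (filter_ex _ (T c Hc)) as [N HN].
specialize (H N); replace (P N - 0) with (P N) in HN by ring; lra.
Qed.

End InfiniteProduct.

Lemma Rsum_geom_le (r : R) (N : nat) :
  (0 <= r < 1)%R -> (Rsum (fun n => r ^ n)%R N <= / (1 - r))%R.
Proof.
intros Hr.
assert (E : Rsum (fun n => r ^ n)%R N = ((1 - r ^ N) / (1 - r))%R).
{ induction N as [|N IH]; cbn [Rsum]; [simpl; field; lra|]; rewrite IH; simpl; field; lra. }
rewrite E; unfold Rdiv; rewrite <- (Rmult_1_l (/ (1 - r))) at 2.
apply Rmult_le_compat_r; [apply Rlt_le, Rinv_0_lt_compat; lra|].
pose proof (pow_le r N ltac:(lra)); lra.
Qed.

Lemma Cmod_pow_lt_1 (q : C) (n : nat) : (Cmod q < 1)%R -> (Cmod (q ^ S n) < 1)%R.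
Proof.
intros H; induction n as [|n IH]; rewrite Cpow_S, Cmod_mult.
- simpl; rewrite Cmod_1; lra.
- pose proof (Cmod_ge_0 q); pose proof (Cmod_ge_0 (q ^ S n)); nra.
Qed.

Lemma one_minus_neq_0 (z : C) : (Cmod z < 1)%R -> 1 - z <> 0.
Proof.
intros H E; assert (E1 : z = 1) by (replace z with (1 - (1 - z)) by ring; rewrite E; ring).
rewrite E1, Cmod_1 in H; lra.
Qed.

Definition phiN (q : C) (N : nat) : C := Cprod (fun n => 1 - q ^ S n) N.
Definition phi (q : C) : C := Cinfprod (fun n => 1 - q ^ S n).

Section JacobiTripleProduct.

Context (q : C).
Context (Hq : q <> 0) (Hq1 : (Cmod q < 1)%R).

Lemma phi_factor_le n : (Cmod (- q ^ S n) <= Cmod q ^ n)%R.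
Proof.
rewrite Cmod_opp, Cpow_S, Cmod_mult, Cmod_pow.
pose proof (Cmod_ge_0 q); pose proof (pow_le _ n H); nra.
Qed.

Lemma phi_sum_le N : (Rsum (fun n => Cmod q ^ n)%R N <= / (1 - Cmod q))%R.
Proof. apply Rsum_geom_le; split; [apply Cmod_ge_0|exact Hq1]. Qed.

Lemma phiN_tends : tends eventually (phiN q) (phi q).
Proof. exact (Cprod_tends (fun n => - q ^ S n) _ _ phi_factor_le phi_sum_le). Qed.

Lemma phi_neq_0 : phi q <> 0.
Proof.
apply (Cinfprod_neq_0 (fun n => - q ^ S n) _ _ phi_factor_le phi_sum_le).
intros n; apply one_minus_neq_0, Cmod_pow_lt_1, Hq1.
Qed.

Lemma phiN_neq_0 N : phiN q N <> 0.
Proof.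
apply (Cprod_neq_0 (fun n => - q ^ S n)); intros n.
apply one_minus_neq_0, Cmod_pow_lt_1, Hq1.
Qed.

Lemma phiN_bounds : exists c, (0 < c)%R /\
  forall N, (c <= Cmod (phiN q N))%R /\ (Cmod (phiN q N) <= exp (/ (1 - Cmod q)))%R.
Proof.
destruct (Cprod_lower (fun n => - q ^ S n) _ _ phi_factor_le phi_sum_le) as [c [Hc H]].
- intros n; apply one_minus_neq_0, Cmod_pow_lt_1, Hq1.
- exists c; split; [exact Hc|]; intros N; split; [apply H|].
  apply (Cprod_le (fun n => - q ^ S n) _ _ phi_factor_le phi_sum_le).
Qed.

(* Reciprocal of [(1 - q) ... (1 - q^k)], extended by 0 to negative [k]
   so that [psi_pred] holds for all integers. *)
Definition psi (k : Z) : C := if (0 <=? k)%Z then / phiN q (Z.to_nat k) else 0.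

Lemma psi_pred k : psi (k - 1) = (1 - zpow q k) * psi k.
Proof.
unfold psi; destruct (Z.leb_spec 0 k) as [L|L]; destruct (Z.leb_spec 0 (k - 1)) as [L'|L']; try lia.
- replace (Z.to_nat k) with (S (Z.to_nat (k - 1))) by lia; set (n := Z.to_nat (k - 1)).
  replace k with (Z.of_nat (S n)) by lia; rewrite zpow_of_nat.
  unfold phiN; cbn [Cprod]; field; split; [|apply phiN_neq_0].
  apply one_minus_neq_0, Cmod_pow_lt_1, Hq1.
- replace k with 0%Z by lia; simpl; ring.
- ring.
Qed.

(** The Gaussian binomial coefficient (2N choose N+n) in base q, times q^(n(n-1)/2): the coefficient
    of v^n in the finite triple product [JP]. The zeros of [psi] encode the finite support. *)
Definition jt (N : nat) (n : Z) : C :=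
  zpow q (tri n) * (phiN q (2 * N) * psi (Z.of_nat N + n) * psi (Z.of_nat N - n)).

(** Comparison of coefficients after multiplication by the factor (1 + v q^N)(1 + q^(N+1)/v). All
    values of [psi] are reduced to [a] and [b]; what remains is a rational identity in q, q^N and
    q^n. *)
Lemma jt_succ N n :
  jt (S N) n = (1 + q ^ S (2 * N)) * jt N n + q ^ N * jt N (n - 1) + q ^ S N * jt N (n + 1).
Proof.
unfold jt.
set (a := psi (Z.of_nat (S N) + n)); set (b := psi (Z.of_nat (S N) - n)).
assert (E1 : psi (Z.of_nat N + n) = (1 - zpow q (Z.of_nat (S N) + n)) * a).
{ unfold a; rewrite <- psi_pred; f_equal; lia. }
assert (E2 : psi (Z.of_nat N - n) = (1 - zpow q (Z.of_nat (S N) - n)) * b).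
{ unfold b; rewrite <- psi_pred; f_equal; lia. }
assert (E3 : psi (Z.of_nat N + (n - 1)) = (1 - zpow q (Z.of_nat N + n)) * psi (Z.of_nat N + n)).
{ rewrite <- psi_pred; f_equal; lia. }
assert (E4 : psi (Z.of_nat N - (n + 1)) = (1 - zpow q (Z.of_nat N - n)) * psi (Z.of_nat N - n)).
{ rewrite <- psi_pred; f_equal; lia. }
replace (Z.of_nat N - (n - 1))%Z with (Z.of_nat (S N) - n)%Z by lia.
replace (Z.of_nat N + (n + 1))%Z with (Z.of_nat (S N) + n)%Z by lia.
fold a b; rewrite E3, E4, E1, E2.
replace (tri (n - 1)) with (tri n + (1 - n))%Z
  by (pose proof (tri_double n); pose proof (tri_double (n - 1)); nia).
rewrite tri_succ.
replace (2 * S N)%nat with (S (S (2 * N))) by lia.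
unfold phiN; cbn [Cprod].
replace (q ^ S (S (2 * N))) with (q * (q * (q ^ N * q ^ N)))
  by (rewrite !Cpow_S, <- Cpow_add_r; replace (N + N)%nat with (2 * N)%nat by lia; ring).
replace (q ^ S (2 * N)) with (q * (q ^ N * q ^ N))
  by (rewrite !Cpow_S, <- Cpow_add_r; replace (N + N)%nat with (2 * N)%nat by lia; ring).
repeat first [rewrite zpow_add by exact Hq|rewrite zpow_sub by exact Hq].
rewrite !zpow_of_nat, zpow_1_r, !Cpow_S.
field; now apply zpow_neq_0.
Qed.

Lemma psi_bound : exists K, (0 <= K)%R /\ forall k, (Cmod (psi k) <= K)%R.
Proof.
destruct phiN_bounds as [c [Hc H]]; exists (/ c)%R.
assert (P : (0 < / c)%R) by (now apply Rinv_0_lt_compat).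
split; [lra|]; intros k; unfold psi; destruct (0 <=? k)%Z.
- rewrite Cmod_inv by apply phiN_neq_0; apply Rinv_le_contravar; [exact Hc|apply H].
- rewrite Cmod_0; lra.
Qed.

(** The products of 1 - q^k stay between two positive constants, so the finite coefficients are
    dominated by the theta coefficients uniformly in N; this is what permits N to tend to
    infinity. *)
Lemma jt_bound : exists K, (0 <= K)%R /\ forall N n, (Cmod (jt N n) <= K * Cmod (zpow q (tri n)))%R.
Proof.
destruct psi_bound as [K [HK H]]; destruct phiN_bounds as [c0 [_ H']].
set (E0 := exp (/ (1 - Cmod q))) in *.
exists (E0 * K * K)%R.
assert (HE : (0 <= E0)%R) by (apply Rlt_le, exp_pos).
split; [repeat apply Rmult_le_pos; assumption|].
intros N n; unfold jt; rewrite Cmod_mult, Rmult_comm.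
apply Rmult_le_compat_r; [apply Cmod_ge_0|]; rewrite !Cmod_mult.
repeat apply Rmult_le_compat; try apply Rmult_le_pos; try apply Cmod_ge_0; try apply H; apply H'.
Qed.

Lemma jt_summable N (v : C) : v <> 0 -> abs_summable (fun n => jt N n * zpow v n).
Proof.
intros Hv; destruct jt_bound as [K [HK H]].
apply abs_summable_le with (1 := summable_scal K _ HK (theta_term_summable q v Hq Hq1 Hv)).
intros n; unfold theta_term; rewrite !Cmod_mult, <- Rmult_assoc.
apply Rmult_le_compat_r; [apply Cmod_ge_0|apply H].
Qed.

Definition JP (v : C) (N : nat) : C := Cprod (fun k => (1 + v * q ^ k) * (1 + q ^ S k / v)) N.

Lemma jt_0 n : n <> 0%Z -> jt 0 n = 0.
Proof.
intros Hn; unfold jt, psi; simpl Z.of_nat; rewrite Z.add_0_l, Z.sub_0_l.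
destruct (Z.leb_spec 0 n); destruct (Z.leb_spec 0 (- n)); try lia; ring.
Qed.

Lemma Zsum_single (w : Z -> C) : (forall k, k <> 0%Z -> w k = 0) -> Zsum w = w 0%Z.
Proof.
intros H.
assert (E : forall N, Csum (zfold w) (S N) = w 0%Z).
{ induction N as [|N IH].
  - simpl; unfold zfold; simpl; rewrite (H (-1)%Z) by lia; ring.
  - cbn [Csum] in *; rewrite IH; unfold zfold; rewrite (H (Z.of_nat (S N))), (H (- Z.of_nat (S (S N)))%Z) by lia; ring. }
apply Zsum_eq.
- split; [intros; apply Cmod_ge_0|]; exists (Cmod (w 0%Z)); intros [|N]; [simpl; apply Cmod_ge_0|].
  induction N as [|N IH].
  + simpl; unfold zfoldR; simpl; rewrite (H (-1)%Z), Cmod_0 by lia; lra.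
  + cbn [Rsum] in *; unfold zfoldR at 3; rewrite (H (Z.of_nat (S N))), (H (- Z.of_nat (S (S N)))%Z) by lia.
    rewrite Cmod_0; lra.
- intros eps Heps; exists 1%nat; intros [|N] HN; [lia|].
  rewrite E; replace (w 0%Z - w 0%Z) with (RtoC 0) by ring; now rewrite Cmod_0.
Qed.

Lemma JP_expand N (v : C) : v <> 0 -> JP v N = Zsum (fun n => jt N n * zpow v n).
Proof.
intros Hv; induction N as [|N IH].
- rewrite Zsum_single.
  + unfold JP, jt, psi, phiN; simpl; field; apply C1_nz.
  + intros k Hk; rewrite jt_0 by exact Hk; ring.
- pose proof (jt_summable N v Hv) as S.
  unfold JP; cbn [Cprod]; fold (JP v N); change (Cprod _ N) with (JP v N); rewrite IH.
  assert (Em : v * Zsum (fun n => jt N n * zpow v n) = Zsum (fun n => jt N (n - 1) * zpow v n)).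
  { rewrite <- Zsum_scal by exact S.
    rewrite <- (Zsum_shift (fun n => v * (jt N n * zpow v n)) (-1)) by (now apply abs_summable_scal).
    apply Zsum_ext; intros n; change (n + -1)%Z with (n - 1)%Z.
    rewrite zpow_sub, zpow_1_r by exact Hv; field; exact Hv. }
  assert (Ep : / v * Zsum (fun n => jt N n * zpow v n) = Zsum (fun n => jt N (n + 1) * zpow v n)).
  { rewrite <- Zsum_scal by exact S.
    rewrite <- (Zsum_shift (fun n => / v * (jt N n * zpow v n)) 1) by (now apply abs_summable_scal).
    apply Zsum_ext; intros n; rewrite zpow_succ by exact Hv; field; exact Hv. }
  assert (Sm : abs_summable (fun n => jt N (n - 1) * zpow v n)).
  { apply abs_summable_ext with (2 := abs_summable_shift _ (-1) (abs_summable_scal v _ S)).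
    intros n; change (n + -1)%Z with (n - 1)%Z.
    rewrite zpow_sub, zpow_1_r by exact Hv; field; exact Hv. }
  assert (Sp : abs_summable (fun n => jt N (n + 1) * zpow v n)).
  { apply abs_summable_ext with (2 := abs_summable_shift _ 1 (abs_summable_scal (/ v) _ S)).
    intros n; rewrite zpow_succ by exact Hv; field; exact Hv. }
  set (Z0 := Zsum (fun n => jt N n * zpow v n)) in *.
  replace (Z0 * ((1 + v * q ^ N) * (1 + q ^ Datatypes.S N / v))) with
    ((1 + q ^ Datatypes.S (2 * N)) * Z0 + q ^ N * (v * Z0) + q ^ Datatypes.S N * (/ v * Z0)).
  + rewrite Em, Ep; unfold Z0.
    rewrite <- !Zsum_scal, <- Zsum_plus, <- Zsum_plus
      by (repeat apply abs_summable_plus; try apply abs_summable_scal; assumption).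
    apply Zsum_ext; intros n; rewrite jt_succ; ring.
  + rewrite !Cpow_S; replace (2 * N)%nat with (N + N)%nat by lia; rewrite Cpow_add_r; field; exact Hv.
Qed.

Lemma eventually_shift (c : Z) :
  filterlim (fun N => Z.to_nat (Z.of_nat N + c)) eventually eventually.
Proof. intros P [N0 HN0]; exists (N0 + Z.abs_nat c)%nat; intros N HN; apply HN0; lia. Qed.

Lemma psi_tends (c : Z) : tends eventually (fun N => psi (Z.of_nat N + c)) (/ phi q).
Proof.
apply tends_ext_loc with (fun N => / phiN q (Z.to_nat (Z.of_nat N + c))).
- apply eventually_filter.
- exists (Z.abs_nat c); intros N HN; unfold psi; destruct (Z.leb_spec 0 (Z.of_nat N + c)); [reflexivity|lia].
- apply tends_inv; [apply eventually_filter|apply phi_neq_0|].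
  apply (tends_comp eventually eventually (fun N => Z.to_nat (Z.of_nat N + c)) (phiN q));
    [apply eventually_shift|apply phiN_tends].
Qed.

Lemma jt_tends n : tends eventually (fun N => jt N n) (zpow q (tri n) / phi q).
Proof.
replace (zpow q (tri n) / phi q) with (zpow q (tri n) * (phi q * / phi q * / phi q))
  by (field; apply phi_neq_0).
unfold jt; apply tends_scal; [apply eventually_filter|].
apply tends_mult; [apply eventually_filter|apply tends_mult; [apply eventually_filter| |]|].
- apply (tends_comp eventually eventually (fun N => 2 * N)%nat (phiN q)); [|apply phiN_tends].
  intros P [N0 HN0]; exists N0; intros N HN; apply HN0; lia.
- apply psi_tends.
- exact (psi_tends (- n)).
Qed.

(** Dominated convergence in the finite identity [JP_expand]. Stating the product as a limit of
    partial products lets later identities regroup finitely many factors. *)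
Lemma jacobi_triple_product (v : C) : v <> 0 -> tends eventually (JP v) (Th q v / phi q).
Proof.
intros Hv.
apply tends_ext with (fun N => Zsum (fun n => jt N n * zpow v n));
  [apply eventually_filter|intros N; now rewrite JP_expand|].
replace (Th q v / phi q) with (Zsum (fun n => zpow q (tri n) / phi q * zpow v n)).
- destruct jt_bound as [K [HK H]].
  apply (Zsum_dominated eventually) with
    (1 := summable_scal K _ HK (theta_term_summable q v Hq Hq1 Hv)).
  + apply filter_forall; intros N n; unfold theta_term; rewrite !Cmod_mult, <- Rmult_assoc.
    apply Rmult_le_compat_r; [apply Cmod_ge_0|apply H].
  + intros n; apply tends_mult; [apply eventually_filter|apply jt_tends|apply tends_const, eventually_filter].
- unfold Th, Cdiv; rewrite Cmult_comm, <- Zsum_scal by (now apply theta_term_summable).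
  apply Zsum_ext; intros n; unfold theta_term; ring.
Qed.

(** The factor 1 + v with index k = 0 vanishes at v = -1. *)
Lemma jt_sum_eq_0 N : Zsum (fun n => jt (S N) n * zpow (-(1)) n) = 0.
Proof.
rewrite <- JP_expand by apply Copp_neq_0, C1_nz.
unfold JP; induction N as [|N IH].
- simpl; ring.
- cbn [Cprod] in *; rewrite IH; ring.
Qed.

End JacobiTripleProduct.

(** If no factor of the triple product vanishes, neither does the convergent product. *)
Lemma Th_eq_0 (q v : C) :
  q <> 0 -> (Cmod q < 1)%R -> v <> 0 -> Th q v = 0 -> exists j : Z, v * zpow q j = -(1).
Proof.
intros Hq Hq1 Hv HT.
apply Classical_Prop.NNPP; intros Hno.
assert (Hnz1 : forall k : nat, 1 + v * q ^ k <> 0).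
{ intros k E; apply Hno; exists (Z.of_nat k); rewrite zpow_of_nat.
  replace (v * q ^ k) with (1 + v * q ^ k - 1) by ring; rewrite E; ring. }
assert (Hnz2 : forall k : nat, 1 + q ^ S k / v <> 0).
{ intros k E; apply Hno; exists (- Z.of_nat (S k))%Z; rewrite zpow_opp_of_nat.
  assert (Hk : q ^ S k <> 0) by (now apply Cpow_nz).
  assert (E1 : q ^ S k = - v).
  { replace (q ^ S k) with ((1 + q ^ S k / v) * v - v) by (field; exact Hv); rewrite E; ring. }
  rewrite E1; field; exact Hv. }
(* The deviation of the k-th factor pair from 1. Its three summands are bounded by |v|, |q|/|v| and
   1 times |q|^k, whence [K]. *)
set (u := fun k => v * q ^ k + q ^ S k / v + q ^ k * q ^ S k).
set (K := (Cmod v + Cmod q / Cmod v + 1)%R).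
assert (Hu : forall k, (Cmod (u k) <= K * Cmod q ^ k)%R).
{ intros k; unfold u, K.
  eapply Rle_trans; [apply Cmod_triangle|]; rewrite !Rmult_plus_distr_r.
  apply Rplus_le_compat; [eapply Rle_trans; [apply Cmod_triangle|]; apply Rplus_le_compat|].
  - rewrite Cmod_mult, Cmod_pow; lra.
  - rewrite Cmod_div, Cpow_S, Cmod_mult, Cmod_pow by exact Hv.
    right; field; intros E; now apply Cmod_eq_0 in E.
  - rewrite Cmod_mult, Cmod_pow.
    pose proof (Cmod_pow_lt_1 q k Hq1); pose proof (pow_le _ k (Cmod_ge_0 q)); nra. }
assert (HK : (0 <= K)%R).
{ unfold K, Rdiv; pose proof (Cmod_ge_0 v).
  pose proof (Rinv_0_lt_compat _ (proj1 (Cmod_gt_0 v) Hv)); pose proof (Cmod_ge_0 q); nra. }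
assert (HB : forall N, (Rsum (fun k => K * Cmod q ^ k)%R N <= K * / (1 - Cmod q))%R).
{ intros N; rewrite Rsum_scal; apply Rmult_le_compat_l; [exact HK|now apply phi_sum_le]. }
assert (Hf : forall k, (1 + v * q ^ k) * (1 + q ^ S k / v) = 1 + u k)
  by (intros k; unfold u; field; exact Hv).
apply (Cinfprod_neq_0 u _ _ Hu HB).
- intros k; rewrite <- Hf; apply Cmult_neq_0; auto.
- transitivity (Th q v / phi q); [|rewrite HT; unfold Cdiv; ring].
  apply Clim_tends; [apply eventually_filter|].
  apply tends_ext with (JP q v); [apply eventually_filter| |now apply jacobi_triple_product].
  intros N; unfold JP; induction N as [|N IH]; cbn [Cprod]; [reflexivity|now rewrite IH, Hf].
Qed.

Lemma Cmod_square_lt_1 (r : C) : (Cmod r < 1)%R -> (Cmod (r * r) < 1)%R.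
Proof. intros H; rewrite Cmod_mult; pose proof (Cmod_ge_0 r); nra. Qed.

Lemma Cpow_double (z : C) (n : nat) : z ^ (2 * n) = (z * z) ^ n.
Proof. rewrite Cpow_mult_r; f_equal; simpl; ring. Qed.

(** The factors of the triple product of base r with even and with odd index are triple products of
    base r^2, at v and at v r. *)
Lemma Th_split (r v : C) :
  r <> 0 -> (Cmod r < 1)%R -> v <> 0 ->
  Th r v / phi r = Th (r * r) v * Th (r * r) (v * r) / (phi (r * r) * phi (r * r)).
Proof.
intros Hr Hr1 Hv.
pose proof (Cmult_neq_0 _ _ Hr Hr) as Hq; pose proof (Cmod_square_lt_1 r Hr1) as Hq1.
pose proof (Cmult_neq_0 _ _ Hv Hr) as Hvr.
apply (tends_unique eventually (fun N => JP r v (2 * N))).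
- apply (tends_comp eventually eventually (fun N => 2 * N)%nat (JP r v));
    [|now apply jacobi_triple_product].
  intros P [N0 HN0]; exists N0; intros N HN; apply HN0; lia.
- apply tends_ext with (fun N => JP (r * r) v N * JP (r * r) (v * r) N).
  + apply eventually_filter.
  + intros N; unfold JP; induction N as [|N IH]; [simpl; ring|].
    replace (2 * S N)%nat with (S (S (2 * N))) by lia; cbn [Cprod]; rewrite <- IH.
    rewrite !Cpow_S, Cpow_double; field; split; assumption.
  + replace (Th (r * r) v * Th (r * r) (v * r) / (phi (r * r) * phi (r * r))) with
      (Th (r * r) v / phi (r * r) * (Th (r * r) (v * r) / phi (r * r)))
      by (field; now apply phi_neq_0).
    apply tends_mult; [apply eventually_filter| |]; now apply jacobi_triple_product.
Qed.

(** Factorwise this is (1 + x)(1 - x) = 1 - x^2. *)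
Lemma Th_square (q v : C) :
  q <> 0 -> (Cmod q < 1)%R -> v <> 0 ->
  Th (q * q) (- (v * v)) / phi (q * q) = Th q v * Th q (- v) / (phi q * phi q).
Proof.
intros Hq Hq1 Hv.
pose proof (Cmult_neq_0 _ _ Hq Hq) as Hqq; pose proof (Cmod_square_lt_1 q Hq1) as Hqq1.
pose proof (Copp_neq_0 _ (Cmult_neq_0 _ _ Hv Hv)) as Hvv; pose proof (Copp_neq_0 _ Hv) as Hv'.
apply (tends_unique eventually (JP (q * q) (- (v * v)))); [now apply jacobi_triple_product|].
apply tends_ext with (fun N => JP q v N * JP q (- v) N).
- apply eventually_filter.
- intros N; unfold JP; induction N as [|N IH]; [simpl; ring|].
  cbn [Cprod]; rewrite <- IH, !Cpow_S, Cpow_mult_l; field; exact Hv.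
- replace (Th q v * Th q (- v) / (phi q * phi q)) with (Th q v / phi q * (Th q (- v) / phi q))
    by (field; now apply phi_neq_0).
  apply tends_mult; [apply eventually_filter| |]; now apply jacobi_triple_product.
Qed.

(** Sorting the factors 1 - q^k by k modulo 3: the multiples of 3 give [phi] of base q^3, the other
    two classes its triple product at v = -q. This makes eta a theta series, to which Poisson
    summation applies. *)
Lemma pentagonal (q : C) :
  q <> 0 -> (Cmod q < 1)%R -> phi q = Th (q * q * q) (- q).
Proof.
intros Hq Hq1; set (p := q * q * q).
assert (Hp : p <> 0) by (repeat apply Cmult_neq_0; exact Hq).
assert (Hp1 : (Cmod p < 1)%R).
{ unfold p; rewrite Cmod_mult; pose proof (Cmod_square_lt_1 q Hq1); pose proof (Cmod_ge_0 q).
  pose proof (Cmod_ge_0 (q * q)); nra. }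
pose proof (Copp_neq_0 _ Hq) as Hq'.
apply (tends_unique eventually (fun N => phiN q (3 * N))).
- apply (tends_comp eventually eventually (fun N => 3 * N)%nat (phiN q)); [|now apply phiN_tends].
  intros P [N0 HN0]; exists N0; intros N HN; apply HN0; lia.
- apply tends_ext with (fun N => phiN p N * JP p (- q) N).
  + apply eventually_filter.
  + intros N; unfold phiN, JP; induction N as [|N IH]; [simpl; ring|].
    replace (3 * S N)%nat with (S (S (S (3 * N)))) by lia; cbn [Cprod]; rewrite <- IH.
    rewrite !Cpow_S, Cpow_mult_r; replace (q ^ 3) with p by (unfold p; simpl; ring).
    generalize (p ^ N); intros X; unfold p; field; exact Hq.
  + replace (Th p (- q)) with (phi p * (Th p (- q) / phi p)) by (field; now apply phi_neq_0).
    apply tends_mult; [apply eventually_filter|now apply phiN_tends|now apply jacobi_triple_product].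
Qed.

(** * The cube of the eta product *)

Section JacobiCube.

Context (q : C).
Context (Hq : q <> 0) (Hq1 : (Cmod q < 1)%R).

Lemma summable_index_mult (c : Z -> C) (a b d : R) :
  (0 < a)%R -> (0 <= d)%R ->
  (forall n, (Cmod (c n) <= d * exp (- a * IZR n ^ 2 + b * Rabs (IZR n)))%R) ->
  forall n, (Cmod (IZR n * c n) <= d * exp (- a * IZR n ^ 2 + (b + 1) * Rabs (IZR n)))%R.
Proof.
intros Ha Hd Hc n; rewrite Cmod_mult, Cmod_R.
replace (- a * IZR n ^ 2 + (b + 1) * Rabs (IZR n))%R with
  (Rabs (IZR n) + (- a * IZR n ^ 2 + b * Rabs (IZR n)))%R by ring.
rewrite exp_plus, <- Rmult_assoc, (Rmult_comm d), Rmult_assoc.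
apply Rmult_le_compat; [apply Rabs_pos|apply Cmod_ge_0| |apply Hc].
pose proof (exp_ineq1_le (Rabs (IZR n))); lra.
Qed.

Lemma theta_m1_le n :
  (Cmod (theta_term q (-(1)) n) <=
   1 * exp (- (- ln (Cmod q) / 2) * IZR n ^ 2 + (- ln (Cmod q) / 2) * Rabs (IZR n)))%R.
Proof.
rewrite Rmult_1_l; pose proof (theta_term_le q (-(1)) 0 n Hq Hq1 (Copp_neq_0 _ C1_nz)) as H.
rewrite Rplus_0_r in H; apply H; rewrite Cmod_opp, Cmod_1, ln_1, Rabs_R0; lra.
Qed.

(** The triple product differentiated at its zero v = -1, carried out on the finite products: their
    first moments [D] satisfy a recursion that is solved exactly, and dominated convergence gives
    the limit. *)
Lemma jacobi_cube :
  Zsum (fun n => IZR n * theta_term q (-(1)) n) = - (phi q * (phi q * phi q)).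
Proof.
pose proof (ln_Cmod_neg q Hq Hq1) as Hl; set (l := (- ln (Cmod q) / 2)%R) in *.
assert (Hl0 : (0 < l)%R) by (unfold l; lra).
pose proof (Copp_neq_0 _ C1_nz) as H1.
destruct (jt_bound q Hq1) as [K [HK H]].
set (c := fun N n => jt q N n * zpow (-(1)) n).
assert (HM : forall N n, (Cmod (IZR n * c N n) <= K * exp (- l * IZR n ^ 2 + (l + 1) * Rabs (IZR n)))%R).
{ intros N; apply summable_index_mult; auto; intros n; unfold c.
  rewrite Cmod_mult; eapply Rle_trans; [apply Rmult_le_compat_r; [apply Cmod_ge_0|apply H]|].
  rewrite Rmult_assoc, <- Cmod_mult; apply Rmult_le_compat_l; [exact HK|].
  pose proof (theta_m1_le n) as I; rewrite Rmult_1_l in I; exact I. }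
pose proof (summable_gauss K l (l + 1) HK Hl0) as SG.
assert (Sn : forall N, abs_summable (fun n => IZR n * c N n))
  by (intros N; apply abs_summable_le with (1 := SG), HM).
assert (S0 : forall N, abs_summable (c N)) by (intros N; now apply jt_summable).
set (D := fun N => Zsum (fun n => IZR n * c N n)).
assert (Dsucc : forall N, D (S N) = (1 - q ^ N) * (1 - q ^ S N) * D N
                                    - (q ^ N - q ^ S N) * Zsum (c N)).
{ intros N; unfold D.
  set (z := zpow (-(1))) in *.
  assert (z1 : forall n, z (n + 1)%Z = - z n) by (intros n; unfold z; rewrite zpow_succ by exact H1; ring).
  assert (z2 : forall n, z (n - 1)%Z = - z n).
  { intros n; replace n with (n - 1 + 1)%Z at 2 by lia; rewrite z1; ring. }
  (* The weights k + 1 and k - 1 both become n after the shifts k = n - 1 and k = n + 1, so the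
     neighbouring coefficients enter with the weight n of the moment. *)
  set (f := fun k => IZR k * c N k + c N k); set (g := fun k => IZR k * c N k - c N k).
  assert (Sf : abs_summable f) by (now apply abs_summable_plus).
  assert (Sg : abs_summable g) by (now apply abs_summable_minus).
  assert (Zf : Zsum f = Zsum (fun n => IZR n * c N n) + Zsum (c N)) by (now apply Zsum_plus).
  assert (Zg : Zsum g = Zsum (fun n => IZR n * c N n) - Zsum (c N)) by (now apply Zsum_minus).
  assert (Sf' : abs_summable (fun n => f (n + -1)%Z)) by (now apply abs_summable_shift).
  assert (Sg' : abs_summable (fun n => g (n + 1)%Z)) by (now apply abs_summable_shift).
  transitivity (Zsum (fun n => (1 + q ^ S (2 * N)) * (IZR n * c N n) +
    ((- q ^ N) * f (n + -1)%Z + (- q ^ S N) * g (n + 1)%Z))).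
  { apply Zsum_ext; intros n; unfold f, g, c; rewrite jt_succ by assumption.
    change (n + -1)%Z with (n - 1)%Z; fold z; rewrite z1, z2, minus_IZR, plus_IZR, RtoC_minus, RtoC_plus; ring. }
  clearbody f g.
  rewrite Zsum_plus, Zsum_plus, !Zsum_scal, (Zsum_shift f (-1) Sf), (Zsum_shift g 1 Sg), Zf, Zg;
  try apply abs_summable_plus; try apply abs_summable_scal; auto.
  rewrite !Cpow_S; replace (2 * N)%nat with (N + N)%nat by lia; rewrite Cpow_add_r; ring. }
(* At N = 0 the first moment is 0 and the zeroth is the empty product 1; from N = 1 on the zeroth
   moment vanishes by [jt_sum_eq_0] and the recursion is a pure product. *)
assert (D1 : forall N, D (S N) = - (phiN q N * phiN q (S N))).
{ induction N as [|N IH].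
  - rewrite Dsucc; unfold D.
    replace (Zsum (fun n => IZR n * c 0%nat n)) with (RtoC 0).
    + unfold c; rewrite <- JP_expand by assumption; unfold JP, phiN; simpl; ring.
    + symmetry; rewrite Zsum_single; [simpl; ring|].
      intros k Hk; unfold c; rewrite jt_0 by exact Hk; ring.
  - rewrite Dsucc, IH; unfold c; rewrite jt_sum_eq_0 by assumption.
    unfold phiN; cbn [Cprod]; ring. }
apply (tends_unique eventually (fun N => phi q * D (S N))).
- apply (tends_comp eventually eventually S (fun N => phi q * D N)).
  { intros P [N0 HN0]; exists N0; intros N HN; apply HN0; lia. }
  apply tends_ext with (fun N => Zsum (fun n => phi q * (IZR n * c N n))).
  { apply eventually_filter. }
  { intros N; unfold D; now rewrite Zsum_scal. }
  apply (Zsum_dominated eventually) with (1 := summable_scal _ _ (Cmod_ge_0 (phi q)) SG).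
  + apply filter_forall; intros N n; rewrite Cmod_mult.
    apply Rmult_le_compat_l; [apply Cmod_ge_0|apply HM].
  + intros n; unfold c, theta_term.
    replace (IZR n * (zpow q (tri n) * zpow (-(1)) n)) with
      (phi q * (IZR n * (zpow q (tri n) / phi q * zpow (-(1)) n))) by (field; now apply phi_neq_0).
    apply tends_scal, tends_scal, tends_mult; try apply eventually_filter.
    * now apply jt_tends.
    * apply tends_const, eventually_filter.
- apply tends_ext with (fun N => - (phi q * (phiN q N * phiN q (S N)))).
  + apply eventually_filter.
  + intros N; rewrite D1; ring.
  + apply tends_opp, tends_scal, tends_mult; try apply eventually_filter; [now apply phiN_tends|].
    apply (tends_comp eventually eventually S (phiN q)); [|now apply phiN_tends].
    intros P [N0 HN0]; exists N0; intros N HN; apply HN0; lia.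
Qed.

End JacobiCube.

(** * Appell sums as theta quotients *)

Section AppellSums.

Context (q : C) (Hq : q <> 0) (Hq1 : (Cmod q < 1)%R).

Let c : Z -> C := theta_term q (-(1)).
Let lam : R := (- ln (Cmod q))%R.

Lemma lam_pos : (0 < lam)%R.
Proof. unfold lam; pose proof (ln_Cmod_neg q Hq Hq1); lra. Qed.

Lemma c_summable : abs_summable c.
Proof. apply theta_term_summable; auto; apply Copp_neq_0, C1_nz. Qed.

(** The Laurent coefficients of Th(-y)/(1 - y): division by 1 - y replaces the coefficients by their
    partial sums from minus infinity. They decay in both directions because the total is Th(-1) =
    0. *)
Definition theta_partial (n : Z) : C := Zsum (fun k => if (k <=? n)%Z then c k else 0).

Let b : Z -> C := theta_partial.

Lemma truncation_summable (p : Z -> bool) : abs_summable (fun k => if p k then c k else 0).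
Proof.
apply abs_summable_le with (1 := c_summable); intros k; destruct (p k); [apply Rle_refl|].
rewrite Cmod_0; apply Cmod_ge_0.
Qed.

Lemma Zsum_single_at (w : Z -> C) (k0 : Z) :
  abs_summable w -> (forall k, k <> k0 -> w k = 0) -> Zsum w = w k0.
Proof.
intros Hs H; rewrite <- (Zsum_shift w k0 Hs), Zsum_single; [reflexivity|].
intros k Hk; apply H; lia.
Qed.

Lemma theta_partial_diff n : b n - b (n - 1) = c n.
Proof.
unfold b, theta_partial; rewrite <- Zsum_minus by apply truncation_summable.
rewrite Zsum_single_at with (k0 := n).
- rewrite Z.leb_refl; destruct (Z.leb_spec n (n - 1)); [lia|]; ring.
- apply abs_summable_minus; apply truncation_summable.
- intros k Hk; destruct (Z.leb_spec k n), (Z.leb_spec k (n - 1)); try lia; ring.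
Qed.

(** Since the full series is 0, the sum up to n is minus the sum beyond n, which the sign-reversing
    reflection k -> 1 - k carries to the sum up to -n. *)
Lemma theta_partial_opp n : b (- n) = b n.
Proof.
unfold b, theta_partial.
rewrite <- (Zsum_reflect (fun k => if (k <=? - n)%Z then c k else 0) 1) by apply truncation_summable.
assert (E : Zsum (fun k => if (k <=? n)%Z then c k else 0) +
            Zsum (fun k => if (n + 1 <=? k)%Z then c k else 0) = 0).
{ rewrite <- Zsum_plus by apply truncation_summable.
  transitivity (Th q (-(1))); [|now apply Th_m1].
  apply Zsum_ext; intros k; fold c; destruct (Z.leb_spec k n), (Z.leb_spec (n + 1) k); try lia; unfold c; ring. }
assert (E' : forall x y : C, x + y = 0 -> x = - y)
  by (intros x y H; replace x with (x + y - y) by ring; rewrite H; ring).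
rewrite (E' _ _ E).
rewrite <- Zsum_opp by apply truncation_summable; apply Zsum_ext; intros k.
unfold c; destruct (Z.leb_spec (1 - k) (- n)), (Z.leb_spec (n + 1) k); try lia; [|ring].
now apply theta_term_m1_reflect.
Qed.

(** For n <= 0 the sum runs over small terms only and is estimated directly. For n > 0 large terms
    cancel against each other, and the symmetry replaces n by -n. *)
Lemma theta_partial_le : exists C0, (0 <= C0)%R /\
  forall n, (Cmod (b n) <= C0 * exp (- (lam / 2) * IZR n ^ 2 + lam / 2 * Rabs (IZR n)))%R.
Proof.
pose proof lam_pos as Hl.
destruct (summable_exp_abs lam Hl) as [_ [C0 HC0]].
exists C0; split; [exact (HC0 0%nat)|].
assert (H : forall n, (n <= 0)%Z ->
  (Cmod (b n) <= C0 * exp (- (lam / 2) * IZR n ^ 2 + lam / 2 * Rabs (IZR n)))%R).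
{ intros n Hn; rewrite Rmult_comm.
  apply Zsum_le with (fun k =>
    (exp (- (lam / 2) * IZR n ^ 2 + lam / 2 * Rabs (IZR n)) * exp (- (lam * Rabs (IZR k))))%R).
  - intros N; rewrite (Rsum_ext _ (fun i =>
      (exp (- (lam / 2) * IZR n ^ 2 + lam / 2 * Rabs (IZR n)) *
       zfoldR (fun k => exp (- (lam * Rabs (IZR k)))) i)%R)) by (intros; unfold zfoldR; ring).
    rewrite Rsum_scal; apply Rmult_le_compat_l; [apply Rlt_le, exp_pos|apply HC0].
  - intros k; destruct (Z.leb_spec k n) as [L|L].
    + unfold c; rewrite Cmod_theta_term, Cmod_opp, Cmod_1, ln_1, <- exp_plus
        by (try apply Copp_neq_0, C1_nz; exact Hq).
      apply exp_le_compat; rewrite IZR_tri.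
      assert (I1 : (IZR n <= 0)%R) by (apply IZR_le; lia).
      assert (I2 : (IZR k <= 0)%R) by (apply IZR_le; lia).
      rewrite !Rabs_left1 by assumption.
      replace (ln (Cmod q)) with (- lam)%R by (unfold lam; ring).
      (* Both factors are nonpositive when k < n <= 0. The product says that n(n+1)/2 + |k| is at
         most k(k-1)/2, so a Gaussian in n splits off a geometric term in k. *)
      assert (I3 : (0 <= IZR ((k - n) * (k + n + 1)))%R).
      { apply IZR_le; destruct (Z.eq_dec k n) as [->|]; [lia|]; apply Z.mul_nonpos_nonpos; lia. }
      rewrite mult_IZR, !plus_IZR, minus_IZR in I3.
      assert (I5 : (0 <= (IZR k ^ 2 - IZR k) / 2 - (IZR n ^ 2 + IZR n) / 2 + IZR k)%R) by lra.
      pose proof (Rmult_le_pos _ _ (Rlt_le _ _ Hl) I5); lra.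
    + rewrite Cmod_0; apply Rmult_le_pos; apply Rlt_le, exp_pos. }
intros n; destruct (Z.le_gt_cases n 0); [now apply H|].
rewrite <- theta_partial_opp; specialize (H (- n)%Z ltac:(lia)).
rewrite opp_IZR, Rabs_Ropp in H; replace ((- IZR n) ^ 2)%R with (IZR n ^ 2)%R in H by ring; exact H.
Qed.

Lemma Laurent_summable (beta : Z -> C) (C0 a mu : R) (y : C) :
  (0 < a)%R -> (0 <= C0)%R -> y <> 0 ->
  (forall n, (Cmod (beta n) <= C0 * exp (- a * IZR n ^ 2 + mu * Rabs (IZR n)))%R) ->
  abs_summable (fun n => beta n * zpow y n).
Proof.
intros Ha HC Hy H.
apply abs_summable_le with (1 := summable_gauss C0 a (mu + Rabs (ln (Cmod y))) HC Ha).
intros n; rewrite Cmod_mult, Cmod_zpow by exact Hy.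
eapply Rle_trans; [apply Rmult_le_compat_r; [apply Rlt_le, exp_pos|apply H]|].
rewrite Rmult_assoc, <- exp_plus; apply Rmult_le_compat_l; [exact HC|]; apply exp_le_compat.
assert (I : (IZR n * ln (Cmod y) <= Rabs (ln (Cmod y)) * Rabs (IZR n))%R).
{ eapply Rle_trans; [apply Rle_abs|]; rewrite Rabs_mult, Rmult_comm; apply Rle_refl. }
lra.
Qed.

Lemma theta_partial_summable (y : C) : y <> 0 -> abs_summable (fun n => b n * zpow y n).
Proof.
intros Hy; destruct theta_partial_le as [C0 [HC H]]; pose proof lam_pos.
apply (Laurent_summable b C0 (lam / 2) (lam / 2)); auto; lra.
Qed.

Lemma theta_partial_factor (y : C) :
  y <> 0 -> (1 - y) * Zsum (fun n => b n * zpow y n) = Th q (- y).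
Proof.
intros Hy; pose proof (theta_partial_summable y Hy) as S.
replace ((1 - y) * Zsum (fun n => b n * zpow y n)) with
  (Zsum (fun n => b n * zpow y n) - y * Zsum (fun n => b n * zpow y n)) by ring.
pose proof (abs_summable_scal y _ S) as Sy.
rewrite <- Zsum_scal, <- (Zsum_shift _ (-1) Sy), <- Zsum_minus
  by (try exact S; try exact (abs_summable_shift _ (-1) Sy)).
apply Zsum_ext; intros n; change (n + -1)%Z with (n - 1)%Z.
unfold theta_term; rewrite zpow_Copp by exact Hy.
replace (zpow q (tri n) * (zpow (-(1)) n * zpow y n)) with (c n * zpow y n)
  by (unfold c, theta_term; ring).
rewrite <- theta_partial_diff, zpow_sub, zpow_1_r by exact Hy; field; exact Hy.
Qed.

(** The value of Th(-y)/(1 - y) at y = 1, found by summation by parts: the sum of the partial sums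
    is minus the first moment of the theta coefficients, which [jacobi_cube] evaluates. *)
Lemma theta_partial_sum : Zsum b = phi q * (phi q * phi q).
Proof.
destruct theta_partial_le as [C0 [HC H]]; pose proof lam_pos as Hl.
assert (Hl2 : (0 < lam / 2)%R) by lra.
assert (Sb : abs_summable b).
{ apply abs_summable_ext with (2 := theta_partial_summable 1 C1_nz).
  intros; rewrite zpow_1_l; ring. }
assert (Sn : abs_summable (fun n => IZR n * b n)).
{ apply abs_summable_le with (1 := summable_gauss C0 (lam / 2) (lam / 2 + 1) HC Hl2).
  apply summable_index_mult; assumption. }
assert (Sm : abs_summable (fun n => IZR n * b n + b n)) by (now apply abs_summable_plus).
assert (E : Zsum (fun n => IZR n * c n) = Zsum (fun n => IZR n * b n) - Zsum (fun n => IZR n * b n + b n)).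
{ rewrite <- (Zsum_shift _ (-1) Sm), <- Zsum_minus by (try exact Sn; exact (abs_summable_shift _ (-1) Sm)).
  apply Zsum_ext; intros n; change (n + -1)%Z with (n - 1)%Z.
  rewrite <- theta_partial_diff, minus_IZR, RtoC_minus; ring. }
unfold c in E; rewrite jacobi_cube, Zsum_plus in E by assumption.
replace (Zsum b) with (- (Zsum (fun n => IZR n * b n) - (Zsum (fun n => IZR n * b n) + Zsum b))) by ring.
rewrite <- E; ring.
Qed.

(** * Lattice sums and their two-step recursion *)

Section Lattice.

Context (beta : Z -> C) (r : C) (C0 mu0 : R) (Hr : r <> 0) (HC0 : (0 <= C0)%R) (Hmu0 : (0 <= mu0)%R).
Context (Hbeta : forall n, (Cmod (beta n) <= C0 * exp (- (lam / 2) * IZR n ^ 2 + mu0 * Rabs (IZR n)))%R).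

(** The j-th summand of [lattice_sum] contributes v^(2j + n) for each index n of its inner series.
    Writing n = N - 2j collects the coefficient of v^N, with exponent j(j-1) + j(N - 2j) of q. *)
Definition lattice_term (N j : Z) : C := zpow r j * zpow q (- (j * j) - j + N * j) * beta (N - 2 * j).
Definition lattice_coeff (N : Z) : C := Zsum (lattice_term N).

(** One double series summed in both orders. The accompanying summability statements are what later
    justifies reindexing the coefficients and splitting the sum over N. *)
Lemma lattice_sum (v : C) : v <> 0 ->
  (forall N, abs_summable (lattice_term N)) /\
  abs_summable (fun j => zpow r j * zpow q (2 * tri j) * zpow v (2 * j) *
                         Zsum (fun n => beta n * zpow (v * zpow q j) n)) /\
  abs_summable (fun N => lattice_coeff N * zpow v N) /\
  Zsum (fun j => zpow r j * zpow q (2 * tri j) * zpow v (2 * j) *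
                 Zsum (fun n => beta n * zpow (v * zpow q j) n)) =
  Zsum (fun N => lattice_coeff N * zpow v N).
Proof.
intros Hv; pose proof lam_pos as Hl.
assert (Hl2 : (0 < lam / 2)%R) by lra.
set (a := fun j N => lattice_term N j * zpow v N).
set (mu := (Rabs (ln (Cmod r)) + lam + Rabs (ln (Cmod v)) + mu0)%R).
assert (Sin : forall y : C, y <> 0 -> abs_summable (fun n => beta n * zpow y n)).
{ intros y Hy; apply (Laurent_summable beta C0 (lam / 2) mu0); auto. }
assert (Hin : forall j, zpow r j * zpow q (2 * tri j) * zpow v (2 * j) *
                 Zsum (fun n => beta n * zpow (v * zpow q j) n) = Zsum (fun N => a j N)).
{ intros j; assert (Hy : v * zpow q j <> 0) by (apply Cmult_neq_0; [|apply zpow_neq_0]; assumption).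
  pose proof (Sin _ Hy) as S.
  rewrite <- (Zsum_shift _ (- (2 * j)) S), <- Zsum_scal by (exact (abs_summable_shift _ (- (2 * j)) S)).
  apply Zsum_ext; intros N; change (N + - (2 * j))%Z with (N - 2 * j)%Z; unfold a, lattice_term.
  rewrite tri_double, zpow_mult_l, <- zpow_mult_r by (try apply zpow_neq_0; assumption).
  replace (- (j * j) - j + N * j)%Z with (j * (j - 1) + j * (N - 2 * j))%Z by ring.
  replace (zpow v N) with (zpow v (2 * j) * zpow v (N - 2 * j))
    by (rewrite <- zpow_add by exact Hv; f_equal; lia).
  rewrite (zpow_add q) by exact Hq; ring. }
(* Stated for all w with |ln |w|| at most |ln |v||, because it is used at w = v for the interchange
   and at w = 1 for the summability of the coefficients alone. *)
assert (Bd : forall w : C, w <> 0 -> (Rabs (ln (Cmod w)) <= Rabs (ln (Cmod v)))%R -> forall j N,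
  (Cmod (lattice_term N j * zpow w N) <= C0 * exp (- (lam / 2) * IZR j ^ 2 + mu * Rabs (IZR j)) *
                         (1 * exp (- (lam / 2) * IZR (N - j) ^ 2 + mu * Rabs (IZR (N - j)))))%R).
{ intros w Hw Hwv j N; unfold lattice_term; rewrite !Cmod_mult, !Cmod_zpow by assumption.
  replace (ln (Cmod q)) with (- lam)%R by (unfold lam; ring).
  rewrite Rmult_1_l, (Rmult_assoc C0), <- !exp_plus.
  set (x := exp (IZR j * ln (Cmod r) + IZR (- (j * j) - j + N * j) * - lam)).
  apply Rle_trans with (x * (C0 * exp (- (lam / 2) * IZR (N - 2 * j) ^ 2 + mu0 * Rabs (IZR (N - 2 * j)))) *
                        exp (IZR N * ln (Cmod w)))%R.
  { apply Rmult_le_compat_r; [apply Rlt_le, exp_pos|].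
    apply Rmult_le_compat_l; [apply Rlt_le, exp_pos|apply Hbeta]. }
  unfold x; rewrite (Rmult_comm (exp _)), !Rmult_assoc; apply Rmult_le_compat_l; [exact HC0|].
  rewrite <- !exp_plus; apply exp_le_compat.
  (* In the variables j and k = N - j the quadratic part of the exponent is jk + (k - j)^2/2 = (j^2
     + k^2)/2. It is positive definite and diagonal, so the majorant factors as [Zsum_swap]
     demands. *)
  set (k := (N - j)%Z); replace N with (j + k)%Z by (unfold k; lia).
  replace (j + k - 2 * j)%Z with (k - j)%Z by lia.
  replace (- (j * j) - j + (j + k) * j)%Z with (j * k - j)%Z by ring.
  rewrite !minus_IZR, plus_IZR, mult_IZR; set (X := IZR j); set (Y := IZR k).
  assert (A1 : (X * ln (Cmod r) <= Rabs (ln (Cmod r)) * Rabs X)%R).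
  { eapply Rle_trans; [apply Rle_abs|]; rewrite Rabs_mult, Rmult_comm; apply Rle_refl. }
  assert (A2 : ((X + Y) * ln (Cmod w) <= Rabs (ln (Cmod v)) * (Rabs X + Rabs Y))%R).
  { eapply Rle_trans; [apply Rle_abs|]; rewrite Rabs_mult, Rmult_comm.
    apply Rmult_le_compat; try apply Rabs_pos; [exact Hwv|apply Rabs_triang]. }
  assert (A3 : (mu0 * Rabs (Y - X) <= mu0 * (Rabs X + Rabs Y))%R).
  { apply Rmult_le_compat_l; [exact Hmu0|].
    unfold Rminus; eapply Rle_trans; [apply Rabs_triang|]; rewrite Rabs_Ropp; lra. }
  assert (A4 : (lam * X <= lam * Rabs X)%R) by (apply Rmult_le_compat_l; [lra|apply Rle_abs]).
  pose proof (Rabs_pos X); pose proof (Rabs_pos Y).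
  pose proof (Rmult_le_pos _ _ (Rabs_pos (ln (Cmod r))) (Rabs_pos Y)).
  pose proof (Rmult_le_pos _ _ (Rlt_le _ _ Hl) (Rabs_pos Y)).
  unfold mu; nra. }
destruct (Zsum_swap a _ _ (summable_gauss C0 _ mu HC0 Hl2) (summable_gauss 1 _ mu Rle_0_1 Hl2)
  (Bd v Hv (Rle_refl _))) as [_ [S2 [S3 E]]].
destruct (Zsum_swap (fun j N => lattice_term N j * zpow 1 N) _ _
  (summable_gauss C0 _ mu HC0 Hl2) (summable_gauss 1 _ mu Rle_0_1 Hl2)) as [S1 _].
{ apply Bd; [apply C1_nz|rewrite Cmod_1, ln_1, Rabs_R0; apply Rabs_pos]. }
assert (S1' : forall N, abs_summable (lattice_term N)).
{ intros N; apply abs_summable_ext with (2 := S1 N); intros j; simpl; rewrite zpow_1_l; ring. }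
assert (Hout : forall N, Zsum (fun j => a j N) = lattice_coeff N * zpow v N).
{ intros N; unfold lattice_coeff; rewrite Cmult_comm, <- Zsum_scal by apply S1'.
  apply Zsum_ext; intros j; unfold a; ring. }
split; [exact S1'|split; [|split]].
- apply abs_summable_ext with (2 := S2); intros j; now rewrite Hin.
- apply abs_summable_ext with (2 := S3); exact Hout.
- transitivity (Zsum (fun j => Zsum (fun N => a j N))); [apply Zsum_ext, Hin|].
  rewrite E; apply Zsum_ext, Hout.
Qed.

(** The translation (j, N) -> (j + 1, N + 2) preserves N - 2j, hence the value of [beta]; only the
    monomials change. *)
Lemma lattice_coeff_step N : lattice_coeff (N + 2) = r * zpow q N * lattice_coeff N.
Proof.
destruct (lattice_sum 1 C1_nz) as [S _].
unfold lattice_coeff; rewrite <- (Zsum_shift (lattice_term (N + 2)) 1 (S _)), <- Zsum_scal by apply S.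
apply Zsum_ext; intros j; unfold lattice_term.
replace (N + 2 - 2 * (j + 1))%Z with (N - 2 * j)%Z by lia.
replace (- ((j + 1) * (j + 1)) - (j + 1) + (N + 2) * (j + 1))%Z with
  (N + (- (j * j) - j + N * j))%Z by ring.
rewrite zpow_succ, (zpow_add q N) by assumption; ring.
Qed.

(** The reflection j -> -j leaves over a power of q linear in j, which the hypothesis on r^2 lets
    r^(2j) absorb. It is used with kap = 0 for integral s and kap = 1 for half-integral s. *)
Lemma lattice_coeff_reflect (kap : Z) :
  r * r = zpow q (2 - kap) -> (forall n, beta (kap - n) = beta n) ->
  forall N, lattice_coeff (kap - N) = lattice_coeff N.
Proof.
intros Hrr Hb N; destruct (lattice_sum 1 C1_nz) as [S _].
unfold lattice_coeff; rewrite <- (Zsum_reflect (lattice_term N) 0 (S _)).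
apply Zsum_ext; intros j; unfold lattice_term.
replace (kap - N - 2 * j)%Z with (kap - (N - 2 * (0 - j)))%Z by lia; rewrite Hb; f_equal.
assert (E : zpow r j * zpow r j = zpow q ((2 - kap) * j)).
{ rewrite <- zpow_mult_l, Hrr, <- zpow_mult_r by assumption; reflexivity. }
replace (0 - j)%Z with (- j)%Z by lia; rewrite zpow_opp by exact Hr.
replace (- (j * j) - j + (kap - N) * j)%Z with
  (- (- j * - j) - - j + N * - j + - ((2 - kap) * j))%Z by ring.
rewrite zpow_add, zpow_opp, <- E by exact Hq; field; now apply zpow_neq_0.
Qed.

End Lattice.

(* At [v = 1] every term of the outer sum except [j = 0] contains a zero of the theta function. *)
Lemma theta_partial_at_pow j : j <> 0%Z -> Zsum (fun n => b n * zpow (zpow q j) n) = 0.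
Proof.
intros Hj; pose proof (zpow_neq_0 q j Hq) as Hy.
assert (N1 : 1 - zpow q j <> 0).
{ intros E; assert (E1 : zpow q j = 1) by (replace (zpow q j) with (1 - (1 - zpow q j)) by ring; rewrite E; ring).
  assert (E2 : exp (IZR j * ln (Cmod q)) = exp 0) by (now rewrite <- Cmod_zpow, E1, Cmod_1, exp_0 by exact Hq).
  apply exp_inv in E2; pose proof (ln_Cmod_neg q Hq Hq1).
  apply Rmult_integral in E2; destruct E2 as [E2|E2]; [apply (eq_IZR j 0) in E2; contradiction|lra]. }
apply Cmult_cancel_l with (1 - zpow q j); [exact N1|].
rewrite theta_partial_factor by exact Hy.
assert (Hm : -(1) <> 0) by apply Copp_neq_0, C1_nz.
apply Cmult_cancel_l with (theta_term q (-(1)) j).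
- unfold theta_term; apply Cmult_neq_0; now apply zpow_neq_0.
- pose proof (Th_shift q (-(1)) j Hq Hq1 Hm) as E; rewrite Th_m1 in E by assumption.
  replace (- zpow q j) with (-(1) * zpow q j) by ring; rewrite <- E; ring.
Qed.

(** Even and odd refer to the parity of 2s. The odd term averages s = 1/2 and s = 3/2, up to a
    factor 2: their numerators differ by v q^j, which produces 1 + v q^j here. *)
Definition appell_even_term (v : C) (j : Z) : C :=
  zpow q j * zpow q (tri j) * zpow v j / (1 - v * zpow q j).

Definition appell_odd_term (r v : C) (j : Z) : C :=
  zpow (- r) j * zpow q (tri j) * zpow v j * (1 + v * zpow q j) / (1 - v * zpow q j).

Lemma Th_opp_neq_0 (v : C) : v <> 0 -> (forall j, v * zpow q j <> 1) -> Th q (- v) <> 0.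
Proof.
intros Hv Hp E; destruct (Th_eq_0 q (- v) Hq Hq1 (Copp_neq_0 _ Hv) E) as [j Hj].
apply (Hp j); replace (v * zpow q j) with (- (- v * zpow q j)) by ring; rewrite Hj; ring.
Qed.

(** Quasi-periodicity moves the pole of the j-th term to y = v q^j, where the zero of Th(-y) at y =
    1 cancels it; the quotient is a Laurent series in y. *)
Lemma Th_opp_shift (v : C) j :
  v <> 0 -> v * zpow q j <> 1 ->
  Th q (- v) / (1 - v * zpow q j) =
  zpow q (tri j) * zpow (- v) j * Zsum (fun n => b n * zpow (v * zpow q j) n).
Proof.
intros Hv Hp.
assert (Hy : v * zpow q j <> 0) by (apply Cmult_neq_0; [|apply zpow_neq_0]; assumption).
rewrite (Th_shift q (- v) j Hq Hq1 (Copp_neq_0 _ Hv)).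
replace (- v * zpow q j) with (- (v * zpow q j)) by ring.
rewrite <- theta_partial_factor by exact Hy; unfold theta_term; field.
intros E; apply Hp; replace (v * zpow q j) with (1 - (1 - v * zpow q j)) by ring; rewrite E; ring.
Qed.

(** Here r = -q and kap = 0. The recursion acts on each parity class of N separately; symmetry
    annihilates the odd class, and the even class is a theta series of base q^2. *)
Theorem appell_even (v : C) :
  v <> 0 -> (forall j, v * zpow q j <> 1) ->
  abs_summable (appell_even_term v) /\
  Th q (- v) * Zsum (appell_even_term v) * Th (q * q) (- q) =
  phi q * (phi q * phi q) * Th (q * q) (- (v * v * q)).
Proof.
intros Hv Hp; pose proof lam_pos as Hl.
destruct theta_partial_le as [C0 [HC0 Hb]].
assert (Hr : - q <> 0) by (now apply Copp_neq_0).
assert (Hmu : (0 <= lam / 2)%R) by lra.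
pose proof (lattice_sum b (- q) C0 (lam / 2) Hr HC0 Hmu Hb) as L.
set (g := lattice_coeff b (- q)) in L.
assert (g_step : forall N, g (N + 2)%Z = - q * zpow q N * g N)
  by (intros N; exact (lattice_coeff_step b (- q) C0 (lam / 2) Hr HC0 Hmu Hb N)).
assert (g_opp : forall N, g (- N)%Z = g N).
{ intros N; apply (lattice_coeff_reflect b (- q) C0 (lam / 2) Hr HC0 Hmu Hb 0).
  - simpl; ring.
  - intros n; apply theta_partial_opp. }
(* From -1 to 1 the recursion has factor -q q^(-1) = -1, whereas symmetry makes the two coefficients
   equal. *)
assert (g_odd : forall k, g (2 * k + 1)%Z = 0).
{ apply Z_bi_ind.
  - apply C_double_eq_0; change (2 * 0 + 1)%Z with (-1 + 2)%Z at 1; rewrite g_step.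
    change (-1)%Z with (- (1))%Z; rewrite g_opp; simpl; field; exact Hq.
  - intros n IH; replace (2 * (n + 1) + 1)%Z with (2 * n + 1 + 2)%Z by lia; rewrite g_step, IH; ring.
  - intros n IH; replace (2 * (n + 1) + 1)%Z with (2 * n + 1 + 2)%Z in IH by lia.
    rewrite g_step in IH; apply Cmult_cancel_l with (- q * zpow q (2 * n + 1)).
    + apply Cmult_neq_0; [exact Hr|now apply zpow_neq_0].
    + rewrite IH; ring. }
assert (g_even : forall k, g (2 * k)%Z = g 0%Z * (zpow (-(1)) k * zpow q (k * k))).
{ apply Z_bi_ind.
  - simpl; ring.
  - intros n IH; replace (2 * (n + 1))%Z with (2 * n + 2)%Z by lia; rewrite g_step, IH.
    rewrite zpow_succ by apply Copp_neq_0, C1_nz.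
    replace ((n + 1) * (n + 1))%Z with (1 + 2 * n + n * n)%Z by ring.
    rewrite !(zpow_add q), zpow_1_r by exact Hq; ring.
  - intros n IH; replace (2 * (n + 1))%Z with (2 * n + 2)%Z in IH by lia; rewrite g_step in IH.
    apply Cmult_cancel_l with (- q * zpow q (2 * n)).
    + apply Cmult_neq_0; [exact Hr|now apply zpow_neq_0].
    + rewrite IH, zpow_succ by apply Copp_neq_0, C1_nz.
      replace ((n + 1) * (n + 1))%Z with (1 + 2 * n + n * n)%Z by ring.
      rewrite !(zpow_add q), zpow_1_r by exact Hq; ring. }
assert (G : forall w : C, w <> 0 -> abs_summable (fun N => g N * zpow w N) ->
  Zsum (fun N => g N * zpow w N) = g 0%Z * Th (q * q) (- (w * w * q))).
{ intros w Hw S; rewrite Zsum_even_odd by exact S.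
  rewrite (Zsum_single (fun k => g (2 * k + 1)%Z * zpow w (2 * k + 1)%Z))
    by (intros; rewrite g_odd; ring).
  rewrite g_odd, Cmult_0_l, Cplus_0_r; unfold Th.
  rewrite <- Zsum_scal.
  - apply Zsum_ext; intros k; rewrite g_even; unfold theta_term.
    rewrite (zpow_Copp (w * w * q)) by (repeat apply Cmult_neq_0; assumption).
    rewrite <- zpow_2, <- zpow_2, zpow_mult_l, <- !zpow_mult_r, tri_double
      by (try apply zpow_neq_0; assumption).
    replace (k * k)%Z with (k * (k - 1) + k)%Z by ring; rewrite (zpow_add q) by exact Hq; ring.
  - apply theta_term_summable; [now apply Cmult_neq_0|now apply Cmod_square_lt_1|].
    apply Copp_neq_0; repeat apply Cmult_neq_0; assumption. }
(* The expansion [L] is valid at v = 1, where the Appell sum itself is undefined; only the j = 0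
   term remains, and it determines [g 0]. *)
assert (V1 : phi q * (phi q * phi q) = g 0%Z * Th (q * q) (- q)).
{ destruct (L 1 C1_nz) as [_ [_ [S E]]].
  rewrite (G 1 C1_nz S), Zsum_single in E.
  - replace (1 * 1 * q) with q in E by ring; rewrite <- E, <- theta_partial_sum.
    change (tri 0) with 0%Z; simpl zpow; rewrite !Cmult_1_l.
    apply Zsum_ext; intros n; rewrite zpow_1_l; fold b; ring.
  - intros k Hk; rewrite Cmult_1_l, theta_partial_at_pow by exact Hk; ring. }
destruct (L v Hv) as [_ [S2 [S3 E]]]; rewrite (G v Hv S3) in E.
pose proof (Th_opp_neq_0 v Hv Hp) as HT.
assert (E2 : forall j, zpow (- q) j * zpow q (2 * tri j) * zpow v (2 * j) *
    Zsum (fun n => b n * zpow (v * zpow q j) n) = Th q (- v) * appell_even_term v j).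
{ intros j; unfold appell_even_term, Cdiv.
  replace (Th q (- v) * (zpow q j * zpow q (tri j) * zpow v j * / (1 - v * zpow q j))) with
    (Th q (- v) / (1 - v * zpow q j) * (zpow q j * zpow q (tri j) * zpow v j)) by (unfold Cdiv; ring).
  rewrite Th_opp_shift by auto.
  replace (2 * tri j)%Z with (tri j + tri j)%Z by lia; replace (2 * j)%Z with (j + j)%Z by lia.
  rewrite !zpow_add, (zpow_Copp q), (zpow_Copp v) by assumption; ring. }
assert (SA : abs_summable (appell_even_term v)).
{ apply abs_summable_ext with (2 := abs_summable_scal (/ Th q (- v)) _ S2).
  intros j; rewrite E2; field; exact HT. }
split; [exact SA|].
rewrite <- Zsum_scal by exact SA.
replace (Zsum (fun k => Th q (- v) * appell_even_term v k)) with (g 0%Z * Th (q * q) (- (v * v * q))).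
- rewrite V1; ring.
- rewrite <- E; apply Zsum_ext, E2.
Qed.

(** Here r^2 = q and kap = 1. The symmetry links the two parity classes through g(1) = g(0), and
    together they form one theta series of base r. *)
Theorem appell_odd (r v : C) :
  r * r = q -> v <> 0 -> (forall j, v * zpow q j <> 1) ->
  abs_summable (appell_odd_term r v) /\
  Th q (- v) * Zsum (appell_odd_term r v) * Th r 1 = 2 * (phi q * (phi q * phi q)) * Th r v.
Proof.
intros Hrr Hv Hp; pose proof lam_pos as Hl.
destruct theta_partial_le as [C0 [HC0 Hb]].
assert (Hr : r <> 0) by (intros E; apply Hq; rewrite <- Hrr, E; ring).
assert (Hr1 : (Cmod r < 1)%R).
{ apply Rnot_le_lt; intros H1; rewrite <- Hrr, Cmod_mult in Hq1; nra. }
(* Coefficients of (1 + y) Th(-y)/(1 - y): the extra numerator 1 + v q^j of the odd term is absorbed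
   into the inner series. *)
set (beta := fun n => b n + b (n - 1)%Z).
(* The factor exp lam and the enlarged linear rate 2 lam pay for replacing n - 1 by n in the
   Gaussian bound of the second summand. *)
set (C1 := (C0 * (1 + exp lam))%R).
set (mu0 := (2 * lam)%R).
assert (HC1 : (0 <= C1)%R) by (unfold C1; pose proof (exp_pos lam); nra).
assert (Hmu : (0 <= mu0)%R) by (unfold mu0; lra).
assert (Hbeta : forall n, (Cmod (beta n) <= C1 * exp (- (lam / 2) * IZR n ^ 2 + mu0 * Rabs (IZR n)))%R).
{ intros n; unfold beta; eapply Rle_trans; [apply Cmod_triangle|].
  pose proof (Rabs_pos (IZR n)) as P0.
  assert (B1 : (Cmod (b n) <= C0 * exp (- (lam / 2) * IZR n ^ 2 + mu0 * Rabs (IZR n)))%R).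
  { eapply Rle_trans; [apply Hb|]; apply Rmult_le_compat_l; [exact HC0|].
    apply exp_le_compat; unfold mu0; nra. }
  assert (B2 : (Cmod (b (n - 1)%Z) <= C0 * exp (lam + (- (lam / 2) * IZR n ^ 2 + mu0 * Rabs (IZR n))))%R).
  { eapply Rle_trans; [apply Hb|]; apply Rmult_le_compat_l; [exact HC0|].
    apply exp_le_compat; rewrite minus_IZR; unfold mu0.
    assert (I1 : (Rabs (IZR n - 1) <= Rabs (IZR n) + 1)%R).
    { unfold Rminus; eapply Rle_trans; [apply Rabs_triang|].
      rewrite Rabs_Ropp, Rabs_R1; lra. }
    pose proof (Rle_abs (IZR n)); nra. }
  rewrite exp_plus in B2; unfold C1; lra. }
pose proof (lattice_sum beta r C1 mu0 Hr HC1 Hmu Hbeta) as L.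
set (g := lattice_coeff beta r) in L.
assert (g_step : forall N, g (N + 2)%Z = r * zpow q N * g N)
  by (intros N; exact (lattice_coeff_step beta r C1 mu0 Hr HC1 Hmu Hbeta N)).
assert (g_1 : g 1%Z = g 0%Z).
{ apply (lattice_coeff_reflect beta r C1 mu0 Hr HC1 Hmu Hbeta 1) with (N := 0%Z).
  - simpl; rewrite Hrr; ring.
  - intros n; unfold beta; rewrite <- (theta_partial_opp n), <- (theta_partial_opp (n - 1)).
    replace (1 - n - 1)%Z with (- n)%Z by lia; replace (- (n - 1))%Z with (1 - n)%Z by lia; ring. }
assert (tri2 : forall N, tri (N + 2) = (2 * N + 1 + tri N)%Z).
{ intros N; rewrite tri_add; change (tri 2) with 1%Z; lia. }
assert (step : forall N, g N = g 0%Z * zpow r (tri N) <-> g (N + 2)%Z = g 0%Z * zpow r (tri (N + 2))).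
{ intros N; rewrite g_step, tri2, !(zpow_add r), (zpow_mult_r r 2), zpow_2, Hrr, zpow_1_r by exact Hr.
  split; intros E; [rewrite E; ring|].
  apply Cmult_cancel_l with (r * zpow q N);
    [apply Cmult_neq_0; [exact Hr|now apply zpow_neq_0]|rewrite E; ring]. }
assert (g_all : forall N, g N = g 0%Z * zpow r (tri N) /\ g (N + 1)%Z = g 0%Z * zpow r (tri (N + 1))).
{ apply Z_bi_ind.
  - change (tri 0) with 0%Z; change (tri (0 + 1)) with 0%Z; simpl; split; [ring|rewrite g_1; ring].
  - intros n [H1 H2]; split; [exact H2|]; replace (n + 1 + 1)%Z with (n + 2)%Z by lia; exact (proj1 (step n) H1).
  - intros n [H1 H2]; split; [|exact H1]; apply (proj2 (step n)); replace (n + 2)%Z with (n + 1 + 1)%Z by lia; exact H2. }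
assert (G : forall w : C, w <> 0 -> Zsum (fun N => g N * zpow w N) = g 0%Z * Th r w).
{ intros w Hw; unfold Th; rewrite <- Zsum_scal by (now apply theta_term_summable).
  apply Zsum_ext; intros N; rewrite (proj1 (g_all N)); unfold theta_term; ring. }
assert (Hbs : forall y : C, y <> 0 ->
  Zsum (fun n => beta n * zpow y n) = (1 + y) * Zsum (fun n => b n * zpow y n)).
{ intros y Hy; pose proof (theta_partial_summable y Hy) as S.
  pose proof (abs_summable_scal y _ S) as Sy.
  replace ((1 + y) * Zsum (fun n => b n * zpow y n)) with
    (Zsum (fun n => b n * zpow y n) + y * Zsum (fun n => b n * zpow y n)) by ring.
  rewrite <- Zsum_scal, <- (Zsum_shift _ (-1) Sy), <- Zsum_plus
    by (try exact S; try exact (abs_summable_shift _ (-1) Sy)).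
  apply Zsum_ext; intros n; change (n + -1)%Z with (n - 1)%Z; unfold beta.
  rewrite zpow_sub, zpow_1_r by exact Hy; field; exact Hy. }
assert (V1 : 2 * (phi q * (phi q * phi q)) = g 0%Z * Th r 1).
{ destruct (L 1 C1_nz) as [_ [_ [S E]]].
  rewrite (G 1 C1_nz), Zsum_single in E.
  - rewrite <- E, <- theta_partial_sum.
    change (tri 0) with 0%Z; simpl zpow; rewrite !Cmult_1_l, Hbs by apply C1_nz.
    replace (1 + 1) with (RtoC 2) by (rewrite <- RtoC_plus; f_equal; ring).
    f_equal; apply Zsum_ext; intros n; rewrite zpow_1_l; fold b; ring.
  - intros k Hk; rewrite Cmult_1_l, Hbs, theta_partial_at_pow by (try apply zpow_neq_0; assumption); ring. }
destruct (L v Hv) as [_ [S2 [_ E]]]; rewrite (G v Hv) in E.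
pose proof (Th_opp_neq_0 v Hv Hp) as HT.
assert (E2 : forall j, zpow r j * zpow q (2 * tri j) * zpow v (2 * j) *
    Zsum (fun n => beta n * zpow (v * zpow q j) n) = Th q (- v) * appell_odd_term r v j).
{ intros j; unfold appell_odd_term, Cdiv.
  assert (Hy : v * zpow q j <> 0) by (apply Cmult_neq_0; [|apply zpow_neq_0]; assumption).
  replace (Th q (- v) * (zpow (- r) j * zpow q (tri j) * zpow v j * (1 + v * zpow q j) * / (1 - v * zpow q j))) with
    (Th q (- v) / (1 - v * zpow q j) * (zpow (- r) j * zpow q (tri j) * zpow v j * (1 + v * zpow q j)))
    by (unfold Cdiv; ring).
  rewrite Th_opp_shift, Hbs by auto.
  replace (2 * tri j)%Z with (tri j + tri j)%Z by lia; replace (2 * j)%Z with (j + j)%Z by lia.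
  rewrite !zpow_add, (zpow_Copp r), (zpow_Copp v) by assumption.
  assert (E1 : zpow (-(1)) j * zpow (-(1)) j = 1).
  { rewrite <- zpow_add by apply Copp_neq_0, C1_nz; replace (j + j)%Z with (2 * j)%Z by lia; apply zpow_m1_even. }
  set (m := zpow (-(1)) j) in *; set (Sb := Zsum _).
  transitivity (m * m * (zpow r j * (zpow q (tri j) * zpow q (tri j)) * (zpow v j * zpow v j) *
    ((1 + v * zpow q j) * Sb))); [rewrite E1; ring|ring]. }
assert (SA : abs_summable (appell_odd_term r v)).
{ apply abs_summable_ext with (2 := abs_summable_scal (/ Th q (- v)) _ S2).
  intros j; rewrite E2; field; exact HT. }
split; [exact SA|].
rewrite <- Zsum_scal by exact SA.
replace (Zsum (fun k => Th q (- v) * appell_odd_term r v k)) with (g 0%Z * Th r v).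
- rewrite V1; ring.
- rewrite <- E; apply Zsum_ext, E2.
Qed.

(** [Th_square] rewrites both theta series of base q^2 as products of base q with the same factor
    [k], so that only theta functions at tau itself remain. *)
Corollary appell_even_product (s v : C) :
  s * s = q -> v <> 0 -> (forall j, v * zpow q j <> 1) ->
  Th q (- v) * Zsum (appell_even_term v) * (Th q s * Th q (- s)) =
  phi q * (phi q * phi q) * (Th q (v * s) * Th q (- (v * s))).
Proof.
intros Hss Hv Hp.
assert (Hs : s <> 0) by (intros E; apply Hq; rewrite <- Hss, E; ring).
destruct (appell_even v Hv Hp) as [_ H].
pose proof (Th_square q s Hq Hq1 Hs) as E1; rewrite Hss in E1.
pose proof (Th_square q (v * s) Hq Hq1 (Cmult_neq_0 _ _ Hv Hs)) as E2.
replace (v * s * (v * s)) with (v * v * q) in E2 by (rewrite <- Hss; ring).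
assert (N1 : phi q <> 0) by (now apply phi_neq_0).
assert (N2 : phi (q * q) <> 0) by (apply phi_neq_0, Cmod_square_lt_1; assumption).
set (k := phi (q * q) / (phi q * phi q)).
assert (Nk : k <> 0) by (unfold k, Cdiv; apply Cmult_neq_0, Cinv_neq_0, Cmult_neq_0; assumption).
assert (F1 : Th (q * q) (- q) = k * (Th q s * Th q (- s))).
{ replace (Th (q * q) (- q)) with (Th (q * q) (- q) / phi (q * q) * phi (q * q)) by (field; exact N2).
  rewrite E1; unfold k; field; exact N1. }
assert (F2 : Th (q * q) (- (v * v * q)) = k * (Th q (v * s) * Th q (- (v * s)))).
{ replace (Th (q * q) (- (v * v * q))) with (Th (q * q) (- (v * v * q)) / phi (q * q) * phi (q * q))
    by (field; exact N2).
  rewrite E2; unfold k; field; exact N1. }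
rewrite F1, F2 in H; apply Cmult_cancel_l with k; [exact Nk|].
etransitivity; [|etransitivity; [exact H|]]; ring.
Qed.

(** Here [Th_split] does the same for the two theta series of base r. *)
Corollary appell_odd_product (r v : C) :
  r * r = q -> v <> 0 -> (forall j, v * zpow q j <> 1) ->
  Th q (- v) * Zsum (appell_odd_term r v) * (Th q 1 * Th q r) =
  2 * (phi q * (phi q * phi q)) * (Th q v * Th q (v * r)).
Proof.
intros Hrr Hv Hp.
assert (Hr : r <> 0) by (intros E; apply Hq; rewrite <- Hrr, E; ring).
assert (Hr1 : (Cmod r < 1)%R).
{ apply Rnot_le_lt; intros H1; rewrite <- Hrr, Cmod_mult in Hq1; nra. }
destruct (appell_odd r v Hrr Hv Hp) as [_ H].
pose proof (Th_split r 1 Hr Hr1 C1_nz) as E1; rewrite Hrr, Cmult_1_l in E1.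
pose proof (Th_split r v Hr Hr1 Hv) as E2; rewrite Hrr in E2.
assert (N1 : phi q <> 0) by (now apply phi_neq_0).
assert (N2 : phi r <> 0) by (now apply phi_neq_0).
set (k := phi r / (phi q * phi q)).
assert (Nk : k <> 0) by (unfold k, Cdiv; apply Cmult_neq_0, Cinv_neq_0, Cmult_neq_0; assumption).
assert (F1 : Th r 1 = k * (Th q 1 * Th q r)).
{ replace (Th r 1) with (Th r 1 / phi r * phi r) by (field; exact N2).
  rewrite E1; unfold k; field; exact N1. }
assert (F2 : Th r v = k * (Th q v * Th q (v * r))).
{ replace (Th r v) with (Th r v / phi r * phi r) by (field; exact N2).
  rewrite E2; unfold k; field; exact N1. }
rewrite F1, F2 in H; apply Cmult_cancel_l with k; [exact Nk|].
etransitivity; [|etransitivity; [exact H|]]; ring.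
Qed.

End AppellSums.

(** * Poisson summation for the Gaussian *)

Lemma Zsum_finite (u : Z -> C) (N : nat) :
  (forall k, (k < - Z.of_nat N \/ Z.of_nat N <= k)%Z -> u k = 0) ->
  abs_summable u /\ Zsum u = Csum (zfold u) N.
Proof.
intros H.
assert (E : forall K, Csum (zfold u) (N + K) = Csum (zfold u) N).
{ induction K as [|K IH]; [now rewrite Nat.add_0_r|].
  rewrite Nat.add_succ_r; cbn [Csum]; rewrite IH; unfold zfold at 2.
  rewrite (H (Z.of_nat (N + K))), (H (- Z.of_nat (S (N + K)))%Z) by lia; ring. }
assert (ER : forall K, Rsum (zfoldR (fun k => Cmod (u k))) (N + K) = Rsum (zfoldR (fun k => Cmod (u k))) N).
{ induction K as [|K IH]; [now rewrite Nat.add_0_r|].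
  rewrite Nat.add_succ_r; cbn [Rsum]; rewrite IH; unfold zfoldR at 2.
  rewrite (H (Z.of_nat (N + K))), (H (- Z.of_nat (S (N + K)))%Z), Cmod_0 by lia; ring. }
assert (S : abs_summable u).
{ split; [intros; apply Cmod_ge_0|]; exists (Rsum (zfoldR (fun k => Cmod (u k))) N); intros K.
  rewrite <- (ER K); apply Rsum_mono; [|lia]; apply zfoldR_pos; intros; apply Cmod_ge_0. }
split; [exact S|]; apply Zsum_eq; [exact S|].
intros eps Heps; exists N; intros K HK.
replace K with (N + (K - N))%nat by lia; rewrite E.
replace (Csum (zfold u) N - Csum (zfold u) N) with (RtoC 0) by ring; now rewrite Cmod_0.
Qed.

Lemma Csum_rev (u : nat -> C) (N : nat) : Csum (fun n => u (N - S n)%nat) N = Csum u N.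
Proof.
induction N as [|N IH]; [reflexivity|].
cbn [Csum]; rewrite <- IH.
assert (H : forall K w, Csum w (S K) = w 0%nat + Csum (fun n => w (S n)) K).
{ induction K as [|K IHK]; intros w; [simpl; ring|].
  change (Csum w (S (S K))) with (Csum w (S K) + w (S K)); rewrite IHK; simpl; ring. }
change (Csum (fun n => u (S N - S n)%nat) N + u (S N - S N)%nat) with
  (Csum (fun n => u (S N - S n)%nat) (S N)).
rewrite H; replace (S N - 1)%nat with N by lia; rewrite Cplus_comm; f_equal.
Qed.

Lemma Csum_add (u : nat -> C) (N K : nat) :
  Csum u (N + K) = Csum u N + Csum (fun n => u (N + n)%nat) K.
Proof. induction K as [|K IH]; [rewrite Nat.add_0_r; simpl; ring|rewrite Nat.add_succ_r; simpl; rewrite IH; ring]. Qed.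

Lemma Csum_swap (u : nat -> nat -> C) (N K : nat) :
  Csum (fun i => Csum (u i) K) N = Csum (fun n => Csum (fun i => u i n) N) K.
Proof.
induction K as [|K IH]; simpl.
- induction N as [|N IHN]; simpl; [reflexivity|rewrite IHN; ring].
- rewrite Csum_plus; now rewrite IH.
Qed.

(** The window of size lK meets each residue class modulo l in a window of size K of quotients. On
    the negative half the residues are traversed backwards, hence the reversal of the finite sum. *)
Lemma Csum_zfold_residues (u : Z -> C) (l K : nat) :
  Csum (zfold u) (l * K) =
  Csum (fun i => Csum (zfold (fun k => u (Z.of_nat l * k + Z.of_nat i)%Z)) K) l.
Proof.
rewrite Csum_swap; induction K as [|K IH]; [now rewrite Nat.mul_0_r|].
rewrite Nat.mul_succ_r, Csum_add, IH; cbn [Csum]; f_equal.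
unfold zfold; rewrite !Csum_plus; f_equal.
- apply Csum_ext; intros; f_equal; lia.
- rewrite <- Csum_rev; apply Csum_ext; intros n Hn; f_equal; lia.
Qed.

(* [cb m r] is the binomial coefficient (2m choose m+r) divided by 4^m. *)
Fixpoint cb (m : nat) (r : Z) : R :=
  match m with
  | O => if (r =? 0)%Z then 1%R else 0%R
  | S m' => ((cb m' (r - 1) + 2 * cb m' r + cb m' (r + 1)) / 4)%R
  end.

Lemma cb_pos m r : (0 <= cb m r)%R.
Proof.
revert r; induction m as [|m IH]; intros r; simpl; [destruct (r =? 0)%Z; lra|].
pose proof (IH (r - 1)%Z); pose proof (IH r); pose proof (IH (r + 1)%Z); lra.
Qed.

Lemma cb_opp m r : cb m (- r) = cb m r.
Proof.
revert r; induction m as [|m IH]; intros r; simpl.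
- destruct (Z.eqb_spec (- r) 0), (Z.eqb_spec r 0); try lia; reflexivity.
- replace (- r - 1)%Z with (- (r + 1))%Z by lia; replace (- r + 1)%Z with (- (r - 1))%Z by lia.
  rewrite !IH; lra.
Qed.

Lemma cb_support m r : (Z.of_nat m < Z.abs r)%Z -> cb m r = 0%R.
Proof.
revert r; induction m as [|m IH]; intros r Hr; cbn [cb].
- destruct (Z.eqb_spec r 0); [lia|reflexivity].
- rewrite !IH by lia; lra.
Qed.

(** The ratio of neighbouring binomial coefficients in product form, so that it also covers the
    range where they vanish. The induction uses the instances at r - 1, r and r + 1. *)
Lemma cb_ratio m r : ((INR m + IZR r + 1) * cb m (r + 1) = (INR m - IZR r) * cb m r)%R.
Proof.
revert r; induction m as [|m IH]; intros r; cbn [cb].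
- destruct (Z.eqb_spec (r + 1) 0), (Z.eqb_spec r 0); try lia; simpl.
  + replace r with (-1)%Z by lia; simpl; ring.
  + subst r; simpl; ring.
  + ring.
- rewrite S_INR.
  replace (r + 1 - 1)%Z with r by lia; replace (r + 1 + 1)%Z with (r + 2)%Z by lia.
  pose proof (IH (r + 1)%Z) as H1; pose proof (IH r) as H2; pose proof (IH (r - 1)%Z) as H3.
  replace (r + 1 + 1)%Z with (r + 2)%Z in H1 by lia; replace (r - 1 + 1)%Z with r in H3 by lia.
  rewrite plus_IZR in H1; rewrite minus_IZR in H3; nra.
Qed.

Lemma cb_step m (r : nat) :
  cb m (Z.of_nat r + 1) = (cb m (Z.of_nat r) * ((INR m - INR r) / (INR m + INR r + 1)))%R.
Proof.
pose proof (cb_ratio m (Z.of_nat r)) as E; rewrite <- INR_IZR_INZ in E.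
pose proof (pos_INR m); pose proof (pos_INR r).
apply Rmult_eq_reg_l with (INR m + INR r + 1)%R; [rewrite E; field|]; lra.
Qed.

Lemma cb_0_pos m : (0 < cb m 0)%R.
Proof.
induction m as [|m IH]; simpl; [lra|].
pose proof (cb_pos m (-1)); pose proof (cb_pos m 1); lra.
Qed.

(** Each ratio equals 1 - (2i+1)/(m+i+1), at most exp(-(2i+1)/(m+R0)), and the odd numbers add up to
    r^2. R0 = m yields the global Gaussian bound, R0 = r the sharp one for the limit. *)
Lemma cb_upper m (R0 r : nat) :
  (r <= R0)%nat -> (r <= m)%nat ->
  (cb m (Z.of_nat r) <= cb m 0 * exp (- (INR r ^ 2 / (INR m + INR R0))))%R.
Proof.
intros H1 H2; induction r as [|r IH].
- simpl; replace (- (0 * (0 * 1) / (INR m + INR R0)))%R with 0%R by (unfold Rdiv; ring); rewrite exp_0; lra.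
- specialize (IH ltac:(lia) ltac:(lia)).
  assert (P : (0 < INR m)%R) by (apply lt_0_INR; lia).
  pose proof (pos_INR r) as P1; assert (P2 : (INR r + 1 <= INR R0)%R) by (rewrite <- S_INR; apply le_INR; lia).
  assert (P3 : (INR r + 1 <= INR m)%R) by (rewrite <- S_INR; apply le_INR; lia).
  replace (Z.of_nat (S r)) with (Z.of_nat r + 1)%Z by lia.
  set (d := ((2 * INR r + 1) / (INR m + INR R0))%R).
  assert (F : (cb m (Z.of_nat r + 1) <= cb m (Z.of_nat r) * (1 - d))%R).
  { replace (cb m (Z.of_nat r + 1)) with (cb m (Z.of_nat r) * ((INR m - INR r) / (INR m + INR r + 1)))%R
      by (symmetry; apply cb_step).
    apply Rmult_le_compat_l; [apply cb_pos|].
    replace ((INR m - INR r) / (INR m + INR r + 1))%R with (1 - (2 * INR r + 1) / (INR m + INR r + 1))%R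
      by (field; lra).
    apply Rplus_le_compat_l, Ropp_le_contravar; unfold d, Rdiv.
    apply Rmult_le_compat_l; [lra|apply Rinv_le_contravar; lra]. }
  eapply Rle_trans; [exact F|].
  apply Rle_trans with (cb m (Z.of_nat r) * exp (- d))%R.
  { apply Rmult_le_compat_l; [apply cb_pos|]; pose proof (exp_ineq1_le (- d)); lra. }
  replace (- (INR (S r) ^ 2 / (INR m + INR R0)))%R with (- (INR r ^ 2 / (INR m + INR R0)) + - d)%R
    by (rewrite S_INR; unfold d; field; lra).
  rewrite exp_plus, <- Rmult_assoc; apply Rmult_le_compat_r; [apply Rlt_le, exp_pos|exact IH].
Qed.

(** The counterpart with 1/(1 + x) >= exp(-x), after writing each ratio as 1/(1 + (2i+1)/(m-i)). *)
Lemma cb_lower m (R0 r : nat) :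
  (r <= R0)%nat -> (R0 < m)%nat ->
  (cb m 0 * exp (- (INR r ^ 2 / (INR m - INR R0))) <= cb m (Z.of_nat r))%R.
Proof.
intros H1 H2; induction r as [|r IH].
- simpl; replace (- (0 * (0 * 1) / (INR m - INR R0)))%R with 0%R by (unfold Rdiv; ring); rewrite exp_0; lra.
- specialize (IH ltac:(lia)).
  assert (P : (INR R0 < INR m)%R) by (apply lt_INR; lia).
  pose proof (pos_INR r) as P1; assert (P2 : (INR r + 1 <= INR R0)%R) by (rewrite <- S_INR; apply le_INR; lia).
  replace (Z.of_nat (S r)) with (Z.of_nat r + 1)%Z by lia.
  set (d := ((2 * INR r + 1) / (INR m - INR R0))%R).
  assert (Pd : (0 <= d)%R) by (apply Rmult_le_pos; [lra|apply Rlt_le, Rinv_0_lt_compat; lra]).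
  assert (F : (cb m (Z.of_nat r) * exp (- d) <= cb m (Z.of_nat r + 1))%R).
  { replace (cb m (Z.of_nat r + 1)) with (cb m (Z.of_nat r) * ((INR m - INR r) / (INR m + INR r + 1)))%R
      by (symmetry; apply cb_step).
    apply Rmult_le_compat_l; [apply cb_pos|].
    replace ((INR m - INR r) / (INR m + INR r + 1))%R with (/ (1 + (2 * INR r + 1) / (INR m - INR r)))%R
      by (field; lra).
    rewrite exp_Ropp; apply Rinv_le_contravar.
    - assert (0 <= (2 * INR r + 1) / (INR m - INR r))%R; [|lra].
      apply Rmult_le_pos; [lra|apply Rlt_le, Rinv_0_lt_compat; lra].
    - eapply Rle_trans; [|apply exp_ineq1_le]; apply Rplus_le_compat_l; unfold d, Rdiv.
      apply Rmult_le_compat_l; [lra|apply Rinv_le_contravar; lra]. }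
  eapply Rle_trans; [|exact F].
  replace (- (INR (S r) ^ 2 / (INR m - INR R0)))%R with (- (INR r ^ 2 / (INR m - INR R0)) + - d)%R
    by (rewrite S_INR; unfold d; field; lra).
  rewrite exp_plus, <- Rmult_assoc; apply Rmult_le_compat_r; [apply Rlt_le, exp_pos|exact IH].
Qed.

Lemma cb_abs m r : cb m r = cb m (Z.of_nat (Z.abs_nat r)).
Proof.
destruct (Z.le_gt_cases 0 r); [f_equal; lia|rewrite <- cb_opp; f_equal; lia].
Qed.

Lemma cb_gauss_le m r :
  (0 < m)%nat -> (cb m r <= cb m 0 * exp (- (IZR r ^ 2 / (2 * INR m))))%R.
Proof.
intros Hm; pose proof (cb_0_pos m) as P0.
destruct (Z.le_gt_cases (Z.abs r) (Z.of_nat m)) as [L|L].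
- rewrite cb_abs; pose proof (cb_upper m m (Z.abs_nat r) ltac:(lia) ltac:(lia)) as H.
  replace (INR (Z.abs_nat r) ^ 2)%R with (IZR r ^ 2)%R in H
    by (rewrite INR_IZR_INZ, Zabs2Nat.id_abs, abs_IZR, pow2_abs; reflexivity).
  replace (INR m + INR m)%R with (2 * INR m)%R in H by ring; exact H.
- rewrite cb_support by lia; apply Rmult_le_pos; [lra|apply Rlt_le, exp_pos].
Qed.

Lemma cb_Laurent m (w : C) : w <> 0 ->
  abs_summable (fun r => cb m r * zpow w r) /\
  Zsum (fun r => cb m r * zpow w r) = ((2 + w + / w) / 4) ^ m.
Proof.
intros Hw; induction m as [|m [IH1 IH2]].
- destruct (Zsum_finite (fun r => cb 0 r * zpow w r) 1) as [S E].
  { intros k Hk; simpl; destruct (Z.eqb_spec k 0); [lia|ring]. }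
  split; [exact S|]; rewrite E; simpl; unfold zfold; simpl; ring.
- set (f := fun r => cb m r * zpow w r) in *.
  assert (E : forall r, cb (S m) r * zpow w r =
    / 4 * (w * f (r + -1)%Z + (2 * f r + / w * f (r + 1)%Z))).
  { intros r; unfold f; change (r + -1)%Z with (r - 1)%Z; cbn [cb].
    rewrite zpow_sub, zpow_succ, zpow_1_r by exact Hw.
    rewrite RtoC_div, !RtoC_plus, RtoC_mult by lra; field; exact Hw. }
  assert (S1 : abs_summable (fun r => w * f (r + -1)%Z))
    by (apply (abs_summable_scal w (fun r => f (r + -1)%Z)), abs_summable_shift, IH1).
  assert (S3 : abs_summable (fun r => / w * f (r + 1)%Z))
    by (apply (abs_summable_scal (/ w) (fun r => f (r + 1)%Z)), abs_summable_shift, IH1).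
  assert (S2 : abs_summable (fun r => 2 * f r)) by (apply abs_summable_scal, IH1).
  assert (S23 : abs_summable (fun r => 2 * f r + / w * f (r + 1)%Z)) by (now apply abs_summable_plus).
  assert (S123 : abs_summable (fun r => w * f (r + -1)%Z + (2 * f r + / w * f (r + 1)%Z)))
    by (now apply abs_summable_plus).
  split.
  + apply abs_summable_ext with (2 := abs_summable_scal (/ 4) _ S123); intros r; now rewrite E.
  + rewrite (Zsum_ext _ _ E), Zsum_scal, Zsum_plus, Zsum_plus by assumption.
    rewrite (Zsum_scal w (fun r => f (r + -1)%Z)), (Zsum_scal (/ w) (fun r => f (r + 1)%Z)),
      (Zsum_shift f (-1)), (Zsum_shift f 1), Zsum_scal, IH2
      by (try apply abs_summable_shift; exact IH1).
    rewrite Cpow_S; field; exact Hw.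
Qed.

Lemma Cexp_I (t : R) : Cexp (Ci * t) = RtoC (cos t) + Ci * RtoC (sin t).
Proof.
unfold Cexp, Ci, Cmult, Cplus, RtoC; simpl.
replace (0 * t - 1 * 0)%R with 0%R by ring; replace (0 * 0 + 1 * t)%R with t by ring.
rewrite exp_0; f_equal; ring.
Qed.

Lemma Ci2 : Ci * Ci = -(1).
Proof. unfold Ci, Cmult, RtoC, Copp; simpl; f_equal; ring. Qed.

Lemma cos_square_Cexp (t : R) :
  (2 + Cexp (2 * (Ci * t)) + / Cexp (2 * (Ci * t))) / 4 = RtoC (cos t ^ 2).
Proof.
rewrite <- Cexp_opp.
replace (2 * (Ci * t)) with (Ci * RtoC (2 * t)) by (rewrite RtoC_mult; ring).
replace (- (Ci * RtoC (2 * t))) with (Ci * RtoC (- (2 * t))) by (rewrite RtoC_opp; ring).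
rewrite !Cexp_I, cos_neg, sin_neg, cos_2a_cos, RtoC_opp, RtoC_minus, !RtoC_mult, RtoC_pow.
simpl; field; intros E; apply RtoC_inj in E; lra.
Qed.

Lemma Cexp_I_neq_1 (t : R) : (0 < t < 2 * PI)%R -> Cexp (Ci * t) <> 1.
Proof.
intros Ht; rewrite Cexp_I; intros E.
assert (E1 : cos t = 1%R).
{ apply (f_equal fst) in E; unfold Ci, Cmult, Cplus, RtoC in E; simpl in E; lra. }
pose proof (sin_gt_0 (t / 2) ltac:(lra) ltac:(lra)) as H.
replace t with (2 * (t / 2))%R in E1 by lra.
rewrite cos_2a_sin in E1; nra.
Qed.

Lemma root_of_unity_sum (z : C) (N : nat) :
  z <> 0 -> z <> 1 -> z ^ (2 * N) = 1 -> Csum (zfold (zpow z)) N = 0.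
Proof.
intros Hz H1 HN.
assert (E : forall K, (z - 1) * Csum (zfold (zpow z)) K = z ^ K - / z ^ K).
{ induction K as [|K IH].
  - simpl; field; apply C1_nz.
  - cbn [Csum]; unfold zfold at 2; rewrite Cmult_plus_distr_l, IH, zpow_of_nat, zpow_opp_of_nat, Cpow_S.
    field; split; [now apply Cpow_nz|exact Hz]. }
apply Cmult_cancel_l with (z - 1).
- intros E'; apply H1; replace z with (z - 1 + 1) by ring; rewrite E'; ring.
- rewrite E; replace (2 * N)%nat with (N + N)%nat in HN by lia; rewrite Cpow_add_r in HN.
  pose proof (Cpow_nz z N Hz) as Hp.
  replace (/ z ^ N) with (/ z ^ N * 1) by ring; rewrite <- HN; field; exact Hp.
Qed.

(* The binomial theorem summed over the (2N)-th roots of unity; its limit is Poisson's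
   formula for the Gaussian (Polya's proof), so that no Fourier analysis is needed. *)
Lemma polya_identity (m N : nat) (rho : Z) (a : R) : (0 < N)%nat ->
  Csum (zfold (fun k => RtoC ((cos (PI * (IZR k + a) / INR (2 * N)) ^ 2) ^ m) *
                        Cexp (- (2 * PI * Ci * IZR k * (IZR rho / INR (2 * N)))))) N =
  INR (2 * N) * Zsum (fun nu => cb m (rho + Z.of_nat (2 * N) * nu) *
      Cexp (2 * PI * Ci * a * (IZR nu + IZR rho / INR (2 * N)))).
Proof.
intros HN; set (l := (2 * N)%nat).
assert (Hl : INR l <> 0%R) by (apply not_0_INR; lia).
assert (HlC : RtoC (INR l) <> 0) by (intros E; apply RtoC_inj in E; contradiction).
(* Terms of the Laurent expansion of cos^(2m), reindexed by [rho] so that the dependence on k is the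
   pure character exp(2 pi i k r / l). *)
set (u := fun (k r : Z) => cb m (r + rho) * Cexp (2 * PI * Ci * a * (IZR (r + rho) / INR l)) *
                          Cexp (2 * PI * Ci * IZR k * (IZR r / INR l))).
assert (U : forall k, abs_summable (u k) /\
  RtoC ((cos (PI * (IZR k + a) / INR l) ^ 2) ^ m) * Cexp (- (2 * PI * Ci * IZR k * (IZR rho / INR l)))
  = Zsum (u k)).
{ intros k; set (t := (PI * (IZR k + a) / INR l)%R).
  destruct (cb_Laurent m (Cexp (2 * (Ci * t))) (Cexp_neq_0 _)) as [S E].
  rewrite cos_square_Cexp, <- RtoC_pow in E.
  assert (F : forall r, u k r = Cexp (- (2 * PI * Ci * IZR k * (IZR rho / INR l))) *
    (cb m (r + rho) * zpow (Cexp (2 * (Ci * t))) (r + rho))).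
  { intros r; unfold u; rewrite zpow_Cexp.
    replace (cb m (r + rho) * Cexp (2 * PI * Ci * a * (IZR (r + rho) / INR l)) *
             Cexp (2 * PI * Ci * IZR k * (IZR r / INR l))) with
      (cb m (r + rho) * (Cexp (2 * PI * Ci * a * (IZR (r + rho) / INR l)) *
             Cexp (2 * PI * Ci * IZR k * (IZR r / INR l)))) by ring.
    replace (Cexp (- (2 * PI * Ci * IZR k * (IZR rho / INR l))) *
      (cb m (r + rho) * Cexp (IZR (r + rho) * (2 * (Ci * t))))) with
      (cb m (r + rho) * (Cexp (- (2 * PI * Ci * IZR k * (IZR rho / INR l))) *
       Cexp (IZR (r + rho) * (2 * (Ci * t))))) by ring.
    rewrite <- !Cexp_plus; f_equal; f_equal; unfold t.
    rewrite RtoC_div, RtoC_mult, !plus_IZR, !RtoC_plus by exact Hl; field; exact HlC. }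
  pose proof (abs_summable_scal (Cexp (- (2 * PI * Ci * IZR k * (IZR rho / INR l)))) _
    (abs_summable_shift _ rho S)) as S'.
  split; [apply abs_summable_ext with (2 := S'); intros r; now rewrite F|].
  rewrite (Zsum_ext _ _ F), Zsum_scal, (Zsum_shift _ rho S), E by (exact (abs_summable_shift _ rho S)); ring. }
transitivity (Csum (fun n => Zsum (fun r => zfold (fun k => u k r) n)) N).
{ apply Csum_ext; intros n _; unfold zfold; rewrite Zsum_plus by apply U; now rewrite !(proj2 (U _)). }
rewrite <- (proj2 (Csum_Zsum (fun n r => zfold (fun k => u k r) n) N
  (fun n => abs_summable_plus _ _ (proj1 (U _)) (proj1 (U _))))).
set (g := fun r => cb m (r + rho) * Cexp (2 * PI * Ci * a * (IZR (r + rho) / INR l))).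
set (G := fun r => Csum (zfold (zpow (Cexp (2 * PI * Ci * (IZR r / INR l))))) N).
assert (E1 : forall r, Csum (fun n => zfold (fun k => u k r) n) N = g r * G r).
{ intros r; unfold G; rewrite <- Csum_scal; apply Csum_ext; intros n _; unfold zfold, u, g.
  rewrite !zpow_Cexp, Cmult_plus_distr_l; f_equal; f_equal; f_equal; ring. }
rewrite (Zsum_ext _ _ E1).
assert (HG : forall k i, G (Z.of_nat l * k + Z.of_nat i)%Z = G (Z.of_nat i)).
{ intros k i; unfold G; f_equal; f_equal; f_equal.
  rewrite plus_IZR, mult_IZR, <- INR_IZR_INZ, RtoC_plus, RtoC_mult.
  replace (2 * PI * Ci * ((INR l * IZR k + IZR (Z.of_nat i)) / INR l)) with
    (2 * PI * Ci * IZR k + 2 * PI * Ci * (IZR (Z.of_nat i) / INR l)) by (field; exact HlC).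
  rewrite Cexp_plus, Cexp_2PI_Z; ring. }
assert (G0 : G 0%Z = INR l).
{ unfold G; replace (2 * PI * Ci * (0 / INR l)) with (RtoC 0) by (field; exact HlC).
  rewrite Cexp_0.
  assert (Q : forall K, Csum (zfold (zpow 1)) K = INR (2 * K)).
  { induction K as [|K IHK]; [reflexivity|]; cbn [Csum]; rewrite IHK; unfold zfold; rewrite !zpow_1_l.
    replace (2 * S K)%nat with (S (S (2 * K))) by lia; rewrite !S_INR, !RtoC_plus; ring. }
  apply Q. }
assert (Gi : forall i, (0 < i < l)%nat -> G (Z.of_nat i) = 0).
{ intros i Hi; unfold G; apply root_of_unity_sum; [apply Cexp_neq_0| |].
  - replace (2 * PI * Ci * (IZR (Z.of_nat i) / INR l)) with
      (Ci * RtoC (2 * PI * (INR i / INR l)))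
      by (rewrite <- INR_IZR_INZ, !RtoC_mult, RtoC_div by exact Hl; ring).
    apply Cexp_I_neq_1; pose proof PI_RGT_0.
    assert (Pl : (0 < INR l)%R) by (apply lt_0_INR; lia).
    assert (P1 : (0 < INR i / INR l)%R) by (apply Rdiv_lt_0_compat; [apply lt_0_INR; lia|exact Pl]).
    assert (P2 : (INR i / INR l < 1)%R).
    { apply Rmult_lt_reg_r with (INR l); [exact Pl|]; unfold Rdiv; rewrite Rmult_assoc, Rinv_l, Rmult_1_r, Rmult_1_l by exact Hl.
      apply lt_INR; lia. }
    split; [apply Rmult_lt_0_compat; lra|].
    rewrite <- (Rmult_1_r (2 * PI)) at 2; apply Rmult_lt_compat_l; lra.
  - fold l; rewrite <- zpow_of_nat, zpow_Cexp, <- INR_IZR_INZ.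
    replace (INR l * (2 * PI * Ci * (IZR (Z.of_nat i) / INR l))) with (2 * PI * Ci * IZR (Z.of_nat i))
      by (field; exact HlC).
    apply Cexp_2PI_Z. }
(* The binomial coefficients vanish for |r + rho| > m, so a window of size K contains the support,
   and one of size l * K can be sorted into full residue classes. *)
set (K := (m + Z.abs_nat rho + 1)%nat).
assert (gsup : forall r, (Z.of_nat K <= Z.abs r)%Z -> g r = 0).
{ intros r Hr; unfold g; rewrite cb_support by lia; ring. }
destruct (Zsum_finite (fun r => g r * G r) (l * K)) as [_ ->].
{ intros k Hk; rewrite gsup by nia; ring. }
rewrite Csum_zfold_residues.
rewrite (Csum_ext _ (fun i => G (Z.of_nat i) * Csum (zfold (fun k => g (Z.of_nat l * k + Z.of_nat i)%Z)) K)).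
2:{ intros i _; rewrite <- Csum_scal; apply Csum_ext; intros n _; unfold zfold; rewrite !HG; ring. }
assert (R2 : forall w : nat -> C, (forall i, (0 < i < l)%nat -> w i = 0) -> Csum w l = w 0%nat).
{ intros w Hw; assert (Q : forall j, (S j <= l)%nat -> Csum w (S j) = w 0%nat).
  { induction j as [|j IHj]; intros Hj; [simpl; ring|].
    change (Csum w (S (S j))) with (Csum w (S j) + w (S j)); rewrite IHj, (Hw (S j)) by lia; ring. }
  replace l with (S (l - 1)) by lia; apply Q; lia. }
rewrite R2 by (intros i Hi; rewrite Gi by exact Hi; ring).
change (Z.of_nat 0) with 0%Z; rewrite G0; f_equal.
transitivity (Csum (zfold (fun nu => cb m (rho + Z.of_nat l * nu) *
      Cexp (2 * PI * Ci * a * (IZR nu + IZR rho / INR l)))) K).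
- apply Csum_ext; intros n _.
  assert (Q : forall nu, g (Z.of_nat l * nu + 0)%Z = cb m (rho + Z.of_nat l * nu) *
      Cexp (2 * PI * Ci * a * (IZR nu + IZR rho / INR l))).
  { intros nu; unfold g; rewrite Z.add_0_r, (Z.add_comm _ rho); f_equal; f_equal.
    rewrite plus_IZR, mult_IZR, <- INR_IZR_INZ, RtoC_plus, RtoC_mult; field; exact HlC. }
  unfold zfold; now rewrite !Q.
- symmetry; apply Zsum_finite; intros k Hk; rewrite cb_support by nia; ring.
Qed.

(** * The limit in Polya's identity *)

Lemma is_lim_seq_lt (u : nat -> R) (l c : R) :
  is_lim_seq u l -> (l < c)%R -> eventually (fun n => (u n < c)%R).
Proof.
intros H Hc; apply is_lim_seq_spec in H.
assert (P : (0 < c - l)%R) by lra.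
generalize (H (mkposreal _ P)); apply filter_imp; intros n Hn; simpl in Hn.
apply Rabs_def2 in Hn; lra.
Qed.

Lemma is_lim_seq_gt (u : nat -> R) (l c : R) :
  is_lim_seq u l -> (c < l)%R -> eventually (fun n => (c < u n)%R).
Proof.
intros H Hc; apply is_lim_seq_spec in H.
assert (P : (0 < l - c)%R) by lra.
generalize (H (mkposreal _ P)); apply filter_imp; intros n Hn; simpl in Hn.
apply Rabs_def2 in Hn; lra.
Qed.

Lemma is_lim_seq_p_infty_gt (u : nat -> R) (c : R) :
  is_lim_seq u p_infty -> eventually (fun n => (c < u n)%R).
Proof. intros H; apply is_lim_seq_spec in H; apply H. Qed.

Lemma is_lim_seq_inv_p_infty (u : nat -> R) :
  is_lim_seq u p_infty -> is_lim_seq (fun n => / u n)%R 0%R.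
Proof. intros H; apply (is_lim_seq_inv u p_infty H); discriminate. Qed.

Lemma eventually_ge_1 : eventually (fun m => (1 <= m)%nat).
Proof. now exists 1%nat. Qed.

Lemma tends_is_lim_seq (u : nat -> R) (l : R) :
  is_lim_seq u l -> tends eventually (fun n => RtoC (u n)) (RtoC l).
Proof. intros H; apply tends_RtoC; [apply eventually_filter|exact H]. Qed.

Lemma sin_square_bounds (y : R) :
  (y ^ 2 <= 6)%R -> (y ^ 2 * (1 - y ^ 2 / 6) ^ 2 <= sin y ^ 2 <= y ^ 2)%R.
Proof.
assert (P : forall y, (0 <= y)%R -> (y ^ 2 <= 6)%R -> (y ^ 2 * (1 - y ^ 2 / 6) ^ 2 <= sin y ^ 2 <= y ^ 2)%R).
{ clear y; intros y H0 H; pose proof PI_RGT_0 as HP; pose proof PI2_3_2 as HP2.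
  assert (Hy : (y <= PI)%R) by nra.
  destruct (sin_bound y 0 H0 Hy) as [B1 _]; unfold sin_approx in B1; simpl in B1.
  unfold sin_term in B1; simpl in B1.
  assert (B2 : (y * (1 - y ^ 2 / 6) <= sin y)%R).
  { eapply Rle_trans; [|exact B1]; right; field. }
  assert (B3 : (sin y <= y)%R).
  { destruct H0 as [H0| <-]; [apply Rlt_le, sin_lt_x, H0|rewrite sin_0; lra]. }
  assert (B4 : (0 <= y * (1 - y ^ 2 / 6))%R) by (apply Rmult_le_pos; lra).
  split; [|apply pow_incr; lra].
  replace (y ^ 2 * (1 - y ^ 2 / 6) ^ 2)%R with ((y * (1 - y ^ 2 / 6)) ^ 2)%R by ring.
  apply pow_incr; lra. }
intros H; destruct (Rle_lt_dec 0 y) as [H0|H0]; [now apply P|].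
pose proof (P (- y)%R ltac:(lra)) as Q; rewrite sin_neg in Q.
replace ((- y) ^ 2)%R with (y ^ 2)%R in Q by ring.
replace ((- sin y) ^ 2)%R with (sin y ^ 2)%R in Q by ring; now apply Q.
Qed.

Lemma pow_one_minus_le (t : R) (m : nat) : (0 <= t <= 1)%R -> ((1 - t) ^ m <= exp (- (INR m * t)))%R.
Proof.
intros Ht; replace (- (INR m * t))%R with (INR m * - t)%R by ring.
induction m as [|m IH]; [simpl; rewrite Rmult_0_l, exp_0; lra|].
rewrite S_INR, Rmult_plus_distr_r, exp_plus, Rmult_1_l; cbn [pow]; rewrite Rmult_comm.
apply Rmult_le_compat; [apply pow_le; lra|lra|exact IH|].
pose proof (exp_ineq1_le (- t)); lra.
Qed.

Lemma pow_one_minus_ge (t : R) (m : nat) :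
  (0 <= t < 1)%R -> (exp (- (INR m * t / (1 - t))) <= (1 - t) ^ m)%R.
Proof.
intros Ht; induction m as [|m IH]; [simpl; unfold Rdiv; rewrite !Rmult_0_l, Ropp_0, exp_0; lra|].
replace (- (INR (S m) * t / (1 - t)))%R with (- (t / (1 - t)) + - (INR m * t / (1 - t)))%R
  by (rewrite S_INR; field; lra).
rewrite exp_plus; cbn [pow]; apply Rmult_le_compat; try (apply Rlt_le, exp_pos); [|exact IH].
rewrite exp_Ropp; apply Rle_trans with (/ / (1 - t))%R; [|rewrite Rinv_inv; lra].
apply Rinv_le_contravar; [apply Rinv_0_lt_compat; lra|].
apply Rle_trans with (1 + t / (1 - t))%R; [right; field; lra|apply exp_ineq1_le].
Qed.

Section PoissonSetup.

Context (T : R) (HT : (0 < T)%R).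

(** With a period P asymptotic to sqrt(pi m/T), cos^(2m)(pi x/P) tends to exp(-pi T x^2).
    [half_period] rounds so that P is an even integer, at most 2 above the scale, which does not
    affect the limit. *)
Definition scale (m : nat) : R := sqrt (PI * INR m / T).
Definition half_period (m : nat) : nat := Z.to_nat (up (scale m / 2)).
Definition period (m : nat) : R := INR (2 * half_period m).

Lemma scale_pos m : (0 <= scale m)%R.
Proof. apply sqrt_pos. Qed.

Lemma half_period_spec m : (0 < half_period m)%nat /\ (scale m < period m <= scale m + 2)%R.
Proof.
pose proof (scale_pos m) as H0; destruct (archimed (scale m / 2)) as [A1 A2].
assert (Hu : (0 < up (scale m / 2))%Z) by (apply lt_IZR; lra).
assert (E : INR (half_period m) = IZR (up (scale m / 2))).
{ unfold half_period; rewrite INR_IZR_INZ, Z2Nat.id by lia; reflexivity. }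
split; [unfold half_period; lia|].
unfold period; rewrite mult_INR, E; simpl; lra.
Qed.

Lemma period_pos m : (0 < period m)%R.
Proof. pose proof (scale_pos m); destruct (half_period_spec m); lra. Qed.

Lemma scale_lim : is_lim_seq scale p_infty.
Proof.
apply is_lim_seq_spec; intros M; pose proof PI_RGT_0 as HP.
assert (H : is_lim_seq (fun m => (PI / T * INR m)%R) p_infty).
{ evar_last; [apply is_lim_seq_scal_l, is_lim_seq_INR|].
  simpl; assert (0 < PI / T)%R by (apply Rdiv_lt_0_compat; assumption).
  destruct (Rle_dec 0 (PI / T)) as [L|L]; [|lra].
  destruct (Rle_lt_or_eq_dec 0 (PI / T) L); [reflexivity|lra]. }
generalize (is_lim_seq_p_infty_gt _ (M ^ 2)%R H); apply filter_imp; intros m Hm.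
unfold scale; replace (PI * INR m / T)%R with (PI / T * INR m)%R by (field; lra).
apply Rle_lt_trans with (sqrt (M ^ 2)); [|apply sqrt_lt_1; [apply pow2_ge_0|pose proof (pow2_ge_0 M); lra|exact Hm]].
replace (M ^ 2)%R with (Rsqr M) by (unfold Rsqr; ring); rewrite sqrt_Rsqr_abs; apply Rle_abs.
Qed.

Lemma period_lim : is_lim_seq period p_infty.
Proof.
apply is_lim_seq_le_p_loc with scale; [|exact scale_lim].
apply filter_forall; intros m; destruct (half_period_spec m); lra.
Qed.

Lemma inv_period_lim : is_lim_seq (fun m => / period m)%R 0%R.
Proof. apply is_lim_seq_inv_p_infty, period_lim. Qed.

Lemma period_ratio_lim : is_lim_seq (fun m => (period m / scale m)%R) 1%R.
Proof.
apply is_lim_seq_le_le_loc with (fun _ => 1%R) (fun m => (1 + 2 * / scale m)%R).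
- generalize (is_lim_seq_p_infty_gt _ 0%R scale_lim); apply filter_imp; intros m Hm.
  destruct (half_period_spec m) as [_ H].
  split; apply Rmult_le_reg_r with (scale m); try exact Hm; unfold Rdiv.
  + rewrite Rmult_assoc, Rinv_l; lra.
  + rewrite Rmult_assoc, Rinv_l, Rmult_plus_distr_r, (Rmult_assoc 2), Rinv_l; lra.
- apply is_lim_seq_const.
- evar_last; [apply is_lim_seq_plus'; [apply is_lim_seq_const|]|].
  + apply (is_lim_seq_scal_l _ 2 0%R), is_lim_seq_inv_p_infty, scale_lim.
  + simpl; f_equal; ring.
Qed.

Lemma period_sq_lim : is_lim_seq (fun m => (period m ^ 2 / INR m)%R) (PI / T)%R.
Proof.
pose proof PI_RGT_0 as HP.
apply is_lim_seq_ext_loc with (fun m => (PI / T * ((period m / scale m) * (period m / scale m)))%R).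
- exists 1%nat; intros m Hm.
  assert (Pm : (0 < INR m)%R) by (apply lt_0_INR; lia).
  assert (E : (scale m * scale m = PI * INR m / T)%R).
  { apply sqrt_sqrt; apply Rlt_le, Rdiv_lt_0_compat; [apply Rmult_lt_0_compat|]; assumption. }
  assert (Ps : scale m <> 0%R).
  { intros E0; rewrite E0, Rmult_0_l in E.
    assert (0 < PI * INR m / T)%R by (apply Rdiv_lt_0_compat; [apply Rmult_lt_0_compat|]; assumption); lra. }
  replace (PI / T)%R with (scale m * scale m / INR m)%R by (rewrite E; field; lra).
  field; split; [lra|exact Ps].
- evar_last; [apply (is_lim_seq_scal_l _ (PI / T) (1 * 1)%R), is_lim_seq_mult'; apply period_ratio_lim|].
  simpl; f_equal; ring.
Qed.

Lemma inv_period_sq_lim : is_lim_seq (fun m => (INR m / period m ^ 2)%R) (T / PI)%R.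
Proof.
pose proof PI_RGT_0 as HP.
apply is_lim_seq_ext_loc with (fun m => / (period m ^ 2 / INR m))%R.
- exists 1%nat; intros m Hm; assert (Pm : (0 < INR m)%R) by (apply lt_0_INR; lia).
  pose proof (period_pos m); field; split; lra.
- evar_last; [apply is_lim_seq_inv; [exact period_sq_lim|]|].
  + intros E; injection E as E; assert (0 < PI / T)%R by (apply Rdiv_lt_0_compat; assumption); lra.
  + simpl; f_equal; field; split; lra.
Qed.

Lemma half_period_eventually (k : Z) :
  eventually (fun m => (- Z.of_nat (half_period m) <= k < Z.of_nat (half_period m))%Z).
Proof.
generalize (is_lim_seq_p_infty_gt _ (2 * (Rabs (IZR k) + 1))%R period_lim); apply filter_imp; intros m Hm.
unfold period in Hm; rewrite mult_INR in Hm; simpl (INR 2) in Hm; rewrite INR_IZR_INZ, <- abs_IZR in Hm.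
assert (H : (IZR (Z.abs k) < IZR (Z.of_nat (half_period m)))%R) by lra.
apply lt_IZR in H; lia.
Qed.

Section Shifts.

Context (a b : R).

(** An integer whose ratio to the period tends to b; through it the integral shift of
    [polya_identity] produces an arbitrary real b. *)
Definition shift_index (m : nat) : Z := up (b * period m).

Lemma shift_index_lim : is_lim_seq (fun m => (IZR (shift_index m) / period m)%R) b.
Proof.
apply is_lim_seq_le_le with (fun _ => b) (fun m => (b + / period m)%R).
- intros m; pose proof (period_pos m) as P; destruct (archimed (b * period m)) as [A1 A2].
  unfold shift_index; split; apply Rmult_le_reg_r with (period m); try exact P; unfold Rdiv.
  + rewrite Rmult_assoc, Rinv_l; lra.
  + rewrite Rmult_assoc, Rinv_l, Rmult_plus_distr_r, Rinv_l; lra.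
- apply is_lim_seq_const.
- evar_last; [apply is_lim_seq_plus'; [apply is_lim_seq_const|apply inv_period_lim]|].
  simpl; f_equal; ring.
Qed.

Definition left_term (m : nat) (k : Z) : C :=
  RtoC ((cos (PI * (IZR k + a) / period m) ^ 2) ^ m) *
  Cexp (- (2 * PI * Ci * IZR k * (IZR (shift_index m) / period m))).

Definition right_term (m : nat) (nu : Z) : C :=
  RtoC (cb m (shift_index m + Z.of_nat (2 * half_period m) * nu) / cb m 0) *
  Cexp (2 * PI * Ci * a * (IZR nu + IZR (shift_index m) / period m)).

(** With s = sin^2 y, the power (1 - s)^m lies between exp(-m s/(1 - s)) and exp(-m s), and m s has
    the limit (T/pi) c^2. *)
Lemma cos_pow_lim (c : R) :
  is_lim_seq (fun m => ((cos (c / period m) ^ 2) ^ m)%R) (exp (- (T / PI * c ^ 2))).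
Proof.
set (y := fun m => (c / period m)%R).
assert (Ly : is_lim_seq y 0%R).
{ evar_last; [apply (is_lim_seq_scal_l _ c 0%R), inv_period_lim|simpl; f_equal; ring]. }
assert (Ly2 : is_lim_seq (fun m => (y m ^ 2)%R) 0%R).
{ apply is_lim_seq_ext with (fun m => (y m * y m)%R); [intros; ring|].
  evar_last; [apply is_lim_seq_mult'; exact Ly|simpl; f_equal; ring]. }
assert (Lm : is_lim_seq (fun m => (INR m * y m ^ 2)%R) (T / PI * c ^ 2)%R).
{ apply is_lim_seq_ext with (fun m => (c ^ 2 * (INR m / period m ^ 2))%R).
  - intros m; unfold y; pose proof (period_pos m); field; lra.
  - evar_last; [apply (is_lim_seq_scal_l _ (c ^ 2) (T / PI)%R), inv_period_sq_lim|simpl; f_equal; ring]. }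
assert (Lt : is_lim_seq (fun m => (INR m * sin (y m) ^ 2)%R) (T / PI * c ^ 2)%R).
{ apply is_lim_seq_le_le_loc with
    (fun m => ((INR m * y m ^ 2) * ((1 - y m ^ 2 / 6) * (1 - y m ^ 2 / 6)))%R) (fun m => (INR m * y m ^ 2)%R).
  - generalize (is_lim_seq_lt _ _ 6 Ly2 ltac:(lra)); apply filter_imp; intros m Hm.
    destruct (sin_square_bounds (y m)) as [B1 B2]; [lra|].
    pose proof (pos_INR m); split; [|apply Rmult_le_compat_l; assumption].
    replace (INR m * y m ^ 2 * ((1 - y m ^ 2 / 6) * (1 - y m ^ 2 / 6)))%R with
      (INR m * (y m ^ 2 * (1 - y m ^ 2 / 6) ^ 2))%R by ring.
    apply Rmult_le_compat_l; assumption.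
  - assert (L1 : is_lim_seq (fun m => (1 - y m ^ 2 / 6)%R) 1%R).
    { apply is_lim_seq_ext with (fun m => (1 - / 6 * (y m ^ 2))%R); [intros; field|].
      evar_last; [apply is_lim_seq_minus'; [apply is_lim_seq_const|apply (is_lim_seq_scal_l _ (/ 6) 0%R), Ly2]|].
      simpl; f_equal; ring. }
    evar_last; [apply is_lim_seq_mult'; [exact Lm|apply is_lim_seq_mult'; exact L1]|simpl; f_equal; ring].
  - exact Lm. }
assert (Ls : is_lim_seq (fun m => (sin (y m) ^ 2)%R) 0%R).
{ apply is_lim_seq_le_le_loc with (fun _ => 0%R) (fun m => (y m ^ 2)%R);
    [|apply is_lim_seq_const|exact Ly2].
  generalize (is_lim_seq_lt _ _ 6 Ly2 ltac:(lra)); apply filter_imp; intros m Hm.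
  split; [apply pow2_ge_0|apply sin_square_bounds; lra]. }
assert (Ec : forall z, (cos z ^ 2 = 1 - sin z ^ 2)%R).
{ intros z; pose proof (sin2_cos2 z) as E; unfold Rsqr in E; lra. }
assert (Lexp : forall w, is_lim_seq w (T / PI * c ^ 2)%R ->
   is_lim_seq (fun m => exp (- w m)) (exp (- (T / PI * c ^ 2)))).
{ intros w Hw; apply is_lim_seq_continuous with (f := fun z => exp (- z)); [|exact Hw].
  apply derivable_continuous_pt.
  apply derivable_pt_comp with (f1 := Ropp) (f2 := exp);
    [apply derivable_pt_opp, derivable_pt_id|apply derivable_pt_exp]. }
apply is_lim_seq_le_le_loc with
  (fun m => exp (- (INR m * sin (y m) ^ 2 / (1 - sin (y m) ^ 2)))) (fun m => exp (- (INR m * sin (y m) ^ 2))).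
- generalize (is_lim_seq_lt _ _ 1 Ls ltac:(lra)); apply filter_imp; intros m Hm.
  pose proof (pow2_ge_0 (sin (y m))) as H0; fold (y m); rewrite Ec; split.
  + apply pow_one_minus_ge; lra.
  + apply pow_one_minus_le; lra.
- apply Lexp.
  assert (L1 : is_lim_seq (fun m => (1 - sin (y m) ^ 2)%R) 1%R).
  { evar_last; [apply is_lim_seq_minus'; [apply is_lim_seq_const|exact Ls]|simpl; f_equal; ring]. }
  evar_last; [apply is_lim_seq_div'; [exact Lt|exact L1|lra]|simpl; f_equal; field; apply PI_neq0].
- apply Lexp, Lt.
Qed.

Lemma tends_phase (c d : C) (u : nat -> R) (l : R) :
  is_lim_seq u l -> tends eventually (fun m => Cexp (c * (d + RtoC (u m)))) (Cexp (c * (d + RtoC l))).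
Proof.
intros H; apply tends_Cexp; [apply eventually_filter|].
apply tends_scal; [apply eventually_filter|].
apply tends_plus; [apply eventually_filter|apply tends_const, eventually_filter|now apply tends_is_lim_seq].
Qed.

Lemma RtoC_div_period (x : R) m : RtoC x / RtoC (period m) = RtoC (x / period m).
Proof. pose proof (period_pos m); rewrite RtoC_div by lra; reflexivity. Qed.

Definition poisson_left (k : Z) : C := Cexp (- (PI * T * (IZR k + a) ^ 2) - 2 * PI * Ci * IZR k * b).
Definition poisson_right (nu : Z) : C := Cexp (- (PI * (IZR nu + b) ^ 2 / T) + 2 * PI * Ci * a * (IZR nu + b)).

Lemma left_term_lim k : tends eventually (fun m => left_term m k) (poisson_left k).
Proof.
unfold left_term, poisson_left.
replace (- (PI * T * (IZR k + a) ^ 2) - 2 * PI * Ci * IZR k * b) with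
  (RtoC (- (T / PI * (PI * (IZR k + a)) ^ 2)) + (- (2 * PI * Ci * IZR k)) * (0 + RtoC b)).
- rewrite Cexp_plus, Cexp_R; apply tends_mult; [apply eventually_filter| |].
  + apply tends_is_lim_seq, cos_pow_lim.
  + apply tends_ext with
      (fun m => Cexp (- (2 * PI * Ci * IZR k) * (0 + RtoC (IZR (shift_index m) / period m)))).
    * apply eventually_filter.
    * intros m; f_equal; rewrite RtoC_div_period; ring.
    * apply tends_phase, shift_index_lim.
- rewrite RtoC_opp, RtoC_mult, RtoC_div, RtoC_pow, RtoC_mult, RtoC_plus by apply PI_neq0.
  field; intros E; apply RtoC_inj in E; exact (PI_neq0 E).
Qed.

(** A local central limit theorem: the binomial coefficient at distance r from the centre is
    squeezed between exp(-r^2/(m - |r|)) and exp(-r^2/(m + |r|)) times the central one. *)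
Lemma right_term_lim nu : tends eventually (fun m => right_term m nu) (poisson_right nu).
Proof.
pose proof PI_RGT_0 as HP.
unfold right_term, poisson_right; rewrite Cexp_plus.
apply tends_mult; [apply eventually_filter| |].
2:{ apply tends_ext with
      (fun m => Cexp (2 * PI * Ci * a * (IZR nu + RtoC (IZR (shift_index m) / period m)))).
    - apply eventually_filter.
    - intros m; f_equal; rewrite RtoC_div_period; ring.
    - apply tends_phase, shift_index_lim. }
replace (- (PI * (IZR nu + b) ^ 2 / T)) with (RtoC (- (PI / T * (IZR nu + b) ^ 2))).
2:{ rewrite RtoC_opp, RtoC_mult, RtoC_div, RtoC_pow, RtoC_plus by lra; field.
    intros E; apply RtoC_inj in E; lra. }
rewrite Cexp_R; apply tends_is_lim_seq.
set (s := fun m => (IZR nu + IZR (shift_index m) / period m)%R).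
set (r := fun m => (shift_index m + Z.of_nat (2 * half_period m) * nu)%Z).
assert (Er : forall m, IZR (r m) = (period m * s m)%R).
{ intros m; unfold r, s; rewrite plus_IZR, mult_IZR, <- INR_IZR_INZ; fold (period m).
  pose proof (period_pos m); field; lra. }
assert (Ls : is_lim_seq s (IZR nu + b)%R)
  by (apply is_lim_seq_plus'; [apply is_lim_seq_const|apply shift_index_lim]).
assert (Lr2 : is_lim_seq (fun m => (IZR (r m) ^ 2 / INR m)%R) (PI / T * (IZR nu + b) ^ 2)%R).
{ apply is_lim_seq_ext with (fun m => (period m ^ 2 / INR m * (s m * s m))%R).
  - intros m; rewrite Er; unfold Rdiv; ring.
  - evar_last; [apply is_lim_seq_mult'; [apply period_sq_lim|apply is_lim_seq_mult'; exact Ls]|].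
    simpl; f_equal; ring. }
(* The distance r grows only like the square root of m, so both denominators m - |r| and m + |r| are
   asymptotic to m. *)
assert (Lr1 : is_lim_seq (fun m => (Rabs (IZR (r m)) / INR m)%R) 0%R).
{ apply is_lim_seq_ext with (fun m => (period m ^ 2 / INR m * (/ period m * Rabs (s m)))%R).
  - intros m; rewrite Er, Rabs_mult; pose proof (period_pos m); rewrite (Rabs_pos_eq (period m)) by lra.
    unfold Rdiv; replace (period m ^ 2)%R with (period m * period m)%R by ring.
    replace (period m * period m * / INR m * (/ period m * Rabs (s m)))%R with
      (period m * / period m * (period m * / INR m * Rabs (s m)))%R by ring.
    rewrite Rinv_r by lra; ring.
  - evar_last; [apply is_lim_seq_mult'; [apply period_sq_lim|apply is_lim_seq_mult';
      [apply inv_period_lim|apply (is_lim_seq_abs s (IZR nu + b)%R), Ls]]|].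
    simpl; f_equal; ring. }
assert (Lexp : forall w, is_lim_seq w (PI / T * (IZR nu + b) ^ 2)%R ->
   is_lim_seq (fun m => exp (- w m)) (exp (- (PI / T * (IZR nu + b) ^ 2)))).
{ intros w Hw; apply is_lim_seq_continuous with (f := fun z => exp (- z)); [|exact Hw].
  apply derivable_continuous_pt.
  apply derivable_pt_comp with (f1 := Ropp) (f2 := exp);
    [apply derivable_pt_opp, derivable_pt_id|apply derivable_pt_exp]. }
apply is_lim_seq_le_le_loc with
  (fun m => exp (- (IZR (r m) ^ 2 / INR m / (1 - Rabs (IZR (r m)) / INR m))))
  (fun m => exp (- (IZR (r m) ^ 2 / INR m / (1 + Rabs (IZR (r m)) / INR m)))).
- pose proof (is_lim_seq_lt _ 0 1 Lr1 Rlt_0_1) as Er1.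
  generalize (filter_and _ _ Er1 eventually_ge_1).
  apply filter_imp; intros m [H1 Hm].
  assert (Pm : (0 < INR m)%R) by (apply lt_0_INR; lia).
  set (n := Z.abs_nat (r m)).
  assert (En : Rabs (IZR (r m)) = INR n) by (unfold n; rewrite INR_IZR_INZ, Zabs2Nat.id_abs, abs_IZR; reflexivity).
  assert (En2 : (IZR (r m) ^ 2 = INR n ^ 2)%R) by (rewrite <- En, pow2_abs; reflexivity).
  rewrite En in *; rewrite En2.
  assert (Hlt : (INR n < INR m)%R).
  { apply Rmult_lt_reg_r with (/ INR m)%R; [apply Rinv_0_lt_compat, Pm|].
    rewrite Rinv_r by lra; exact H1. }
  assert (Hn : (n < m)%nat) by (now apply INR_lt).
  fold (r m); rewrite (cb_abs m (r m)); fold n; pose proof (cb_0_pos m) as Pc.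
  pose proof (cb_upper m n n (Nat.le_refl _) ltac:(lia)) as U.
  pose proof (cb_lower m n n (Nat.le_refl _) Hn) as L; pose proof (pos_INR n).
  replace (INR n ^ 2 / INR m / (1 - INR n / INR m))%R with (INR n ^ 2 / (INR m - INR n))%R by (field; lra).
  replace (INR n ^ 2 / INR m / (1 + INR n / INR m))%R with (INR n ^ 2 / (INR m + INR n))%R by (field; lra).
  split; apply Rmult_le_reg_r with (cb m 0); try exact Pc; unfold Rdiv; rewrite (Rmult_assoc (cb m _)), Rinv_l by lra;
  unfold Rdiv in U, L; lra.
- apply Lexp.
  assert (L1 : is_lim_seq (fun m => (1 - Rabs (IZR (r m)) / INR m)%R) 1%R).
  { evar_last; [apply is_lim_seq_minus'; [apply is_lim_seq_const|exact Lr1]|simpl; f_equal; ring]. }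
  evar_last; [apply is_lim_seq_div'; [exact Lr2|exact L1|lra]|simpl; f_equal; field; lra].
- apply Lexp.
  assert (L1 : is_lim_seq (fun m => (1 + Rabs (IZR (r m)) / INR m)%R) 1%R).
  { evar_last; [apply is_lim_seq_plus'; [apply is_lim_seq_const|exact Lr1]|simpl; f_equal; ring]. }
  evar_last; [apply is_lim_seq_div'; [exact Lr2|exact L1|lra]|simpl; f_equal; field; lra].
Qed.

Lemma Cmod_Cexp_I (t : R) : Cmod (Cexp (Ci * t)) = 1%R.
Proof.
rewrite Cmod_Cexp; replace (Re (Ci * t)) with 0%R; [apply exp_0|].
unfold Ci, RtoC, Cmult; simpl; ring.
Qed.

Lemma left_sum_lim :
  tends eventually (fun m => Csum (zfold (left_term m)) (half_period m)) (Zsum poisson_left).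
Proof.
pose proof PI_RGT_0 as HP; pose proof PI_4 as HP4.
(* Extending the terms by 0 outside the growing window turns the finite sums into bilateral series,
   to which dominated convergence applies. *)
set (u := fun m k => if ((- Z.of_nat (half_period m) <=? k)%Z && (k <? Z.of_nat (half_period m))%Z)%bool
                     then left_term m k else 0).
apply tends_ext with (fun m => Zsum (u m)).
{ apply eventually_filter. }
{ intros m; destruct (Zsum_finite (u m) (half_period m)) as [_ ->].
  - intros k Hk; unfold u; destruct (Z.leb_spec (- Z.of_nat (half_period m)) k),
      (Z.ltb_spec k (Z.of_nat (half_period m))); simpl; try lia; reflexivity.
  - apply Csum_ext; intros n Hn; unfold zfold, u; f_equal;
    match goal with |- (if (?x && ?y)%bool then _ else _) = _ => replace (x && y)%bool with true; [reflexivity|] end;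
    symmetry; apply andb_true_intro; split; try apply Z.leb_le; try apply Z.ltb_lt; lia. }
(* In the window |y| <= pi/2 + 4/10 <= 24/10, so y^2/6 <= 96/100 and (1 - y^2/6)^2 >= 16/10000. The
   factor T/2 stands for T because m/P^2 is only eventually above T/(2 pi). *)
set (al := (16 / 10000 * (PI * T / 2))%R).
assert (Hal : (0 < al)%R) by (unfold al; nra).
apply (Zsum_dominated eventually) with (1 := summable_gauss 1 al (2 * al * Rabs a) Rle_0_1 Hal).
- assert (Ea : eventually (fun m => (PI * Rabs a * / period m < 4 / 10)%R)).
  { apply is_lim_seq_lt with 0%R; [|lra].
    evar_last; [apply (is_lim_seq_scal_l _ (PI * Rabs a) 0%R), inv_period_lim|simpl; f_equal; ring]. }
  assert (Em : eventually (fun m => (T / PI / 2 < INR m / period m ^ 2)%R)).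
  { apply is_lim_seq_gt with (T / PI)%R; [apply inv_period_sq_lim|].
    assert (0 < T / PI)%R by (apply Rdiv_lt_0_compat; assumption); lra. }
  generalize (filter_and _ _ Ea Em); apply filter_imp; intros m [H1 H2] k; unfold u.
  destruct (Z.leb_spec (- Z.of_nat (half_period m)) k), (Z.ltb_spec k (Z.of_nat (half_period m)));
    simpl; try (rewrite Cmod_0, Rmult_1_l; apply Rlt_le, exp_pos).
  pose proof (period_pos m) as Pp.
  unfold left_term; rewrite Cmod_mult.
  replace (- (2 * PI * Ci * IZR k * (IZR (shift_index m) / period m))) with
    (Ci * RtoC (- (2 * PI * IZR k * (IZR (shift_index m) / period m)))).
  2:{ rewrite RtoC_opp, !RtoC_mult, <- RtoC_div_period; ring. }
  rewrite Cmod_Cexp_I, Rmult_1_r, Rmult_1_l, Cmod_R.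
  set (y := (PI * (IZR k + a) / period m)%R).
  assert (Hk : (Rabs (IZR k) <= period m / 2)%R).
  { unfold period; rewrite mult_INR; simpl (INR 2); rewrite INR_IZR_INZ, <- abs_IZR.
    replace ((1 + 1) * IZR (Z.of_nat (half_period m)) / 2)%R with (IZR (Z.of_nat (half_period m))) by field.
    apply IZR_le; lia. }
  assert (Hy : (Rabs y <= 24 / 10)%R).
  { unfold y, Rdiv; rewrite Rabs_mult, Rabs_mult, Rabs_inv, (Rabs_pos_eq PI), (Rabs_pos_eq (period m)) by lra.
    apply Rle_trans with (PI * (period m / 2) * / period m + PI * Rabs a * / period m)%R.
    - rewrite <- Rmult_plus_distr_r, <- Rmult_plus_distr_l.
      apply Rmult_le_compat_r; [apply Rlt_le, Rinv_0_lt_compat, Pp|].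
      apply Rmult_le_compat_l; [lra|].
      eapply Rle_trans; [apply Rabs_triang|lra].
    - replace (PI * (period m / 2) * / period m)%R with (PI / 2)%R by (field; lra); lra. }
  assert (Hy2 : (y ^ 2 <= 576 / 100)%R).
  { rewrite <- pow2_abs; pose proof (Rabs_pos y); nra. }
  destruct (sin_square_bounds y ltac:(lra)) as [B1 B2].
  assert (B3 : (16 / 10000 * y ^ 2 <= sin y ^ 2)%R).
  { eapply Rle_trans; [|exact B1]; rewrite Rmult_comm; apply Rmult_le_compat_l; [apply pow2_ge_0|nra]. }
  assert (Ec : (cos y ^ 2 = 1 - sin y ^ 2)%R).
  { pose proof (sin2_cos2 y) as E; unfold Rsqr in E; lra. }
  assert (B4 : (0 <= sin y ^ 2 <= 1)%R).
  { split; [apply pow2_ge_0|]; pose proof (pow2_ge_0 (cos y)); lra. }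
  rewrite Rabs_pos_eq by (apply pow_le, pow2_ge_0); rewrite Ec.
  eapply Rle_trans; [apply pow_one_minus_le; exact B4|]; apply exp_le_compat.
  assert (B5 : (al * (IZR k + a) ^ 2 <= INR m * sin y ^ 2)%R).
  { apply Rle_trans with (INR m * (16 / 10000 * y ^ 2))%R;
      [|apply Rmult_le_compat_l; [apply pos_INR|exact B3]].
    replace (INR m * (16 / 10000 * y ^ 2))%R with
      (16 / 10000 * (INR m / period m ^ 2 * (PI ^ 2 * (IZR k + a) ^ 2)))%R by (unfold y; field; lra).
    unfold al; rewrite Rmult_assoc; apply Rmult_le_compat_l; [lra|].
    replace (PI * T / 2 * (IZR k + a) ^ 2)%R with (T / PI / 2 * (PI ^ 2 * (IZR k + a) ^ 2))%R by (field; lra).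
    apply Rmult_le_compat_r; [apply Rmult_le_pos; apply pow2_ge_0|lra]. }
  assert (B6 : (- (2 * al * (IZR k * a)) <= 2 * al * Rabs a * Rabs (IZR k))%R).
  { replace (2 * al * Rabs a * Rabs (IZR k))%R with (2 * al * Rabs (IZR k * a))%R by (rewrite Rabs_mult; ring).
    replace (- (2 * al * (IZR k * a)))%R with (2 * al * - (IZR k * a))%R by ring.
    apply Rmult_le_compat_l; [lra|].
    rewrite <- (Rabs_Ropp (IZR k * a)); apply Rle_abs. }
  pose proof (Rmult_le_pos _ _ (Rlt_le _ _ Hal) (pow2_ge_0 a)); nra.
- intros k; apply tends_ext_loc with (fun m => left_term m k).
  + apply eventually_filter.
  + generalize (half_period_eventually k); apply filter_imp; intros m Hm; unfold u.
    destruct (Z.leb_spec (- Z.of_nat (half_period m)) k), (Z.ltb_spec k (Z.of_nat (half_period m)));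
      simpl; try lia; reflexivity.
  + apply left_term_lim.
Qed.

Lemma right_sum_lim : eventually (fun m => abs_summable (right_term m)) /\
  tends eventually (fun m => Zsum (right_term m)) (Zsum poisson_right).
Proof.
pose proof PI_RGT_0 as HP.
(* One factor 1/2 comes from the exponent r^2/(2m) of [cb_gauss_le], the other from P^2/m being only
   eventually above pi/(2T). *)
set (al := (PI / T / 4)%R).
assert (Hal : (0 < al)%R) by (unfold al; assert (0 < PI / T)%R by (apply Rdiv_lt_0_compat; assumption); lra).
set (be := (2 * al * (Rabs b + 1))%R).
assert (D : eventually (fun m => forall nu,
  (Cmod (right_term m nu) <= 1 * exp (- al * IZR nu ^ 2 + be * Rabs (IZR nu)))%R)).
{ assert (Em : eventually (fun m => (PI / T / 2 < period m ^ 2 / INR m)%R)).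
  { apply is_lim_seq_gt with (PI / T)%R; [apply period_sq_lim|unfold al in Hal; lra]. }
  assert (Es : eventually (fun m => (Rabs (IZR (shift_index m) / period m) < Rabs b + 1)%R)).
  { apply is_lim_seq_lt with (Rabs b); [apply (is_lim_seq_abs _ b), shift_index_lim|lra]. }
  generalize (filter_and _ _ eventually_ge_1 (filter_and _ _ Em Es)); apply filter_imp; intros m [Hm [H1 H2]] nu.
  assert (Pm : (0 < INR m)%R) by (apply lt_0_INR; lia).
  pose proof (period_pos m) as Pp; pose proof (cb_0_pos m) as Pc.
  unfold right_term; rewrite Cmod_mult.
  replace (2 * PI * Ci * a * (IZR nu + IZR (shift_index m) / period m)) with
    (Ci * RtoC (2 * PI * a * (IZR nu + IZR (shift_index m) / period m)))
    by (rewrite !RtoC_mult, RtoC_plus, <- RtoC_div_period; ring).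
  rewrite Cmod_Cexp_I, Rmult_1_r, Rmult_1_l, Cmod_R.
  set (r := (shift_index m + Z.of_nat (2 * half_period m) * nu)%Z).
  set (d := (IZR (shift_index m) / period m)%R) in *.
  rewrite Rabs_pos_eq by (apply Rmult_le_pos; [apply cb_pos|apply Rlt_le, Rinv_0_lt_compat, Pc]).
  apply Rle_trans with (exp (- (IZR r ^ 2 / (2 * INR m)))).
  { apply Rmult_le_reg_r with (cb m 0); [exact Pc|]; unfold Rdiv at 1; rewrite Rmult_assoc, Rinv_l, Rmult_1_r, Rmult_comm by lra.
    apply cb_gauss_le; lia. }
  apply exp_le_compat.
  assert (Er : IZR r = (period m * (IZR nu + d))%R).
  { unfold r, d; rewrite plus_IZR, mult_IZR, <- INR_IZR_INZ; fold (period m); field; lra. }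
  assert (B1 : (al * (IZR nu + d) ^ 2 <= IZR r ^ 2 / (2 * INR m))%R).
  { rewrite Er; replace ((period m * (IZR nu + d)) ^ 2 / (2 * INR m))%R with
      (period m ^ 2 / INR m / 2 * (IZR nu + d) ^ 2)%R by (field; lra).
    apply Rmult_le_compat_r; [apply pow2_ge_0|unfold al; lra]. }
  assert (B2 : (- (2 * al * (IZR nu * d)) <= be * Rabs (IZR nu))%R).
  { unfold be; replace (- (2 * al * (IZR nu * d)))%R with (2 * al * - (IZR nu * d))%R by ring.
    rewrite (Rmult_assoc (2 * al)); apply Rmult_le_compat_l; [lra|].
    eapply Rle_trans; [apply Rle_abs|]; rewrite Rabs_Ropp, Rabs_mult, Rmult_comm.
    apply Rmult_le_compat_r; [apply Rabs_pos|lra]. }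
  pose proof (Rmult_le_pos _ _ (Rlt_le _ _ Hal) (pow2_ge_0 d)); nra. }
split.
- revert D; apply filter_imp; intros m Hm.
  apply abs_summable_le with (1 := summable_gauss 1 al be Rle_0_1 Hal); exact Hm.
- apply (Zsum_dominated eventually) with (1 := summable_gauss 1 al be Rle_0_1 Hal); [exact D|].
  intros nu; apply right_term_lim.
Qed.

(** The prefactor is kept inside the limit: its own limit is found afterwards from a case in which
    both sides are known. *)
Lemma poisson_limit :
  tends eventually (fun m => RtoC (period m * cb m 0) * Zsum (right_term m)) (Zsum poisson_left).
Proof.
refine (tends_ext_loc eventually _ _ _ _ left_sum_lim).
generalize (proj1 right_sum_lim); apply filter_imp; intros m S.
pose proof (polya_identity m (half_period m) (shift_index m) a (proj1 (half_period_spec m))) as E.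
fold (period m) in E.
etransitivity; [exact E|].
transitivity (RtoC (period m) * (RtoC (cb m 0) * Zsum (right_term m))); [|rewrite RtoC_mult; ring].
apply (f_equal (Cmult (period m))).
rewrite <- Zsum_scal by exact S; apply Zsum_ext; intros nu; unfold right_term.
pose proof (cb_0_pos m); rewrite RtoC_div by lra; field.
intros E0; apply RtoC_inj in E0; lra.
Qed.

End Shifts.

End PoissonSetup.

Lemma Zsum_gauss_neq_0 (u : Z -> R) :
  (forall k, (0 <= u k)%R) -> (0 < u 0%Z)%R -> abs_summable (fun k => RtoC (u k)) ->
  Zsum (fun k => RtoC (u k)) <> 0.
Proof.
intros H0 H1 S E; pose proof (Zsum_tends _ S) as L; rewrite E in L.
destruct (filter_ex _ (filter_and _ _ eventually_ge_1 (L _ H1))) as [N [HN1 HN]].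
assert (Q : Csum (zfold (fun k => RtoC (u k))) N = RtoC (Rsum (zfoldR u) N)).
{ clear; induction N as [|N IH]; simpl; [reflexivity|].
  rewrite IH, RtoC_plus; unfold zfold, zfoldR; now rewrite RtoC_plus. }
rewrite Q in HN; replace (RtoC (Rsum (zfoldR u) N) - 0) with (RtoC (Rsum (zfoldR u) N)) in HN by ring.
rewrite Cmod_R in HN; pose proof (Rle_abs (Rsum (zfoldR u) N)).
pose proof (Rsum_mono (zfoldR u) 1 N (zfoldR_pos u H0) HN1) as HM.
simpl in HM; unfold zfoldR at 1 in HM; simpl in HM.
pose proof (H0 (-1)%Z); lra.
Qed.

Lemma poisson_left_sum_neq_0 : Zsum (poisson_left 1 0 0) <> 0.
Proof.
assert (E : forall k, poisson_left 1 0 0 k = RtoC (exp (- (PI * IZR k ^ 2)))).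
{ intros k; unfold poisson_left; rewrite <- Cexp_R, RtoC_opp, RtoC_mult, RtoC_pow; f_equal; ring. }
rewrite (Zsum_ext _ _ E); apply Zsum_gauss_neq_0.
- intros; apply Rlt_le, exp_pos.
- apply exp_pos.
- apply abs_summable_le with (1 := summable_gauss 1 PI 0 Rle_0_1 PI_RGT_0).
  intros k; rewrite Cmod_R, Rabs_pos_eq by (apply Rlt_le, exp_pos).
  rewrite Rmult_1_l; apply exp_le_compat; lra.
Qed.

(** At T = 1 and a = b = 0 the two theta series coincide and are not zero, which forces the
    prefactor to tend to 1. This plays the role of Wallis' product. *)
Lemma central_binomial_lim : tends eventually (fun m => RtoC (period 1 m * cb m 0)) 1.
Proof.
pose proof (poisson_limit 1 Rlt_0_1 0 0) as H1.
destruct (right_sum_lim 1 Rlt_0_1 0 0) as [_ H2].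
assert (E : Zsum (poisson_right 1 0 0) = Zsum (poisson_left 1 0 0)).
{ apply Zsum_ext; intros k; unfold poisson_right, poisson_left; f_equal; field; apply C1_nz. }
pose proof poisson_left_sum_neq_0 as N; rewrite E in H2.
replace (RtoC 1) with (Zsum (poisson_left 1 0 0) / Zsum (poisson_left 1 0 0)) by (field; exact N).
refine (tends_ext_loc eventually _ _ _ _ (tends_div _ _ _ _ _ N H1 H2)).
generalize (tends_neq_0 _ _ _ N H2); apply filter_imp; intros m Hm; field; exact Hm.
Qed.

(** In the prefactor only the period depends on T, so this ratio carries the constant from T = 1 to
    every T > 0. *)
Lemma period_scaling_lim (T : R) : (0 < T)%R ->
  is_lim_seq (fun m => (period T m / period 1 m)%R) (/ sqrt T)%R.
Proof.
intros HT; pose proof PI_RGT_0 as HP; pose proof (sqrt_lt_R0 T HT) as Hs.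
apply is_lim_seq_ext_loc with
  (fun m => ((period T m / scale T m) / (period 1 m / scale 1 m) * / sqrt T)%R).
- generalize (filter_and _ _ (is_lim_seq_p_infty_gt _ 0%R (scale_lim T HT))
    (is_lim_seq_p_infty_gt _ 0%R (scale_lim 1 Rlt_0_1))); apply filter_imp; intros m [H1 H2].
  assert (E : scale 1 m = (scale T m * sqrt T)%R).
  { unfold scale; rewrite <- sqrt_mult_alt; [f_equal; field; lra|].
    apply Rmult_le_pos; [|apply Rlt_le, Rinv_0_lt_compat, HT].
    apply Rmult_le_pos; [lra|apply pos_INR]. }
  pose proof (period_pos 1 m); pose proof (period_pos T m).
  rewrite E; field; repeat split; lra.
- evar_last; [apply (is_lim_seq_scal_r _ (/ sqrt T) (1 / 1)%R), is_lim_seq_div';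
    [apply period_ratio_lim, HT|apply period_ratio_lim, Rlt_0_1|lra]|].
  simpl; f_equal; field; lra.
Qed.

Theorem poisson_summation_real (T a b : R) : (0 < T)%R ->
  Zsum (poisson_left T a b) = RtoC (/ sqrt T) * Zsum (poisson_right T a b).
Proof.
intros HT; apply (tends_unique eventually _ _ _ (poisson_limit T HT a b)).
replace (RtoC (/ sqrt T)) with (RtoC (/ sqrt T) * 1) by ring.
apply tends_mult; [apply eventually_filter| |apply right_sum_lim, HT].
apply tends_ext with (fun m => RtoC (period T m / period 1 m) * RtoC (period 1 m * cb m 0)).
- apply eventually_filter.
- intros m; rewrite <- RtoC_mult; f_equal; pose proof (period_pos 1 m); field; lra.
- apply tends_mult; [apply eventually_filter| |apply central_binomial_lim].
  now apply tends_is_lim_seq, period_scaling_lim.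
Qed.

(** * Poisson summation with a complex shift *)

Lemma RtoC_neq_0 (x : R) : x <> 0%R -> RtoC x <> 0.
Proof. intros H E; apply RtoC_inj in E; contradiction. Qed.

Lemma RtoC_m1 : RtoC (-1) = -(1).
Proof. exact (RtoC_opp 1). Qed.

Lemma Re_Im_split (z : C) : z = RtoC (Re z) + Ci * RtoC (Im z).
Proof. destruct z as [x y]; unfold RtoC, Ci, Cmult, Cplus; simpl; f_equal; ring. Qed.

Lemma Re_mult_RtoC (x : R) (z : C) : Re (z * RtoC x) = (Re z * x)%R.
Proof. destruct z; simpl; ring. Qed.

Lemma gauss_summable (A : R) (c B : C) :
  (0 < A)%R -> abs_summable (fun k => c * Cexp (- (A * IZR k ^ 2) + B * IZR k)).
Proof.
intros HA; apply abs_summable_le with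
  (1 := summable_gauss (Cmod c) A (Rabs (Re B)) (Cmod_ge_0 c) HA).
intros k; rewrite Cmod_mult, Cmod_Cexp; apply Rmult_le_compat_l; [apply Cmod_ge_0|].
apply exp_le_compat.
replace (- (A * IZR k ^ 2) + B * IZR k) with (RtoC (- (A * IZR k ^ 2)) + B * IZR k)
  by (rewrite RtoC_opp, RtoC_mult, RtoC_pow; ring).
change (Re (RtoC (- (A * IZR k ^ 2)) + B * IZR k)) with ((- (A * IZR k ^ 2)) + Re (B * IZR k))%R.
rewrite Re_mult_RtoC.
assert (H : (Re B * IZR k <= Rabs (Re B) * Rabs (IZR k))%R)
  by (rewrite <- Rabs_mult; apply Rle_abs).
lra.
Qed.

Definition poisson_left_C (T : R) (a : C) (b : R) (k : Z) : C :=
  Cexp (- (PI * T * (IZR k + a) ^ 2) - 2 * PI * Ci * IZR k * b).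
Definition poisson_right_C (T : R) (a : C) (b : R) (nu : Z) : C :=
  Cexp (- (PI * (IZR nu + b) ^ 2 / T) + 2 * PI * Ci * a * (IZR nu + b)).

Lemma Cpow_2 (z : C) : z ^ 2 = z * z.
Proof. simpl; ring. Qed.

Lemma poisson_left_C_summable (T : R) (a : C) (b : R) :
  (0 < T)%R -> abs_summable (poisson_left_C T a b).
Proof.
intros HT; apply abs_summable_ext with
  (2 := gauss_summable (PI * T) (Cexp (- (PI * T * a ^ 2))) (- (2 * PI * T * a) - 2 * PI * Ci * b)
     (Rmult_lt_0_compat _ _ PI_RGT_0 HT)).
intros k; unfold poisson_left_C; rewrite <- Cexp_plus; f_equal; rewrite RtoC_mult, !Cpow_2; ring.
Qed.

Lemma poisson_right_C_summable (T : R) (a : C) (b : R) :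
  (0 < T)%R -> abs_summable (poisson_right_C T a b).
Proof.
intros HT; apply abs_summable_ext with
  (2 := gauss_summable (PI / T) (Cexp (- (PI * b ^ 2 / T) + 2 * PI * Ci * a * b))
     (- (2 * PI * b / T) + 2 * PI * Ci * a) (Rdiv_lt_0_compat _ _ PI_RGT_0 HT)).
assert (NT : RtoC T <> 0) by (apply RtoC_neq_0; lra).
intros k; unfold poisson_right_C; rewrite <- Cexp_plus; f_equal.
rewrite RtoC_div, !Cpow_2 by lra; field; exact NT.
Qed.

(** The imaginary part [be] of the shift a can be traded for the real frequency shift T [be]:
    completing the square takes the same factor [c] out of both series, and the real case
    applies. *)
Theorem poisson_summation (T : R) (a : C) (b : R) : (0 < T)%R ->
  Zsum (poisson_left_C T a b) = RtoC (/ sqrt T) * Zsum (poisson_right_C T a b).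
Proof.
intros HT; set (al := Re a); set (be := Im a).
assert (NT : RtoC T <> 0) by (apply RtoC_neq_0; lra).
assert (Ea : a = al + Ci * be) by apply Re_Im_split.
set (c := Cexp (PI * T * be ^ 2 - 2 * PI * Ci * T * be * al)).
assert (E1 : forall k, poisson_left_C T a b k = c * poisson_left T al (b + T * be) k).
{ intros k; unfold poisson_left_C, poisson_left, c; rewrite <- Cexp_plus; f_equal; rewrite Ea.
  rewrite RtoC_plus, RtoC_mult, !Cpow_2.
  transitivity (- (PI * T * ((IZR k + al) * (IZR k + al) + 2 * Ci * be * (IZR k + al) + (Ci * Ci) * (be * be)))
    - 2 * PI * Ci * IZR k * b); [ring|rewrite Ci2; ring]. }
assert (E2 : forall k, poisson_right_C T a b k = c * poisson_right T al (b + T * be) k).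
{ intros k; unfold poisson_right_C, poisson_right, c; rewrite <- Cexp_plus; f_equal; rewrite Ea.
  rewrite RtoC_plus, RtoC_mult, !Cpow_2.
  transitivity (- (PI * ((IZR k + b) * (IZR k + b)) / T) + 2 * PI * (Ci * al + (Ci * Ci) * be) * (IZR k + b));
    [ring|rewrite Ci2; field; exact NT]. }
assert (Nc : c <> 0) by apply Cexp_neq_0.
assert (S1 : abs_summable (poisson_left T al (b + T * be))).
{ apply abs_summable_ext with (2 := abs_summable_scal (/ c) _ (poisson_left_C_summable T a b HT)).
  intros k; rewrite E1; field; exact Nc. }
assert (S2 : abs_summable (poisson_right T al (b + T * be))).
{ apply abs_summable_ext with (2 := abs_summable_scal (/ c) _ (poisson_right_C_summable T a b HT)).
  intros k; rewrite E2; field; exact Nc. }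
rewrite (Zsum_ext _ _ E1), (Zsum_ext _ _ E2), !Zsum_scal, poisson_summation_real by assumption; ring.
Qed.

(** * Theta series as T tends to 0 *)

Lemma at_right_pos : at_right 0 (fun T => (0 < T)%R).
Proof. exists (mkposreal 1 Rlt_0_1); intros T _ H; exact H. Qed.

Lemma at_right_lt (c : R) : (0 < c)%R -> at_right 0 (fun T => (T < c)%R).
Proof.
intros Hc; exists (mkposreal c Hc); intros T H _.
change (Rabs (T - 0) < c)%R in H; rewrite Rminus_0_r in H; pose proof (Rle_abs T); lra.
Qed.

#[local] Instance at_right_proper : ProperFilter (at_right 0) := at_right_proper_filter 0.

Lemma tends_exp_inv_0 (c : R) : (0 < c)%R -> tends (at_right 0) (fun T => RtoC (exp (- (c / T)))) 0.
Proof.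
intros Hc eps Heps.
assert (P : (0 < c * eps)%R) by (now apply Rmult_lt_0_compat).
generalize (filter_and _ _ at_right_pos (at_right_lt _ P)); apply filter_imp; intros T [H1 H2].
replace (RtoC (exp (- (c / T))) - 0) with (RtoC (exp (- (c / T)))) by ring.
rewrite Cmod_R, Rabs_pos_eq by (apply Rlt_le, exp_pos).
rewrite exp_Ropp.
assert (P2 : (0 < c / T)%R) by (now apply Rdiv_lt_0_compat).
apply Rle_lt_trans with (/ (c / T))%R.
- apply Rinv_le_contravar; [exact P2|]; pose proof (exp_ineq1_le (c / T)); lra.
- replace (/ (c / T))%R with (T / c)%R by (field; lra).
  apply Rmult_lt_reg_r with c; [exact Hc|]; unfold Rdiv; rewrite Rmult_assoc, Rinv_l; lra.
Qed.

(** For T < 1 the terms are dominated by their values at T = 1, and only those with exponent 0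
    survive. *)
Lemma tends_gauss_cusp (n : Z -> Z) (c : Z -> C) :
  (forall k, (0 <= n k)%Z) -> summable (fun k => (exp (- (PI * IZR (n k))) * Cmod (c k))%R) ->
  tends (at_right 0) (fun T => Zsum (fun k => RtoC (exp (- (PI * IZR (n k) / T))) * c k))
    (Zsum (fun k => if (n k =? 0)%Z then c k else 0)).
Proof.
intros Hn S; pose proof PI_RGT_0 as HP.
apply (Zsum_dominated (at_right 0)) with (1 := S).
- generalize (filter_and _ _ at_right_pos (at_right_lt 1 Rlt_0_1)); apply filter_imp; intros T [H1 H2] k.
  rewrite Cmod_mult; apply Rmult_le_compat_r; [apply Cmod_ge_0|].
  rewrite Cmod_R, Rabs_pos_eq by (apply Rlt_le, exp_pos).
  apply exp_le_compat, Ropp_le_contravar.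
  assert (P : (0 <= PI * IZR (n k))%R) by (apply Rmult_le_pos; [lra|apply IZR_le, Hn]).
  unfold Rdiv; rewrite <- (Rmult_1_r (PI * IZR (n k))) at 1; apply Rmult_le_compat_l; [exact P|].
  rewrite <- Rinv_1; apply Rinv_le_contravar; lra.
- intros k; destruct (Z.eqb_spec (n k) 0) as [E|E].
  + apply tends_ext with (fun _ => c k); [apply at_right_proper| |apply tends_const, at_right_proper].
    intros T; rewrite E; unfold Rdiv; rewrite Rmult_0_r, Rmult_0_l, Ropp_0, exp_0; ring.
  + replace (RtoC 0) with (0 * c k) by ring.
    apply tends_mult; [apply at_right_proper| |apply tends_const, at_right_proper].
    apply tends_exp_inv_0, Rmult_lt_0_compat; [exact HP|].
    specialize (Hn k); apply IZR_lt; lia.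
Qed.

Lemma gauss_coeff_summable (p : R) (c B : C) :
  summable (fun k => (exp (- (PI * (IZR k ^ 2 + p * IZR k))) * Cmod (c * Cexp (B * IZR k)))%R).
Proof.
eapply summable_le; [|exact (gauss_summable PI c (B - RtoC (PI * p)) PI_RGT_0)].
intros k; cbn beta; split.
- apply Rmult_le_pos; [apply Rlt_le, exp_pos|apply Cmod_ge_0].
- right; rewrite <- (Rabs_pos_eq (exp _)) at 1 by (apply Rlt_le, exp_pos).
  rewrite <- Cmod_R, <- Cmod_mult; f_equal.
  transitivity (c * (RtoC (exp (- (PI * (IZR k ^ 2 + p * IZR k)))) * Cexp (B * IZR k))); [ring|].
  f_equal; rewrite <- Cexp_R, <- Cexp_plus; f_equal.
  rewrite RtoC_opp, !RtoC_mult, RtoC_plus, RtoC_mult, RtoC_pow; ring.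
Qed.

Lemma Cexp_PI_Ci : Cexp (PI * Ci) = -(1).
Proof.
replace (PI * Ci) with (Ci * PI) by ring; rewrite Cexp_I, cos_PI, sin_PI.
rewrite RtoC_m1; ring.
Qed.

Lemma theta_even_cusp (a : C) :
  tends (at_right 0) (fun T => RtoC (sqrt T) * Zsum (poisson_left_C T a 0)) 1.
Proof.
set (c := fun k : Z => 1 * Cexp (2 * PI * Ci * a * IZR k)).
replace (RtoC 1) with (Zsum (fun k => if (k * k =? 0)%Z then c k else 0)).
- apply tends_ext_loc with (fun T => Zsum (fun k => RtoC (exp (- (PI * IZR (k * k) / T))) * c k)).
  + apply at_right_proper.
  + generalize at_right_pos; apply filter_imp; intros T HT.
    rewrite poisson_summation, Cmult_assoc, <- RtoC_mult, Rinv_r, Cmult_1_l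
      by (try apply Rgt_not_eq, sqrt_lt_R0; exact HT).
    apply Zsum_ext; intros k; unfold poisson_right_C, c.
    rewrite Cmult_1_l, <- Cexp_R, <- Cexp_plus; f_equal.
    rewrite RtoC_opp, RtoC_div, RtoC_mult, mult_IZR, RtoC_mult by lra; rewrite Cpow_2; field.
    apply RtoC_neq_0; lra.
  + apply (tends_gauss_cusp (fun k => (k * k)%Z)); [intros; apply Z.square_nonneg|].
    eapply summable_le; [|exact (gauss_coeff_summable 0 1 (2 * PI * Ci * a))].
    intros k; cbn beta; split.
    * apply Rmult_le_pos; [apply Rlt_le, exp_pos|apply Cmod_ge_0].
    * right; unfold c; f_equal; f_equal; f_equal; rewrite mult_IZR; ring.
- rewrite Zsum_single.
  + unfold c; simpl; replace (2 * PI * Ci * a * 0) with (RtoC 0) by ring; rewrite Cexp_0; ring.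
  + intros k Hk; destruct (Z.eqb_spec (k * k) 0); [nia|reflexivity].
Qed.

(** With b = 1/2 one has (k + 1/2)^2 = k(k + 1) + 1/4. The 1/4 becomes the exponential prefactor,
    and the minimum is attained twice, at k = 0 and k = -1; these two terms give the cosine. *)
Lemma poisson_half (T : R) (a : C) : (0 < T)%R ->
  RtoC (sqrt T * exp (PI / (4 * T))) * Zsum (poisson_left_C T a (1 / 2)) =
  Zsum (fun k => RtoC (exp (- (PI * IZR (k * (k + 1)) / T))) *
                 (Cexp (PI * Ci * a) * Cexp (2 * PI * Ci * a * IZR k))).
Proof.
intros HT; rewrite poisson_summation by exact HT.
transitivity (RtoC (exp (PI / (4 * T))) * Zsum (poisson_right_C T a (1 / 2))).
- rewrite Cmult_assoc, <- RtoC_mult; f_equal; f_equal; field; apply Rgt_not_eq, sqrt_lt_R0, HT.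
- rewrite <- Zsum_scal by (now apply poisson_right_C_summable).
  apply Zsum_ext; intros k; unfold poisson_right_C.
  rewrite <- !Cexp_R, <- !Cexp_plus; f_equal.
  rewrite RtoC_opp, !RtoC_div, !RtoC_mult, mult_IZR, plus_IZR, RtoC_mult, RtoC_plus by lra.
  rewrite Cpow_2; field; apply RtoC_neq_0; lra.
Qed.

Lemma theta_odd_cusp (a : C) :
  tends (at_right 0) (fun T => RtoC (sqrt T * exp (PI / (4 * T))) * Zsum (poisson_left_C T a (1 / 2)))
    (2 * Ccos (a * PI)).
Proof.
set (c := fun k : Z => Cexp (PI * Ci * a) * Cexp (2 * PI * Ci * a * IZR k)).
replace (2 * Ccos (a * PI)) with (Zsum (fun k => if (k * (k + 1) =? 0)%Z then c k else 0)).
- apply tends_ext_loc with (fun T => Zsum (fun k => RtoC (exp (- (PI * IZR (k * (k + 1)) / T))) * c k)).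
  + apply at_right_proper.
  + generalize at_right_pos; apply filter_imp; intros T HT; now rewrite poisson_half.
  + apply (tends_gauss_cusp (fun k => (k * (k + 1))%Z)); [intros; nia|].
    eapply summable_le; [|exact (gauss_coeff_summable 1 (Cexp (PI * Ci * a)) (2 * PI * Ci * a))].
    intros k; cbn beta; split.
    * apply Rmult_le_pos; [apply Rlt_le, exp_pos|apply Cmod_ge_0].
    * right; unfold c; f_equal; f_equal; f_equal; rewrite mult_IZR, plus_IZR; ring.
- destruct (Zsum_finite (fun k => if (k * (k + 1) =? 0)%Z then c k else 0) 1) as [_ ->].
  + intros k Hk; destruct (Z.eqb_spec (k * (k + 1)) 0); [nia|reflexivity].
  + simpl; unfold zfold, c; simpl; rewrite <- !Cexp_plus; unfold Ccos.
    replace (PI * Ci * a + 2 * PI * Ci * a * 0) with (Ci * (a * PI)) by ring.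
    replace (PI * Ci * a + 2 * PI * Ci * a * -1) with (- (Ci * (a * PI))) by (rewrite RtoC_m1; ring).
    field.
Qed.

(** When the cosine vanishes, w = exp(pi i a) satisfies w^2 = -1, and on the Poisson-dual side the
    terms of index k and -1 - k cancel. *)
Lemma theta_odd_eq_0 (T : R) (a : C) : (0 < T)%R -> Ccos (a * PI) = 0 ->
  Zsum (poisson_left_C T a (1 / 2)) = 0.
Proof.
intros HT Hc.
set (w := Cexp (PI * Ci * a)).
assert (Nw : w <> 0) by apply Cexp_neq_0.
assert (Hw : w = - / w).
{ unfold Ccos in Hc; fold (Cexp (Ci * (a * PI))) in Hc.
  replace (Ci * (a * PI)) with (PI * Ci * a) in Hc by ring; rewrite Cexp_opp in Hc; fold w in Hc.
  assert (E : w + / w = 0) by (transitivity (2 * ((w + / w) / 2)); [field; exact Nw|rewrite Hc; ring]).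
  transitivity (w + / w - / w); [ring|rewrite E; ring]. }
assert (Hww : w * w = -(1)) by (rewrite Hw at 2; field; exact Nw).
apply Cmult_cancel_l with (RtoC (sqrt T * exp (PI / (4 * T)))).
{ apply RtoC_neq_0, Rgt_not_eq, Rmult_lt_0_compat; [now apply sqrt_lt_R0|apply exp_pos]. }
rewrite poisson_half by exact HT; rewrite Cmult_0_r; fold w.
set (u := fun k : Z => RtoC (exp (- (PI * IZR (k * (k + 1)) / T))) * (w * Cexp (2 * PI * Ci * a * IZR k))).
assert (Eu : forall k, Cexp (2 * PI * Ci * a * IZR k) = zpow (-(1)) k).
{ intros k; rewrite <- Hww; unfold w; rewrite <- Cexp_plus, zpow_Cexp; f_equal; ring. }
assert (S : abs_summable u).
{ apply abs_summable_ext with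
    (2 := abs_summable_scal (RtoC (exp (PI / (4 * T)))) _ (poisson_right_C_summable T a (1 / 2) HT)).
  intros k; unfold u, w, poisson_right_C.
  rewrite <- !Cexp_R, <- !Cexp_plus; f_equal.
  rewrite RtoC_opp, !RtoC_div, !RtoC_mult, mult_IZR, plus_IZR, RtoC_mult, RtoC_plus by lra.
  rewrite Cpow_2; field; apply RtoC_neq_0; lra. }
apply C_double_eq_0; change (Zsum u = - Zsum u).
rewrite <- (Zsum_reflect u (-1) S) at 1; rewrite <- Zsum_opp by exact S.
apply Zsum_ext; intros k; unfold u; rewrite !Eu.
replace ((-1 - k) * (-1 - k + 1))%Z with (k * (k + 1))%Z by ring.
assert (E1 : zpow (-(1)) (-1 - k) = - zpow (-(1)) k).
{ assert (N1 : -(1) <> 0) by apply Copp_neq_0, C1_nz.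
  replace (-1 - k)%Z with (k + 2 * (- k - 1) + 1)%Z by lia.
  rewrite zpow_succ, zpow_add, zpow_m1_even by exact N1; ring. }
rewrite E1; ring.
Qed.

(** * Theta functions and eta at the cusp *)

(** At z = a tau the linear term completes the square to (k + a)^2, at the cost of the factor exp(pi
    T a^2), which tends to 1. *)
Lemma vartheta00_cusp_form (T : R) (a : C) :
  vartheta 0 0 (Ci * T) (a * (Ci * T)) = Zsum (fun k => Cexp (PI * T * a ^ 2) * poisson_left_C T a 0 k).
Proof.
unfold vartheta; apply Zsum_ext; intros k; unfold poisson_left_C; rewrite <- Cexp_plus; f_equal.
simpl INR; rewrite !Cpow_2.
transitivity (PI * (Ci * Ci) * T * (IZR k * IZR k) + 2 * PI * (Ci * Ci) * IZR k * (a * T)); [field|].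
rewrite Ci2; ring.
Qed.

Lemma vartheta10_cusp_form (T : R) (a : C) :
  vartheta 1 0 (Ci * T) (a * (Ci * T)) =
  Zsum (fun k => Cexp (PI * T * a ^ 2) * poisson_left_C T (a + 1 / 2) 0 k).
Proof.
unfold vartheta; apply Zsum_ext; intros k; unfold poisson_left_C; rewrite <- Cexp_plus; f_equal.
simpl INR; rewrite !Cpow_2.
transitivity (PI * (Ci * Ci) * T * ((IZR k + 1 / 2) * (IZR k + 1 / 2)) +
  2 * PI * (Ci * Ci) * (IZR k + 1 / 2) * (a * T)); [field|].
rewrite Ci2; field.
Qed.

Lemma vartheta01_cusp_form (T : R) (a : C) :
  vartheta 0 1 (Ci * T) (a * (Ci * T)) =
  Zsum (fun k => Cexp (PI * T * a ^ 2) * poisson_left_C T a (1 / 2) k).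
Proof.
unfold vartheta; apply Zsum_ext; intros k; unfold poisson_left_C; rewrite <- Cexp_plus.
(* Inserts exp(2 pi i k) = 1: the alternating sign is exp(pi i k) in the theta function and exp(-pi
   i k) in [poisson_left_C]. *)
rewrite <- (Cmult_1_r (Cexp (PI * T * a ^ 2 + _))), <- (Cexp_2PI_Z k), <- Cexp_plus; f_equal.
simpl INR; rewrite !Cpow_2, RtoC_div by lra.
transitivity (PI * (Ci * Ci) * T * (IZR k * IZR k) + 2 * PI * (Ci * Ci) * IZR k * (a * T) + PI * Ci * IZR k);
  [field|].
rewrite Ci2; field.
Qed.

Lemma tends_gauss_prefactor (a : C) : tends (at_right 0) (fun T => Cexp (PI * T * a ^ 2)) 1.
Proof.
rewrite <- Cexp_0; replace (RtoC 0) with (PI * 0 * a ^ 2) by ring.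
apply tends_Cexp; [apply at_right_proper|].
apply tends_mult; [apply at_right_proper| |apply tends_const, at_right_proper].
apply tends_scal; [apply at_right_proper|].
apply tends_RtoC; [apply at_right_proper|]; intros P H; now apply filter_le_within.
Qed.

Lemma vartheta00_cusp (a : C) :
  tends (at_right 0) (fun T => RtoC (sqrt T) * vartheta 0 0 (Ci * T) (a * (Ci * T))) 1.
Proof.
replace (RtoC 1) with (1 * 1) by ring.
refine (tends_ext_loc _ _ _ _ _ (tends_mult _ _ _ _ _ (tends_gauss_prefactor a) (theta_even_cusp a))).
generalize at_right_pos; apply filter_imp; intros T HT.
rewrite vartheta00_cusp_form, Zsum_scal by (now apply poisson_left_C_summable); ring.
Qed.

Lemma vartheta10_cusp (a : C) :
  tends (at_right 0) (fun T => RtoC (sqrt T) * vartheta 1 0 (Ci * T) (a * (Ci * T))) 1.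
Proof.
replace (RtoC 1) with (1 * 1) by ring.
refine (tends_ext_loc _ _ _ _ _ (tends_mult _ _ _ _ _ (tends_gauss_prefactor a) (theta_even_cusp (a + 1 / 2)))).
generalize at_right_pos; apply filter_imp; intros T HT.
rewrite vartheta10_cusp_form, Zsum_scal by (now apply poisson_left_C_summable); ring.
Qed.

Lemma vartheta01_cusp (a : C) :
  tends (at_right 0) (fun T => RtoC (sqrt T * exp (PI / (4 * T))) * vartheta 0 1 (Ci * T) (a * (Ci * T)))
    (2 * Ccos (a * PI)).
Proof.
replace (2 * Ccos (a * PI)) with (1 * (2 * Ccos (a * PI))) by ring.
refine (tends_ext_loc _ _ _ _ _ (tends_mult _ _ _ _ _ (tends_gauss_prefactor a) (theta_odd_cusp a))).
generalize at_right_pos; apply filter_imp; intros T HT.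
rewrite vartheta01_cusp_form, Zsum_scal by (now apply poisson_left_C_summable); ring.
Qed.

Lemma vartheta01_eq_0 (T : R) (a : C) : (0 < T)%R -> Ccos (a * PI) = 0 ->
  vartheta 0 1 (Ci * T) (a * (Ci * T)) = 0.
Proof.
intros HT Hc; rewrite vartheta01_cusp_form, Zsum_scal, theta_odd_eq_0
  by (try apply poisson_left_C_summable; assumption); ring.
Qed.

Definition nome (T : R) : C := RtoC (exp (- (2 * PI * T))).

Lemma nome_neq_0 (T : R) : nome T <> 0.
Proof. apply RtoC_neq_0, Rgt_not_eq, exp_pos. Qed.

Lemma nome_lt_1 (T : R) : (0 < T)%R -> (Cmod (nome T) < 1)%R.
Proof.
intros HT; unfold nome; rewrite Cmod_R, Rabs_pos_eq by (apply Rlt_le, exp_pos).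
rewrite <- exp_0; apply exp_increasing; pose proof PI_RGT_0; nra.
Qed.

Lemma eta_phi (T : R) : eta (Ci * T) = RtoC (exp (- (PI * T / 12))) * phi (nome T).
Proof.
unfold eta, phi; f_equal.
- unfold qpow; rewrite <- Cexp_R; f_equal.
  transitivity (2 * PI * (Ci * Ci) * (1 / 24) * T); [ring|].
  rewrite Ci2, RtoC_opp, RtoC_div, RtoC_mult by lra; field.
- f_equal; apply FunctionalExtensionality.functional_extensionality; intros n; f_equal.
  unfold qpow, nome; rewrite <- zpow_of_nat, <- Cexp_R, zpow_Cexp, <- INR_IZR_INZ; f_equal.
  transitivity (2 * PI * (Ci * Ci) * INR (S n) * T); [ring|].
  rewrite Ci2, RtoC_opp, !RtoC_mult; ring.
Qed.

Lemma eta_neq_0 (T : R) : (0 < T)%R -> eta (Ci * T) <> 0.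
Proof.
intros HT; rewrite eta_phi; apply Cmult_neq_0; [apply RtoC_neq_0, Rgt_not_eq, exp_pos|].
apply phi_neq_0, nome_lt_1, HT.
Qed.

(** The prefactor exp(-pi T/12) of eta completes the pentagonal exponent pi T (3k^2 - k) to 3 pi T
    (k - 1/6)^2; the sign (-1)^k is the frequency 1/2. *)
Lemma eta_theta (T : R) : (0 < T)%R -> eta (Ci * T) = Zsum (poisson_left_C (3 * T) (- (1 / 6)) (1 / 2)).
Proof.
intros HT; rewrite eta_phi, pentagonal by (try apply nome_neq_0; now apply nome_lt_1).
pose proof (nome_neq_0 T) as N0; pose proof (nome_lt_1 T HT) as N1.
set (q := nome T) in *.
unfold Th; rewrite <- Zsum_scal.
- apply Zsum_ext; intros k; unfold theta_term, poisson_left_C.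
  rewrite zpow_Copp, !zpow_mult_l by (repeat apply Cmult_neq_0; assumption).
  unfold q, nome; rewrite <- !Cexp_R, !zpow_Cexp.
  replace (-(1)) with (Cexp (- (PI * Ci)))
    by (rewrite Cexp_opp, Cexp_PI_Ci; field; apply C1_nz).
  rewrite zpow_Cexp, <- !Cexp_plus; f_equal.
  rewrite IZR_tri, !RtoC_opp, !RtoC_div, !RtoC_mult, RtoC_minus, RtoC_pow, !Cpow_2 by lra; field.
- apply theta_term_summable; [repeat apply Cmult_neq_0; assumption| |now apply Copp_neq_0].
  rewrite Cmod_mult; pose proof (Cmod_square_lt_1 q N1); pose proof (Cmod_ge_0 q).
  pose proof (Cmod_ge_0 (q * q)); nra.
Qed.

Lemma filterlim_scale_at_right (c : R) : (0 < c)%R -> filterlim (fun T => (c * T)%R) (at_right 0) (at_right 0).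
Proof.
intros Hc P [[d Hd] HP].
assert (Hdc : (0 < d / c)%R) by (now apply Rdiv_lt_0_compat).
exists (mkposreal _ Hdc); intros T HT HT0; apply HP.
- change (Rabs (c * T - 0) < d)%R; change (Rabs (T - 0) < d / c)%R in HT.
  rewrite Rminus_0_r in *; rewrite Rabs_mult, (Rabs_pos_eq c) by lra.
  apply Rmult_lt_reg_l with (/ c)%R; [now apply Rinv_0_lt_compat|].
  rewrite <- Rmult_assoc, Rinv_l, Rmult_1_l, Rmult_comm by lra; exact HT.
- now apply Rmult_lt_0_compat.
Qed.

Lemma eta_cusp : tends (at_right 0) (fun T => RtoC (sqrt T * exp (PI / (12 * T))) * eta (Ci * T)) 1.
Proof.
pose proof (sqrt_lt_R0 3 ltac:(lra)) as H3.
assert (N3 : RtoC (sqrt 3) <> 0) by (apply RtoC_neq_0; lra).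
pose proof (tends_comp _ _ _ _ _ (filterlim_scale_at_right 3 ltac:(lra)) (theta_odd_cusp (- (1 / 6)))) as H.
(* The limit constant 2 cos(pi/6) cancels the factor sqrt 3 that the scale 3T contributes. *)
assert (E : 2 * Ccos (- (1 / 6) * PI) = RtoC (sqrt 3)).
{ unfold Ccos; replace (Ci * (- (1 / 6) * PI)) with (Ci * RtoC (- (PI / 6)))
    by (rewrite RtoC_opp, RtoC_div by lra; field).
  replace (- (Ci * RtoC (- (PI / 6)))) with (Ci * RtoC (PI / 6)) by (rewrite RtoC_opp; ring).
  rewrite !Cexp_I, cos_neg, sin_neg, cos_PI6, RtoC_opp, RtoC_div by lra; field. }
rewrite E in H.
replace (RtoC 1) with (/ sqrt 3 * sqrt 3) by (field; exact N3).
refine (tends_ext_loc _ _ _ _ _ (tends_scal _ (/ sqrt 3) _ _ H)).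
generalize at_right_pos; apply filter_imp; intros T HT.
rewrite eta_theta, sqrt_mult, Rmult_assoc, RtoC_mult by lra.
replace (PI / (4 * (3 * T)))%R with (PI / (12 * T))%R by (field; lra); field; exact N3.
Qed.

(** * The function E and the correction term *)

Definition gauss (t : R) : R := exp (- (PI * t ^ 2)).

Lemma continuous_gauss t : continuous gauss t.
Proof. apply (ex_derive_continuous gauss); unfold gauss; auto_derive; exact I. Qed.

Lemma E_derive x : is_derive E x (2 * gauss x)%R.
Proof.
unfold E; apply (is_derive_scal (fun x => RInt gauss 0 x) x 2 (gauss x)).
apply (is_derive_RInt gauss (fun x => RInt gauss 0 x) 0 x).
- apply filter_forall; intros y; apply (RInt_correct (V := R_CompleteNormedModule)).
  apply (ex_RInt_continuous (V := R_CompleteNormedModule)); intros z _; apply continuous_gauss.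
- apply continuous_gauss.
Qed.

Lemma E_0 : E 0 = 0%R.
Proof. unfold E; rewrite RInt_point; apply Rmult_0_r. Qed.

Lemma monotone_of_derive (f f' : R -> R) (a b : R) :
  (a <= b)%R -> (forall x, is_derive f x (f' x)) -> (forall x, (a <= x)%R -> (0 <= f' x)%R) -> (f a <= f b)%R.
Proof.
intros Hab Hd Hp.
destruct (MVT_gen f a b f') as [c [Hc E]].
- intros x _; apply Hd.
- intros x _; apply derivable_continuous_pt; exists (f' x); apply is_derive_Reals, Hd.
- rewrite Rmin_left, Rmax_right in Hc by exact Hab.
  assert (0 <= f' c * (b - a))%R by (apply Rmult_le_pos; [apply Hp|]; lra); lra.
Qed.

Lemma gauss_pos t : (0 < gauss t)%R.
Proof. apply exp_pos. Qed.

Lemma gauss_decr (s t : R) : (0 <= s <= t)%R -> (gauss t <= gauss s)%R.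
Proof.
intros H; unfold gauss; apply exp_le_compat, Ropp_le_contravar.
apply Rmult_le_compat_l; [apply Rlt_le, PI_RGT_0|]; apply pow_incr; exact H.
Qed.

Lemma E_incr (x y : R) : (x <= y)%R -> (E x <= E y)%R.
Proof.
intros H; apply (monotone_of_derive E (fun x => (2 * gauss x)%R)); [exact H|apply E_derive|].
intros z _; pose proof (gauss_pos z); lra.
Qed.

Lemma E_opp x : E (- x) = (- E x)%R.
Proof.
assert (P : forall x, (0 <= x)%R -> E (- x) = (- E x)%R).
{ clear x; intros x Hx.
  assert (D : forall z : R, is_derive (fun z : R => (E z + E (- z))%R) z 0%R).
  { intros z.
    assert (D1 : is_derive Ropp z (-1)%R) by (auto_derive; [exact I|ring]).
    pose proof (is_derive_comp E Ropp z _ _ (E_derive _) D1) as D2.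
    pose proof (is_derive_plus E (fun z => E (- z)) z _ _ (E_derive z) D2) as D3.
    replace 0%R with (plus (2 * gauss z)%R (scal (-1)%R (2 * gauss (- z))%R)); [exact D3|].
    replace (gauss (- z)) with (gauss z) by (unfold gauss; f_equal; ring).
    unfold plus, scal; simpl; unfold mult; simpl; ring. }
  destruct (MVT_gen (fun z => (E z + E (- z))%R) 0 x (fun _ => 0%R)) as [c [_ Ec]].
  - intros y _; apply D.
  - intros y _; apply derivable_continuous_pt; exists 0%R; apply is_derive_Reals, D.
  - simpl in Ec; rewrite Ropp_0, E_0 in Ec; lra. }
destruct (Rle_lt_dec 0 x) as [H|H]; [now apply P|].
pose proof (P (- x)%R ltac:(lra)) as Q; rewrite Ropp_involutive in Q; lra.
Qed.

Lemma E_step (h : R) (k : nat) : (0 < h)%R ->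
  (2 * h * gauss (INR (S k) * h) <= E (INR (S k) * h) - E (INR k * h) <= 2 * h * gauss (INR k * h))%R.
Proof.
intros Hh; pose proof (pos_INR k) as Hk.
assert (L : (INR k * h <= INR (S k) * h)%R) by (rewrite S_INR; nra).
assert (L0 : (0 <= INR k * h)%R) by (apply Rmult_le_pos; lra).
destruct (MVT_gen E (INR k * h) (INR (S k) * h) (fun x => (2 * gauss x)%R)) as [c [Hc Ec]].
- intros x _; apply E_derive.
- intros x _; apply derivable_continuous_pt; exists (2 * gauss x)%R; apply is_derive_Reals, E_derive.
- rewrite Rmin_left, Rmax_right in Hc by exact L; rewrite Ec.
  replace (INR (S k) * h - INR k * h)%R with h by (rewrite S_INR; ring).
  pose proof (gauss_decr c (INR (S k) * h) ltac:(lra)); pose proof (gauss_decr (INR k * h) c ltac:(lra)).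
  split; nra.
Qed.

(** On each mesh interval monotonicity leaves a trapezoidal error of at most h times the drop of the
    Gaussian; the drops telescope, so the total error is at most h whatever N is. *)
Lemma E_riemann_sum (h : R) (N : nat) : (0 < h)%R ->
  (Rabs (E (INR N * h) - h * Rsum (zfoldR (fun k => gauss (IZR k * h))) N) <= h)%R.
Proof.
intros Hh.
assert (H : (Rabs (E (INR N * h) - h * Rsum (zfoldR (fun k => gauss (IZR k * h))) N) <=
             h * (1 - gauss (INR N * h)))%R).
{ induction N as [|N IH].
  - simpl; rewrite Rmult_0_l, E_0, Rmult_0_r, Rminus_0_r, Rabs_R0; unfold gauss.
    replace (- (PI * 0 ^ 2))%R with 0%R by ring; rewrite exp_0; lra.
  - cbn [Rsum]; pose proof (E_step h N Hh) as [S1 S2].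
    assert (Z1 : zfoldR (fun k => gauss (IZR k * h)) N = (gauss (INR N * h) + gauss (INR (S N) * h))%R).
    { unfold zfoldR; rewrite opp_IZR, <- !INR_IZR_INZ; f_equal; unfold gauss; f_equal; f_equal; ring. }
    rewrite Z1; apply Rabs_le_between in IH; apply Rabs_le; lra. }
eapply Rle_trans; [exact H|]; pose proof (gauss_pos (INR N * h)); nra.
Qed.

Lemma gauss_sum_tends (h : R) : (0 < h)%R ->
  tends eventually (fun N => RtoC (h * Rsum (zfoldR (fun k => gauss (IZR k * h))) N))
    (RtoC (sqrt (h * h)) * Zsum (poisson_left_C (h * h) 0 0)).
Proof.
intros Hh.
rewrite sqrt_square by lra.
apply tends_ext with (fun N => RtoC h * Csum (zfold (poisson_left_C (h * h) 0 0)) N).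
- apply eventually_filter.
- intros N; rewrite RtoC_mult; f_equal.
  induction N as [|N IH]; [reflexivity|]; cbn [Csum Rsum]; rewrite IH, RtoC_plus; f_equal.
  unfold zfold, zfoldR; rewrite RtoC_plus; f_equal; unfold poisson_left_C, gauss;
  rewrite <- Cexp_R; f_equal; rewrite RtoC_opp, !RtoC_mult, RtoC_pow, !RtoC_mult, !Cpow_2; ring.
- apply tends_scal; [apply eventually_filter|].
  apply Zsum_tends, poisson_left_C_summable; nra.
Qed.

(** With mesh h = sqrt T the Riemann sum over all integers is sqrt T times a theta series, which
    tends to 1 at the cusp. The Gaussian integral is thus evaluated by Poisson summation. *)
Lemma gauss_mesh (eps : R) : (0 < eps)%R -> exists h, (0 < h < eps)%R /\
  exists N0, forall N, (N0 <= N)%nat ->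
    (Rabs (h * Rsum (zfoldR (fun k => gauss (IZR k * h))) N - 1) < eps)%R.
Proof.
intros Heps.
pose proof (theta_even_cusp 0 (eps / 2)%R ltac:(lra)) as H1.
destruct (filter_ex _ (filter_and _ _ at_right_pos (filter_and _ _ H1
  (at_right_lt (eps * eps) (Rmult_lt_0_compat _ _ Heps Heps))))) as [T [HT [H2 H3]]].
pose proof (sqrt_lt_R0 T HT) as Hs; exists (sqrt T); split.
- split; [exact Hs|]; rewrite <- (sqrt_square eps) by lra; apply sqrt_lt_1; nra.
- pose proof (gauss_sum_tends (sqrt T) Hs (eps / 2)%R ltac:(lra)) as [N0 HN0].
  rewrite sqrt_sqrt in HN0 by lra.
  exists N0; intros N HN; specialize (HN0 N HN).
  rewrite <- Cmod_R, RtoC_minus.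
  eapply Rle_lt_trans; [apply (Cmod_triangle_minus _ (RtoC (sqrt T) * Zsum (poisson_left_C T 0 0)))|lra].
Qed.

Lemma E_le_1 x : (E x <= 1)%R.
Proof.
apply Rnot_lt_le; intros H.
destruct (gauss_mesh ((E x - 1) / 3)%R ltac:(lra)) as [h [Hh [N0 HN]]].
destruct (INR_unbounded (x / h)%R) as [K HK].
set (N := (N0 + K)%nat).
assert (Hx : (x <= INR N * h)%R).
{ unfold N; rewrite plus_INR; pose proof (pos_INR N0).
  assert (x / h * h = x)%R by (field; lra); nra. }
pose proof (E_incr _ _ Hx) as H1.
pose proof (E_riemann_sum h N ltac:(lra)) as H2; apply Rabs_le_between in H2.
pose proof (HN N ltac:(unfold N; lia)) as H3; apply Rabs_def2 in H3; lra.
Qed.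

Lemma E_sup (eps : R) : (0 < eps)%R -> exists X, forall y, (X <= y)%R -> (1 - eps < E y)%R.
Proof.
intros Heps; destruct (gauss_mesh (eps / 3)%R ltac:(lra)) as [h [Hh [N0 HN]]].
exists (INR N0 * h)%R; intros y Hy.
pose proof (E_incr _ _ Hy); pose proof (E_riemann_sum h N0 ltac:(lra)) as H2; apply Rabs_le_between in H2.
pose proof (HN N0 ltac:(lia)) as H3; apply Rabs_def2 in H3; lra.
Qed.

(** The function F(y) = gauss(x) E(y - x) - E(y) is nondecreasing for y >= x, since x^2 + (y - x)^2
    <= y^2. Comparing F(x) = -E(x) with large y, where E(y) is close to 1 and E(y - x) at most 1,
    gives the bound. *)
Lemma one_minus_E_le x : (0 <= x)%R -> (1 - E x <= gauss x)%R.
Proof.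
intros Hx; apply Rle_plus_epsilon; intros eps Heps.
destruct (E_sup eps Heps) as [X HX]; set (y := Rmax X x).
pose proof (HX y (Rmax_l _ _)) as H1; pose proof (Rmax_r X x) as H2; fold y in H2.
set (F := fun y => (gauss x * E (y - x) - E y)%R).
assert (HF : (F x <= F y)%R).
{ apply (monotone_of_derive F (fun y => (gauss x * (2 * gauss (y - x)) - 2 * gauss y)%R)); [exact H2| |].
  - intros z; unfold F.
    assert (D1 : is_derive (fun y : R => (y - x)%R) z 1%R) by (auto_derive; [exact I|ring]).
    pose proof (is_derive_comp E (fun y : R => (y - x)%R) z _ _ (E_derive _) D1) as D2.
    pose proof (is_derive_scal (fun y : R => E (y - x)) z (gauss x) _ D2) as D3.
    pose proof (is_derive_minus _ E z _ _ D3 (E_derive z)) as D4.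
    replace (gauss x * (2 * gauss (z - x)) - 2 * gauss z)%R with
      (minus (gauss x * scal 1%R (2 * gauss (z - x))%R)%R (2 * gauss z)%R); [exact D4|].
    unfold minus, plus, opp, scal; simpl; unfold mult; simpl; ring.
  - intros z Hz.
    assert (gauss z <= gauss x * gauss (z - x))%R; [|lra].
    unfold gauss; rewrite <- exp_plus; apply exp_le_compat.
    pose proof PI_RGT_0 as HP.
    assert (I : (x ^ 2 + (z - x) ^ 2 <= z ^ 2)%R) by nra.
    pose proof (Rmult_le_compat_l PI _ _ ltac:(lra) I); lra. }
unfold F in HF; rewrite Rminus_diag, E_0 in HF.
pose proof (E_le_1 (y - x)); pose proof (gauss_pos x); nra.
Qed.

Lemma E_tail (x s : R) :
  ((0 <= x)%R /\ s = 1%R) \/ ((x <= 0)%R /\ s = (-1)%R) -> (Rabs (s - E x) <= gauss x)%R.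
Proof.
assert (P : forall x, (0 <= x)%R -> (Rabs (1 - E x) <= gauss x)%R).
{ clear; intros x Hx; rewrite Rabs_pos_eq; [now apply one_minus_E_le|pose proof (E_le_1 x); lra]. }
intros [[H ->]|[H ->]]; [now apply P|].
pose proof (P (- x)%R ltac:(lra)) as Q; rewrite E_opp in Q.
replace (gauss (- x)) with (gauss x) in Q by (unfold gauss; f_equal; ring).
rewrite <- Rabs_Ropp; replace (- (-1 - E x))%R with (1 - - E x)%R by ring; exact Q.
Qed.

(** For m = 1 and n = j + 2l the argument n - 1/2 - j + 2m of the sign is 2l + 3/2, which changes
    sign between l = -1 and l = 0. *)
Lemma sign_index (l : Z) :
  ((0 <= l)%Z /\ sign (2 * IZR l + 3 / 2) = 1%R) \/ ((l < 0)%Z /\ sign (2 * IZR l + 3 / 2) = (-1)%R).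
Proof.
destruct (Z.le_gt_cases 0 l) as [H|H]; [left|right]; (split; [exact H|]).
- apply sign_eq_1; apply IZR_le in H; lra.
- apply sign_eq_m1; assert (H' : (l <= -1)%Z) by lia; apply IZR_le in H'; lra.
Qed.

Lemma Im_half_period (T delta : R) : Im (Ci * T / 2 - delta) = (T / 2)%R.
Proof.
replace (Ci * T / 2 - delta) with (RtoC (- delta) + Ci * RtoC (T / 2))
  by (rewrite RtoC_opp, RtoC_div by lra; field).
unfold Ci, RtoC, Cmult, Cplus; simpl; ring.
Qed.

Lemma Im_2tau (T : R) : Im (2 * (Ci * T)) = (2 * T)%R.
Proof. unfold Ci, RtoC, Cmult; simpl; ring. Qed.

(** The modulus is 2 tau, so Im w / Im (2 tau) = 1/4, and after completing the square both E and the
    exponential depend on y = n - 1/2 only. Since 2 delta is an integer, delta contributes a phase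
    independent of l. *)
Lemma Rjm_term (T delta j : R) (l : Z) : (0 < T)%R -> Cexp (2 * PI * Ci * (2 * delta)) = 1 ->
  (let n := (j + 2 * 1 * IZR l)%R in
    RtoC (sign (n - 1 / 2 - j + 2 * 1)
          - E ((n - 2 * 1 * (Im (Ci * T / 2 - delta) / Im (2 * (Ci * T)))) * sqrt (Im (2 * (Ci * T)) / 1)))%R
    * Cexp (- (PI * Ci * n ^ 2 * (2 * (Ci * T)) / (2 * 1%R)) + 2 * PI * Ci * n * (Ci * T / 2 - delta))) =
  Cexp (- (PI * T / 4) - 2 * PI * Ci * j * delta) *
  RtoC ((sign (2 * IZR l + 3 / 2) - E ((j + 2 * IZR l - 1 / 2) * sqrt (2 * T))) *
        exp (PI * T * (j + 2 * IZR l - 1 / 2) ^ 2)).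
Proof.
intros HT Hd; cbv zeta; rewrite Im_half_period, Im_2tau.
replace (j + 2 * 1 * IZR l - 1 / 2 - j + 2 * 1)%R with (2 * IZR l + 3 / 2)%R by field.
replace (j + 2 * 1 * IZR l - 2 * 1 * (T / 2 / (2 * T)))%R with (j + 2 * IZR l - 1 / 2)%R by (field; lra).
replace (2 * T / 1)%R with (2 * T)%R by field.
set (c := (sign (2 * IZR l + 3 / 2) - E ((j + 2 * IZR l - 1 / 2) * sqrt (2 * T)))%R).
transitivity (RtoC c * (Cexp (RtoC (PI * T * (j + 2 * IZR l - 1 / 2) ^ 2)) *
  Cexp (- (PI * T / 4) - 2 * PI * Ci * j * delta))); [|rewrite (RtoC_mult c), Cexp_R; ring].
rewrite <- Cexp_plus; apply (f_equal (Cmult c)).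
assert (P : Cexp (2 * PI * Ci * (2 * delta) * IZR (- l)) = 1).
{ replace (2 * PI * Ci * (2 * delta) * IZR (- l)) with (IZR (- l) * (2 * PI * Ci * (2 * delta))) by ring.
  rewrite <- zpow_Cexp, Hd; apply zpow_1_l. }
match goal with |- _ = Cexp ?X => transitivity (Cexp X * Cexp (2 * PI * Ci * (2 * delta) * IZR (- l))) end;
  [rewrite <- Cexp_plus; f_equal|rewrite P; ring].
rewrite opp_IZR, RtoC_opp, !RtoC_mult, RtoC_pow, RtoC_minus, !RtoC_plus, !RtoC_mult, RtoC_div, !Cpow_2 by lra.
transitivity (- (PI * (Ci * Ci) * ((j + 2 * 1 * IZR l) * (j + 2 * 1 * IZR l)) * T) +
   PI * (Ci * Ci) * (j + 2 * 1 * IZR l) * T - 2 * PI * Ci * (j + 2 * 1 * IZR l) * delta); [field|].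
rewrite Ci2; field.
Qed.

(** The decay exp(-2 pi T y^2) of the difference between sign and E outweighs the growth exp(pi T
    y^2), so the series converges absolutely. *)
Lemma E_gauss_le (T y s : R) : (0 < T)%R ->
  ((0 <= y)%R /\ s = 1%R) \/ ((y <= 0)%R /\ s = (-1)%R) ->
  (Cmod (RtoC ((s - E (y * sqrt (2 * T))) * exp (PI * T * y ^ 2))) <= exp (- (PI * T) * y ^ 2))%R.
Proof.
intros HT Hy; pose proof (sqrt_lt_R0 (2 * T) ltac:(lra)) as Hs.
rewrite Cmod_R, Rabs_mult, (Rabs_pos_eq (exp _)) by (apply Rlt_le, exp_pos).
apply Rle_trans with (gauss (y * sqrt (2 * T)) * exp (PI * T * y ^ 2))%R.
- apply Rmult_le_compat_r; [apply Rlt_le, exp_pos|]; apply E_tail.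
  destruct Hy as [[H E0]|[H E0]]; [left|right]; (split; [nra|exact E0]).
- unfold gauss; rewrite <- exp_plus; apply exp_le_compat.
  replace ((y * sqrt (2 * T)) ^ 2)%R with (y ^ 2 * (sqrt (2 * T) * sqrt (2 * T)))%R by ring.
  rewrite sqrt_sqrt by lra; right; ring.
Qed.

Lemma Rjm_one_half (T delta : R) : (0 < T)%R -> Cexp (2 * PI * Ci * (2 * delta)) = 1 ->
  Rjm (1 / 2) 1 (2 * (Ci * T)) (Ci * T / 2 - delta) = Cexp (- (PI * T / 4) - PI * Ci * delta).
Proof.
intros HT Hd; unfold Rjm.
etransitivity; [apply Zsum_ext; intros l; exact (Rjm_term T delta (1 / 2)%R l HT Hd)|].
set (g := fun l : Z => RtoC ((sign (2 * IZR l + 3 / 2) - E ((1 / 2 + 2 * IZR l - 1 / 2) * sqrt (2 * T))) *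
        exp (PI * T * (1 / 2 + 2 * IZR l - 1 / 2) ^ 2))).
assert (Y : forall l, (1 / 2 + 2 * IZR l - 1 / 2 = 2 * IZR l)%R) by (intros; lra).
assert (S : abs_summable g).
{ assert (HA : (0 < 4 * (PI * T))%R) by (pose proof PI_RGT_0; nra).
  apply abs_summable_le with (1 := summable_gauss 1 (4 * (PI * T)) 0 Rle_0_1 HA).
  intros l; unfold g; rewrite Y, Rmult_1_l.
  eapply Rle_trans; [apply (E_gauss_le T (2 * IZR l)); [exact HT|]|apply exp_le_compat; right; ring].
  destruct (sign_index l) as [[H E0]|[H E0]]; [left|right]; (split; [|exact E0]).
  - apply IZR_le in H; lra.
  - apply IZR_lt in H; lra. }
assert (V : Zsum g = 1).
{ assert (E2 : Zsum (fun l => g l + g (0 - l)%Z) = 2).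
  { rewrite Zsum_single.
    - change (0 - 0)%Z with 0%Z; unfold g; rewrite !Y.
      destruct (sign_index 0) as [[_ E0]|[H _]]; [|lia]; rewrite E0, Rmult_0_r, Rmult_0_l, E_0.
      replace (PI * T * 0 ^ 2)%R with 0%R by ring; rewrite exp_0, <- RtoC_plus; f_equal; ring.
    - intros k Hk; unfold g; rewrite !Y, <- RtoC_plus, minus_IZR.
      replace (2 * (0 - IZR k) * sqrt (2 * T))%R with (- (2 * IZR k * sqrt (2 * T)))%R by ring.
      rewrite E_opp; replace ((2 * (0 - IZR k)) ^ 2)%R with ((2 * IZR k) ^ 2)%R by ring.
      assert (E3 : sign (2 * (0 - IZR k) + 3 / 2) = (- sign (2 * IZR k + 3 / 2))%R).
      { rewrite <- minus_IZR; destruct (sign_index k) as [[H1 ->]|[H1 ->]];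
          destruct (sign_index (0 - k)) as [[H2 ->]|[H2 ->]]; try lia; ring. }
      rewrite E3; f_equal; ring. }
  rewrite Zsum_plus, Zsum_reflect in E2 by (try apply abs_summable_reflect; exact S).
  apply Cmult_cancel_l with (RtoC 2); [apply RtoC_neq_0; lra|].
  transitivity (Zsum g + Zsum g); [ring|rewrite E2; ring]. }
etransitivity; [exact (Zsum_scal _ g S)|]; rewrite V, Cmult_1_r; f_equal; rewrite RtoC_div by lra; field.
Qed.

Lemma Rjm_three_half (T delta : R) : (0 < T)%R -> Cexp (2 * PI * Ci * (2 * delta)) = 1 ->
  Rjm (3 / 2) 1 (2 * (Ci * T)) (Ci * T / 2 - delta) = 0.
Proof.
intros HT Hd; unfold Rjm.
etransitivity; [apply Zsum_ext; intros l; exact (Rjm_term T delta (3 / 2)%R l HT Hd)|].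
set (g := fun l : Z => RtoC ((sign (2 * IZR l + 3 / 2) - E ((3 / 2 + 2 * IZR l - 1 / 2) * sqrt (2 * T))) *
        exp (PI * T * (3 / 2 + 2 * IZR l - 1 / 2) ^ 2))).
assert (Y : forall l, (3 / 2 + 2 * IZR l - 1 / 2 = 2 * IZR l + 1)%R) by (intros; lra).
assert (S : abs_summable g).
{ assert (HA : (0 < 4 * (PI * T))%R) by (pose proof PI_RGT_0; nra).
  apply abs_summable_le with (1 := summable_gauss 1 (4 * (PI * T)) (4 * (PI * T)) Rle_0_1 HA).
  intros l; unfold g; rewrite Y, Rmult_1_l.
  eapply Rle_trans; [apply (E_gauss_le T (2 * IZR l + 1)); [exact HT|]|apply exp_le_compat].
  - destruct (sign_index l) as [[H E0]|[H E0]]; [left|right]; (split; [|exact E0]).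
    + apply IZR_le in H; lra.
    + assert (H' : (l <= -1)%Z) by lia; apply IZR_le in H'; lra.
  - pose proof (Rle_abs (- IZR l)) as H1; rewrite Rabs_Ropp in H1; nra. }
assert (V : Zsum g = 0).
(* Here y = 2l + 1, and the reflection l -> -1 - l sending y to -y has no fixed point, so nothing
   survives. *)
{ apply C_double_eq_0; rewrite <- Zsum_opp by exact S; rewrite <- (Zsum_mirror g).
  apply Zsum_ext; intros k; unfold g; rewrite !Y, <- RtoC_opp, minus_IZR.
  replace (2 * (-1 - IZR k) + 1)%R with (- (2 * IZR k + 1))%R by ring.
  replace (- (2 * IZR k + 1) * sqrt (2 * T))%R with (- ((2 * IZR k + 1) * sqrt (2 * T)))%R by ring.
  rewrite E_opp; replace ((- (2 * IZR k + 1)) ^ 2)%R with ((2 * IZR k + 1) ^ 2)%R by ring.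
  assert (E3 : sign (2 * (-1 - IZR k) + 3 / 2) = (- sign (2 * IZR k + 3 / 2))%R).
  { rewrite <- minus_IZR; destruct (sign_index k) as [[H1 ->]|[H1 ->]];
      destruct (sign_index (-1 - k)) as [[H2 ->]|[H2 ->]]; try lia; ring. }
  rewrite E3; f_equal; ring. }
etransitivity; [exact (Zsum_scal _ g S)|]; rewrite V; ring.
Qed.

(** * Phi and its modification at m = 1 *)

Lemma nome_Cexp (T : R) : nome T = Cexp (2 * PI * Ci * (Ci * T)).
Proof.
unfold nome; rewrite <- Cexp_R; f_equal.
transitivity (2 * PI * (Ci * Ci) * T); [rewrite Ci2, RtoC_opp, !RtoC_mult|]; ring.
Qed.

Lemma IZR_2mul (j : Z) : RtoC (IZR (2 * j)) = 2 * RtoC (IZR j).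
Proof. now rewrite mult_IZR, RtoC_mult. Qed.

Lemma IZR_tri_C (n : Z) : RtoC (IZR (tri n)) = (RtoC (IZR n) * RtoC (IZR n) - RtoC (IZR n)) / 2.
Proof. rewrite IZR_tri, RtoC_div, RtoC_minus, RtoC_pow, Cpow_2 by lra; reflexivity. Qed.

Lemma half_nat_2 : RtoC (half_nat 2) = 1.
Proof. unfold half_nat; f_equal; simpl; field. Qed.

Lemma half_int_C (S : Z) : RtoC (half_int S) = RtoC (IZR S) / 2.
Proof. unfold half_int; rewrite RtoC_div by lra; reflexivity. Qed.

Lemma Cexp_Ci_half_PI : Cexp (PI * Ci / 2) = Ci.
Proof.
replace (PI * Ci / 2) with (Ci * RtoC (PI / 2)) by (rewrite RtoC_div by lra; field).
rewrite Cexp_I, cos_PI2, sin_PI2; ring.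
Qed.

Lemma Copp_involutive (z : C) : - - z = z.
Proof. ring. Qed.

Lemma Ci_Cexp (z : C) : Ci * Cexp z = Cexp (PI * Ci / 2 + z).
Proof. now rewrite Cexp_plus, Cexp_Ci_half_PI. Qed.

Lemma opp_Ci_Cexp (z : C) : - (Ci * Cexp z) = Cexp (- (PI * Ci / 2) + z).
Proof.
rewrite Ci_Cexp, (Cexp_plus (PI * Ci / 2)), Cexp_plus, (Cexp_opp (PI * Ci / 2)), Cexp_Ci_half_PI.
assert (N : Ci <> 0).
{ intros E; apply C1_nz; transitivity (- (Ci * Ci)); [rewrite Ci2; ring|rewrite E; ring]. }
apply Cmult_cancel_l with Ci; [exact N|].
transitivity (- (Ci * Ci) * Cexp z); [ring|rewrite Ci2; field; exact N].
Qed.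

(** * Mumford thetas in multiplicative variables *)

Section ThetaForms.

Context (T : R) (HT : (0 < T)%R).

Let tau : C := Ci * T.
Let q : C := nome T.

Lemma q_Cexp : q = Cexp (2 * PI * Ci * tau).
Proof. apply nome_Cexp. Qed.

Lemma tau_gauss (c : C) (k : Z) (A : R) (B : C) : (0 < A)%R ->
  abs_summable (fun k => c * Cexp (PI * Ci * tau * A * IZR k ^ 2 + B * IZR k)).
Proof.
intros HA; pose proof PI_RGT_0 as HP.
pose proof (Rmult_lt_0_compat _ _ (Rmult_lt_0_compat _ _ HP HT) HA) as P.
apply abs_summable_ext with (2 := gauss_summable (PI * T * A) c B P).
intros j; f_equal; f_equal; f_equal; unfold tau; rewrite !RtoC_mult.
transitivity (PI * (Ci * Ci) * T * A * IZR j ^ 2); [rewrite Ci2|]; ring.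
Qed.

Lemma vartheta00_Th w : vartheta 0 0 tau w = Th q (Cexp (2 * PI * Ci * (w + tau / 2))).
Proof.
unfold vartheta, Th; apply Zsum_ext; intros n; unfold theta_term.
rewrite q_Cexp, !zpow_Cexp, IZR_tri_C, <- Cexp_plus; f_equal; simpl INR; rewrite Cpow_2; field.
Qed.

Lemma vartheta01_Th w : vartheta 0 1 tau w = Th q (- Cexp (2 * PI * Ci * (w + tau / 2))).
Proof.
replace (- Cexp (2 * PI * Ci * (w + tau / 2))) with (Cexp (2 * PI * Ci * (w + tau / 2) + PI * Ci))
  by (rewrite Cexp_plus, Cexp_PI_Ci; ring).
unfold vartheta, Th; apply Zsum_ext; intros n; unfold theta_term.
rewrite q_Cexp, !zpow_Cexp, IZR_tri_C, <- Cexp_plus; f_equal; simpl INR; rewrite Cpow_2; field.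
Qed.

Lemma Th_terms_summable (z : C) : abs_summable (theta_term q (Cexp z)).
Proof. apply theta_term_summable; [apply nome_neq_0|now apply nome_lt_1|apply Cexp_neq_0]. Qed.

Lemma vartheta10_Th w :
  vartheta 1 0 tau w = Cexp (PI * Ci * tau / 4 + PI * Ci * w) * Th q (Cexp (2 * PI * Ci * (w + tau))).
Proof.
unfold vartheta, Th; rewrite <- Zsum_scal by apply Th_terms_summable.
apply Zsum_ext; intros n; unfold theta_term.
rewrite q_Cexp, !zpow_Cexp, IZR_tri_C, <- !Cexp_plus; f_equal; simpl INR; rewrite Cpow_2; field.
Qed.

Lemma vartheta11_Th w :
  vartheta 1 1 tau w = Ci * Cexp (PI * Ci * tau / 4 + PI * Ci * w) * Th q (- Cexp (2 * PI * Ci * (w + tau))).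
Proof.
replace (- Cexp (2 * PI * Ci * (w + tau))) with (Cexp (2 * PI * Ci * (w + tau) + PI * Ci))
  by (rewrite Cexp_plus, Cexp_PI_Ci; ring).
unfold vartheta, Th; rewrite <- Zsum_scal by apply Th_terms_summable.
apply Zsum_ext; intros n; unfold theta_term.
rewrite Ci_Cexp, q_Cexp, !zpow_Cexp, IZR_tri_C, <- !Cexp_plus; f_equal; simpl INR; rewrite Cpow_2; field.
Qed.

Lemma eta_cube : eta tau * (eta tau * eta tau) = Cexp (PI * Ci * tau / 4) * (phi q * (phi q * phi q)).
Proof.
unfold tau, q; rewrite eta_phi, <- Cexp_R.
replace (Cexp (PI * Ci * (Ci * T) / 4)) with
  (Cexp (RtoC (- (PI * T / 12))) * (Cexp (RtoC (- (PI * T / 12))) * Cexp (RtoC (- (PI * T / 12)))));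
  [ring|].
rewrite <- !Cexp_plus; f_equal; rewrite RtoC_opp, RtoC_div, RtoC_mult by lra.
transitivity (PI * (Ci * Ci) * T / 4); [rewrite Ci2|]; field.
Qed.

(** * The functions Phi as Appell sums of base q *)

Section PhiForms.

Context (delta : R) (Hdelta : Cexp (2 * PI * Ci * (2 * delta)) = 1) (w : C).

Let z1 : C := w + tau / 2 - delta.
Let z2 : C := w - tau / 2 + delta.
Let v : C := Cexp (2 * PI * Ci * z1).
Let rho : C := Cexp (PI * Ci * tau - 2 * PI * Ci * delta).
Let h : C := Cexp (PI * Ci * z1).
Let pf : C := Cexp (- (2 * PI * Ci * 1 * (tau / 8))).

Context (Hpole : forall j, v * zpow q j <> 1).

(** Characters (delta = 1/2) and supercharacters (delta = 0) are treated together. Only the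
    integrality of 2 delta enters, so two exponents need to agree only up to multiples of 2 pi i (2
    delta). *)
Lemma Cexp_phase (A B : C) (k : Z) : A = B + 2 * PI * Ci * (2 * delta) * IZR k -> Cexp A = Cexp B.
Proof.
intros ->; rewrite Cexp_plus.
replace (2 * PI * Ci * (2 * delta) * IZR k) with (IZR k * (2 * PI * Ci * (2 * delta))) by ring.
rewrite <- zpow_Cexp, Hdelta, zpow_1_l; ring.
Qed.

(** With [beta], the numerators in [Phi1] and [Phi2] for s = 1/2; those for s = 3/2 are obtained by
    multiplying with [pole1] and [pole2]. *)
Definition alpha (j : Z) : C :=
  Cexp (2 * PI * Ci * IZR j * (z1 + z2) + PI * Ci * z1 + 2 * PI * Ci * tau * (2 * (IZR j * IZR j) + IZR j)).
Definition beta (j : Z) : C :=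
  Cexp (- (2 * PI * Ci * IZR j * (z1 + z2)) - PI * Ci * z2 + 2 * PI * Ci * tau * (2 * (IZR j * IZR j) + IZR j)).
Definition pole1 (j : Z) : C := Cexp (2 * PI * Ci * z1) * Cexp (2 * PI * Ci * IZR j * (2 * tau)).
Definition pole2 (j : Z) : C := Cexp (- (2 * PI * Ci * z2)) * Cexp (2 * PI * Ci * IZR j * (2 * tau)).

Lemma alpha_summable : abs_summable alpha.
Proof.
apply abs_summable_ext with (2 := tau_gauss (Cexp (PI * Ci * z1)) 0 4
  (2 * PI * Ci * (z1 + z2) + 2 * PI * Ci * tau) ltac:(lra)).
intros j; unfold alpha; rewrite <- Cexp_plus; f_equal; rewrite Cpow_2; ring.
Qed.

Lemma beta_summable : abs_summable beta.
Proof.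
apply abs_summable_ext with (2 := tau_gauss (Cexp (- (PI * Ci * z2))) 0 4
  (- (2 * PI * Ci * (z1 + z2)) + 2 * PI * Ci * tau) ltac:(lra)).
intros j; unfold beta; rewrite <- Cexp_plus; f_equal; rewrite Cpow_2; ring.
Qed.

Lemma pole1_eq j : pole1 j = v * zpow q (2 * j).
Proof. unfold pole1; rewrite q_Cexp, zpow_Cexp, IZR_2mul; f_equal; f_equal; ring. Qed.

Lemma pole1_neq j : 1 - pole1 j <> 0.
Proof.
rewrite pole1_eq; intros E; apply (Hpole (2 * j)).
replace (v * zpow q (2 * j)) with (1 - (1 - v * zpow q (2 * j))) by ring; rewrite E; ring.
Qed.

Lemma IZR_odd_index (j : Z) : RtoC (IZR (2 * (-1 - j) + 1)) = -(1) - 2 * RtoC (IZR j).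
Proof.
replace (2 * (-1 - j) + 1)%Z with (-1 - 2 * j)%Z by lia.
rewrite minus_IZR, RtoC_minus, IZR_2mul, RtoC_m1; reflexivity.
Qed.

(** Since z1 - z2 = tau - 2 delta, the poles of [Phi2] sit at the odd powers of q missing from
    [pole1_eq]. This interleaving is what merges [Phi1] and [Phi2] into one Appell sum. *)
Lemma pole2_eq j : v * zpow q (2 * (-1 - j) + 1) = / pole2 j.
Proof.
unfold pole2; rewrite <- Cexp_plus, <- Cexp_opp, q_Cexp, zpow_Cexp, IZR_odd_index.
unfold v; rewrite <- Cexp_plus; apply Cexp_phase with (-1)%Z; rewrite RtoC_m1; unfold z1, z2; field.
Qed.

Lemma pole2_neq_0 j : pole2 j <> 0.
Proof. unfold pole2; apply Cmult_neq_0; apply Cexp_neq_0. Qed.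

Lemma pole2_neq j : 1 - pole2 j <> 0.
Proof.
intros E; apply (Hpole (2 * (-1 - j) + 1)); rewrite pole2_eq.
replace (pole2 j) with (1 - (1 - pole2 j)) by ring; rewrite E; field; apply C1_nz.
Qed.

Lemma pole2_minus_neq j : pole2 j - 1 <> 0.
Proof.
intros E; apply (pole2_neq j); transitivity (- (pole2 j - 1)); [ring|rewrite E; ring].
Qed.

Lemma inv_pole2_neq j : 1 - / pole2 j <> 0.
Proof.
rewrite <- pole2_eq; intros E; apply (Hpole (2 * (-1 - j) + 1)).
replace (v * zpow q (2 * (-1 - j) + 1)) with (1 - (1 - v * zpow q (2 * (-1 - j) + 1))) by ring; rewrite E; ring.
Qed.

Lemma v_neq_0 : v <> 0.
Proof. apply Cexp_neq_0. Qed.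

(** The even-indexed Appell terms are those of [Phi1]; the odd-indexed ones, traversed by j -> -1 -
    j, are minus those of [Phi2]. *)
Lemma Phi_even_form :
  Phi 2 2 (2 * tau) z1 z2 (tau / 8) = pf * (v * Zsum (appell_even_term q v)).
Proof.
destruct (appell_even q (nome_neq_0 T) (nome_lt_1 T HT) v v_neq_0 Hpole) as [S _].
destruct (summable_even_odd _ S) as [Se So].
unfold Phi, Phi1, Phi2; cbv zeta; rewrite half_nat_2, half_int_C; fold pf.
rewrite (Zsum_even_odd _ S), Cmult_plus_distr_l, <- (Zsum_scal v _ Se), <- (Zsum_scal v _ So).
unfold Cminus; rewrite Cmult_plus_distr_l; f_equal; [f_equal|].
- apply Zsum_ext; intros j; fold (pole1 j); unfold appell_even_term; rewrite <- pole1_eq.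
  transitivity (v * (zpow q (2 * j) * zpow q (tri (2 * j)) * zpow v (2 * j)) / (1 - pole1 j)); [|unfold Cdiv; ring].
  unfold Cdiv; f_equal.
  rewrite q_Cexp, !zpow_Cexp, IZR_tri_C, IZR_2mul, Cpow_2; unfold v; rewrite zpow_Cexp, IZR_2mul, <- !Cexp_plus.
  apply Cexp_phase with j; unfold z1, z2; field.
- assert (E : forall c x y : C, x = - y -> - (c * x) = c * y) by (intros c x y ->; ring).
  apply E; rewrite <- Zsum_opp by (now apply abs_summable_scal).
  rewrite <- (Zsum_mirror (fun k => - (v * appell_even_term q v (2 * k + 1)))).
  apply Zsum_ext; intros j; fold (pole2 j); unfold appell_even_term; rewrite pole2_eq.
  pose proof (pole2_neq j); pose proof (pole2_neq_0 j); pose proof (inv_pole2_neq j); pose proof (pole2_minus_neq j).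
  set (N0 := zpow q (2 * (-1 - j) + 1) * zpow q (tri (2 * (-1 - j) + 1)) * zpow v (2 * (-1 - j) + 1)).
  (* Because -1/(1 - 1/p) = p/(1 - p), inverting the pole produces the sign that turns the
     difference [Phi1] - [Phi2] into a single sum. *)
  transitivity (v * N0 * pole2 j / (1 - pole2 j)); [|field; repeat split; assumption].
  unfold Cdiv; f_equal.
  unfold N0, pole2; rewrite q_Cexp, !zpow_Cexp, IZR_tri_C, IZR_odd_index, Cpow_2; unfold v.
  rewrite zpow_Cexp, IZR_odd_index, <- !Cexp_plus.
  apply Cexp_phase with (- j)%Z; rewrite opp_IZR, RtoC_opp; unfold z1, z2; field.
Qed.

Lemma rho_square : - rho * - rho = q.
Proof.
rewrite q_Cexp; transitivity (rho * rho); [ring|]; unfold rho; rewrite <- Cexp_plus.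
apply Cexp_phase with (-1)%Z; rewrite RtoC_m1; ring.
Qed.

Let odd_term : Z -> C := appell_odd_term q (- rho) v.

Lemma odd_term_even j : h * odd_term (2 * j) = alpha j * (1 + pole1 j) / (1 - pole1 j).
Proof.
unfold odd_term, appell_odd_term; rewrite <- pole1_eq.
transitivity (h * (zpow (- - rho) (2 * j) * zpow q (tri (2 * j)) * zpow v (2 * j)) * (1 + pole1 j) / (1 - pole1 j));
  [unfold Cdiv; ring|unfold Cdiv; f_equal; f_equal].
replace (- - rho) with rho by ring.
unfold h, rho, alpha; rewrite q_Cexp, !zpow_Cexp, IZR_tri_C, IZR_2mul; unfold v.
rewrite zpow_Cexp, IZR_2mul, <- !Cexp_plus.
apply Cexp_phase with (- (2 * j))%Z; rewrite opp_IZR, RtoC_opp, IZR_2mul; unfold z1, z2; field.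
Qed.

Lemma odd_term_odd j : h * odd_term (2 * (-1 - j) + 1) = - (beta j * (1 + pole2 j) / (1 - pole2 j)).
Proof.
unfold odd_term, appell_odd_term; rewrite pole2_eq.
pose proof (pole2_neq j); pose proof (pole2_neq_0 j); pose proof (inv_pole2_neq j); pose proof (pole2_minus_neq j).
replace (- - rho) with rho by ring.
transitivity (h * (zpow rho (2 * (-1 - j) + 1) * zpow q (tri (2 * (-1 - j) + 1)) * zpow v (2 * (-1 - j) + 1)) *
  (1 + / pole2 j) / (1 - / pole2 j)); [unfold Cdiv; ring|].
replace (h * (zpow rho (2 * (-1 - j) + 1) * zpow q (tri (2 * (-1 - j) + 1)) * zpow v (2 * (-1 - j) + 1)))
  with (beta j); [field; repeat split; assumption|].
unfold h, rho, beta; rewrite q_Cexp, !zpow_Cexp, IZR_tri_C, IZR_odd_index; unfold v.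
rewrite zpow_Cexp, IZR_odd_index, <- !Cexp_plus; symmetry.
apply Cexp_phase with (1 + 2 * j)%Z; rewrite plus_IZR, RtoC_plus, IZR_2mul; unfold z1, z2; field.
Qed.

Lemma odd_term_summable : abs_summable odd_term.
Proof. exact (proj1 (appell_odd q (nome_neq_0 T) (nome_lt_1 T HT) (- rho) v rho_square v_neq_0 Hpole)). Qed.

(* [sg = 1] for s = 1/2 and [sg = -1] for s = 3/2: these two functions differ by a theta series,
   and their mean is the doubly quasi-periodic function. *)
Lemma Phi_odd_form (S : Z) (sg : C) : (S = 1%Z /\ sg = 1) \/ (S = 3%Z /\ sg = -(1)) ->
  Phi 2 S (2 * tau) z1 z2 (tau / 8) =
  pf * (1 / 2 * h * Zsum odd_term) + sg * (1 / 2 * (pf * (Zsum alpha - Zsum beta))).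
Proof.
intros HS; pose proof odd_term_summable as Ho; pose proof alpha_summable as Ha; pose proof beta_summable as Hb.
destruct (summable_even_odd _ Ho) as [Se So].
assert (E1 : Zsum (fun j => Cexp (2 * PI * Ci * half_nat 2 * IZR j * (z1 + z2) + 2 * PI * Ci * half_int S * z1)
    * Cexp (2 * PI * Ci * (2 * tau) * (half_nat 2 * IZR j ^ 2 + half_int S * IZR j))
    / (1 - Cexp (2 * PI * Ci * z1) * Cexp (2 * PI * Ci * IZR j * (2 * tau)))) =
  1 / 2 * h * Zsum (fun j => odd_term (2 * j)) + sg * (1 / 2) * Zsum alpha).
{ rewrite <- (Zsum_scal (1 / 2 * h) _ Se), <- (Zsum_scal (sg * (1 / 2)) _ Ha), <- Zsum_plus
    by (now apply abs_summable_scal).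
  apply Zsum_ext; intros j; fold (pole1 j).
  replace (1 / 2 * h * odd_term (2 * j)) with (1 / 2 * (h * odd_term (2 * j))) by ring.
  rewrite odd_term_even; pose proof (pole1_neq j); rewrite half_nat_2, half_int_C, <- Cexp_plus, Cpow_2.
  destruct HS as [[-> ->]|[-> ->]].
  - transitivity (alpha j / (1 - pole1 j)); [|field; assumption].
    unfold Cdiv, alpha; f_equal; f_equal; field.
  - transitivity (alpha j * pole1 j / (1 - pole1 j)); [|field; assumption].
    unfold Cdiv, alpha, pole1; rewrite <- !Cexp_plus; f_equal; f_equal; field. }
assert (E2 : Zsum (fun j => Cexp (- (2 * PI * Ci * half_nat 2 * IZR j * (z1 + z2)) - 2 * PI * Ci * half_int S * z2)
    * Cexp (2 * PI * Ci * (2 * tau) * (half_nat 2 * IZR j ^ 2 + half_int S * IZR j))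
    / (1 - Cexp (- (2 * PI * Ci * z2)) * Cexp (2 * PI * Ci * IZR j * (2 * tau)))) =
  - (1 / 2 * h) * Zsum (fun j => odd_term (2 * j + 1)) + sg * (1 / 2) * Zsum beta).
{ rewrite <- (Zsum_mirror (fun j => odd_term (2 * j + 1))).
  assert (So' : abs_summable (fun j => odd_term (2 * (-1 - j) + 1)))
    by (exact (abs_summable_reflect (fun j => odd_term (2 * j + 1)) (-1) So)).
  rewrite <- (Zsum_scal (- (1 / 2 * h)) _ So'), <- (Zsum_scal (sg * (1 / 2)) _ Hb), <- Zsum_plus
    by (now apply abs_summable_scal).
  apply Zsum_ext; intros j; fold (pole2 j).
  replace (- (1 / 2 * h) * odd_term (2 * (-1 - j) + 1)) with (- (1 / 2) * (h * odd_term (2 * (-1 - j) + 1))) by ring.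
  rewrite odd_term_odd; pose proof (pole2_neq j); rewrite half_nat_2, half_int_C, <- Cexp_plus, Cpow_2.
  destruct HS as [[-> ->]|[-> ->]].
  - transitivity (beta j / (1 - pole2 j)); [|field; assumption].
    unfold Cdiv, beta; f_equal; f_equal; field.
  - transitivity (beta j * pole2 j / (1 - pole2 j)); [|field; assumption].
    unfold Cdiv, beta, pole2; rewrite <- !Cexp_plus; f_equal; f_equal; field. }
unfold Phi, Phi1, Phi2; cbv zeta; rewrite E1, E2, half_nat_2; fold pf.
rewrite (Zsum_even_odd _ Ho); ring.
Qed.

(** The difference of the cases s = 1/2 and s = 3/2 has no poles; up to a factor, [alpha] lists the
    even-indexed terms of vartheta_11 and [- beta] the odd-indexed ones. *)
Lemma alpha_beta_vartheta :
  pf * (Zsum alpha - Zsum beta) = - (Ci * Cexp (- (PI * Ci * delta)) * vartheta 1 1 tau w).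
Proof.
set (d := Cexp (- (PI * Ci * delta))).
assert (Nd : d <> 0) by apply Cexp_neq_0.
assert (E : vartheta 1 1 tau w = Ci * / d * pf * (Zsum alpha - Zsum beta)).
{ assert (S : abs_summable (fun n : Z =>
    Cexp (PI * Ci * tau * (IZR n + INR 1 / 2) ^ 2 + 2 * PI * Ci * (IZR n + INR 1 / 2) * (w + INR 1 / 2)))).
  { apply abs_summable_ext with (2 := tau_gauss (Cexp (PI * Ci * tau / 4 + PI * Ci * (w + 1 / 2))) 0 1
      (PI * Ci * tau + 2 * PI * Ci * (w + 1 / 2)) ltac:(lra)).
    intros j; rewrite <- Cexp_plus; f_equal; simpl INR; rewrite !Cpow_2; field. }
  pose proof alpha_summable as Ha; pose proof beta_summable as Hb.
  unfold vartheta; rewrite (Zsum_even_odd _ S).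
  rewrite <- (Zsum_mirror (fun k => Cexp (PI * Ci * tau * (IZR (2 * k + 1) + INR 1 / 2) ^ 2 +
    2 * PI * Ci * (IZR (2 * k + 1) + INR 1 / 2) * (w + INR 1 / 2)))).
  transitivity (Ci * / d * pf * Zsum alpha + (- (Ci * / d * pf)) * Zsum beta); [|ring].
  rewrite <- !Zsum_scal by assumption; f_equal; apply Zsum_ext; intros j.
  - transitivity (Ci * Cexp (PI * Ci * delta - 2 * PI * Ci * 1 * (tau / 8) + (2 * PI * Ci * IZR j * (z1 + z2) +
      PI * Ci * z1 + 2 * PI * Ci * tau * (2 * (IZR j * IZR j) + IZR j)))).
    2:{ unfold d, pf, alpha, Cminus; rewrite <- Cexp_opp, !Cexp_plus, Copp_involutive; ring. }
    rewrite Ci_Cexp, IZR_2mul.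
    match goal with |- _ = Cexp ?X => transitivity (Cexp X * Cexp (2 * PI * Ci * IZR j)) end;
      [rewrite <- Cexp_plus; f_equal; simpl INR; rewrite Cpow_2; unfold z1, z2; field|rewrite Cexp_2PI_Z; ring].
  - transitivity (- (Ci * Cexp (PI * Ci * delta - 2 * PI * Ci * 1 * (tau / 8) + (- (2 * PI * Ci * IZR j * (z1 + z2)) -
      PI * Ci * z2 + 2 * PI * Ci * tau * (2 * (IZR j * IZR j) + IZR j))))).
    2:{ unfold d, pf, beta, Cminus; rewrite <- Cexp_opp, !Cexp_plus, Copp_involutive; ring. }
    rewrite opp_Ci_Cexp, IZR_odd_index.
    match goal with |- _ = Cexp ?X => transitivity (Cexp X * Cexp (2 * PI * Ci * IZR (- j))) end;
      [rewrite <- Cexp_plus; f_equal; rewrite opp_IZR, RtoC_opp; simpl INR; rewrite Cpow_2; unfold z1, z2; field|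
       rewrite Cexp_2PI_Z; ring]. }
rewrite E.
transitivity (- (Ci * Ci) * (d * / d) * (pf * (Zsum alpha - Zsum beta))); [|ring].
rewrite Ci2, Cinv_r by exact Nd; ring.
Qed.

(** The surviving R-value is [c], precisely the factor relating the theta functions of index 1/2 and
    -1/2 to the sums of [alpha] and [beta], so it cancels. *)
Lemma Phi_add_form :
  Phi_add 2 1 (2 * tau) z1 z2 (tau / 8) = - (1 / 2 * (pf * (Zsum alpha - Zsum beta))).
Proof.
pose proof alpha_summable as Ha; pose proof beta_summable as Hb.
assert (Hm : half_nat 2 = 1%R) by (unfold half_nat; simpl; field).
assert (Hs : half_int 1 = (1 / 2)%R) by reflexivity.
unfold Phi_add; cbv zeta; rewrite Hm, Hs; fold pf; cbn [Csum].
replace (1 / 2 + INR 0)%R with (1 / 2)%R by (simpl; ring).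
replace (1 / 2 + INR 1)%R with (3 / 2)%R by (simpl; field).
replace ((z1 - z2) / 2) with (tau / 2 - delta) by (unfold z1, z2; field).
pose proof (Rjm_three_half T delta HT Hdelta) as R3; pose proof (Rjm_one_half T delta HT Hdelta) as R1.
fold tau in R1, R3; rewrite R1, R3.
set (c := Cexp (- (PI * T / 4) - PI * Ci * delta)).
assert (Hc : c = Cexp (PI * Ci * tau / 4 - PI * Ci * delta)).
{ unfold c, tau; f_equal; transitivity (PI * (Ci * Ci) * T / 4 - PI * Ci * delta); [rewrite Ci2|]; field. }
assert (Nc : c <> 0) by apply Cexp_neq_0.
assert (Fa : forall j : Z, Cexp (2 * PI * Ci * 1 * (IZR j + RtoC (1 / 2) / (2 * 1)) * (z1 + z2)) *
    Cexp (2 * PI * Ci * (2 * tau) * 1 * (IZR j + RtoC (1 / 2) / (2 * 1)) ^ 2) = / c * alpha j).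
{ intros j; rewrite Hc; unfold alpha; rewrite <- Cexp_opp, <- !Cexp_plus; f_equal.
  rewrite RtoC_div, Cpow_2 by lra; unfold z1, z2; field. }
assert (Fb : forall j : Z, Cexp (2 * PI * Ci * 1 * (IZR j + RtoC (- (1 / 2)) / (2 * 1)) * (z1 + z2)) *
    Cexp (2 * PI * Ci * (2 * tau) * 1 * (IZR j + RtoC (- (1 / 2)) / (2 * 1)) ^ 2) = / c * beta (0 - j)).
{ intros j; rewrite Hc; unfold beta; rewrite <- Cexp_opp, <- !Cexp_plus; f_equal.
  rewrite RtoC_opp, RtoC_div, Cpow_2, minus_IZR, RtoC_minus by lra; unfold z1, z2; field. }
unfold theta; rewrite (Zsum_ext _ _ Fa), (Zsum_ext _ _ Fb).
rewrite (Zsum_scal (/ c) alpha Ha), (Zsum_scal (/ c) (fun j => beta (0 - j)) (abs_summable_reflect _ 0 Hb)).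
rewrite (Zsum_reflect beta 0 Hb); field; exact Nc.
Qed.

Lemma Phi_even_product :
  Phi 2 2 (2 * tau) z1 z2 (tau / 8) * Th q (- v) * (vartheta 0 0 tau 0 * vartheta 0 1 tau 0) =
  - (Ci * Cexp (- (2 * PI * Ci * delta)) * (eta tau * (eta tau * eta tau)) *
     vartheta 1 0 tau w * vartheta 1 1 tau w).
Proof.
set (s := Cexp (PI * Ci * tau)).
assert (Hs : s * s = q) by (rewrite q_Cexp; unfold s; rewrite <- Cexp_plus; f_equal; ring).
pose proof (appell_even_product q (nome_neq_0 T) (nome_lt_1 T HT) s v Hs v_neq_0 Hpole) as A.
assert (V0 : vartheta 0 0 tau 0 = Th q s).
{ rewrite vartheta00_Th; unfold s; f_equal; f_equal; field. }
assert (V1 : vartheta 0 1 tau 0 = Th q (- s)).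
{ rewrite vartheta01_Th; unfold s; f_equal; f_equal; f_equal; field. }
set (e := Cexp (- (2 * PI * Ci * delta))).
assert (He : e * e = 1).
{ unfold e; rewrite <- Cexp_plus, <- Cexp_0; apply Cexp_phase with (-1)%Z; rewrite RtoC_m1; ring. }
set (y := Cexp (2 * PI * Ci * (w + tau))).
assert (Hvs : v * s = e * y).
{ unfold v, s, e, y; rewrite <- !Cexp_plus; f_equal; unfold z1; field. }
(* The sign e distinguishes the two values of delta; y and -y both occur in the product, so it drops
   out of the theta factors. *)
assert (Epm : e = 1 \/ e = -(1)).
{ assert (E0 : (e - 1) * (e + 1) = 0) by (transitivity (e * e - 1); [ring|rewrite He; ring]).
  destruct (Ceq_dec (e - 1) 0) as [E|E].
  - left; replace e with (e - 1 + 1) by ring; rewrite E; ring.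
  - right; assert (E' : e + 1 = 0) by (apply Cmult_cancel_l with (e - 1); [exact E|rewrite E0; ring]).
    replace e with (e + 1 - 1) by ring; rewrite E'; ring. }
assert (Sym : Th q (v * s) * Th q (- (v * s)) = Th q y * Th q (- y)).
{ rewrite Hvs; destruct Epm as [-> | ->].
  - replace (1 * y) with y by ring; reflexivity.
  - replace (-(1) * y) with (- y) by ring; replace (- - y) with y by ring; ring. }
rewrite Sym, <- V0, <- V1 in A.
rewrite Phi_even_form, vartheta10_Th, vartheta11_Th, eta_cube; fold y.
set (P3 := phi q * (phi q * phi q)) in *.
transitivity (pf * v * (Th q (- v) * Zsum (appell_even_term q v) * (vartheta 0 0 tau 0 * vartheta 0 1 tau 0)));
  [ring|rewrite A].
transitivity (pf * v * P3 * Th q y * Th q (- y)); [ring|].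
transitivity ((- (Ci * Ci)) * (e * Cexp (PI * Ci * tau / 4) * (Cexp (PI * Ci * tau / 4 + PI * Ci * w) *
  Cexp (PI * Ci * tau / 4 + PI * Ci * w))) * P3 * Th q y * Th q (- y)); [|ring].
rewrite Ci2; replace (- - (1)) with (RtoC 1) by ring; rewrite Cmult_1_l; do 3 f_equal.
unfold pf, v, e; rewrite <- !Cexp_plus; f_equal; unfold z1; field.
Qed.

(** The factors at v, -v and -rho stay in the form [Th]: which of vartheta_00 and vartheta_01 they
    are depends on delta. *)
Lemma Phi_odd_product :
  pf * (1 / 2 * h * Zsum odd_term) * Th q (- v) * (vartheta 1 0 tau 0 * Th q (- rho)) =
  - (Ci * Cexp (- (PI * Ci * delta)) * (eta tau * (eta tau * eta tau)) * Th q v * vartheta 1 1 tau w).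
Proof.
pose proof (appell_odd_product q (nome_neq_0 T) (nome_lt_1 T HT) (- rho) v rho_square v_neq_0 Hpole) as A.
fold odd_term in A.
assert (V0 : vartheta 1 0 tau 0 = Cexp (PI * Ci * tau / 4) * Th q 1).
{ rewrite vartheta10_Th; f_equal; [f_equal; field|].
  (* One shift of the index shows that the theta series takes the same value at 1 and at q, the
     argument supplied by [vartheta10_Th]. *)
  rewrite (Th_shift q 1 1 (nome_neq_0 T) (nome_lt_1 T HT) C1_nz).
  unfold theta_term; change (tri 1) with 0%Z; rewrite zpow_1_l; simpl zpow.
  rewrite !Cmult_1_l, Cmult_1_r, q_Cexp; f_equal; f_equal; ring. }
assert (Hvr : v * - rho = - Cexp (2 * PI * Ci * (w + tau))).
{ transitivity (- (v * rho)); [ring|f_equal]; unfold v, rho; rewrite <- Cexp_plus.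
  apply Cexp_phase with (-1)%Z; rewrite RtoC_m1; unfold z1; field. }
rewrite Hvr in A; rewrite V0, vartheta11_Th, eta_cube.
set (P3 := phi q * (phi q * phi q)) in *; set (y := Th q (- Cexp (2 * PI * Ci * (w + tau)))) in *.
transitivity (pf * Cexp (PI * Ci * tau / 4) * h * / 2 *
  (Th q (- v) * Zsum odd_term * (Th q 1 * Th q (- rho)))); [field|rewrite A].
transitivity (pf * Cexp (PI * Ci * tau / 4) * h * (P3 * Th q v * y)); [field|].
transitivity ((- (Ci * Ci)) * (Cexp (- (PI * Ci * delta)) * Cexp (PI * Ci * tau / 4) *
  Cexp (PI * Ci * tau / 4 + PI * Ci * w)) * (P3 * Th q v * y)); [|ring].
rewrite Ci2; replace (- - (1)) with (RtoC 1) by ring; rewrite Cmult_1_l; f_equal.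
unfold pf, h; rewrite <- !Cexp_plus; f_equal; unfold z1; field.
Qed.

End PhiForms.

End ThetaForms.

(** * Exact values of the characters *)

Lemma locally'_ball (z : C) (r : R) (P : C -> Prop) :
  (0 < r)%R -> (forall w, (Cmod (w - z) < r)%R -> w <> z -> P w) -> locally' z P.
Proof.
intros Hr H.
apply (locally_le_locally_norm (V := C_NormedModule) z).
exists (mkposreal r Hr); intros w Hw Hne; apply H; [exact Hw|exact Hne].
Qed.

#[local] Instance locally'_proper (z : C) : ProperFilter (locally' z).
Proof.
constructor.
- intros P [eps HP]; exists (z + RtoC (eps / 2)); apply HP.
  + apply (norm_compat1 (V := C_NormedModule)).
    change (Cmod (z + RtoC (eps / 2) - z) < eps)%R.
    replace (z + RtoC (eps / 2) - z) with (RtoC (eps / 2)) by ring.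
    rewrite Cmod_R, Rabs_pos_eq; destruct eps as [e He]; simpl; lra.
  + intros E; assert (E' : RtoC (eps / 2) = 0)
      by (replace (RtoC (eps / 2)) with (z + RtoC (eps / 2) - z) by ring; rewrite E; ring).
    apply RtoC_inj in E'; destruct eps as [e He]; simpl in E'; lra.
- apply within_filter, locally_filter.
Qed.

Lemma tends_id (z : C) : tends (locally' z) (fun w => w) z.
Proof. intros eps Heps; apply locally'_ball with eps; auto. Qed.

(** An identity on a punctured neighbourhood together with continuity of the closed form gives the
    value at z, whether or not z is a removable singularity. *)
Lemma quotient_by_continuity_eq (num den f : C -> C) (z : C) :
  locally' z (fun w => num w / den w = f w) -> tends (locally' z) f (f z) ->
  quotient_by_continuity num den z = f z.
Proof.
intros H Hf; apply Clim_tends; [apply locally'_proper|].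
apply tends_ext_loc with f; [apply locally'_proper| |exact Hf].
revert H; apply filter_imp; intros w Hw; now symmetry.
Qed.

(** A ball of radius r/2 contains at most one point of S other than its centre; the radius is shrunk
    to avoid that point, and the centre is excluded already. *)
Lemma locally'_of_separated (S : C -> Prop) (r : R) (z : C) :
  (0 < r)%R -> (forall w w', S w -> S w' -> (Cmod (w - w') < r)%R -> w = w') ->
  locally' z (fun w => ~ S w).
Proof.
intros Hr Hsep.
destruct (Classical_Prop.classic (exists w0, S w0 /\ w0 <> z /\ (Cmod (w0 - z) < r / 2)%R))
  as [[w0 [H0 [H1 H2]]]|Hno].
- apply locally'_ball with (Cmod (w0 - z)).
  + apply Cmod_gt_0; intros E; apply H1; replace w0 with (w0 - z + z) by ring; rewrite E; ring.
  + intros w Hw Hne HS; assert (E : w = w0).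
    { apply Hsep; auto; eapply Rle_lt_trans; [apply (Cmod_triangle_minus w z)|].
      rewrite (Cmod_minus_sym z w0); lra. }
    rewrite E in Hw; lra.
- apply locally'_ball with (r / 2)%R; [lra|].
  intros w Hw Hne HS; apply Hno; now exists w.
Qed.

Lemma Im_le_Cmod (z : C) : (Rabs (Im z) <= Cmod z)%R.
Proof. destruct z as [x y]; eapply Rle_trans; [apply Rmax_r|apply (Rmax_Cmod (x, y))]. Qed.

Lemma Re_le_Cmod (z : C) : (Rabs (Re z) <= Cmod z)%R.
Proof. destruct z as [x y]; eapply Rle_trans; [apply Rmax_l|apply (Rmax_Cmod (x, y))]. Qed.

(** The excluded points form a coset of the lattice spanned by 1 and iT, whose nonzero elements have
    modulus at least min(1, T). *)
Lemma nome_powers_isolated (T : R) (c z : C) : (0 < T)%R -> c <> 0 ->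
  locally' z (fun w => forall j, c * Cexp (2 * PI * Ci * w) * zpow (nome T) j <> 1).
Proof.
intros HT Hc; pose proof PI_RGT_0 as HP.
set (S := fun w => exists j, c * Cexp (2 * PI * Ci * w) * zpow (nome T) j = 1).
assert (HS : locally' z (fun w => ~ S w)).
{ apply locally'_of_separated with (Rmin 1 T); [apply Rmin_glb_lt; lra|].
  intros w w' [j Hj] [j' Hj'] Hlt.
  pose proof (Rmin_l 1 T) as M1; pose proof (Rmin_r 1 T) as M2.
  (* Here exp(2 pi i u) = 1. The modulus makes u real, so |w - w'| < T forces j = j'; then u = w -
     w' is real and smaller than 1 in modulus, hence 0. *)
  set (u := w - w' + Ci * RtoC (T * IZR (j - j'))).
  assert (Eu : Cexp (2 * PI * Ci * u) = 1).
  { rewrite nome_Cexp, zpow_Cexp in Hj, Hj'.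
    replace (2 * PI * Ci * u) with ((2 * PI * Ci * w + IZR j * (2 * PI * Ci * (Ci * T))) -
      (2 * PI * Ci * w' + IZR j' * (2 * PI * Ci * (Ci * T))))
      by (unfold u; rewrite RtoC_mult, minus_IZR, RtoC_minus; ring).
    unfold Cminus; rewrite Cexp_plus, Cexp_opp, !Cexp_plus.
    rewrite <- Cmult_assoc in Hj, Hj'.
    set (A := Cexp (2 * PI * Ci * w) * Cexp (IZR j * (2 * PI * Ci * (Ci * T)))) in *.
    set (A' := Cexp (2 * PI * Ci * w') * Cexp (IZR j' * (2 * PI * Ci * (Ci * T)))) in *.
    assert (E : A = A') by (apply Cmult_cancel_l with c; [exact Hc|now rewrite Hj, Hj']).
    rewrite E; apply Cinv_r; unfold A'; apply Cmult_neq_0; apply Cexp_neq_0. }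
  assert (Im0 : Im u = 0%R).
  { pose proof (f_equal Cmod Eu) as E; rewrite Cmod_Cexp, Cmod_1, <- exp_0 in E; apply exp_inv in E.
    assert (E' : Re (2 * PI * Ci * u) = (- (2 * PI) * Im u)%R)
      by (destruct u as [x y]; unfold Ci, RtoC, Cmult; simpl; ring).
    rewrite E' in E; apply Rmult_integral in E; destruct E as [E|E]; lra. }
  assert (Imu : Im u = (Im (w - w') + T * IZR (j - j'))%R).
  { unfold u; destruct (w - w') as [x y]; unfold Ci, RtoC, Cmult, Cplus; simpl; ring. }
  assert (Hjj : (j - j' = 0)%Z).
  { pose proof (Im_le_Cmod (w - w')) as B.
    assert (B1 : (Rabs (T * IZR (j - j')) < T)%R).
    { replace (T * IZR (j - j'))%R with (- Im (w - w'))%R by lra; rewrite Rabs_Ropp; lra. }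
    rewrite Rabs_mult, Rabs_pos_eq, <- abs_IZR in B1 by lra.
    assert (B2 : (IZR (Z.abs (j - j')) < 1)%R) by nra.
    apply lt_IZR in B2; lia. }
  assert (Eu' : u = RtoC (Re (w - w'))).
  { rewrite Hjj, Rmult_0_r, Rplus_0_r in Imu.
    unfold u; rewrite Hjj, Rmult_0_r, (Re_Im_split (w - w')) at 1.
    rewrite <- Imu, Im0; ring. }
  set (t := Re (w - w')) in *.
  assert (Ht : (Rabs t < 1)%R) by (pose proof (Re_le_Cmod (w - w')); unfold t; lra).
  assert (T0 : t = 0%R).
  { destruct (Rtotal_order t 0) as [H|[H|H]]; [exfalso|exact H|exfalso].
    - rewrite Rabs_left in Ht by exact H.
      apply (Cexp_I_neq_1 (2 * PI * - t)); [split; nra|].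
      replace (Ci * RtoC (2 * PI * - t)) with (- (2 * PI * Ci * u))
        by (rewrite Eu', !RtoC_mult, RtoC_opp; ring).
      rewrite Cexp_opp, Eu; field; apply C1_nz.
    - rewrite Rabs_pos_eq in Ht by lra.
      apply (Cexp_I_neq_1 (2 * PI * t)); [split; nra|].
      replace (Ci * RtoC (2 * PI * t)) with (2 * PI * Ci * u)
        by (rewrite Eu', !RtoC_mult; ring).
      exact Eu. }
  assert (Ew : w - w' = 0).
  { transitivity u; [unfold u; rewrite Hjj, Rmult_0_r; ring|rewrite Eu', T0; reflexivity]. }
  replace w with (w - w' + w') by ring; rewrite Ew; ring. }
revert HS; apply filter_imp; intros w Hw j E; apply Hw; now exists j.
Qed.

Lemma tends_Th_shift (T : R) (c d z : C) : (0 < T)%R -> d <> 0 ->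
  tends (locally' z) (fun w => Th (nome T) (d * Cexp (2 * PI * Ci * (w + c))))
    (Th (nome T) (d * Cexp (2 * PI * Ci * (z + c)))).
Proof.
intros HT Hd.
apply tends_Th; [apply locally'_proper|apply nome_neq_0|now apply nome_lt_1| |].
- apply Cmult_neq_0; [exact Hd|apply Cexp_neq_0].
- apply tends_scal; [apply locally'_proper|].
  apply tends_Cexp; [apply locally'_proper|].
  apply tends_scal; [apply locally'_proper|].
  apply tends_plus; [apply locally'_proper|apply tends_id|apply tends_const, locally'_proper].
Qed.

Lemma tends_vartheta00 (T : R) (z : C) : (0 < T)%R ->
  tends (locally' z) (vartheta 0 0 (Ci * T)) (vartheta 0 0 (Ci * T) z).
Proof.
intros HT; pose proof (tends_Th_shift T (Ci * T / 2) 1 z HT C1_nz) as H.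
rewrite vartheta00_Th, <- (Cmult_1_l (Cexp _)).
refine (tends_ext _ _ _ _ _ H); intros w; now rewrite vartheta00_Th, Cmult_1_l.
Qed.

Lemma tends_vartheta01 (T : R) (z : C) : (0 < T)%R ->
  tends (locally' z) (vartheta 0 1 (Ci * T)) (vartheta 0 1 (Ci * T) z).
Proof.
intros HT; pose proof (tends_Th_shift T (Ci * T / 2) (-(1)) z HT (Copp_neq_0 _ C1_nz)) as H.
rewrite vartheta01_Th.
replace (- Cexp (2 * PI * Ci * (z + Ci * T / 2))) with (-(1) * Cexp (2 * PI * Ci * (z + Ci * T / 2))) by ring.
refine (tends_ext _ _ _ _ _ H); intros w; rewrite vartheta01_Th; f_equal; ring.
Qed.

Lemma tends_vartheta10 (T : R) (z : C) : (0 < T)%R ->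
  tends (locally' z) (vartheta 1 0 (Ci * T)) (vartheta 1 0 (Ci * T) z).
Proof.
intros HT; pose proof (tends_Th_shift T (Ci * T) 1 z HT C1_nz) as H.
rewrite vartheta10_Th, <- (Cmult_1_l (Cexp (2 * PI * Ci * (z + Ci * T)))) by exact HT.
apply tends_ext with (fun w => Cexp (PI * Ci * (Ci * T) / 4 + PI * Ci * w) *
  Th (nome T) (1 * Cexp (2 * PI * Ci * (w + Ci * T)))).
- apply locally'_proper.
- intros w; now rewrite vartheta10_Th, Cmult_1_l.
- apply tends_mult; [apply locally'_proper| |exact H].
  apply tends_Cexp; [apply locally'_proper|].
  apply tends_plus; [apply locally'_proper|apply tends_const, locally'_proper|].
  apply tends_scal; [apply locally'_proper|apply tends_id].
Qed.

(** * Closed forms of the characters *)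

Section Characters.

Context (T : R) (HT : (0 < T)%R).

Let tau : C := Ci * T.

(** The first condition avoids the poles of Phi and thereby the zeros of Th at -v, which is
    vartheta_00 or vartheta_01; the second avoids the zeros of the numerator of R. *)
Definition regular_point (delta : R) (w : C) : Prop :=
  (forall j, Cexp (2 * PI * Ci * (w + tau / 2 - delta)) * zpow (nome T) j <> 1) /\ vartheta 1 1 tau w <> 0.

Lemma regular_points (delta : R) (z : C) : locally' z (regular_point delta).
Proof.
assert (H1 := nome_powers_isolated T (Cexp (2 * PI * Ci * (tau / 2 - delta))) z HT (Cexp_neq_0 _)).
assert (H2 := nome_powers_isolated T (Cexp (2 * PI * Ci * tau)) z HT (Cexp_neq_0 _)).
generalize (filter_and _ _ H1 H2); apply filter_imp; intros w [W1 W2]; split.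
- intros j; replace (2 * PI * Ci * (w + tau / 2 - delta)) with
    (2 * PI * Ci * (tau / 2 - delta) + 2 * PI * Ci * w) by ring.
  rewrite Cexp_plus; apply W1.
- unfold tau; rewrite vartheta11_Th by exact HT.
  apply Cmult_neq_0; [apply Cmult_neq_0; [|apply Cexp_neq_0]|].
  + intros E; apply C1_nz; transitivity (- (Ci * Ci)); [rewrite Ci2; ring|rewrite E; ring].
  + apply Th_opp_neq_0; [apply nome_neq_0|now apply nome_lt_1|apply Cexp_neq_0|].
    intros j; replace (2 * PI * Ci * (w + Ci * T)) with (2 * PI * Ci * tau + 2 * PI * Ci * w)
      by (unfold tau; ring).
    rewrite Cexp_plus; apply W2.
Qed.

Lemma delta_plus : Cexp (2 * PI * Ci * (2 * RtoC (1 / 2))) = 1.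
Proof.
replace (2 * PI * Ci * (2 * RtoC (1 / 2))) with (2 * PI * Ci * IZR 1) by (rewrite RtoC_div by lra; field).
apply Cexp_2PI_Z.
Qed.

Lemma delta_minus : Cexp (2 * PI * Ci * (2 * RtoC 0)) = 1.
Proof. replace (2 * PI * Ci * (2 * RtoC 0)) with (RtoC 0) by ring; apply Cexp_0. Qed.

Lemma v_plus w : Cexp (2 * PI * Ci * (w + tau / 2 - RtoC (1 / 2))) = - Cexp (2 * PI * Ci * (w + tau / 2)).
Proof.
replace (2 * PI * Ci * (w + tau / 2 - RtoC (1 / 2))) with (2 * PI * Ci * (w + tau / 2) + - (PI * Ci))
  by (rewrite RtoC_div by lra; field).
rewrite Cexp_plus, Cexp_opp, Cexp_PI_Ci; field; apply C1_nz.
Qed.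

Lemma v_minus w : Cexp (2 * PI * Ci * (w + tau / 2 - RtoC 0)) = Cexp (2 * PI * Ci * (w + tau / 2)).
Proof. f_equal; ring. Qed.

Lemma Th_plus w : Th (nome T) (- Cexp (2 * PI * Ci * (w + tau / 2 - RtoC (1 / 2)))) = vartheta 0 0 tau w.
Proof. rewrite v_plus, Copp_involutive; symmetry; apply vartheta00_Th. Qed.

Lemma Th_plus_opp w : Th (nome T) (Cexp (2 * PI * Ci * (w + tau / 2 - RtoC (1 / 2)))) = vartheta 0 1 tau w.
Proof. rewrite v_plus; symmetry; apply vartheta01_Th. Qed.

Lemma Th_minus w : Th (nome T) (- Cexp (2 * PI * Ci * (w + tau / 2 - RtoC 0))) = vartheta 0 1 tau w.
Proof. rewrite v_minus; symmetry; apply vartheta01_Th. Qed.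

Lemma Th_minus_opp w : Th (nome T) (Cexp (2 * PI * Ci * (w + tau / 2 - RtoC 0))) = vartheta 0 0 tau w.
Proof. rewrite v_minus; symmetry; apply vartheta00_Th. Qed.

Lemma Th_rho_plus : Th (nome T) (- Cexp (PI * Ci * tau - 2 * PI * Ci * RtoC (1 / 2))) = vartheta 0 0 tau 0.
Proof.
unfold tau; rewrite vartheta00_Th; fold tau; f_equal.
replace (PI * Ci * tau - 2 * PI * Ci * RtoC (1 / 2)) with (2 * PI * Ci * (0 + tau / 2) + - (PI * Ci))
  by (rewrite RtoC_div by lra; field).
rewrite Cexp_plus, Cexp_opp, Cexp_PI_Ci; field; apply C1_nz.
Qed.

Lemma Th_rho_minus : Th (nome T) (- Cexp (PI * Ci * tau - 2 * PI * Ci * RtoC 0)) = vartheta 0 1 tau 0.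
Proof.
unfold tau; rewrite vartheta01_Th; fold tau; do 3 f_equal; field.
Qed.

Lemma phase_plus : Cexp (- (PI * Ci * RtoC (1 / 2))) = - Ci.
Proof.
replace (- (PI * Ci * RtoC (1 / 2))) with (- (PI * Ci / 2) + 0) by (rewrite RtoC_div by lra; field).
rewrite <- opp_Ci_Cexp, Cexp_0; ring.
Qed.

Lemma phase2_plus : Cexp (- (2 * PI * Ci * RtoC (1 / 2))) = -(1).
Proof.
replace (- (2 * PI * Ci * RtoC (1 / 2))) with (- (PI * Ci)) by (rewrite RtoC_div by lra; field).
rewrite Cexp_opp, Cexp_PI_Ci; field; apply C1_nz.
Qed.

Lemma phase_minus : Cexp (- (PI * Ci * RtoC 0)) = 1.
Proof. replace (- (PI * Ci * RtoC 0)) with (RtoC 0) by ring; apply Cexp_0. Qed.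

Lemma phase2_minus : Cexp (- (2 * PI * Ci * RtoC 0)) = 1.
Proof. replace (- (2 * PI * Ci * RtoC 0)) with (RtoC 0) by ring; apply Cexp_0. Qed.

Context (N00 : vartheta 0 0 tau 0 <> 0) (N01 : vartheta 0 1 tau 0 <> 0) (N10 : vartheta 1 0 tau 0 <> 0).

Let eta3 : C := eta tau * (eta tau * eta tau).
Let cplus : C := eta (tau / 2) * eta (2 * tau).

Lemma half_tau : tau / 2 = Ci * RtoC (T / 2).
Proof. unfold tau; rewrite RtoC_div by lra; field. Qed.

Lemma double_tau : 2 * tau = Ci * RtoC (2 * T).
Proof. unfold tau; rewrite RtoC_mult; ring. Qed.

Lemma eta_half_neq_0 : eta (tau / 2) <> 0.
Proof. rewrite half_tau; apply eta_neq_0; lra. Qed.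

Lemma eta_double_neq_0 : eta (2 * tau) <> 0.
Proof. rewrite double_tau; apply eta_neq_0; lra. Qed.

Lemma eta_tau_neq_0 : eta tau <> 0.
Proof. now apply eta_neq_0. Qed.

Lemma z1_plus w : w + tau / 2 - 1 / 2 = w + tau / 2 - RtoC (1 / 2).
Proof. rewrite RtoC_div by lra; reflexivity. Qed.

Lemma z2_plus w : w - tau / 2 + 1 / 2 = w - tau / 2 + RtoC (1 / 2).
Proof. rewrite RtoC_div by lra; reflexivity. Qed.

Lemma z1_minus w : w + tau / 2 = w + tau / 2 - RtoC 0.
Proof. ring. Qed.

Lemma z2_minus w : w - tau / 2 = w - tau / 2 + RtoC 0.
Proof. ring. Qed.

Lemma Ci_neq_0 : Ci <> 0.
Proof. intros E; apply C1_nz; transitivity (- (Ci * Ci)); [rewrite Ci2; ring|rewrite E; ring]. Qed.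

Lemma regular_Th_neq_0 delta w : regular_point delta w ->
  Th (nome T) (- Cexp (2 * PI * Ci * (w + tau / 2 - RtoC delta))) <> 0.
Proof.
intros [H _]; apply Th_opp_neq_0; [apply nome_neq_0|now apply nome_lt_1|apply Cexp_neq_0|exact H].
Qed.

(** Division by R cancels vartheta_11(w) and the denominator vartheta_00(w) coming from the Appell
    sum; what remains is a multiple of vartheta_10(w), so every singularity is removable. *)
Lemma ch_plus_1 z :
  ch_plus 1 tau z = Ci * eta3 * vartheta 1 0 tau z / (vartheta 0 0 tau 0 * vartheta 0 1 tau 0 * cplus).
Proof.
pose proof eta_half_neq_0 as NA; pose proof eta_double_neq_0 as NB.
unfold ch_plus; apply (quotient_by_continuity_eq _ _
  (fun z => Ci * eta3 * vartheta 1 0 tau z / (vartheta 0 0 tau 0 * vartheta 0 1 tau 0 * cplus))).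
- generalize (regular_points (1 / 2) z); apply filter_imp; intros w Hw.
  change (Z.of_nat 1 + 1)%Z with 2%Z; rewrite z1_plus, z2_plus.
  pose proof (Phi_even_product T HT (1 / 2) delta_plus w (proj1 Hw)) as E; fold tau in E.
  pose proof (regular_Th_neq_0 _ _ Hw) as N; destruct Hw as [_ N11].
  rewrite Th_plus in E, N; rewrite phase2_plus in E; fold eta3 in E.
  unfold R_plus; fold cplus.
  match type of E with ?P * _ * _ = _ => set (ph := P) in * end.
  replace ph with (Ci * eta3 * vartheta 1 0 tau w * vartheta 1 1 tau w /
    (vartheta 0 0 tau w * (vartheta 0 0 tau 0 * vartheta 0 1 tau 0))).
  + unfold cplus; field; repeat split; assumption.
  + apply Cmult_cancel_l with (vartheta 0 0 tau w * (vartheta 0 0 tau 0 * vartheta 0 1 tau 0)).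
    * repeat apply Cmult_neq_0; assumption.
    * transitivity (Ci * eta3 * vartheta 1 0 tau w * vartheta 1 1 tau w);
        [field; repeat split; assumption|].
      transitivity (ph * vartheta 0 0 tau w * (vartheta 0 0 tau 0 * vartheta 0 1 tau 0)); [rewrite E|]; ring.
- unfold Cdiv; apply tends_mult; [apply locally'_proper| |apply tends_const, locally'_proper].
  apply tends_scal; [apply locally'_proper|now apply tends_vartheta10].
Qed.

Lemma ch_minus_1 z :
  ch_minus 1 tau z = - (Ci * eta (tau / 2) * vartheta 1 0 tau z / (vartheta 0 0 tau 0 * vartheta 0 1 tau 0)).
Proof.
pose proof eta_half_neq_0 as NA; pose proof eta_tau_neq_0 as NB.
unfold ch_minus; apply (quotient_by_continuity_eq _ _
  (fun z => - (Ci * eta (tau / 2) * vartheta 1 0 tau z / (vartheta 0 0 tau 0 * vartheta 0 1 tau 0)))).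
- generalize (regular_points 0 z); apply filter_imp; intros w Hw.
  change (Z.of_nat 1 + 1)%Z with 2%Z.
  pose proof (Phi_even_product T HT 0 delta_minus w (proj1 Hw)) as E; fold tau in E.
  pose proof (regular_Th_neq_0 _ _ Hw) as N; destruct Hw as [_ N11].
  rewrite Th_minus in E, N; rewrite phase2_minus in E; rewrite <- z1_minus, <- z2_minus in E.
  unfold R_minus; rewrite Cpow_S, Cpow_2.
  match type of E with ?P * _ * _ = _ => set (ph := P) in * end.
  replace ph with (- (Ci * (eta tau * (eta tau * eta tau)) * vartheta 1 0 tau w * vartheta 1 1 tau w) /
    (vartheta 0 1 tau w * (vartheta 0 0 tau 0 * vartheta 0 1 tau 0))).
  + field; repeat split; assumption.
  + apply Cmult_cancel_l with (vartheta 0 1 tau w * (vartheta 0 0 tau 0 * vartheta 0 1 tau 0)).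
    * repeat apply Cmult_neq_0; assumption.
    * transitivity (- (Ci * (eta tau * (eta tau * eta tau)) * vartheta 1 0 tau w * vartheta 1 1 tau w));
        [field; repeat split; assumption|].
      transitivity (ph * vartheta 0 1 tau w * (vartheta 0 0 tau 0 * vartheta 0 1 tau 0)); [rewrite E|]; ring.
- apply tends_opp; [apply locally'_proper|].
  unfold Cdiv; apply tends_mult; [apply locally'_proper| |apply tends_const, locally'_proper].
  apply tends_scal; [apply locally'_proper|now apply tends_vartheta10].
Qed.

Definition plus_main (z : C) : C :=
  - (eta3 * vartheta 0 1 tau z / (vartheta 1 0 tau 0 * vartheta 0 0 tau 0 * cplus)).
Definition minus_main (z : C) : C :=
  - (Ci * eta (tau / 2) * vartheta 0 0 tau z / (vartheta 1 0 tau 0 * vartheta 0 1 tau 0)).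

Lemma tends_plus_main z : tends (locally' z) plus_main (plus_main z).
Proof.
apply tends_opp; [apply locally'_proper|].
unfold Cdiv; apply tends_mult; [apply locally'_proper| |apply tends_const, locally'_proper].
apply tends_scal; [apply locally'_proper|now apply tends_vartheta01].
Qed.

Lemma tends_minus_main z : tends (locally' z) minus_main (minus_main z).
Proof.
apply tends_opp; [apply locally'_proper|].
unfold Cdiv; apply tends_mult; [apply locally'_proper| |apply tends_const, locally'_proper].
apply tends_scal; [apply locally'_proper|now apply tends_vartheta00].
Qed.

(* [A] is the quasi-periodic part of Phi and [B] the theta series removed by Phi_add. *)
Lemma plus_regular_quotients w : regular_point (1 / 2) w -> exists A B : C,
  (forall (S : Z) (sg : C), (S = 1%Z /\ sg = 1) \/ (S = 3%Z /\ sg = -(1)) ->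
    Phi 2 S (2 * tau) (w + tau / 2 - 1 / 2) (w - tau / 2 + 1 / 2) (tau / 8) = A + sg * B) /\
  Phi_add 2 1 (2 * tau) (w + tau / 2 - 1 / 2) (w - tau / 2 + 1 / 2) (tau / 8) = - B /\
  A / R_plus tau w = plus_main w /\ B / R_plus tau w = - (vartheta 0 0 tau w / (2 * cplus)).
Proof.
intros Hw; pose proof eta_half_neq_0 as NA; pose proof eta_double_neq_0 as NB; pose proof Ci_neq_0 as NI.
pose proof (Phi_odd_product T HT (1 / 2) delta_plus w (proj1 Hw)) as E; fold tau in E.
pose proof (fun (S : Z) (sg : C) => Phi_odd_form T HT (1 / 2) delta_plus w (proj1 Hw) S sg) as F; fold tau in F.
pose proof (Phi_add_form T HT (1 / 2) delta_plus w) as G; fold tau in G.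
pose proof (alpha_beta_vartheta T HT (1 / 2) w) as K; fold tau in K.
rewrite K in G; rewrite phase_plus in G.
rewrite Th_plus, Th_plus_opp, Th_rho_plus, phase_plus in E; fold eta3 in E.
pose proof (regular_Th_neq_0 _ _ Hw) as N; rewrite Th_plus in N; destruct Hw as [_ N11].
match type of E with ?P * _ * _ = _ => set (A := P) in * end.
exists A, (1 / 2 * - (Ci * - Ci * vartheta 1 1 tau w)); split; [|split; [|split]].
- intros S sg HS; rewrite z1_plus, z2_plus, (F S sg HS), K, phase_plus; reflexivity.
- rewrite z1_plus, z2_plus; exact G.
- replace A with (- (eta3 * vartheta 0 1 tau w * vartheta 1 1 tau w) /
    (vartheta 0 0 tau w * (vartheta 1 0 tau 0 * vartheta 0 0 tau 0))).
  + unfold R_plus, plus_main, cplus; field; repeat split; assumption.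
  + apply Cmult_cancel_l with (vartheta 0 0 tau w * (vartheta 1 0 tau 0 * vartheta 0 0 tau 0)).
    * repeat apply Cmult_neq_0; assumption.
    * transitivity (Ci * Ci * (eta3 * vartheta 0 1 tau w * vartheta 1 1 tau w));
        [rewrite Ci2; field; repeat split; assumption|].
      transitivity (A * vartheta 0 0 tau w * (vartheta 1 0 tau 0 * vartheta 0 0 tau 0)); [rewrite E|]; ring.
- transitivity (Ci * Ci * (vartheta 0 0 tau w / (2 * cplus))); [|rewrite Ci2; ring].
  unfold R_plus, cplus; field; repeat split; assumption.
Qed.

Lemma minus_regular_quotients w : regular_point 0 w -> exists A B : C,
  (forall (S : Z) (sg : C), (S = 1%Z /\ sg = 1) \/ (S = 3%Z /\ sg = -(1)) ->
    Phi 2 S (2 * tau) (w + tau / 2) (w - tau / 2) (tau / 8) = A + sg * B) /\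
  Phi_add 2 1 (2 * tau) (w + tau / 2) (w - tau / 2) (tau / 8) = - B /\
  A / R_minus tau w = minus_main w /\
  B / R_minus tau w = - (Ci * vartheta 0 1 tau w * eta (tau / 2) / (2 * eta3)).
Proof.
intros Hw; pose proof eta_half_neq_0 as NA; pose proof eta_tau_neq_0 as NB; pose proof Ci_neq_0 as NI.
pose proof (Phi_odd_product T HT 0 delta_minus w (proj1 Hw)) as E; fold tau in E.
pose proof (fun (S : Z) (sg : C) => Phi_odd_form T HT 0 delta_minus w (proj1 Hw) S sg) as F; fold tau in F.
pose proof (Phi_add_form T HT 0 delta_minus w) as G; fold tau in G.
pose proof (alpha_beta_vartheta T HT 0 w) as K; fold tau in K.
rewrite K in G; rewrite phase_minus in G.
rewrite Th_minus, Th_minus_opp, Th_rho_minus, phase_minus in E; fold eta3 in E.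
pose proof (regular_Th_neq_0 _ _ Hw) as N; rewrite Th_minus in N; destruct Hw as [_ N11].
match type of E with ?P * _ * _ = _ => set (A := P) in * end.
exists A, (1 / 2 * - (Ci * 1 * vartheta 1 1 tau w)); split; [|split; [|split]].
- intros S sg HS; rewrite (z1_minus w), (z2_minus w), (F S sg HS), K, phase_minus; reflexivity.
- rewrite (z1_minus w), (z2_minus w); exact G.
- replace A with (- (Ci * eta3 * vartheta 0 0 tau w * vartheta 1 1 tau w) /
    (vartheta 0 1 tau w * (vartheta 1 0 tau 0 * vartheta 0 1 tau 0))).
  + unfold R_minus, minus_main, eta3; rewrite Cpow_S, Cpow_2; field; repeat split; assumption.
  + apply Cmult_cancel_l with (vartheta 0 1 tau w * (vartheta 1 0 tau 0 * vartheta 0 1 tau 0)).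
    * repeat apply Cmult_neq_0; assumption.
    * transitivity (- (Ci * eta3 * vartheta 0 0 tau w * vartheta 1 1 tau w));
        [field; repeat split; assumption|].
      transitivity (A * vartheta 0 1 tau w * (vartheta 1 0 tau 0 * vartheta 0 1 tau 0)); [rewrite E|]; ring.
- unfold R_minus, eta3; rewrite Cpow_S, Cpow_2; field; repeat split; assumption.
Qed.

Lemma ch_plus_mod_0 z : ch_plus_mod 0 tau z = plus_main z.
Proof.
unfold ch_plus_mod; apply quotient_by_continuity_eq; [|apply tends_plus_main].
generalize (regular_points (1 / 2) z); apply filter_imp; intros w Hw.
destruct (plus_regular_quotients w Hw) as [A [B [H1 [H2 [H3 H4]]]]].
unfold Phi_mod; change (Z.of_nat 0 + 1)%Z with 1%Z.
rewrite (H1 1%Z 1) by (left; split; reflexivity); rewrite H2, <- H3; f_equal; ring.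
Qed.

Lemma ch_minus_mod_0 z : ch_minus_mod 0 tau z = minus_main z.
Proof.
unfold ch_minus_mod; apply quotient_by_continuity_eq; [|apply tends_minus_main].
generalize (regular_points 0 z); apply filter_imp; intros w Hw.
destruct (minus_regular_quotients w Hw) as [A [B [H1 [H2 [H3 H4]]]]].
unfold Phi_mod; change (Z.of_nat 0 + 1)%Z with 1%Z.
rewrite (H1 1%Z 1) by (left; split; reflexivity); rewrite H2, <- H3; f_equal; ring.
Qed.

Lemma ch_plus_odd (m2 : nat) (sg z : C) : (m2 = 0%nat /\ sg = 1) \/ (m2 = 2%nat /\ sg = -(1)) ->
  ch_plus m2 tau z = plus_main z - sg * (vartheta 0 0 tau z / (2 * cplus)).
Proof.
intros Hm; unfold ch_plus.
apply (quotient_by_continuity_eq _ _ (fun z => plus_main z - sg * (vartheta 0 0 tau z / (2 * cplus)))).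
- generalize (regular_points (1 / 2) z); apply filter_imp; intros w Hw.
  destruct (plus_regular_quotients w Hw) as [A [B [H1 [_ [H3 H4]]]]].
  rewrite (H1 _ sg), <- H3.
  + transitivity (A / R_plus tau w + sg * (B / R_plus tau w)); [unfold Cdiv; ring|rewrite H4; ring].
  + destruct Hm as [[-> ->]|[-> ->]]; [left|right]; split; reflexivity.
- apply tends_minus; [apply locally'_proper|apply tends_plus_main|].
  apply tends_scal; [apply locally'_proper|].
  unfold Cdiv; apply tends_mult; [apply locally'_proper|now apply tends_vartheta00|apply tends_const, locally'_proper].
Qed.

Lemma ch_minus_odd (m2 : nat) (sg z : C) : (m2 = 0%nat /\ sg = 1) \/ (m2 = 2%nat /\ sg = -(1)) ->
  ch_minus m2 tau z = minus_main z - sg * (Ci * vartheta 0 1 tau z * eta (tau / 2) / (2 * eta3)).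
Proof.
intros Hm; unfold ch_minus.
apply (quotient_by_continuity_eq _ _
  (fun z => minus_main z - sg * (Ci * vartheta 0 1 tau z * eta (tau / 2) / (2 * eta3)))).
- generalize (regular_points 0 z); apply filter_imp; intros w Hw.
  destruct (minus_regular_quotients w Hw) as [A [B [H1 [_ [H3 H4]]]]].
  rewrite (H1 _ sg), <- H3.
  + transitivity (A / R_minus tau w + sg * (B / R_minus tau w)); [unfold Cdiv; ring|rewrite H4; ring].
  + destruct Hm as [[-> ->]|[-> ->]]; [left|right]; split; reflexivity.
- apply tends_minus; [apply locally'_proper|apply tends_minus_main|].
  apply tends_scal; [apply locally'_proper|].
  unfold Cdiv; apply tends_mult; [apply locally'_proper| |apply tends_const, locally'_proper].
  apply tends_mult; [apply locally'_proper| |apply tends_const, locally'_proper].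
  apply tends_scal; [apply locally'_proper|now apply tends_vartheta01].
Qed.

End Characters.

(** * Asymptotics *)

(** Writing f = g rho with rho tending to 1, instead of f/g tending to 1, also covers a comparison
    function that vanishes. *)
Lemma equiv_down0_of_ratio (f g : C -> C) (rho : R -> C) :
  tends (at_right 0) rho 1 -> at_right 0 (fun T : R => f (Ci * T) = g (Ci * T) * rho T) ->
  equiv_down0 f g.
Proof.
intros Hr Hf; apply equiv_down0_alt; exists (fun T => rho T - 1); split.
- intros eps; generalize (Hr eps (cond_pos eps)); apply filter_imp; intros T; apply Rlt_le.
- revert Hf; apply filter_imp; intros T ->; ring.
Qed.

Lemma tends_sqrt_0 : tends (at_right 0) (fun T => RtoC (sqrt T)) 0.
Proof.
intros eps Heps.
generalize (filter_and _ _ at_right_pos (at_right_lt _ (Rmult_lt_0_compat _ _ Heps Heps))).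
apply filter_imp; intros T [H0 H1].
replace (RtoC (sqrt T) - 0) with (RtoC (sqrt T)) by ring.
rewrite Cmod_R, Rabs_pos_eq by apply sqrt_pos.
rewrite <- (sqrt_square eps) by lra; apply sqrt_lt_1; nra.
Qed.

(** From x exp(-x) < 1 at x = c/T the quotient is less than sqrt T / c. It handles the subdominant
    term of [ch_plus_odd_ratio], which carries 1/sqrt T. *)
Lemma tends_exp_inv_sqrt_0 (c : R) : (0 < c)%R ->
  tends (at_right 0) (fun T => RtoC (exp (- (c / T))) / RtoC (sqrt T)) 0.
Proof.
intros Hc eps Heps.
assert (P : (0 < c * eps)%R) by (now apply Rmult_lt_0_compat).
generalize (filter_and _ _ at_right_pos (tends_sqrt_0 _ P)); apply filter_imp; intros T [H0 H1].
pose proof (sqrt_lt_R0 T H0) as Hs.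
assert (Hn : RtoC (sqrt T) <> 0) by (apply RtoC_neq_0; lra).
replace (RtoC (sqrt T) - 0) with (RtoC (sqrt T)) in H1 by ring.
rewrite Cmod_R, Rabs_pos_eq in H1 by lra.
replace (RtoC (exp (- (c / T))) / RtoC (sqrt T) - 0)
  with (RtoC (exp (- (c / T)) / sqrt T)) by (rewrite RtoC_div by lra; ring).
pose proof (exp_pos (- (c / T))) as He.
rewrite Cmod_R, Rabs_pos_eq by (apply Rlt_le, Rdiv_lt_0_compat; assumption).
assert (HcT : (0 < c / T)%R) by (now apply Rdiv_lt_0_compat).
pose proof (exp_ineq1 (c / T) ltac:(lra)) as H2.
assert (H3 : (exp (- (c / T)) * (c / T) < 1)%R).
{ rewrite exp_Ropp; apply Rmult_lt_reg_l with (exp (c / T)); [lra|].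
  rewrite <- Rmult_assoc, Rinv_r; lra. }
assert (H4 : (T = sqrt T * sqrt T)%R) by (now rewrite sqrt_sqrt by lra).
assert (H5 : (exp (- (c / T)) * c < T)%R).
{ apply Rmult_lt_reg_r with (/ T)%R; [now apply Rinv_0_lt_compat|].
  rewrite Rinv_r by lra; unfold Rdiv in H3; lra. }
apply Rmult_lt_reg_r with (c * sqrt T)%R; [now apply Rmult_lt_0_compat|].
replace (exp (- (c / T)) / sqrt T * (c * sqrt T))%R with (exp (- (c / T)) * c)%R by (field; lra).
nra.
Qed.

(* The unit of growth at the cusp: with tau = iT, [gr T] is e^{pi i / (24 tau)}. *)
Definition gr (T : R) : C := RtoC (exp (PI / (24 * T))).

Definition sr (T : R) : C := RtoC (sqrt T).

Lemma sr_neq_0 T : (0 < T)%R -> sr T <> 0.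
Proof. intros HT; apply RtoC_neq_0; pose proof (sqrt_lt_R0 T HT); lra. Qed.

Lemma gr_neq_0 T : gr T <> 0.
Proof. apply RtoC_neq_0, Rgt_not_eq, exp_pos. Qed.

Lemma gr_pow (n : nat) (T : R) : (0 < T)%R -> gr T ^ n = RtoC (exp (INR n * PI / (24 * T))).
Proof.
intros HT; unfold gr; rewrite <- RtoC_pow; f_equal.
induction n as [|n IH]; [simpl; rewrite <- exp_0; f_equal; field; lra|].
rewrite S_INR; simpl; rewrite IH, <- exp_plus; f_equal; field; lra.
Qed.

Lemma exp_cusp_real (c T : R) : (0 < T)%R -> exp_cusp c (Ci * T) = RtoC (exp (c * PI / T)).
Proof.
intros HT; unfold exp_cusp.
assert (HT' : RtoC T <> 0) by (apply RtoC_neq_0; lra).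
replace (c * (PI * Ci / (Ci * T))) with (RtoC (c * PI / T)).
- unfold Cexp; simpl; rewrite cos_0, sin_0; apply injective_projections; simpl; ring.
- rewrite RtoC_div, RtoC_mult by lra; field; split; [exact HT'|apply Ci_neq_0].
Qed.

Lemma exp_cusp_pow (n : nat) (T : R) : (0 < T)%R -> exp_cusp (INR n / 24) (Ci * T) = gr T ^ n.
Proof.
intros HT; rewrite exp_cusp_real, gr_pow by assumption; do 2 f_equal; field; lra.
Qed.

Lemma exp_cusp_opp (c T : R) : (0 < T)%R -> exp_cusp (- c) (Ci * T) = / exp_cusp c (Ci * T).
Proof.
intros HT; rewrite !exp_cusp_real by assumption.
rewrite <- RtoC_inv by (apply Rgt_not_eq, exp_pos).
rewrite <- exp_Ropp; do 2 f_equal; field; lra.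
Qed.

Lemma sqrt_mi_real (T : R) : sqrt_mi (Ci * T) = sr T.
Proof. unfold sqrt_mi, sr; do 2 f_equal; simpl; ring. Qed.

Section CuspNormalization.

Context (a : C).

(** Each theta or eta factor is multiplied by the powers of [sr] and [gr] that give it a finite
    limit. In units of 1/24 the growth rates are 6 for vartheta_01, and 2, 4 and 1 for eta at tau,
    tau/2 and 2 tau. *)
Definition theta00_n T := sr T * vartheta 0 0 (Ci * T) (a * (Ci * T)).
Definition theta10_n T := sr T * vartheta 1 0 (Ci * T) (a * (Ci * T)).
Definition theta01_n T := sr T * gr T ^ 6 * vartheta 0 1 (Ci * T) (a * (Ci * T)).
Definition eta_n T := sr T * gr T ^ 2 * eta (Ci * T).
Definition eta_half_n T := sr T * gr T ^ 4 * eta (Ci * T / 2).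
Definition eta_double_n T := sr T * gr T * eta (2 * (Ci * T)).

Lemma theta00_n_cusp : tends (at_right 0) theta00_n 1.
Proof. exact (vartheta00_cusp a). Qed.

Lemma theta10_n_cusp : tends (at_right 0) theta10_n 1.
Proof. exact (vartheta10_cusp a). Qed.

Lemma theta01_n_cusp : tends (at_right 0) theta01_n (2 * Ccos (a * PI)).
Proof.
refine (tends_ext_loc _ _ _ _ _ (vartheta01_cusp a)).
generalize at_right_pos; apply filter_imp; intros T HT; unfold theta01_n.
rewrite gr_pow by exact HT; unfold sr; rewrite RtoC_mult; do 4 f_equal; simpl; field; lra.
Qed.

Lemma eta_n_cusp : tends (at_right 0) eta_n 1.
Proof.
refine (tends_ext_loc _ _ _ _ _ eta_cusp).
generalize at_right_pos; apply filter_imp; intros T HT; unfold eta_n.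
rewrite gr_pow by exact HT; unfold sr; rewrite RtoC_mult; do 4 f_equal; simpl; field; lra.
Qed.

Lemma sqrt2_neq_0 : RtoC (sqrt 2) <> 0.
Proof. apply RtoC_neq_0; pose proof (sqrt_lt_R0 2 ltac:(lra)); lra. Qed.

Lemma sqrt2_sqr : RtoC (sqrt 2) * RtoC (sqrt 2) = 2.
Proof. rewrite <- RtoC_mult, sqrt_sqrt by lra; reflexivity. Qed.

Lemma eta_half_n_cusp : tends (at_right 0) eta_half_n (sqrt 2).
Proof.
pose proof (tends_comp _ _ _ _ _ (filterlim_scale_at_right (/ 2) ltac:(lra)) eta_cusp) as H.
pose proof sqrt2_neq_0 as N.
replace (RtoC (sqrt 2)) with (RtoC (sqrt 2) * 1) by ring.
refine (tends_ext_loc _ _ _ _ _ (tends_scal _ (RtoC (sqrt 2)) _ _ H)).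
generalize at_right_pos; apply filter_imp; intros T HT; unfold eta_half_n.
rewrite gr_pow by exact HT; unfold sr.
replace (Ci * T / 2) with (Ci * RtoC (/ 2 * T)) by (rewrite RtoC_mult, RtoC_inv by lra; field).
rewrite Cmult_assoc, <- !RtoC_mult; do 2 f_equal.
rewrite <- Rmult_assoc, <- sqrt_mult by lra; f_equal; [f_equal; field|f_equal; simpl; field; lra].
Qed.

Lemma eta_double_n_cusp : tends (at_right 0) eta_double_n (/ sqrt 2).
Proof.
pose proof (tends_comp _ _ _ _ _ (filterlim_scale_at_right 2 ltac:(lra)) eta_cusp) as H.
pose proof sqrt2_neq_0 as N.
replace (/ RtoC (sqrt 2)) with (/ RtoC (sqrt 2) * 1) by ring.
refine (tends_ext_loc _ _ _ _ _ (tends_scal _ (/ RtoC (sqrt 2)) _ _ H)).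
generalize at_right_pos; apply filter_imp; intros T HT; unfold eta_double_n, gr, sr.
replace (2 * (Ci * T)) with (Ci * RtoC (2 * T)) by (rewrite RtoC_mult; ring).
rewrite sqrt_mult, !RtoC_mult by lra.
replace (PI / (12 * (2 * T)))%R with (PI / (24 * T))%R by (field; lra).
field; exact N.
Qed.

End CuspNormalization.

Lemma Ccos_0 : Ccos (0 * PI) = 1.
Proof.
unfold Ccos; replace (Ci * (0 * PI)) with (RtoC 0) by ring.
replace (- RtoC 0) with (RtoC 0) by ring; rewrite Cexp_0; field.
Qed.

Lemma theta01_0_cusp : tends (at_right 0) (theta01_n 0) 2.
Proof. pose proof (theta01_n_cusp 0) as H; rewrite Ccos_0, Cmult_1_r in H; exact H. Qed.

Lemma C2_neq_0 : RtoC 2 <> 0.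
Proof. apply RtoC_neq_0; lra. Qed.

(** The nonvanishing of the theta constants, assumed for the closed forms, is read off from their
    nonzero normalized limits; it is thereby available for all small T. *)
Definition generic (T : R) : Prop :=
  (0 < T)%R /\ vartheta 0 0 (Ci * T) 0 <> 0 /\ vartheta 0 1 (Ci * T) 0 <> 0 /\ vartheta 1 0 (Ci * T) 0 <> 0.

Lemma generic_near_0 : at_right 0 generic.
Proof.
generalize (filter_and _ _ at_right_pos (filter_and _ _ (tends_neq_0 _ _ _ C1_nz (theta00_n_cusp 0))
  (filter_and _ _ (tends_neq_0 _ _ _ C2_neq_0 theta01_0_cusp) (tends_neq_0 _ _ _ C1_nz (theta10_n_cusp 0))))).
apply filter_imp; intros T [HT [N00 [N01 N10]]]; unfold theta00_n, theta01_n, theta10_n in *.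
rewrite Cmult_0_l in N00, N01, N10.
repeat split; [exact HT| | |]; intros E; [apply N00|apply N01|apply N10]; rewrite E; ring.
Qed.

Ltac generic_conditions T :=
  intros [HT [N00 [N01 N10]]];
  pose proof (eta_neq_0 T HT); pose proof (eta_half_neq_0 T HT); pose proof (eta_double_neq_0 T HT);
  pose proof (sr_neq_0 T HT); pose proof (gr_neq_0 T); pose proof Ci_neq_0; pose proof sqrt2_neq_0;
  unfold theta00_n, theta01_n, theta10_n, eta_n, eta_half_n, eta_double_n; rewrite ?Cmult_0_l.

Section Ratios.

Context (a : C).

(** The powers of [sr] cancel and those of [gr] add up to 6 + 6 - 4 - 1 = 7, the source of the
    exponent 7/24. *)
Definition plus_ratio T : C :=
  eta_n T ^ 3 * theta01_n a T / (theta10_n 0 T * theta00_n 0 T * (eta_half_n T * eta_double_n T)).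

(** The powers of [gr] leave 4 - 6 = -2, hence the exponent 1/12; sqrt 2 makes the limit 1, since
    eta at tau/2 contributes another sqrt 2 and vartheta_01 a 2. *)
Definition minus_ratio T : C :=
  RtoC (sqrt 2) * theta00_n a T * eta_half_n T / (theta10_n 0 T * theta01_n 0 T).

Lemma plus_main_ratio T : generic T -> plus_main T (a * (Ci * T)) = - (plus_ratio T / gr T ^ 7).
Proof.
unfold plus_ratio, plus_main; generic_conditions T; field; repeat split; assumption.
Qed.

Lemma minus_main_ratio T : generic T ->
  minus_main T (a * (Ci * T)) = - (Ci / RtoC (sqrt 2)) * gr T ^ 2 * minus_ratio T.
Proof.
unfold minus_ratio, minus_main; generic_conditions T; field; repeat split; assumption.
Qed.

(** The theta series part dominates: relative to it the Appell quotient carries exp(-pi/(2T))/sqrt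
    T, because 5 + 7 = 12. As the modification removes exactly the dominant part, honest and
    modified characters grow differently. *)
Lemma ch_plus_odd_ratio T (m2 : nat) (sg : C) : (m2 = 0%nat /\ sg = 1) \/ (m2 = 2%nat /\ sg = -(1)) -> generic T ->
  ch_plus m2 (Ci * T) (a * (Ci * T)) = - sg / 2 * sr T * gr T ^ 5 *
    (theta00_n a T / (eta_half_n T * eta_double_n T) + 2 * sg * plus_ratio T * (/ gr T ^ 12 / sr T)).
Proof.
intros Hm G; pose proof (plus_main_ratio T G) as E; revert G.
generic_conditions T.
rewrite (ch_plus_odd T HT N00 N10 m2 sg _ Hm), E.
destruct Hm as [[_ ->]|[_ ->]]; field; repeat split; assumption.
Qed.

(** Here the roles are reversed: the theta series part is smaller by sqrt T exp(-pi/(4T)), so the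
    modification does not change the leading term and m2 = 0 and 2 share it. *)
Lemma ch_minus_odd_ratio T (m2 : nat) (sg : C) : (m2 = 0%nat /\ sg = 1) \/ (m2 = 2%nat /\ sg = -(1)) -> generic T ->
  ch_minus m2 (Ci * T) (a * (Ci * T)) = - (Ci / RtoC (sqrt 2)) * gr T ^ 2 *
    (minus_ratio T + sg * RtoC (sqrt 2) / 2 * (theta01_n a T * eta_half_n T / eta_n T ^ 3) * (sr T * / gr T ^ 6)).
Proof.
intros Hm G; pose proof (minus_main_ratio T G) as E; revert G.
generic_conditions T.
rewrite (ch_minus_odd T HT N01 N10 m2 sg _ Hm), E.
field; repeat split; assumption.
Qed.

Lemma ch_plus_1_ratio T : generic T ->
  ch_plus 1 (Ci * T) (a * (Ci * T)) = Ci / 2 * gr T ^ 5 *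
    (2 * eta_n T ^ 3 * theta10_n a T / (theta00_n 0 T * theta01_n 0 T * (eta_half_n T * eta_double_n T))).
Proof.
generic_conditions T; rewrite (ch_plus_1 T HT) by assumption; field; repeat split; assumption.
Qed.

Lemma ch_minus_1_ratio T : generic T ->
  ch_minus 1 (Ci * T) (a * (Ci * T)) = - (Ci / RtoC (sqrt 2)) * gr T ^ 2 *
    (RtoC (sqrt 2) * theta10_n a T * eta_half_n T / (theta00_n 0 T * theta01_n 0 T)).
Proof.
generic_conditions T; rewrite (ch_minus_1 T HT) by assumption; field; repeat split; assumption.
Qed.

Lemma eta_half_double_cusp : tends (at_right 0) (fun T => eta_half_n T * eta_double_n T) 1.
Proof.
replace (RtoC 1) with (RtoC (sqrt 2) * / RtoC (sqrt 2)) by (field; apply sqrt2_neq_0).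
apply tends_mult; [apply at_right_proper|apply eta_half_n_cusp|apply eta_double_n_cusp].
Qed.

Lemma eta_n_cube_cusp : tends (at_right 0) (fun T => eta_n T ^ 3) 1.
Proof.
replace (RtoC 1) with (RtoC 1 ^ 3) by ring; apply tends_pow; [apply at_right_proper|apply eta_n_cusp].
Qed.

(** The order of the clauses matters: the cube of eta and the pair of etas are matched as blocks
    with limit 1 before the general product rule, and the constant clause comes last. *)
Ltac cusp_limit :=
  lazymatch goal with
  | |- tends _ (theta00_n _) _ => apply theta00_n_cusp
  | |- tends _ (theta10_n _) _ => apply theta10_n_cusp
  | |- tends _ (theta01_n (RtoC 0)) _ => apply theta01_0_cusp
  | |- tends _ (theta01_n _) _ => apply theta01_n_cusp
  | |- tends _ (fun T => eta_n T ^ 3) _ => apply eta_n_cube_cusp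
  | |- tends _ (fun T => eta_half_n T * eta_double_n T) _ => apply eta_half_double_cusp
  | |- tends _ eta_half_n _ => apply eta_half_n_cusp
  | |- tends _ (fun T => _ / _) _ => apply tends_div; [apply at_right_proper| |cusp_limit|cusp_limit]
  | |- tends _ (fun T => _ * _) _ => apply tends_mult; [apply at_right_proper|cusp_limit|cusp_limit]
  | |- tends _ (fun T => ?c) _ => apply tends_const, at_right_proper
  end.

Lemma plus_ratio_cusp : tends (at_right 0) plus_ratio (2 * Ccos (a * PI)).
Proof.
replace (2 * Ccos (a * PI)) with (1 * (2 * Ccos (a * PI)) / (1 * 1 * 1)) by field.
unfold plus_ratio; cusp_limit.
rewrite !Cmult_1_l; apply C1_nz.
Qed.

Lemma minus_ratio_cusp : tends (at_right 0) minus_ratio 1.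
Proof.
replace (RtoC 1) with (RtoC (sqrt 2) * 1 * RtoC (sqrt 2) / (1 * 2))
  by (rewrite Cmult_1_r, sqrt2_sqr; field).
unfold minus_ratio; cusp_limit.
rewrite !Cmult_1_l; apply C2_neq_0.
Qed.

Lemma gr_inv_pow (n : nat) (T : R) : (0 < T)%R -> / gr T ^ n = RtoC (exp (- (INR n * PI / 24 / T))).
Proof.
intros HT; rewrite gr_pow, <- RtoC_inv, <- exp_Ropp by (try exact HT; apply Rgt_not_eq, exp_pos).
do 3 f_equal; field; lra.
Qed.

Lemma ch_plus_odd_cusp (sg : C) : tends (at_right 0)
  (fun T => theta00_n a T / (eta_half_n T * eta_double_n T) + 2 * sg * plus_ratio T * (/ gr T ^ 12 / sr T)) 1.
Proof.
replace (RtoC 1) with (1 / 1 + 2 * sg * (2 * Ccos (a * PI)) * 0) by field.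
apply tends_plus; [apply at_right_proper|cusp_limit; apply C1_nz|].
apply tends_mult; [apply at_right_proper| |].
- apply tends_scal; [apply at_right_proper|apply plus_ratio_cusp].
- refine (tends_ext_loc _ _ _ _ _ (tends_exp_inv_sqrt_0 (INR 12 * PI / 24) _)).
  + generalize at_right_pos; apply filter_imp; intros T HT; now rewrite gr_inv_pow by exact HT.
  + pose proof PI_RGT_0; simpl; lra.
Qed.

Lemma ch_minus_odd_cusp (sg : C) : tends (at_right 0)
  (fun T => minus_ratio T +
    sg * RtoC (sqrt 2) / 2 * (theta01_n a T * eta_half_n T / eta_n T ^ 3) * (sr T * / gr T ^ 6)) 1.
Proof.
replace (RtoC 1) with (1 + sg * RtoC (sqrt 2) / 2 * (2 * Ccos (a * PI) * RtoC (sqrt 2) / 1) * (0 * 0)) by field.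
apply tends_plus; [apply at_right_proper|apply minus_ratio_cusp|].
apply tends_mult; [apply at_right_proper| |].
- apply tends_scal; [apply at_right_proper|cusp_limit; apply C1_nz].
- apply tends_mult; [apply at_right_proper|apply tends_sqrt_0|].
  refine (tends_ext_loc _ _ _ _ _ (tends_exp_inv_0 (INR 6 * PI / 24) _)).
  + generalize at_right_pos; apply filter_imp; intros T HT; now rewrite gr_inv_pow by exact HT.
  + pose proof PI_RGT_0; simpl; lra.
Qed.

Lemma ch_plus_1_cusp : tends (at_right 0) (fun T =>
  2 * eta_n T ^ 3 * theta10_n a T / (theta00_n 0 T * theta01_n 0 T * (eta_half_n T * eta_double_n T))) 1.
Proof.
replace (RtoC 1) with (2 * 1 * 1 / (1 * 2 * 1)) by field.
cusp_limit; rewrite Cmult_1_l, Cmult_1_r; apply C2_neq_0.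
Qed.

Lemma ch_minus_1_cusp : tends (at_right 0) (fun T =>
  RtoC (sqrt 2) * theta10_n a T * eta_half_n T / (theta00_n 0 T * theta01_n 0 T)) 1.
Proof.
replace (RtoC 1) with (RtoC (sqrt 2) * 1 * RtoC (sqrt 2) / (1 * 2))
  by (rewrite Cmult_1_r, sqrt2_sqr; field).
cusp_limit; rewrite Cmult_1_l; apply C2_neq_0.
Qed.

Lemma ch_plus_mod_0_equiv : equiv_down0 (fun tau => ch_plus_mod 0 tau (a * tau))
  (fun tau => - 2 * Ccos (a * PI) * exp_cusp (- (7 / 24)) tau).
Proof.
assert (X : forall T, generic T ->
  ch_plus_mod 0 (Ci * T) (a * (Ci * T)) = - exp_cusp (- (7 / 24)) (Ci * T) * plus_ratio T).
{ intros T G; transitivity (plus_main T (a * (Ci * T))).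
  - destruct G as [HT [N00 [N01 N10]]]; now apply ch_plus_mod_0.
  - rewrite (plus_main_ratio T G), exp_cusp_opp by apply G.
    replace (7 / 24)%R with (INR 7 / 24)%R by (simpl; lra); rewrite exp_cusp_pow by apply G.
    unfold Cdiv; ring. }
destruct (Ceq_dec (Ccos (a * PI)) 0) as [Hc|Hc].
- apply (equiv_down0_of_ratio _ _ (fun _ => RtoC 1)); [apply tends_const, at_right_proper|].
  generalize generic_near_0; apply filter_imp; intros T G.
  rewrite (X T G), Hc; unfold plus_ratio, theta01_n, Cdiv.
  rewrite vartheta01_eq_0 by (try apply G; exact Hc); ring.
- apply (equiv_down0_of_ratio _ _ (fun T => plus_ratio T / (2 * Ccos (a * PI)))).
  + replace (RtoC 1) with (2 * Ccos (a * PI) / (2 * Ccos (a * PI))) by (field; exact Hc).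
    apply tends_div; [apply at_right_proper| |apply plus_ratio_cusp|apply tends_const, at_right_proper].
    apply Cmult_neq_0; [apply C2_neq_0|exact Hc].
  + generalize generic_near_0; apply filter_imp; intros T G.
    rewrite (X T G); field; exact Hc.
Qed.

Lemma ch_plus_odd_equiv (m2 : nat) (sg : C) : (m2 = 0%nat /\ sg = 1) \/ (m2 = 2%nat /\ sg = -(1)) ->
  equiv_down0 (fun tau => ch_plus m2 tau (a * tau))
    (fun tau => - sg / 2 * sqrt_mi tau * exp_cusp (5 / 24) tau).
Proof.
intros Hm; apply (equiv_down0_of_ratio _ _ _ (ch_plus_odd_cusp sg)).
generalize generic_near_0; apply filter_imp; intros T G.
rewrite (ch_plus_odd_ratio T m2 sg Hm G), sqrt_mi_real.
replace (5 / 24)%R with (INR 5 / 24)%R by (simpl; lra); now rewrite exp_cusp_pow by apply G.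
Qed.

Lemma ch_plus_1_equiv : equiv_down0 (fun tau => ch_plus 1 tau (a * tau))
  (fun tau => Ci / 2 * exp_cusp (5 / 24) tau).
Proof.
apply (equiv_down0_of_ratio _ _ _ ch_plus_1_cusp).
generalize generic_near_0; apply filter_imp; intros T G.
rewrite (ch_plus_1_ratio T G).
replace (5 / 24)%R with (INR 5 / 24)%R by (simpl; lra); now rewrite exp_cusp_pow by apply G.
Qed.

Lemma exp_cusp_12 (T : R) : (0 < T)%R -> exp_cusp (1 / 12) (Ci * T) = gr T ^ 2.
Proof. intros HT; rewrite <- (exp_cusp_pow 2 T HT); f_equal; simpl; lra. Qed.

Lemma ch_minus_mod_0_equiv : equiv_down0 (fun tau => ch_minus_mod 0 tau (a * tau))
  (fun tau => - (Ci / sqrt 2) * exp_cusp (1 / 12) tau).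
Proof.
apply (equiv_down0_of_ratio _ _ _ minus_ratio_cusp).
generalize generic_near_0; apply filter_imp; intros T G.
rewrite exp_cusp_12, <- (minus_main_ratio T G) by apply G.
destruct G as [HT [N00 [N01 N10]]]; now apply ch_minus_mod_0.
Qed.

Lemma ch_minus_equiv (m2 : nat) : (m2 <= 2)%nat ->
  equiv_down0 (fun tau => ch_minus m2 tau (a * tau)) (fun tau => - (Ci / sqrt 2) * exp_cusp (1 / 12) tau).
Proof.
intros Hm.
assert (X : forall sg : C, (m2 = 0%nat /\ sg = 1) \/ (m2 = 2%nat /\ sg = -(1)) ->
  equiv_down0 (fun tau => ch_minus m2 tau (a * tau)) (fun tau => - (Ci / sqrt 2) * exp_cusp (1 / 12) tau)).
{ intros sg Hsg; apply (equiv_down0_of_ratio _ _ _ (ch_minus_odd_cusp sg)).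
  generalize generic_near_0; apply filter_imp; intros T G.
  now rewrite (ch_minus_odd_ratio T m2 sg Hsg G), exp_cusp_12 by apply G. }
destruct m2 as [|[|[|m2]]]; [apply (X 1); now left| |apply (X (-(1))); now right|lia].
apply (equiv_down0_of_ratio _ _ _ ch_minus_1_cusp).
generalize generic_near_0; apply filter_imp; intros T G.
now rewrite (ch_minus_1_ratio T G), exp_cusp_12 by apply G.
Qed.

End Ratios.

Theorem proposition7p1 (a : C) :
  (equiv_down0 (fun tau => ch_plus_mod 0 tau (a * tau))
               (fun tau => - 2 * Ccos (a * PI) * exp_cusp (- (7 / 24)) tau) /\
   equiv_down0 (fun tau => ch_plus 0 tau (a * tau))
               (fun tau => - (1 / 2) * sqrt_mi tau * exp_cusp (5 / 24) tau) /\
   equiv_down0 (fun tau => ch_plus 2 tau (a * tau))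
               (fun tau => 1 / 2 * sqrt_mi tau * exp_cusp (5 / 24) tau) /\
   equiv_down0 (fun tau => ch_plus 1 tau (a * tau))
               (fun tau => Ci / 2 * exp_cusp (5 / 24) tau)) /\
  (equiv_down0 (fun tau => ch_minus_mod 0 tau (a * tau))
               (fun tau => - (Ci / sqrt 2) * exp_cusp (1 / 12) tau) /\
   (forall m2 : nat, (m2 <= 2)%nat ->
    equiv_down0 (fun tau => ch_minus m2 tau (a * tau))
                (fun tau => - (Ci / sqrt 2) * exp_cusp (1 / 12) tau))).
Proof.
pose proof (ch_plus_odd_equiv a 0 1 (or_introl (conj eq_refl eq_refl))) as H0.
pose proof (ch_plus_odd_equiv a 2 (-(1)) (or_intror (conj eq_refl eq_refl))) as H2.
split; [split; [|split; [|split]]|split].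
- apply ch_plus_mod_0_equiv.
- replace (- RtoC 1 / 2) with (- (RtoC 1 / 2)) in H0 by field; exact H0.
- replace (- -(RtoC 1) / 2) with (RtoC 1 / 2) in H2 by field; exact H2.
- apply ch_plus_1_equiv.
- apply ch_minus_mod_0_equiv.
- apply ch_minus_equiv.
Qed.
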